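(* Let $d\ge 2$, let $\omega\subset\mathbb R^{d-1}$ be a bounded connected open set with Lipschitz boundary, and let $\Omega_\varepsilon=\omega\times(0,\varepsilon)$. Let $s_0\in[0,1]$ be fixed and let $\{s_\varepsilon\}_\varepsilon\subset(0,1)$ be such that $s_\varepsilon\to s_0$ as $\varepsilon\to0$. For $u\in H^{s_\varepsilon}(\Omega_\varepsilon)$ let $$E_\varepsilon(u)=\frac{1}{\varepsilon^{1-2s_\varepsilon}}\int_{\Omega_\varepsilon\times\Omega_\varepsilon}\frac{|u(x)-u(y)|^2}{|x-y|^{d+2s_\varepsilon}}\,dx\,dy .$$ Then the following $\Gamma$-convergence results hold with respect to the weak convergence in $L^2_{\rm loc}(\omega\times(0,1))$ of the scaled functions $v_\varepsilon(x',x_d)=u_\varepsilon(x',\varepsilon x_d)$ to $v\in L^2(\omega\times(0,1))$: $\bullet$ if $s_0<1$, then $$\Gamma\text{-}\lim_{\varepsilon\to0}E_\varepsilon = C_{s_0,d}\int_\omega\int_0^1\int_0^1\frac{|v(x',x_d)-v(x',y_d)|^2}{|x_d-y_d|^{1+2s_0}}\,dx_d\,dy_d\,dx',$$ where $C_{s,d}=\int_{\mathbb R^{d-1}}(1+|\xi|^2)^{-\frac d2-s}\,d\xi$; $\bullet$ if $s_0=1$, then $$\Gamma\text{-}\lim_{\varepsilon\to0}(1-s_\varepsilon)E_\varepsilon=\frac{\sigma_d}{2d}\int_\omega\int_0^1\Big|\frac{\partial v}{\partial x_d}(x',x_d)\Big|^2\,dx_d\,dx',$$ where $\sigma_d=\mathcal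 H^{d-1}(S^{d-1})$.
   Context: Points of $\mathbb R^d$ are written $x=(x',x_d)$ with $x'\in\mathbb R^{d-1}$. $H^s(\Omega)$, $s\in(0,1)$, is the set of $u\in L^2(\Omega)$ such that $\int_{\Omega\times\Omega}\frac{|u(x)-u(y)|^2}{|x-y|^{d+2s}}dx\,dy<+\infty$. $\sigma_d$ is the surface measure of the unit sphere of $\mathbb R^d$. $\Gamma$-convergence of functionals $G_\varepsilon$ defined on $H^{s_\varepsilon}(\Omega_\varepsilon)$ to a functional $G$ of $v$, with respect to a convergence of the scaled functions, means that for every sequence $\varepsilon_j\to0^+$ and every $v$: (i) for every $u_{\varepsilon_j}\in H^{s_{\varepsilon_j}}(\Omega_{\varepsilon_j})$ whose scaled functions converge to $v$ one has $G(v)\le\liminf_j G_{\varepsilon_j}(u_{\varepsilon_j})$; (ii) there exist $u_{\varepsilon_j}\in H^{s_{\varepsilon_j}}(\Omega_{\varepsilon_j})$ whose scaled functions converge to $v$ with $\limsup_jG_{\varepsilon_j}(u_{\varepsilon_j})\le G(v)$ (nothing to prove if $G(v)=+\infty$). The limit integrals are understood as $+\infty$ when they diverge; in the case $s_0=1$, the limit is $+\infty$ if the weak derivative $\partial v/\partial x_d$ is not in $L^2(\omega\times(0,1))$. *)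

(* Defs.v *)
From HB Require Import structures.
From mathcomp Require Import all_boot all_order all_algebra.
From mathcomp Require Import all_classical all_reals all_analysis.

Set Implicit Arguments.
Unset Strict Implicit.
Unset Printing Implicit Defensive.

Import Order.TTheory GRing.Theory Num.Theory.
Import numFieldNormedType.Exports.

Local Open Scope classical_set_scope.
Local Open Scope ring_scope.

(* The sigma-algebra on ['rV[R]_n] is the one generated by the coordinates, as
   for [n.-tuple R] in the library; it is the Borel sigma-algebra. *)
Section rV_measurable.
Context {R : realType} {n : nat}.

Let coord (i : 'I_n) (x : 'rV[R]_n) : R := x ord0 i.

Let rV_set0 : g_sigma_preimage coord set0.
Proof. exact: sigma_algebra0. Qed.

Let rV_setC A : g_sigma_preimage coord A -> g_sigma_preimage coord (~` A).
Proof. exact: sigma_algebraC. Qed.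

Let rV_bigcup (F : (set _)^nat) : (forall i, g_sigma_preimage coord (F i)) ->
  g_sigma_preimage coord (\bigcup_i (F i)).
Proof. exact: sigma_algebra_bigcup. Qed.

HB.instance Definition _ := @isMeasurable.Build default_measure_display
  'rV[R]_n (g_sigma_preimage coord) rV_set0 rV_setC rV_bigcup.

End rV_measurable.

Lemma measurable_rV_coord (R : realType) n (i : 'I_n) :
  measurable_fun [set: 'rV[R]_n] (fun x => x ord0 i).
Proof.
move=> _ Y mY; rewrite setTI; apply: sub_sigma_algebra => /=.
rewrite -bigcup_seq/=; exists i => /=; first by rewrite mem_index_enum.
by exists Y => //; rewrite setTI.
Qed.

Lemma measurable_fun_rVP d (T : measurableType d) (R : realType) n
    (f : T -> 'rV[R]_n) :
  (forall i, measurable_fun [set: T] (fun t => f t ord0 i)) ->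
  measurable_fun [set: T] f.
Proof.
move=> mf.
suff h : g_sigma_preimage (fun i t => f t ord0 i) `<=` measurable.
  move=> _ A mA; rewrite setTI; apply: h.
  rewrite (g_sigma_preimage_comp (fun (i : 'I_n) (x : 'rV[R]_n) => x ord0 i) f).
  by exists A => //; rewrite setTI.
apply: smallest_sub; first exact: sigma_algebra_measurable.
case: n f mf => [|n] f mf; first by rewrite big_ord0.
rewrite -bigcup_mkord_ord; apply: bigcup_sub => i Ii.
by move=> A [B mB <-]; exact: mf.
Qed.

(* The library's own instance of this fact is shadowed by the one for finite
   measures. *)
Lemma product_measure_sigma_finite d1 d2 (T1 : measurableType d1)
    (T2 : measurableType d2) (R : realType)
    (m1 : {sigma_finite_measure set T1 -> \bar R})
    (m2 : {sigma_finite_measure set T2 -> \bar R}) :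
  sigma_finite setT (m1 \x m2)%E.
Proof.
have /sigma_finiteP[F [TF ndF Foo]] := sigma_finiteT m1.
have /sigma_finiteP[G [TG ndG Goo]] := sigma_finiteT m2.
exists (fun n => F n `*` G n).
  rewrite -setXTT TF TG predeqE => -[x y]; split.
    move=> [/= [n _ Fnx] [k _ Gky]]; exists (maxn n k) => //; split.
    - by move: x Fnx; exact/subsetPset/ndF/leq_maxl.
    - by move: y Gky; exact/subsetPset/ndG/leq_maxr.
  by move=> [n _ []/= ? ?]; split; exists n.
move=> k; have [? ?] := Foo k; have [? ?] := Goo k.
split; first exact: measurableX.
by rewrite product_measure1E// lte_mul_pinfty// ge0_fin_numE.
Qed.

(* [lebesgue_measure] is declared on [measurableTypeR R], whose display differs
   from that of [R]; [lebR] is the same set function as a measure on [R]. *)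
Section lebR.
Context {R : realType}.

Definition lebR : set R -> \bar R := @lebesgue_measure R.

Let lebR0 : lebR set0 = 0%E.
Proof. exact: (measure0 (@lebesgue_measure R)). Qed.

Let lebR_ge0 A : (0 <= lebR A)%E.
Proof. exact: (measure_ge0 (@lebesgue_measure R)). Qed.

Let lebR_sigma_additive : semi_sigma_additive lebR.
Proof. exact: (@measure_semi_sigma_additive _ _ _ (@lebesgue_measure R)). Qed.

HB.instance Definition _ := isMeasure.Build _ _ _ lebR
  lebR0 lebR_ge0 lebR_sigma_additive.

Let lebR_sigma_finite : sigma_finite setT lebR.
Proof. exact: (sigma_finiteT (@lebesgue_measure R)). Qed.

HB.instance Definition _ := Measure_isSigmaFinite.Build _ _ _ lebR
  lebR_sigma_finite.

End lebR.

Section lebesgue_rV.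
Context {R : realType}.

Definition rV_cons n (p : R * 'rV[R]_n) : 'rV[R]_n.+1 :=
  row_mx (const_mx p.1 : 'rV_1) p.2.

Lemma rV_consS n (p : R * 'rV[R]_n) (j : 'I_n) :
  rV_cons p ord0 (rshift 1 j) = p.2 ord0 j.
Proof. exact: (@row_mxEr _ 1 1 n). Qed.

Lemma rV_cons0 n (p : R * 'rV[R]_n) : rV_cons p ord0 ord0 = p.1.
Proof.
transitivity ((const_mx p.1 : 'rV[R]_1) ord0 ord0); last by rewrite mxE.
rewrite -(@row_mxEl _ 1 1 n _ p.2).
by congr (row_mx _ _ _ _); exact: val_inj.
Qed.

Lemma measurable_rV_cons n : measurable_fun setT (@rV_cons n).
Proof.
apply: measurable_fun_rVP => i; case: (split_ordP (i : 'I_(1 + n))) => j ->.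
  rewrite (_ : (fun _ => _) = fst) //; apply/funext => p.
  rewrite -[RHS]rV_cons0; congr (rV_cons _ _ _); apply: val_inj.
  by case: j => [] [].
rewrite (_ : (fun _ => _) = (fun x : 'rV[R]_n => x ord0 j) \o snd).
  by apply: measurableT_comp => //; exact: measurable_rV_coord.
by apply/funext => p; rewrite rV_consS.
Qed.

Definition rV_uncons n (x : 'rV[R]_n.+1) : R * 'rV[R]_n :=
  (x ord0 ord0, \row_j x ord0 (rshift 1 j)).

Lemma measurable_rV_uncons n : measurable_fun setT (@rV_uncons n).
Proof.
apply/measurable_fun_pairP; split.
  exact: measurable_rV_coord.
apply: measurable_fun_rVP => i.
rewrite (_ : (fun _ => _) = fun x : 'rV[R]_n.+1 => x ord0 (rshift 1 i)).
  exact: measurable_rV_coord.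
by apply/funext => x; rewrite /= mxE.
Qed.

Lemma rV_consK n : cancel (@rV_cons n) (@rV_uncons n).
Proof.
move=> [a x]; rewrite /rV_uncons rV_cons0; congr pair.
by apply/rowP => j; rewrite mxE rV_consS.
Qed.

Section prod.
Variables (n : nat) (m : {sigma_finite_measure set 'rV[R]_n -> \bar R}).

Definition lebesgue_cons : set 'rV[R]_n.+1 -> \bar R :=
  pushforward (@lebR R \x m)%E (@rV_cons n).

Let lebesgue_cons0 : lebesgue_cons set0 = 0%E.
Proof. by rewrite /lebesgue_cons /pushforward preimage_set0 measure0. Qed.

Let lebesgue_cons_ge0 A : (0 <= lebesgue_cons A)%E.
Proof. by rewrite /lebesgue_cons /pushforward; exact: measure_ge0. Qed.

Let lebesgue_cons_sigma_additive : semi_sigma_additive lebesgue_cons.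
Proof.
move=> F mF tF mUF; rewrite /lebesgue_cons /pushforward preimage_bigcup.
apply: measure_semi_sigma_additive.
- by move=> k; rewrite -[X in measurable X]setTI; exact: measurable_rV_cons.
- apply/trivIsetP => /= i j _ _ ij; rewrite -preimage_setI.
  by move/trivIsetP : tF => /(_ _ _ _ _ ij) ->//; rewrite preimage_set0.
- rewrite -preimage_bigcup -[X in measurable X]setTI.
  exact: measurable_rV_cons.
Qed.

HB.instance Definition _ := isMeasure.Build _ _ _ lebesgue_cons
  lebesgue_cons0 lebesgue_cons_ge0 lebesgue_cons_sigma_additive.

Let lebesgue_cons_sigma_finite : sigma_finite setT lebesgue_cons.
Proof.
have [F TF Foo] := product_measure_sigma_finite (@lebR R) m.
exists (fun k => @rV_uncons n @^-1` F k).
  by rewrite -preimage_bigcup -TF preimage_setT.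
move=> k; have [mFk Fkoo] := Foo k; split.
  by rewrite -[X in measurable X]setTI; exact: measurable_rV_uncons.
rewrite /lebesgue_cons /pushforward -comp_preimage.
by rewrite (_ : _ \o _ = id) //; apply/funext => p /=; rewrite rV_consK.
Qed.

HB.instance Definition _ := Measure_isSigmaFinite.Build _ _ _ lebesgue_cons
  lebesgue_cons_sigma_finite.
End prod.

Fixpoint lebesgue_rV n : {sigma_finite_measure set 'rV[R]_n -> \bar R} :=
  match n with
  | 0 => dirac (0 : 'rV[R]_0)
  | n'.+1 => lebesgue_cons (lebesgue_rV n')
  end.

End lebesgue_rV.

Section euclidean.
Context {R : realType} {n : nat}.
Implicit Types x y : 'rV[R]_n.

Definition dotp x y : R := \sum_(i < n) x ord0 i * y ord0 i.

(* The library's norm on ['rV[R]_n] is the sup norm. *)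
Definition enorm x : R := Num.sqrt (dotp x x).

(* Near each boundary point, [D] is the set of points lying strictly above the
   graph of a Lipschitz function [g] over the hyperplane orthogonal to a unit
   vector [nu]. *)
Definition lipschitz_boundary (D : set 'rV[R]_n) : Prop :=
  forall z, (closure D `\` interior D) z ->
  exists (r L : R) (nu : 'rV[R]_n) (g : 'rV[R]_n -> R),
    [/\ 0 < r, enorm nu = 1,
        (forall x y, dotp x nu = 0 -> dotp y nu = 0 ->
           `|g x - g y| <= L * enorm (x - y)) &
        forall x, enorm (x - z) < r ->
          (D x <-> g (x - dotp x nu *: nu) < dotp x nu)].

End euclidean.

(* R^d, whose points are written x = (x', x_d) *)
Notation pt R d := ('rV[R]_(d.-1) * R)%type.

Section points.
Context {R : realType} {d : nat}.

Definition norm2 (x : pt R d) : R := Num.sqrt (enorm x.1 ^+ 2 + x.2 ^+ 2).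

Definition leb : set (pt R d) -> \bar R := (lebesgue_rV d.-1 \x @lebR R)%E.

HB.instance Definition _ := Measure.on leb.
HB.instance Definition _ := Measure_isSigmaFinite.Build _ _ _ leb
  (product_measure_sigma_finite (lebesgue_rV d.-1) (@lebR R)).

Definition cylinder (omega : set 'rV[R]_(d.-1)) (h : R) : set (pt R d) :=
  omega `*` `]0, h[%classic.

End points.

Section hausdorff_measure.
Local Open Scope ereal_scope.
Context {R : realType} {T : Type}.
Variable dist : T -> T -> R.

Definition ball_volume (k : nat) : \bar R :=
  lebesgue_rV k [set x : 'rV[R]_k | (enorm x <= 1)%R].

Definition diam (C : set T) : \bar R :=
  ereal_sup [set (dist p.1 p.2)%:E | p in C `*` C].

(* Normalized by the volume of the Euclidean unit ball of R^k; [diam C] is only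
   used when finite, see [hausdorff_content]. *)
Definition hausdorff_gauge (k : nat) (C : set T) : \bar R :=
  if C == set0 then 0 else ball_volume k * ((fine (diam C) / 2) ^+ k)%:E.

Definition hausdorff_content (k : nat) (delta : R) (A : set T) : \bar R :=
  ereal_inf [set \sum_(0 <= i <oo) hausdorff_gauge k (C i) |
    C in [set C : (set T)^nat |
      A `<=` \bigcup_i C i /\ forall i, diam (C i) <= delta%:E]].

Definition hausdorff_measure (k : nat) (A : set T) : \bar R :=
  ereal_sup [set hausdorff_content k delta A | delta in [set t | (0 < t)%R]].

End hausdorff_measure.

Definition sphere_area (R : realType) (d : nat) : \bar R :=
  hausdorff_measure (fun x y : pt R d => norm2 (x - y)) d.-1
    [set x : pt R d | norm2 x = 1].

Section function_spaces.
Context {R : realType} {d : nat}.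
Implicit Types (D : set (pt R d)) (u v w : pt R d -> R).

Definition L2 D u : Prop :=
  measurable_fun D u /\ (\int[leb]_(x in D) ((u x) ^+ 2)%:E < +oo)%E.

(* The quotient is 0 on the diagonal, which is a null set. *)
Definition gagliardo (s : R) D u : \bar R :=
  (\int[leb \x leb]_(p in D `*` D)
     (`|u p.1 - u p.2| ^+ 2 / norm2 (p.1 - p.2) `^ (d%:R + 2 * s))%:E)%E.

Definition Hs (s : R) D : set (pt R d -> R) :=
  [set u | L2 D u /\ (gagliardo s D u < +oo)%E].

(* v_j converges to v weakly in L^2(K) for every compact subset K of D *)
Definition weak_L2loc D (v_ : nat -> pt R d -> R) v : Prop :=
  forall K, compact K -> K `<=` D -> forall g, L2 K g ->
    (fun j => \int[leb]_(x in K) (v_ j x * g x)) @ \oo -->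
    \int[leb]_(x in K) (v x * g x).

Fixpoint Ck (k : nat) (f : pt R d -> R) : Prop :=
  match k with
  | 0 => continuous f
  | k'.+1 => continuous f /\
      forall e, (forall x, derivable f x e) /\ Ck k' (fun x => 'D_e f x)
  end.

Definition test_function D (f : pt R d -> R) : Prop :=
  [/\ forall k, Ck k f, compact (closure [set x | f x != 0]) &
      closure [set x | f x != 0] `<=` D].

(* w is the weak derivative of v with respect to x_d in D *)
Definition is_weak_dxd D v w : Prop :=
  forall f, test_function D f ->
    \int[leb]_(x in D) (v x * 'D_(0 : 'rV[R]_(d.-1), 1 : R) f x) =
    - \int[leb]_(x in D) (w x * f x).

End function_spaces.

Section functionals.
Context {R : realType} {d : nat}.
Local Open Scope ereal_scope.
Implicit Types (omega : set 'rV[R]_(d.-1)) (v u : pt R d -> R).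

Definition energy (s : R -> R) omega (eps : R) u : \bar R :=
  ((eps `^ (1 - 2 * s eps))^-1)%:E * gagliardo (s eps) (cylinder omega eps) u.

Definition scaled (eps : R) u : pt R d -> R := fun x => u (x.1, eps * x.2)%R.

Definition Csd (s : R) : \bar R :=
  \int[lebesgue_rV d.-1]_xi ((1 + enorm xi ^+ 2) `^ (- (d%:R / 2) - s))%:E.

Definition limit_lt1 (s0 : R) omega v : \bar R :=
  Csd s0 *
  \int[lebesgue_rV d.-1]_(x' in omega)
    \int[lebR]_(yd in `]0%R, 1%R[)
      \int[lebR]_(xd in `]0%R, 1%R[)
        (`|v (x', xd) - v (x', yd)| ^+ 2 / `|xd - yd| `^ (1 + 2 * s0))%:E.

Definition weak_dxd_L2 omega v : set (pt R d -> R) :=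
  [set w | L2 (cylinder omega 1) w /\ is_weak_dxd (cylinder omega 1) v w].

(* By uniqueness up to null sets, the value does not depend on the weak
   derivative picked by [xget]. *)
Definition limit_eq1 omega v : \bar R :=
  if pselect (weak_dxd_L2 omega v !=set0) then
    sphere_area R d * ((2 * d%:R)^-1)%:E *
    \int[lebesgue_rV d.-1]_(x' in omega)
      \int[lebR]_(xd in `]0%R, 1%R[)
        (`|xget (cst 0%R) (weak_dxd_L2 omega v) (x', xd)| ^+ 2)%:E
  else +oo.

End functionals.

Section gamma_convergence.
Local Open Scope ereal_scope.
Context {R : realType} {X Y : Type}.

(* Gamma-convergence, as eps -> 0+, of functionals [F eps] defined on [dom eps]
   to [G] defined on [L], along the convergence [cvgY] of the images by
   [scale eps]. *)
Definition gamma_limit (dom : R -> set X) (scale : R -> X -> Y)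
    (cvgY : (nat -> Y) -> Y -> Prop) (L : set Y)
    (F : R -> X -> \bar R) (G : Y -> \bar R) : Prop :=
  forall eps : nat -> R, (forall j, 0 < eps j)%R ->
  (eps @ \oo --> 0%R)%classic ->
  forall v, L v ->
  (forall u : nat -> X, (forall j, dom (eps j) (u j)) ->
     cvgY (fun j => scale (eps j) (u j)) v ->
     G v <= limn_einf (fun j => F (eps j) (u j))) /\
  (G v < +oo ->
   exists u : nat -> X,
     [/\ forall j, dom (eps j) (u j),
         cvgY (fun j => scale (eps j) (u j)) v &
         limn_esup (fun j => F (eps j) (u j)) <= G v]).

End gamma_convergence.

(* Main.v *)
(* Substituting y = x + z in the double integral and rescaling z anisotropically
   turns the energy of u, with scaled function v, into
     int_h int_xi |h|^(-1-2s) w_s(xi) A((eps |h| xi, h)) dxi dh,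
   where w_s(xi) = (1 + |xi|^2)^(-d/2-s) and A(z) is the integral of
   |v(x + z) - v(x)|^2 over the x such that x and x + z lie in the cylinder.
   Lower bound: A is, by duality with test functions, lower semicontinuous along
   weak convergence, so for s0 < 1 Fatou's lemma applies. For s0 = 1 the weight
   (1 - s) |h|^(1-2s) concentrates at h = 0, where A(z) / h^2 is bounded below by
   the dual expression of the squared norm of the derivative in x_d; if it stays
   bounded, Riesz representation produces that derivative.
   Upper bound: mollify v at a fixed scale, after a shrinking towards the
   cylinder which is needed in the direction x_d only. Horizontal increments of
   the mollified function then contribute a positive power of eps, vertical ones
   are controlled by those of v, and a diagonal argument concludes.
   The constant for s0 = 1 comes out as the integral of w_1. It equals
   sigma_d / (2 d) because inverse stereographic projection, which multiplies
   small distances by almost 2 / (1 + |y|^2), gives sigma_d as the integral of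
   (2 / (1 + |y|^2))^(d-1): the isodiametric inequality bounds the Hausdorff
   measure from below, coverings of cubes by balls bound it from above, and the
   two integrals are compared by integrating out one coordinate at a time. *)
Require Import Defs.
From HB Require Import structures.
From mathcomp Require Import all_boot all_order all_algebra.
From mathcomp Require Import all_classical all_reals all_analysis.
From mathcomp Require Import ring lra measurable_realfun.

Set Implicit Arguments.
Unset Strict Implicit.
Unset Printing Implicit Defensive.

Import Order.TTheory GRing.Theory Num.Theory.
Import numFieldNormedType.Exports.

Local Open Scope classical_set_scope.
Local Open Scope ring_scope.

(** * Measurability and Lebesgue measure on R^n *)

(** The duality rests on [|g|^2 >= 2 <g, f> - |f|^2], with equality at [f = g]. The right-hand side
    is affine in [g], so it passes to weak limits, and when [g] is an increment or a derivative of
    [v] the operation moves to [f]. Maximizing it over test functions [f] serves three times: it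
    gives their density, the lower semicontinuity of increments and the existence of the weak
    derivative. The obstacle is that the shift moved to [f] varies with the index: [v_j] is paired
    with functions that converge uniformly and not with a fixed one, while no bound on the [v_j] is
    given. For the upper bound [v] is extended by zero. The jumps so created across the lateral
    boundary are invisible to vertical increments, unlike jumps across the top and the bottom; hence
    the shrinking in [x_d] only. For horizontal increments a crude bound, which may blow up with the
    mollification scale, is enough, because this scale stays fixed while [eps] tends to 0. *)

Lemma basis_open_measurable d (T : measurableType d) (I : countType)
    (B : I -> set T) (U : set T) : (forall i, measurable (B i)) ->
  (forall x, U x -> exists2 i, B i x & B i `<=` U) -> measurable U.
Proof.
move=> mB UB.
rewrite (_ : U = \bigcup_(i in [set i | B i `<=` U]) B i).
  rewrite bigcup_mkcond; apply: countable_bigcupT_measurable => // i.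
  by case: ifP.
apply/seteqP; split => [x /UB[i Bix BiU]|x [i /= BiU /BiU]//]; by exists i.
Qed.

Lemma ratr_approx (R : realType) (x e : R) : 0 < e ->
  exists q : rat, `|x - ratr q| < e.
Proof.
move=> e0.
have ne : ball x e !=set0 by exists x; exact: ballxx.
have ob : open (ball x e) by exact: ball_open.
have [y [qx [q _ qE]]] := @dense_rat R (ball x e) ne ob.
by exists q; move: qx; rewrite -qE /ball /=.
Qed.

Lemma measurable_cube (R : realType) n (c : 'rV[R]_n) (e : R) :
  measurable [set x : 'rV[R]_n | forall i, `|x ord0 i - c ord0 i| < e].
Proof.
rewrite (_ : [set _ | _] = \bigcap_(i in [set: 'I_n])
    ((fun x : 'rV[R]_n => x ord0 i) @^-1` `](c ord0 i - e), (c ord0 i + e)[)).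
  apply: fin_bigcap_measurable => // i _; rewrite -[X in measurable X]setTI.
  exact: measurable_rV_coord.
apply/seteqP; split => [x /= xe i _|x xe i] /=.
  by rewrite in_itv /=; have := xe i; rewrite ltr_distl.
by have := xe i I; rewrite /= in_itv /= ltr_distl.
Qed.

(** The sigma-algebra is generated by the coordinates; cubes with rational centres and radii
    [1 / (k + 1)] are measurable for it and form a countable base of the sup-norm topology. *)
Lemma open_measurable_rV (R : realType) n (U : set 'rV[R]_n) :
  open U -> measurable U.
Proof.
move=> oU; pose B (k : 'rV[rat]_n * nat) := [set x : 'rV[R]_n | forall i,
  `|x ord0 i - (map_mx ratr k.1 : 'rV[R]_n) ord0 i| < k.2.+1%:R^-1].
apply: (@basis_open_measurable _ _ _ B) => [k|x Ux]; first exact: measurable_cube.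
have /nbhs_ballP[e /= e0 xeU] := oU x Ux.
have [k ke] : exists k : nat, (k.+1%:R^-1 < e / 2 :> R).
  have [k _ /(_ k (leqnn k))] := near_infty_natSinv_lt (PosNum (divr_gt0 e0 (ltr0n _ 2))).
  by exists k.
have /choice[q qx] : forall i, exists q : rat, `|x ord0 i - ratr q| < k.+1%:R^-1.
  by move=> i; apply: ratr_approx; rewrite invr_gt0.
exists (\row_i q i, k) => [i|y By].
  by rewrite !mxE; exact: qx.
apply: xeU; split => // i j; rewrite (ord1 i) /ball /=.
have := By j; rewrite !mxE /= => yq.
rewrite (le_lt_trans (ler_distD (ratr (q j)) _ _))//.
rewrite [e]splitr ltrD ?(lt_trans (qx j))//.
by rewrite distrC (lt_trans yq).
Qed.

Lemma open_measurable_rVR (R : realType) n (U : set ('rV[R]_n * R)) :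
  open U -> measurable U.
Proof.
move=> oU; pose B (k : 'rV[rat]_n * rat * nat) : set ('rV[R]_n * R) := [set x : 'rV[R]_n | forall i,
  `|x ord0 i - (map_mx ratr k.1.1 : 'rV[R]_n) ord0 i| < k.2.+1%:R^-1] `*`
  [set y : R | `|y - ratr k.1.2| < k.2.+1%:R^-1].
apply: (@basis_open_measurable _ _ _ B) => [k|x Ux].
  apply: measurableX => //; first exact: measurable_cube.
  rewrite (_ : [set _ | _] = ball (ratr k.1.2 : R) k.2.+1%:R^-1); first by apply: open_measurable; exact: ball_open.
  by apply/seteqP; split => y /=; rewrite /ball /= distrC.
have /nbhs_ballP[e /= e0 xeU] : nbhs x U by exact: open_nbhs_nbhs.
have [k ke] : exists k : nat, (k.+1%:R^-1 < e / 2 :> R).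
  have [k _ /(_ k (leqnn k))] := near_infty_natSinv_lt (PosNum (divr_gt0 e0 (ltr0n _ 2))).
  by exists k.
have kp : 0 < k.+1%:R^-1 :> R by rewrite invr_gt0.
have /choice[q qx] : forall i, exists q : rat, `|x.1 ord0 i - ratr q| < k.+1%:R^-1.
  by move=> i; exact: ratr_approx.
have [r rx] := ratr_approx x.2 kp.
exists ((\row_i q i, r), k) => [|y [By1 By2]].
  by split => [i|] //=; rewrite !mxE; exact: qx.
apply: xeU; split; last first.
  rewrite /ball /= (le_lt_trans (ler_distD (ratr r) _ _))//.
  rewrite [e]splitr ltrD ?(lt_trans rx)//.
  by rewrite distrC (lt_trans By2).
split => // i j; rewrite (ord1 i) /ball /=.
have := By1 j; rewrite !mxE /= => yq.
rewrite (le_lt_trans (ler_distD (ratr (q j)) _ _))//.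
rewrite [e]splitr ltrD ?(lt_trans (qx j))//.
by rewrite distrC (lt_trans yq).
Qed.

Lemma continuous_measurable_rVR (R : realType) n (f : 'rV[R]_n * R -> R) :
  continuous f -> measurable_fun setT f.
Proof.
move=> /continuousP cf; apply: (measurability _ (measurable_realfun.RGenOpens.measurableE R)).
move=> _ [_ [a [b ->] <-]]; rewrite setTI.
by apply: open_measurable_rVR; apply/cf; exact: interval_open.
Qed.

Lemma closed_measurable_rV (R : realType) n (K : set ('rV[R]_n)) :
  closed K -> measurable K.
Proof.
move=> cK; rewrite -[K]setCK; apply: measurableC; apply: open_measurable_rV.
exact: closed_openC.
Qed.

Lemma closed_measurable_rVR (R : realType) n (K : set ('rV[R]_n * R)) :
  closed K -> measurable K.
Proof.
move=> cK; rewrite -[K]setCK; apply: measurableC; apply: open_measurable_rVR.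
exact: closed_openC.
Qed.

(** * Changes of variables for Lebesgue measure *)

(** The pushforward of [lebR] by [a x + b], multiplied by [a], gives half-open intervals their
    length, so uniqueness of Lebesgue measure identifies it with [lebR]. *)
Lemma lebR_affine (R : realType) (f : R -> \bar R) (a b : R) : (0 < a)%R ->
  measurable_fun setT f -> (forall x, 0 <= f x)%E ->
  (\int[lebR]_x f (a * x + b)%R = a^-1%:E * \int[lebR]_x f x)%E.
Proof.
move=> a0 mf f0.
pose phi : R -> R := (fun x => a * x + b).
have mphi : measurable_fun setT phi.
  by apply: measurable_funD => //; exact: measurable_funM.
have a10 : (0 <= a)%R by exact: ltW.
pose nu0 : {measure set R -> \bar R} := pushforward (@lebR R) phi.
pose nu := nu0 mphi.
pose mu' : {measure set R -> \bar R} := mscale (NngNum a10) nu.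
have key : forall A : set R, measurable A -> lebR A = mu' A.
  (* Uniqueness is stated for [lebesgue_measure] on [measurableTypeR R], so the same maps are
     retyped there. *)
  pose phi' : measurableTypeR R -> measurableTypeR R := phi.
  have mphi' : measurable_fun setT phi' by exact: mphi.
  pose nu1 : {measure set (measurableTypeR R) -> \bar R} := pushforward (@lebesgue_measure R) phi'.
  pose mu1 : {measure set (measurableTypeR R) -> \bar R} := mscale (NngNum a10) (nu1 mphi').
  move=> A mA; have U := @lebesgue_measure_unique R mu1.
  suff K : forall X : set R, ocitv X -> lebesgue_measure X = mu' X by exact: (U K A mA).
  move=> _ [[x y] _ <-].
  rewrite lebesgue_measure_itv /= lte_fin /mu' /mscale /= /nu /nu0 /= /pushforward.
  rewrite (_ : phi @^-1` `]x, y] = `]((x - b) / a), ((y - b) / a)])%classic; last first.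
    apply/seteqP; split => z /=; rewrite !in_itv /= /phi.
      by rewrite ltr_pdivrMr// ler_pdivlMr// ltrBlDr lerBrDr mulrC.
    by rewrite ltr_pdivrMr// ler_pdivlMr// ltrBlDr lerBrDr mulrC.
  rewrite /lebR lebesgue_measure_itv /= lte_fin ltr_pM2r ?invr_gt0// ltrD2r.
  case: ifPn => _; last by rewrite mule0.
  rewrite -!EFinD -EFinM; congr EFin; field; exact: lt0r_neq0.
have H : (\int[lebR]_x f x = \int[mu']_x f x)%E.
  by apply: eq_measure_integral => A mA _; exact: key.
rewrite H /mu' ge0_integral_mscale//.
rewrite /nu /nu0 ge0_integral_pushforward//=.
by rewrite muleA -EFinM mulVf ?gt_eqF// mul1e preimage_setT.
Qed.
Lemma measurable_int_snd d1 d2 (T1 : measurableType d1) (T2 : measurableType d2)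
    (R : realType) (m2 : {sigma_finite_measure set T2 -> \bar R})
    (f : T1 -> T2 -> \bar R) :
  measurable_fun setT (fun p => f p.1 p.2) -> (forall x y, 0 <= f x y)%E ->
  measurable_fun setT (fun x => \int[m2]_y f x y)%E.
Proof.
by move=> mf f0; apply: (@measurable_fun_fubini_tonelli_F _ _ _ _ _ _ (fun p => f p.1 p.2)).
Qed.

Lemma measurable_int_fst d1 d2 (T1 : measurableType d1) (T2 : measurableType d2)
    (R : realType) (m1 : {sigma_finite_measure set T1 -> \bar R})
    (f : T1 -> T2 -> \bar R) :
  measurable_fun setT (fun p => f p.1 p.2) -> (forall x y, 0 <= f x y)%E ->
  measurable_fun setT (fun y => \int[m1]_x f x y)%E.
Proof.
by move=> mf f0; apply: (@measurable_fun_fubini_tonelli_G _ _ _ _ _ m1 (fun p => f p.1 p.2)).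
Qed.

Lemma measurable_rV_affine (R : realType) n (a : R) (b : 'rV[R]_n) :
  measurable_fun setT (fun x : 'rV[R]_n => a *: x + b).
Proof.
apply: measurable_fun_rVP => i; under eq_fun do rewrite !mxE.
apply: measurable_funD => //; apply: measurable_funM => //.
exact: measurable_rV_coord.
Qed.

Lemma rV_unconsK (R : realType) n : cancel (@rV_uncons R n) (@rV_cons R n).
Proof.
move=> x; apply/rowP => i; case: (split_ordP (i : 'I_(1 + n))) => j ->.
  rewrite (_ : lshift n j = ord0); last by apply: val_inj; case: j => [] [].
  by rewrite rV_cons0.
by rewrite rV_consS mxE.
Qed.

Lemma rV_cons_affine (R : realType) n (a t s : R) (x y : 'rV[R]_n) :
  a *: rV_cons (t, x) + rV_cons (s, y) = rV_cons (a * t + s, a *: x + y).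
Proof.
apply/rowP => i; rewrite 2!mxE; case: (split_ordP (i : 'I_(1 + n))) => j ->.
  rewrite (_ : lshift n j = ord0) ?rV_cons0//.
  by apply: val_inj; case: j => [] [].
by rewrite !rV_consS !mxE.
Qed.

Lemma integral_rV_cons (R : realType) n (f : 'rV[R]_n.+1 -> \bar R) :
  measurable_fun setT f -> (forall x, 0 <= f x)%E ->
  (\int[lebesgue_rV n.+1]_x f x =
   \int[lebR]_t \int[lebesgue_rV n]_y f (rV_cons (t, y)))%E.
Proof.
move=> mf f0.
transitivity (\int[(@lebR R \x lebesgue_rV n)%E]_p f (rV_cons p))%E.
  pose nu0 : {measure set 'rV[R]_n.+1 -> \bar R} := pushforward (@lebR R \x lebesgue_rV n)%E (@rV_cons R n).
  transitivity (\int[nu0 (measurable_rV_cons (n := n))]_x f x)%E.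
    by apply: eq_measure_integral => A mA _.
  by rewrite /nu0 ge0_integral_pushforward//; exact: measurable_rV_cons.
rewrite fubini_tonelli1//.
by apply: measurableT_comp => //; exact: measurable_rV_cons.
Qed.

Lemma ge0_integralZT d (T : measurableType d) (R : realType)
    (mu : {measure set T -> \bar R}) (f : T -> \bar R) (k : R) :
  measurable_fun setT f -> (forall x, 0 <= f x)%E -> 0 <= k ->
  (\int[mu]_x (k%:E * f x) = k%:E * \int[mu]_x f x)%E.
Proof. by move=> mf f0 k0; rewrite ge0_integralZl. Qed.

Lemma lebesgue_rV_affine (R : realType) n (f : 'rV[R]_n -> \bar R) (a : R) b :
  0 < a -> measurable_fun setT f -> (forall x, 0 <= f x)%E ->
  (\int[lebesgue_rV n]_x f (a *: x + b)%R = (a ^- n)%:E * \int[lebesgue_rV n]_x f x)%E.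
Proof.
move=> a0; elim: n => [|n IH] in f b * => mf f0.
  rewrite /= !integral_dirac//=; last first.
    by apply: measurableT_comp => //; exact: measurable_rV_affine.
  by rewrite !diracT !mul1e expr0 invr1 mul1e; congr f; rewrite !thinmx0.
rewrite !integral_rV_cons//; last by apply: measurableT_comp => //; exact: measurable_rV_affine.
pose g t y := f (rV_cons (t, y)).
have mg : measurable_fun setT (fun p : R * 'rV[R]_n => g p.1 p.2).
  rewrite /g (_ : (fun _ => _) = f \o @rV_cons R n); last by apply/funext => -[].
  by apply: measurableT_comp => //; exact: measurable_rV_cons.
have mI : measurable_fun setT (fun t => \int[lebesgue_rV n]_y g t y)%E.
  by apply: measurable_int_snd => [|x y]; [exact: mg|exact: f0].
rewrite -(rV_unconsK b) /rV_uncons.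
set b0 := b ord0 ord0; set b' := \row_j _.
transitivity (\int[lebR]_t ((a ^- n)%:E * \int[lebesgue_rV n]_y g (a * t + b0)%R y))%E.
  apply: eq_integral => t _.
  rewrite -(IH (g (a * t + b0)%R) b'); last 2 first.
    exact: (measurableT_comp mg (measurable_pair1 _)).
    by move=> x; exact: f0.
  by apply: eq_integral => y _; rewrite rV_cons_affine.
rewrite ge0_integralZT; last 3 first.
- apply: (measurableT_comp mI).
  by apply: measurable_funD => //; exact: measurable_funM.
- by move=> t; apply: integral_ge0 => y _; exact: f0.
- by rewrite invr_ge0 exprn_ge0 // ltW.
rewrite (@lebR_affine _ (fun t => \int[lebesgue_rV n]_y g t y)%E _ _ a0 mI); last first.
  by move=> t; apply: integral_ge0 => y _; exact: f0.
by rewrite muleA -EFinM -invfM exprSr.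
Qed.

Lemma integral_leb (R : realType) d (f : pt R d -> \bar R) :
  measurable_fun setT f -> (forall x, 0 <= f x)%E ->
  (\int[leb]_x f x = \int[lebesgue_rV d.-1]_y \int[lebR]_t f (y, t))%E.
Proof. by move=> mf f0; rewrite -fubini_tonelli1. Qed.

Lemma integral_leb_sym (R : realType) d (f : pt R d -> \bar R) :
  measurable_fun setT f -> (forall x, 0 <= f x)%E ->
  (\int[leb]_x f x = \int[lebR]_t \int[lebesgue_rV d.-1]_y f (y, t))%E.
Proof. by move=> mf f0; rewrite -fubini_tonelli// -fubini_tonelli1. Qed.

(** Horizontal and vertical factors are independent: thin cylinders and [shrink] scale the height
    alone. *)
Lemma leb_affine (R : realType) d (f : pt R d -> \bar R) (a1 a2 : R) b1 b2 :
  0 < a1 -> 0 < a2 -> measurable_fun setT f -> (forall x, 0 <= f x)%E ->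
  (\int[leb]_x f (a1 *: x.1 + b1, a2 * x.2 + b2)%R =
   (a1 ^- d.-1 * a2^-1)%:E * \int[leb]_x f x)%E.
Proof.
move=> a10 a20 mf f0.
have mphi : measurable_fun setT (fun x : pt R d => (a1 *: x.1 + b1, a2 * x.2 + b2)).
  apply/measurable_fun_pairP; split.
    exact: (measurableT_comp (measurable_rV_affine a1 b1) measurable_fst).
  by apply: measurable_funD => //; apply: measurable_funM.
rewrite integral_leb//; last by apply: measurableT_comp mf mphi.
rewrite integral_leb// /=.
transitivity (\int[lebesgue_rV d.-1]_y (a2^-1%:E * \int[lebR]_t f (a1 *: y + b1, t)%R))%E.
  apply: eq_integral => y _.
  rewrite -(lebR_affine (f := fun t => f (a1 *: y + b1, t)) b2)//.
  exact: (measurableT_comp mf (measurable_pair1 _)).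
have mF : measurable_fun setT (fun y => \int[@lebR R]_t f (y, t))%E.
  apply: (@measurable_int_snd _ _ _ _ _ _ (fun y t => f (y, t))) => //.
  by rewrite (_ : (fun _ => _) = f)//; apply/funext => -[].
rewrite ge0_integralZT; last 3 first.
- by apply: (measurableT_comp mF); exact: measurable_rV_affine.
- by move=> y; apply: integral_ge0.
- by rewrite invr_ge0 ltW.
rewrite (@lebesgue_rV_affine _ _ (fun y => \int[lebR]_t f (y, t))%E _ _ a10 mF); last first.
  by move=> y; apply: integral_ge0.
by rewrite muleA -EFinM mulrC.
Qed.
Lemma lebR_opp (R : realType) (f : R -> \bar R) :
  measurable_fun setT f -> (forall x, 0 <= f x)%E ->
  (\int[lebR]_x f (- x)%R = \int[lebR]_x f x)%E.
Proof.
move=> mf f0.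
have mN : measurable_fun setT (-%R : R -> R) by [].
pose nu0 : {measure set R -> \bar R} := pushforward (@lebR R) -%R.
have -> : (\int[lebR]_x f x = \int[nu0 mN]_x f x)%E.
  apply: eq_measure_integral => A mA _; rewrite /nu0 /=.
  exact/esym/lebesgue_measureN.
by rewrite /nu0 ge0_integral_pushforward.
Qed.

(** Gives access to the fundamental theorem of calculus, which is about [lebesgue_measure]; the
    identity between the two displays preserves the measure. *)
Lemma lebR_lebesgue (R : realType) (D : set R) (f : R -> \bar R) :
  measurable D -> measurable_fun D f ->
  (\int[lebR]_(x in D) f x = \int[lebesgue_measure]_(x in D) f x)%E.
Proof.
move=> mD.
suff ge0 g : measurable_fun D g -> (forall x, 0 <= g x)%E ->
    (\int[lebR]_(x in D) g x = \int[lebesgue_measure]_(x in D) g x)%E.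
  move=> mf; rewrite [LHS]integralE [RHS]integralE; congr (_ - _)%E.
    by apply: ge0; [exact: measurable_funepos|exact: funepos_ge0].
  by apply: ge0; [exact: measurable_funeneg|exact: funeneg_ge0].
move=> mg g0; pose phi : measurableTypeR R -> R := id.
have mphi : measurable_fun setT phi by move=> _ Y mY; rewrite setTI.
pose nu0 : {measure set R -> \bar R} := pushforward (@lebesgue_measure R) phi.
transitivity (\int[nu0 mphi]_(x in D) g x)%E.
  by apply: eq_measure_integral => A mA _.
by rewrite /nu0 ge0_integral_pushforward.
Qed.

Lemma lebR_set1 (R : realType) (x : R) : lebR [set x] = 0%E.
Proof. exact: lebesgue_measure_set1. Qed.

Lemma lebR_even (R : realType) (f : R -> \bar R) :
  measurable_fun setT f -> (forall x, 0 <= f x)%E -> (forall x, f (- x) = f x) ->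
  (\int[lebR]_x f x = 2%:E * \int[lebR]_(x in `]0%R, +oo[) f x)%E.
Proof.
move=> mf f0 fN.
have -> : [set: R] = `]-oo, 0%R[ `|` ([set 0] `|` `]0%R, +oo[)%classic :> set R.
  apply/esym; rewrite -subTset => x _.
  have [x0|x0|->] := ltgtP x 0; [left|right; right|right; left] => //=; by rewrite in_itv /= ?x0.
have mU : measurable ([set (0 : R)] `|` `]0%R, +oo[%classic : set R).
  by apply: measurableU; [exact: measurable_set1|exact: measurable_itv].
rewrite ge0_integral_setU//=; last 2 first.
- exact: measurable_funTS.
- apply/disj_setPRL => x /= [->|]; rewrite in_itv /= ?ltxx//.
  by rewrite andbT => x0; rewrite in_itv /= => /ltW; rewrite leNgt x0.
rewrite ge0_integral_setU//=; last 2 first.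
- exact: measurable_funTS.
- by apply/disj_setPRL => x /=; rewrite in_itv /= andbT => x0 xE; rewrite xE ltxx in x0.
rewrite [X in (_ + (X + _))%E]null_set_integral; last 3 first.
- exact: measurable_set1.
- exact: measurable_funTS.
- exact: lebR_set1.
rewrite add0e (_ : (\int[lebR]_(x in `]-oo, 0%R[) f x) = (\int[lebR]_(x in `]0%R, +oo[) f x))%E.
  by rewrite -mule2n mule_natl.
rewrite integral_mkcond -lebR_opp//; last 2 first.
- by apply/(measurable_restrictT f) => //; exact: measurable_funTS.
- by move=> x; apply: erestrict_ge0.
rewrite [RHS]integral_mkcond; apply: eq_integral => x _.
by rewrite !patchE !mem_setE /= !in_itv /= oppr_lt0 andbT fN.
Qed.

(** * Integrals of powers *)

Lemma FTC_is_derive (R : realType) (f F : R -> R) (a b : R) : a < b ->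
  (forall x, a <= x <= b -> is_derive x 1 F (f x)) ->
  (forall x, a <= x <= b -> {for x, continuous f}) ->
  (\int[lebR]_(x in `[a, b]) (f x)%:E = (F b - F a)%:E)%E.
Proof.
move=> ab dF cf.
have mf : measurable_fun `[a, b] f.
  apply: subspace_continuous_measurable_fun => //.
  by apply: continuous_in_subspaceT => x; rewrite inE /= in_itv /= => /cf.
rewrite lebR_lebesgue//; last exact/measurable_EFinP.
have dc x : a <= x <= b -> {for x, continuous F}.
  by move=> /dF dFx; apply/differentiable_continuous/derivable1_diffP.
rewrite (@continuous_FTC2 _ f F)//.
- by apply: continuous_in_subspaceT => x; rewrite inE /= in_itv /= => /cf.
- split.
  + move=> x; rewrite in_itv /= => /andP[ax xb].
    by have [] := dF x; rewrite ?(ltW ax)//= ?ltW.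
  + by apply/cvg_at_right_filter/dc; rewrite lexx ltW.
  + by apply/cvg_at_left_filter/dc; rewrite lexx ltW.
- move=> x; rewrite in_itv /= => /andP[ax xb].
  have := dF x; rewrite (ltW ax) (ltW xb) => /(_ isT) h.
  by rewrite derive1E derive_val.
Qed.

Lemma powR_continuous_gt0 (R : realType) (p x : R) : 0 < x ->
  {for x, continuous (@powR R ^~ p)}.
Proof.
move=> x0; apply/differentiable_continuous/derivable1_diffP.
by have [] := @is_derive1_powR R p x x0.
Qed.

Lemma integral_powR0 (R : realType) (p eta : R) : 0 < p -> 0 < eta ->
  (\int[lebR]_(x in `]0%R, eta[) (x `^ (p - 1))%:E = (eta `^ p / p)%:E)%E.
Proof.
move=> p0 e0.
have mf : measurable_fun setT (fun x : R => (x `^ (p - 1))%:E).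
  by apply/measurable_EFinP; exact: measurable_powR.
rewrite lebR_lebesgue//; last exact: measurable_funTS.
rewrite integral_itv_bndo_bndc//; last exact: measurable_funTS.
rewrite -lebR_lebesgue//; last exact: measurable_funTS.
(* For [p < 1] the power blows up at 0, so the fundamental theorem is applied on intervals away from
   0 that exhaust []0, eta]]. *)
pose F k := `[eta / k.+1%:R, eta]%classic : set R.
have UF : `]0, eta]%classic = \bigcup_k F k.
  apply/seteqP; split => [x /=|x [k _]] /=; rewrite !in_itv /=.
    move=> /andP[x0 xe].
    have [k ke] : exists k : nat, eta / x < k.+1%:R.
      exists (Num.trunc (eta / x)); exact: truncnS_gt.
    exists k => //; rewrite /F /= in_itv /= xe andbT ler_pdivrMr// mulrC -ler_pdivrMr//.
    exact: ltW.
  rewrite /F /= in_itv /= => /andP[kx ->]; rewrite andbT (lt_le_trans _ kx)//.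
  by rewrite divr_gt0.
have ndF : nondecreasing_seq F.
  move=> i j ij; rewrite subsetEset; apply: subset_itvr; rewrite bnd_simp.
  by rewrite ler_pM2l// lef_pV2 ?posrE// ler_nat.
have := @ge0_nondecreasing_set_cvg_integral _ _ _ F (fun x : R => (x `^ (p - 1))%:E) (@lebR R) ndF.
rewrite -UF => cvgF.
have {}cvgF : (fun k => \int[lebR]_(x in F k) (x `^ (p - 1))%:E)%E @ \oo -->
    (\int[lebR]_(x in `]0%R, eta]) (x `^ (p - 1))%:E)%E.
  apply: cvgF => [i|i|i x _]; first exact: measurable_itv.
    exact: measurable_funTS.
  by rewrite lee_fin powR_ge0.
have FE : (fun k => \int[lebR]_(x in F k) (x `^ (p - 1))%:E)%E @ \oo -->
    (eta `^ p / p)%:E.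
  (* [F 0] is a single point while [FTC_is_derive] wants a nondegenerate interval; the shift starts
     at [F 1]. *)
  rewrite -(cvg_shiftS (fun k => \int[lebR]_(x in F k) (x `^ (p - 1))%:E)%E).
  rewrite (_ : (fun _ => _) = EFin \o (fun k => (eta `^ p / p) - (eta / k.+2%:R) `^ p / p)); last first.
    apply/funext => k; rewrite /F /=; apply: (etrans (@FTC_is_derive _ _ (fun x => x `^ p / p) _ _ _ _ _)) => //=.
    - by rewrite ltr_pdivrMr// ltr_pMr// ltr1n.
    - move=> x /andP[ex _]; have x0 : 0 < x by rewrite (lt_le_trans _ ex)// divr_gt0.
      have -> : x `^ (p - 1) = p^-1 *: (p * x `^ (p - 1)).
        by rewrite /GRing.scale /= mulKf// gt_eqF.
      rewrite (_ : (fun _ => _) = p^-1 \*: (@powR R ^~ p)); last by apply/funext => y /=; rewrite mulrC.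
      by have h := @is_derive1_powR R p x x0; exact: (is_deriveZ p^-1 h).
    - move=> x /andP[ex _]; apply: powR_continuous_gt0.
      by rewrite (lt_le_trans _ ex)// divr_gt0.
  apply: cvg_EFin; first by near=> k.
  rewrite -[X in _ --> X]subr0; apply: cvgB; first exact: cvg_cst.
  rewrite -[X in _ --> X](mul0r p^-1); apply: cvgM; last exact: cvg_cst.
  apply: (@cvg_comp _ _ _ (fun k : nat => eta / k.+2%:R) (@powR R ^~ p) _ (0^'+)); last exact: powR_cvg0.
  move=> P [e /= e0' eP]; near=> k; apply: eP => /=; last by rewrite divr_gt0.
  rewrite sub0r normrN gtr0_norm ?divr_gt0// ltr_pdivrMr// mulrC -ltr_pdivrMr//.
  rewrite (@lt_trans _ _ k.+1%:R)// ?ltr_nat//.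
  by rewrite -ltf_pV2 ?posrE ?divr_gt0// invf_div; near: k; exact: (near_infty_natSinv_lt (PosNum (divr_gt0 e0' e0))).
by apply: (cvg_unique _ cvgF FE).
Unshelve. all: end_near. Qed.
Lemma measurable_powR_fun d (T : measurableType d) (R : realType) (f : T -> R) (p : R) :
  measurable_fun setT f -> measurable_fun setT (fun x => f x `^ p).
Proof. by move=> mf; exact: (measurableT_comp (@measurable_powR R p) mf). Qed.

Lemma integral_powR_sym (R : realType) (p eta : R) : 0 < p -> 0 < eta ->
  (\int[lebR]_(x in `](- eta)%R, eta[) (`|x| `^ (p - 1))%:E = (2 * eta `^ p / p)%:E)%E.
Proof.
move=> p0 e0.
have mf D : measurable_fun D (fun x : R => (`|x| `^ (p - 1))%:E).
  apply/measurable_EFinP/measurable_funTS.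
  by apply: measurable_powR_fun; exact: normr_measurable.
rewrite integral_mkcond lebR_even//; last 3 first.
- by apply/(measurable_restrictT (fun x : R => (`|x| `^ (p - 1))%:E)) => //; exact: mf.
- by move=> x; apply: erestrict_ge0 => y _; rewrite lee_fin powR_ge0.
- move=> x; rewrite !patchE normrN; congr (if _ then _ else _).
  by rewrite !mem_setE !in_itv /= ltrNl opprK ltrNl andbC.
rewrite -mulrA EFinM -integral_powR0//; congr (_ * _)%E.
rewrite -integral_mkcondr integral_mkcond [RHS]integral_mkcond.
apply: eq_integral => x _; rewrite !patchE.
have -> : (x \in `]0%R, +oo[ `&` `](- eta)%R, eta[) = (x \in `]0%R, eta[%classic).
  rewrite in_setI !mem_setE !in_itv /= andbT; case: ltP => //= x0.
  by rewrite (lt_trans _ x0)// oppr_lt0.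
by case: ifPn => //; rewrite mem_setE in_itv /= => /andP[x0 _]; rewrite gtr0_norm.
Qed.

Lemma integral_powRy (R : realType) (r : R) : 1 < r ->
  (\int[lebR]_(x in `[1%R, +oo[) (x `^ (- r))%:E <= ((r - 1)^-1)%:E)%E.
Proof.
move=> r1; have rn0 : r - 1 != 0 by rewrite subr_eq0 gt_eqF.
have mf D : measurable_fun D (fun x : R => (x `^ (- r))%:E).
  by apply/measurable_EFinP/measurable_funTS; exact: measurable_powR.
pose F k := `[1, k.+2%:R]%classic : set R.
have UF : `[1, +oo[%classic = \bigcup_k F k.
  apply/seteqP; split => [x /=|x [k _]]; rewrite /F /= !in_itv /= ?andbT.
    move=> x1; exists (Num.trunc x) => //=; rewrite in_itv /= x1 /=.
    by rewrite (le_trans (ltW (truncnS_gt _)))// ler_nat.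
  by case/andP.
have ndF : nondecreasing_seq F.
  move=> i j ij; rewrite subsetEset; apply: subset_itvl; rewrite bnd_simp.
  by rewrite ler_nat !ltnS.
have := @ge0_nondecreasing_set_cvg_integral _ _ _ F (fun x : R => (x `^ (- r))%:E) (@lebR R) ndF.
rewrite -UF => cvgF.
have {}cvgF : (fun k => \int[lebR]_(x in F k) (x `^ (- r))%:E)%E @ \oo -->
    (\int[lebR]_(x in `[1%R, +oo[) (x `^ (- r))%:E)%E.
  apply: cvgF => [i|i|i x _]; first exact: measurable_itv.
    exact: mf.
  by rewrite lee_fin powR_ge0.
rewrite -(cvg_lim _ cvgF)//; apply: lime_le; first by apply/cvg_ex; eexists; exact: cvgF.
apply: nearW => k; rewrite /F.
apply: (@le_trans _ _ ((- (k.+2%:R `^ (1 - r) / (r - 1))) - (- (1 `^ (1 - r) / (r - 1))))%:E).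
  have x0 (x : R) : 1 <= x <= k.+2%:R -> 0 < x by move=> /andP[x1 _]; rewrite (lt_le_trans _ x1).
  rewrite le_eqVlt; apply/orP; left; apply/eqP; apply: (@FTC_is_derive _ _ (fun x => - (x `^ (1 - r) / (r - 1)))).
  - by rewrite ltr1n.
  - move=> x /x0 xp.
    have -> : x `^ (- r) = (- (r - 1)^-1) *: ((1 - r) * x `^ (1 - r - 1)).
      rewrite (_ : 1 - r - 1 = - r); last by ring.
      by rewrite /GRing.scale /=; field.
    rewrite (_ : (fun _ => _) = (- (r - 1)^-1) \*: (@powR R ^~ (1 - r))); last first.
      by apply/funext => y; rewrite /= /GRing.scale /= mulNr mulrC.
    by have h := @is_derive1_powR R (1 - r) x xp; exact: (is_deriveZ _ h).
  - by move=> x /x0 xp; exact: powR_continuous_gt0.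
rewrite lee_fin opprK powR1 div1r addrC lerBlDr lerDl divr_ge0 ?powR_ge0// subr_ge0.
exact: ltW.
Qed.

(** * Integrals of powers of 1 + |x|^2 *)

Definition radial_int (R : realType) n (p : R) : \bar R :=
  (\int[lebesgue_rV n]_x ((1 + dotp x x) `^ (- p))%:E)%E.

Definition cauchy_int (R : realType) (p : R) : \bar R :=
  (\int[lebR]_x ((1 + x ^+ 2) `^ (- p))%:E)%E.

Lemma cauchy_int_lty (R : realType) (p : R) : 2^-1 < p -> (cauchy_int p < +oo)%E.
Proof.
move=> p2; have p0 : 0 < p by rewrite (lt_trans _ p2)// invr_gt0.
have mf : measurable_fun setT (fun x : R => ((1 + x ^+ 2) `^ (- p))%:E).
  apply/measurable_EFinP; apply: measurable_powR_fun.
  by apply: measurable_funD => //; exact: exprn_measurable.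
rewrite /cauchy_int lebR_even//; last 2 first.
- by move=> x; rewrite lee_fin powR_ge0.
- by move=> x; rewrite sqrrN.
apply: lte_mul_pinfty => //.
have -> : `]0, +oo[%classic = `]0, 1[ `|` `[1, +oo[%classic :> set R.
  apply/seteqP; split => x /=; rewrite !in_itv /= ?andbT; last first.
    by case=> [/andP[]//|x1]; rewrite (lt_le_trans _ x1).
  by move=> x0; case: (ltP x 1) => x1; [left|right]; rewrite // x0.
rewrite ge0_integral_setU//=; last 3 first.
- exact: measurable_funTS.
- by move=> x _; rewrite lee_fin powR_ge0.
- apply/disj_setPRL => x /=; rewrite !in_itv /= andbT => x1.
  by apply/negP; rewrite negb_and -!leNgt x1 orbT.
apply: lte_add_pinfty.
  apply: (@le_lt_trans _ _ (\int[lebR]_(x in `]0%R, 1%R[) 1)%E).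
    apply: ge0_le_integral => //=.
    + by move=> x _; rewrite lee_fin powR_ge0.
    + exact: measurable_funTS.
    + move=> x _; rewrite lee_fin powRN invf_le1 ?powR_gt0 ?ltr_pwDl// ?sqr_ge0//.
      apply: (le_trans (y := 1 `^ p)); first by rewrite powR1.
      by apply: ge0_ler_powR; rewrite ?nnegrE ?addr_ge0 ?sqr_ge0 ?lerDl ?sqr_ge0// ltW.
  by rewrite integral_cst//= mul1e /lebR lebesgue_measure_itv /= lte01 oppr0 adde0 ltry.
apply: (@le_lt_trans _ _ (\int[lebR]_(x in `[1%R, +oo[) (x `^ (- (2 * p)))%:E)%E).
  apply: ge0_le_integral => //=.
  + by move=> x _; rewrite lee_fin powR_ge0.
  + exact: measurable_funTS.
  + by apply/measurable_EFinP/measurable_funTS; exact: measurable_powR.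
  + move=> x; rewrite in_itv /= andbT => x1; have x0 : 0 < x by rewrite (lt_le_trans _ x1).
    rewrite lee_fin !powRN lef_pV2 ?posrE ?powR_gt0 ?ltr_pwDl ?sqr_ge0//.
    rewrite powRrM powR_mulrn ?(ltW x0)//.
    by rewrite ge0_ler_powR ?nnegrE ?(ltW p0)// ?lerDr ?addr_ge0 ?sqr_ge0.
apply: le_lt_trans (integral_powRy _) (ltry _).
by rewrite -ltr_pdivrMl// mulr1.
Qed.

Lemma dotp_rV_cons (R : realType) n (t : R) (x : 'rV[R]_n) :
  dotp (rV_cons (t, x)) (rV_cons (t, x)) = t ^+ 2 + dotp x x.
Proof.
rewrite /dotp big_ord_recl rV_cons0 -expr2; congr (_ + _).
by apply: eq_bigr => i _; rewrite -rshift1 rV_consS.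
Qed.

Lemma dotp_ge0 (R : realType) n (x : 'rV[R]_n) : 0 <= dotp x x.
Proof. by apply: sumr_ge0 => i _; rewrite -expr2 sqr_ge0. Qed.

Lemma measurable_dotp (R : realType) n : measurable_fun setT (fun x : 'rV[R]_n => dotp x x).
Proof.
apply: measurable_sum => i; apply: measurable_funM; exact: measurable_rV_coord.
Qed.

Lemma measurable_radial (R : realType) n (p : R) :
  measurable_fun setT (fun x : 'rV[R]_n => ((1 + dotp x x) `^ p)%:E).
Proof.
apply/measurable_EFinP; apply: measurable_powR_fun.
by apply: measurable_funD => //; exact: measurable_dotp.
Qed.

(** The substitution is [t = sqrt A x]; its Jacobian is the [2^-1] in the exponent. *)
Lemma integral_cauchy_scale (R : realType) (A p : R) : 0 < A ->
  (\int[lebR]_t ((A + t ^+ 2) `^ (- p))%:E = (A `^ (2^-1 - p))%:E * cauchy_int p)%E.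
Proof.
move=> A0; have sA : 0 < Num.sqrt A by rewrite sqrtr_gt0.
have mf : measurable_fun setT (fun x : R => ((A + x ^+ 2) `^ (- p))%:E).
  apply/measurable_EFinP; apply: measurable_powR_fun.
  by apply: measurable_funD => //; exact: exprn_measurable.
have m1 : measurable_fun setT (fun x : R => ((1 + x ^+ 2) `^ (- p))%:E).
  apply/measurable_EFinP; apply: measurable_powR_fun.
  by apply: measurable_funD => //; exact: exprn_measurable.
have := lebR_affine 0 sA mf (fun x => ltac:(by rewrite lee_fin powR_ge0)).
rewrite (_ : (fun x => _) = (fun x => (A `^ (- p))%:E * ((1 + x ^+ 2) `^ (- p))%:E)%E).
  rewrite ge0_integralZT ?powR_ge0//; last by move=> x; rewrite lee_fin powR_ge0.
  move=> H; rewrite /cauchy_int powRD; last by rewrite (gt_eqF A0) implybT.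
  rewrite EFinM -muleA H muleA -EFinM powR12_sqrt ?ltW//.
  by rewrite divff ?mul1e// gt_eqF.
apply/funext => x /=; rewrite addr0 exprMn sqr_sqrtr ?ltW//.
rewrite -{1}(mulr1 A) -mulrDr powRM ?ltW// ?EFinM//.
by rewrite ltr_pwDl// sqr_ge0.
Qed.

(** Integrate out the first coordinate with [A = 1 + |y|^2], where [y] collects the others: this
    costs half a power of [A]. *)
Lemma radial_intS (R : realType) n (p : R) :
  (radial_int n.+1 p = cauchy_int p * radial_int n (p - 2^-1))%E.
Proof.
have mf : measurable_fun setT (fun q : R * 'rV[R]_n =>
    ((1 + dotp (rV_cons q) (rV_cons q)) `^ (- p))%:E).
  by apply: (measurableT_comp (@measurable_radial R n.+1 (- p))); exact: measurable_rV_cons.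
rewrite /radial_int integral_rV_cons; last 2 first.
- exact: measurable_radial.
- by move=> x; rewrite lee_fin powR_ge0.
rewrite (@fubini_tonelli _ _ _ _ _ (@lebR R) (lebesgue_rV n) (fun q => ((1 + dotp (rV_cons q) (rV_cons q)) `^ (- p))%:E) mf); last first.
  by move=> x; rewrite lee_fin powR_ge0.
transitivity (\int[lebesgue_rV n]_y (cauchy_int p * ((1 + dotp y y) `^ (- (p - 2^-1)))%:E))%E.
  apply: eq_integral => y _; rewrite muleC opprB -integral_cauchy_scale; last first.
    by rewrite ltr_pwDl// dotp_ge0.
  apply: eq_integral => t _ /=; rewrite dotp_rV_cons; congr (_ `^ _)%:E.
  by rewrite -addrA; congr (_ + _); rewrite addrC.
rewrite ge0_integralZl//.
- exact: measurable_radial.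
- by move=> x _; rewrite lee_fin powR_ge0.
- by apply: integral_ge0 => x _; rewrite lee_fin powR_ge0.
Qed.

(** Each peeled coordinate lowers [n / 2] and [p] by the same amount, so the condition reproduces
    itself, and it forces exponents above [1 / 2] in the one-dimensional factors. *)
Lemma radial_int_lty (R : realType) n (p : R) : n%:R / 2 < p -> (radial_int n p < +oo)%E.
Proof.
elim: n p => [|n IH] p np.
  rewrite /radial_int /= integral_dirac//; last first.
    exact: measurable_radial.
  by rewrite diracT mul1e ltry.
rewrite radial_intS; apply: lte_mul_pinfty.
- by apply: integral_ge0 => x _; rewrite lee_fin powR_ge0.
- rewrite ge0_fin_numE; last by apply: integral_ge0 => x _; rewrite lee_fin powR_ge0.
  apply: cauchy_int_lty; rewrite (le_lt_trans _ np)// -{1}(mul1r 2^-1) ler_pM2r ?invr_gt0//.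
  by rewrite ler1n.
- by apply: IH; move: np; rewrite -natr1 mulrDl mul1r ltrBrDr.
Qed.

(** * Lower and upper limits, measures of boxes and cylinders *)

Lemma limn_einf_geP (R : realType) (u : (\bar R)^nat) (G : \bar R) :
  (forall a : R, (a%:E < G)%E -> \forall j \near \oo, (a%:E <= u j)%E) ->
  (G <= limn_einf u)%E.
Proof.
move=> H; have Hle (a : R) : (a%:E < G)%E -> (a%:E <= limn_einf u)%E.
  move=> /H [N _ Nu]; rewrite limn_einf_lim; apply: lime_ge.
    exact: is_cvg_einfs.
  near=> n; apply: le_ereal_inf_tmp => _ [k /= nk <-]; apply: Nu => /=.
  by rewrite (leq_trans _ nk)//; near: n; exact: nbhs_infty_ge.
case: G H Hle => [r||] H Hle; last by rewrite leNye.
  apply/lee_addgt0Pr => e e0; rewrite -leeBlDr//; apply: Hle.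
  by rewrite lte_fin ltrBlDr ltrDl.
rewrite leye_eq; apply/eqP/eqyP => r r0; apply: Hle; exact: ltry.
Unshelve. all: end_near. Qed.

Lemma limn_einf_gt_near (R : realType) (u : (\bar R)^nat) (a : \bar R) :
  (a < limn_einf u)%E -> \forall j \near \oo, (a < u j)%E.
Proof.
rewrite limn_einf_lim (cvg_lim _ (@cvg_einfs_sup _ u))// => /ereal_sup_gt[_ [n _ <-] au].
near=> j; apply: (lt_le_trans au); apply: ge_ereal_inf; exists (u j) => //.
by exists j => //=; near: j; exact: nbhs_infty_ge.
Unshelve. all: end_near. Qed.

Lemma limn_esup_leP (R : realType) (u : (\bar R)^nat) (G : \bar R) :
  (forall a : R, (G < a%:E)%E -> \forall j \near \oo, (u j <= a%:E)%E) ->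
  (limn_esup u <= G)%E.
Proof.
move=> H.
have := @limn_einf_geP R (fun j => - u j)%E (- G)%E.
rewrite (_ : limn_einf _ = - limn_esup u)%E ?leeN2; last by rewrite limn_einfN.
apply => a aG; have /H : (G < (- a)%:E)%E by rewrite EFinN lteNr.
by apply: filterS => j; rewrite EFinN leeNr.
Qed.
Lemma lebesgue_rV_prod (R : realType) n (J : 'I_n -> set R) (l : 'I_n -> R) :
  (forall i, measurable (J i)) -> (forall i, lebR (J i) = (l i)%:E) ->
  lebesgue_rV n [set x : 'rV[R]_n | forall i, J i (x ord0 i)] = (\prod_i l i)%:E.
Proof.
elim: n J l => [|n IH] J l mJ lJ.
  rewrite big_ord0 /= (_ : [set _ | _] = setT) ?diracT//.
  by apply/seteqP; split => // x _ [].
rewrite big_ord_recl EFinM -lJ.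
rewrite -(IH (fun i => J (lift ord0 i)) (fun i => l (lift ord0 i)))//.
rewrite -product_measure1E//; last first.
  rewrite (_ : [set _ | _] = \bigcap_(i in [set: 'I_n])
      ((fun x : 'rV[R]_n => x ord0 i) @^-1` J (lift ord0 i))).
    apply: fin_bigcap_measurable => // i _; rewrite -[X in measurable X]setTI.
    exact: measurable_rV_coord.
  by apply/seteqP; split => [x /= xe i _|x xe i] /=; [exact: xe|exact: (xe i I)].
rewrite /= /lebesgue_cons /pushforward; congr (_ _).
apply/seteqP; split => [[t x] /= H|[t x] /= [H0 H] i].
  split; first by have := H ord0; rewrite rV_cons0.
  by move=> i /=; have := H (lift ord0 i); rewrite -[lift _ _]rshift1 rV_consS.
case: (unliftP ord0 i) => [j ->|->]; last by rewrite rV_cons0.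
by rewrite -[X in rV_cons _ _ X]rshift1 rV_consS.
Qed.

Lemma coord_le_norm (R : realType) n (x : 'rV[R]_n) i : `|x ord0 i| <= `|x|.
Proof.
rewrite [leRHS]mx_normrE; apply/bigmax_geP; right => /=.
by exists (ord0, i).
Qed.

Lemma lebesgue_rV_bounded (R : realType) n (A : set 'rV[R]_n) :
  bounded_set A -> measurable A -> (lebesgue_rV n A < +oo)%E.
Proof.
move=> [M [_ HM]] mA; pose N := Num.max (M + 1) 1.
have N0 : 0 < N by rewrite lt_max ltr01 orbT.
have AN x : A x -> `|x| <= N.
  move=> Ax; apply: (HM N) => //.
  by rewrite lt_max ltrDl ltr01.
apply: (@le_lt_trans _ _ (lebesgue_rV n [set x : 'rV[R]_n | forall i, `[- N, N]%classic (x ord0 i)])).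
  apply: le_measure; rewrite ?inE//.
    rewrite (_ : [set _ | _] = \bigcap_(i in [set: 'I_n])
      ((fun x : 'rV[R]_n => x ord0 i) @^-1` `[- N, N])).
      apply: fin_bigcap_measurable => // i _; rewrite -[X in measurable X]setTI.
      exact: measurable_rV_coord.
    by apply/seteqP; split => [x /= xe i _|x xe i] /=; [exact: xe|exact: (xe i I)].
  move=> x /AN xN i /=; rewrite in_itv /= -ler_norml.
  exact: le_trans (coord_le_norm _ _) xN.
rewrite (@lebesgue_rV_prod _ _ (fun=> `[- N, N]%classic) (fun=> N + N)) ?ltry//.
move=> _; rewrite /lebR lebesgue_measure_itv /= lte_fin gtrN//.
by rewrite -EFinD opprK.
Qed.

Lemma measurable_cylinder (R : realType) d (omega : set 'rV[R]_d.-1) (h : R) :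
  measurable omega -> measurable (@cylinder R d omega h).
Proof. by move=> mo; apply: measurableX. Qed.

Lemma leb_cylinder (R : realType) d (omega : set 'rV[R]_d.-1) (h : R) :
  0 < h -> measurable omega ->
  leb (@cylinder R d omega h) = (lebesgue_rV d.-1 omega * h%:E)%E.
Proof.
move=> h0 mo; rewrite /leb /cylinder product_measure1E//.
congr (_ * _)%E; rewrite -[LHS]/(lebesgue_measure `]0, h[%classic).
by rewrite lebesgue_measure_itv /= lte_fin h0 oppr0 adde0.
Qed.

Lemma leb_cylinder_lty (R : realType) d (omega : set 'rV[R]_d.-1) (h : R) :
  0 < h -> bounded_set omega -> measurable omega ->
  (leb (@cylinder R d omega h) < +oo)%E.
Proof.
move=> h0 bo mo; rewrite leb_cylinder// lte_mul_pinfty// ?measure_ge0//.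
  by rewrite ge0_fin_numE ?measure_ge0// lebesgue_rV_bounded.
by rewrite ltry.
Qed.

(** * The energy as an integral of correlations *)

(** The function [A(z)] of the overview. Indicators instead of a domain depending on [z] make the
    integrand jointly measurable in [(y, z)]. *)
Definition corr (R : realType) d (D : set (pt R d)) (w : pt R d -> R) (z : pt R d) : \bar R :=
  (\int[leb]_y (\1_D y * \1_D (y + z) * (w (y + z) - w y) ^+ 2)%:E)%E.

Lemma corr_ge0 (R : realType) d (D : set (pt R d)) w z : (0 <= corr D w z)%E.
Proof.
by apply: integral_ge0 => y _; rewrite lee_fin mulr_ge0 ?sqr_ge0// mulr_ge0.
Qed.

(** Lets a function that is measurable on [D] only be replaced by its extension by 0. *)
Lemma corr_congr (R : realType) d (D : set (pt R d)) (w w' : pt R d -> R) z :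
  (forall x, D x -> w x = w' x) -> corr D w z = corr D w' z.
Proof.
move=> ww'; apply: eq_integral => y _; rewrite !indicE.
case: (boolP (y \in D)) => [|_]; last by rewrite !mul0r.
rewrite inE => /ww' ->; case: (boolP (y + z \in D)) => [|_]; last by rewrite mulr0 !mul0r.
by rewrite inE => /ww' ->.
Qed.

Lemma measurable_ptD (R : realType) d :
  measurable_fun setT (fun p : pt R d * pt R d => p.1 + p.2).
Proof.
apply/measurable_fun_pairP; split => /=.
  apply: measurable_fun_rVP => i /=; under eq_fun do rewrite mxE.
  by apply: measurable_funD; apply: (measurableT_comp (measurable_rV_coord i));
    apply: (measurableT_comp measurable_fst).
by apply: measurable_funD; apply: (measurableT_comp measurable_snd).
Qed.

Lemma measurable_ptDr (R : realType) d (z : pt R d) : measurable_fun setT (fun y : pt R d => y + z).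
Proof. exact: (measurableT_comp (@measurable_ptD R d) (measurable_pair2 z)). Qed.

Lemma measurable_indicT d (T : measurableType d) (R : realType) (D : set T) :
  measurable D -> measurable_fun setT (\1_D : T -> R).
Proof. by move=> mD; exact: measurable_indic. Qed.

Lemma measurable_corr2 (R : realType) d (D : set (pt R d)) (w : pt R d -> R) :
  measurable D -> measurable_fun setT w ->
  measurable_fun setT (fun p : pt R d * pt R d =>
    (\1_D p.1 * \1_D (p.1 + p.2) * (w (p.1 + p.2) - w p.1) ^+ 2)%:E).
Proof.
move=> mD mw; apply/measurable_EFinP; apply: measurable_funM.
  apply: measurable_funM; first exact: (measurableT_comp (measurable_indicT mD) measurable_fst).
  exact: (measurableT_comp (measurable_indicT mD) (@measurable_ptD _ _)).
apply: measurable_funX; apply: measurable_funB.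
  exact: (measurableT_comp mw (@measurable_ptD _ _)).
exact: (measurableT_comp mw measurable_fst).
Qed.

Lemma measurable_corr (R : realType) d (D : set (pt R d)) (w : pt R d -> R) :
  measurable D -> measurable_fun setT w -> measurable_fun setT (corr D w).
Proof.
move=> mD mw.
apply: (@measurable_int_fst _ _ _ _ _ (@leb R d) (fun y z => (\1_D y * \1_D (y + z) * (w (y + z) - w y) ^+ 2)%:E)).
  exact: measurable_corr2.
by move=> x y; rewrite lee_fin mulr_ge0 ?sqr_ge0// mulr_ge0.
Qed.

Lemma norm2E (R : realType) d (x : pt R d) : norm2 x = Num.sqrt (dotp x.1 x.1 + x.2 ^+ 2).
Proof. by rewrite /norm2 /enorm sqr_sqrtr ?dotp_ge0. Qed.

Lemma measurable_norm2 (R : realType) d : measurable_fun setT (@norm2 R d).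
Proof.
rewrite (_ : norm2 = fun x : pt R d => (dotp x.1 x.1 + x.2 ^+ 2) `^ 2^-1).
  apply: measurable_powR_fun; apply: measurable_funD.
    exact: (measurableT_comp (@measurable_dotp _ _) measurable_fst).
  by apply: measurable_funX.
by apply/funext => x; rewrite norm2E powR12_sqrt// addr_ge0 ?dotp_ge0 ?sqr_ge0.
Qed.

Lemma leb_translate (R : realType) d (f : pt R d -> \bar R) z :
  measurable_fun setT f -> (forall x, 0 <= f x)%E ->
  (\int[leb]_x f (x + z)%R = \int[leb]_x f x)%E.
Proof.
move=> mf f0; have := leb_affine z.1 z.2 (ltr01) (ltr01) mf f0.
rewrite expr1n !invr1 mulr1 mul1e => <-; apply: eq_integral => -[x t] _ /=.
by rewrite scale1r mul1r; case: z.
Qed.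

Lemma gagliardo_corr (R : realType) d (s : R) (D : set (pt R d)) (u : pt R d -> R) :
  measurable D -> measurable_fun D u ->
  gagliardo s D u =
  (\int[leb]_z ((norm2 z `^ (d%:R + 2 * s))^-1%:E * corr D u z))%E.
Proof.
move=> mD mu; set q := d%:R + 2 * s.
pose w := u \_ D; have mw : measurable_fun setT w by apply/(measurable_restrictT u).
pose G (p : pt R d * pt R d) := (\1_D p.1 * \1_D p.2 * (w p.1 - w p.2) ^+ 2 / norm2 (p.1 - p.2) `^ q)%:E.
have mN : measurable_fun setT (fun x : pt R d => (norm2 x `^ q)^-1).
  rewrite (_ : (fun _ => _) = fun x : pt R d => norm2 x `^ (- q)).
    by apply: measurable_powR_fun; exact: measurable_norm2.
  by apply/funext => x; rewrite powRN.
have mB : measurable_fun setT (fun p : pt R d * pt R d => p.1 - p.2).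
  apply/measurable_fun_pairP; split => /=.
    apply: measurable_fun_rVP => i /=; under eq_fun do rewrite !mxE.
    by apply: measurable_funB; apply: (measurableT_comp (measurable_rV_coord i));
      apply: (measurableT_comp measurable_fst).
  by apply: measurable_funB; apply: (measurableT_comp measurable_snd).
have mG : measurable_fun setT G.
  apply/measurable_EFinP; apply: measurable_funM; last exact: (measurableT_comp mN mB).
  apply: measurable_funM.
    apply: measurable_funM; first exact: (measurableT_comp (measurable_indicT mD) measurable_fst).
    exact: (measurableT_comp (measurable_indicT mD) measurable_snd).
  by apply: measurable_funX; apply: measurable_funB; [exact: (measurableT_comp mw measurable_fst)|exact: (measurableT_comp mw measurable_snd)].
have G0 p : (0 <= G p)%E.
  by rewrite lee_fin divr_ge0 ?powR_ge0// mulr_ge0 ?sqr_ge0// mulr_ge0.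
transitivity (\int[leb \x leb]_p G p)%E.
  rewrite /gagliardo integral_mkcond; apply: eq_integral => -[x y] _.
  rewrite patchE /G /w !indicE in_setX /= !patchE.
  case: ifPn => [/andP[-> ->]|]; last by case: (x \in D); case: (y \in D); rewrite //= ?mulr0 ?mul0r.
  by rewrite !mul1r real_normK// num_real.
rewrite fubini_tonelli1// (@fubini_tonelli _ _ _ _ _ (@leb R d) (@leb R d) G mG G0).
(* For fixed [y] the variable [x] becomes [z + y]; exchanging the integrals again makes the
   increment [z] the outer variable. *)
transitivity (\int[leb]_y \int[leb]_z G (z + y, y)%R)%E.
  apply: eq_integral => y _; rewrite (@leb_translate _ _ (fun x => G (x, y)))//.
  exact: (measurableT_comp mG (measurable_pair2 y)).
pose G' (p : pt R d * pt R d) := G (p.2 + p.1, p.1).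
have mG' : measurable_fun setT G'.
  apply: (measurableT_comp mG); apply/measurable_fun_pairP; split => /=; last exact: measurable_fst.
  apply: (@eq_measurable_fun _ _ _ _ _ (fun p : pt R d * pt R d => p.1 + p.2)); last exact: measurable_ptD.
  by move=> p _; rewrite addrC.
rewrite (@fubini_tonelli _ _ _ _ _ (@leb R d) (@leb R d) G' mG' (fun=> G0 _)).
apply: eq_integral => z _.
rewrite (@corr_congr _ _ _ _ w); last by move=> x Dx; rewrite /w patchE mem_set.
rewrite -ge0_integralZT.
- apply: eq_integral => y _; rewrite /G' /G /= addrK -EFinM; congr EFin.
  by rewrite [(y + z)%R]addrC; ring.
- exact: (measurableT_comp (measurable_corr2 mD mw) (measurable_pair2 z)).
- by move=> y; rewrite lee_fin mulr_ge0 ?sqr_ge0// mulr_ge0.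
- by rewrite invr_ge0 powR_ge0.
Qed.

Definition wt (R : realType) (d : nat) (s : R) (xi : 'rV[R]_d.-1) : R :=
  (1 + dotp xi xi) `^ (- (d%:R / 2) - s).

Lemma CsdE (R : realType) d (s : R) : @Csd R d s = (\int[lebesgue_rV d.-1]_xi (wt s xi)%:E)%E.
Proof.
by apply: eq_integral => xi _; rewrite /wt /enorm sqr_sqrtr ?dotp_ge0.
Qed.

Lemma wt_ge0 (R : realType) (d : nat) (s : R) (xi : 'rV[R]_d.-1) : 0 <= wt s xi.
Proof. exact: powR_ge0. Qed.

Lemma wt_gt0 (R : realType) (d : nat) (s : R) (xi : 'rV[R]_d.-1) : 0 < wt s xi.
Proof. by rewrite powR_gt0// ltr_pwDl// dotp_ge0. Qed.

Lemma measurable_wt (R : realType) (d : nat) (s : R) :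
  measurable_fun setT (@wt R d s).
Proof. by apply/measurable_EFinP; exact: measurable_radial. Qed.

(** The horizontal variable is measured in units of the vertical increment,
    [z = (eps |h| xi, eps h)]; this splits the singular kernel into a factor in [h] and a factor in
    [xi]. *)
Lemma leb_anisotropic (R : realType) d (f : pt R d -> \bar R) (eps : R) : 0 < eps ->
  measurable_fun setT f -> (forall x, 0 <= f x)%E ->
  (\int[leb]_z f z = \int[lebR]_h \int[lebesgue_rV d.-1]_xi
     ((eps * (eps * `|h|) ^+ d.-1)%:E * f ((eps * `|h|) *: xi, eps * h)%R))%E.
Proof.
move=> e0 mf f0; rewrite integral_leb_sym//.
have mI : measurable_fun setT (fun t => \int[lebesgue_rV d.-1]_y f (y, t))%E.
  apply: (@measurable_int_fst _ _ _ _ _ (lebesgue_rV d.-1) (fun y t => f (y, t))) => //.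
  by rewrite (_ : (fun _ => _) = f)//; apply/funext => -[].
have I0 t : (0 <= \int[lebesgue_rV d.-1]_y f (y, t))%E by apply: integral_ge0 => y _; exact: f0.
have := lebR_affine 0 e0 mI I0.
under eq_integral do rewrite addr0.
move/(congr1 (fun x => eps%:E * x)%E); rewrite muleA -EFinM divff ?gt_eqF// mul1e => <-.
rewrite -ge0_integralZT ?(ltW e0)//; last first.
  by apply: (measurableT_comp mI); apply: measurable_funM.
apply: ge0_ae_eq_integral => //.
- apply: measurable_funeM; apply: (measurableT_comp mI); exact: measurable_funM.
- have mdil : measurable_fun setT (fun p : R * 'rV[R]_d.-1 => ((eps * `|p.1|) *: p.2, eps * p.1) : pt R d).
    apply/measurable_fun_pairP; split => /=.
      apply: measurable_fun_rVP => i /=; under eq_fun do rewrite mxE.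
      apply: measurable_funM.
        by apply: measurable_funM => //; apply: (measurableT_comp (@normr_measurable R setT)).
      by apply: (measurableT_comp (measurable_rV_coord i)).
    by apply: measurable_funM.
  apply: measurable_int_snd => [|h xi].
    apply: emeasurable_funM; last exact: (measurableT_comp mf mdil).
    apply/measurable_EFinP; apply: measurable_funM => //.
    apply: measurable_funX; apply: measurable_funM => //.
    by apply: (measurableT_comp (@normr_measurable R setT)).
  by rewrite mule_ge0// lee_fin mulr_ge0 ?(ltW e0)// exprn_ge0// mulr_ge0// ltW.
- by move=> h _; rewrite mule_ge0// lee_fin ltW.
- by move=> h _; apply: integral_ge0 => xi _; rewrite mule_ge0// lee_fin mulr_ge0 ?(ltW e0)// exprn_ge0// mulr_ge0// ltW.
(* At [h = 0] the dilation in [xi] degenerates, so the inner integrals agree only off this null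
   set. *)
exists [set 0]; split; [exact: measurable_set1|exact: lebR_set1|].
move=> h /= nh; apply: contrapT => h0; apply: nh => _.
have ah : 0 < eps * `|h| by rewrite mulr_gt0// normr_gt0; apply/eqP.
have mfh : measurable_fun setT (fun y => f (y, eps * h)).
  exact: (measurableT_comp mf (measurable_pair2 _)).
have := lebesgue_rV_affine 0 ah mfh (fun=> f0 _).
under eq_integral do rewrite addr0.
move=> H; rewrite ge0_integralZT; last 3 first.
- apply: (eq_measurable_fun (fun x : 'rV[R]_d.-1 => f ((eps * `|h|) *: x + 0, eps * h))).
    by move=> x _; rewrite addr0.
  exact: (measurableT_comp mfh (measurable_rV_affine _ 0)).
- by move=> x; exact: f0.
- by rewrite mulr_ge0 ?(ltW e0)// exprn_ge0// ltW.
rewrite H muleA -EFinM -mulrA divff ?mulr1//.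
by rewrite expf_neq0// gt_eqF.
Qed.

Lemma corr_scale (R : realType) d (omega : set 'rV[R]_d.-1) (eps : R) (u : pt R d -> R)
    (z' : 'rV[R]_d.-1) (h : R) : 0 < eps -> measurable omega ->
  measurable_fun (cylinder omega eps) u ->
  (corr (cylinder omega eps) u (z', eps * h)%R =
   eps%:E * corr (cylinder omega 1) (scaled eps u) (z', h))%E.
Proof.
move=> e0 mo mu.
have mD := @measurable_cylinder R d omega eps mo.
pose w := u \_ (cylinder omega eps); have mw : measurable_fun setT w by apply/(measurable_restrictT u).
have chi x : \1_(cylinder omega eps) (x.1, eps * x.2) = \1_(cylinder omega 1) x :> R.
  rewrite !indicE; congr (_ (nat_of_bool _)); apply/idP/idP; rewrite !inE.
    by move=> [/= ox]; rewrite !in_itv /= => /andP[a b]; split => //=; rewrite in_itv /=; rewrite pmulr_rgt0 in a => //; rewrite a /= -(ltr_pM2l e0) mulr1.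
  move=> [/= ox]; rewrite !in_itv /= => /andP[a b]; split => //=; rewrite in_itv /=.
  by rewrite pmulr_rgt0// a /= -{2}(mulr1 eps) ltr_pM2l.
rewrite (@corr_congr _ _ _ u w); last by move=> x Dx; rewrite /w patchE mem_set.
have mF : measurable_fun setT (fun y : pt R d => (\1_(cylinder omega eps) y *
     \1_(cylinder omega eps) (y + (z', eps * h)) * (w (y + (z', eps * h)) - w y) ^+ 2)%:E).
  exact: (measurableT_comp (measurable_corr2 mD mw) (measurable_pair2 _)).
have F0 y : (0 <= (\1_(cylinder omega eps) y *
     \1_(cylinder omega eps) (y + (z', eps * h)) * (w (y + (z', eps * h)) - w y) ^+ 2)%:E)%E.
  by rewrite lee_fin mulr_ge0 ?sqr_ge0// mulr_ge0.
have := leb_affine 0 0 ltr01 e0 mF F0.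
move/(congr1 (fun x => eps%:E * x)%E); rewrite muleA -EFinM expr1n invr1 mul1r divff ?gt_eqF// mul1e.
rewrite /corr => <-; congr (_ * _)%E; apply: eq_integral => -[x t] _ /=.
rewrite scale1r !addr0.
have -> : (x, eps * t) + (z', eps * h) = ((x + z')%R, eps * (t + h)) :> pt R d.
  by congr pair; rewrite mulrDr.
rewrite (chi (x, t)) (chi (x + z', t + h)).
have wE a b : (a, b) \in cylinder omega 1 -> w (a, eps * b) = u (a, eps * b).
  move=> Dab; rewrite /w patchE; have := chi (a, b); rewrite /= !indicE Dab.
  by case: ifPn => // _ /eqP; rewrite eq_sym oner_eq0.
congr EFin; case: (boolP ((x, t) \in cylinder omega 1)) => Dx; last first.
  by rewrite indicE (negbTE Dx) !mul0r.
case: (boolP ((x + z', t + h) \in cylinder omega 1)) => Dz; last first.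
  by rewrite -[(x, t) + (z', h)]/((x + z', t + h)) [in LHS]indicE [in RHS]indicE
     [X in _ * X * _]indicE [in RHS]indicE (negbTE Dz) !mulr0 !mul0r.
by rewrite /scaled -[(x, t) + (z', h)]/((x + z', t + h)) /= !wE.
Qed.

(** Bookkeeping for [energy_corr], with [a = eps], [b = |h|], [c = 1 + |xi|^2] and [n = d - 1]:
    prefactor, Jacobian, kernel and the factor of [corr_scale]. All powers of [eps] cancel, which
    explains the normalization of the energy. Exponentials reduce the identity to a linear one. *)
Lemma dilation_constant (R : realType) (n : nat) (a b c s : R) : 0 < a -> 0 < b -> 0 < c ->
  (a `^ (1 - 2 * s))^-1 * (a * (a * b) ^+ n *
    ((a * b * c `^ 2^-1) `^ (n.+1%:R + 2 * s))^-1 * a) =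
  b `^ (- 1 - 2 * s) * c `^ (- (n.+1%:R / 2) - s).
Proof.
move=> a0 b0 c0.
have [x ->] : exists x, a = expR x by exists (ln a); rewrite lnK.
have [y ->] : exists y, b = expR y by exists (ln b); rewrite lnK.
have [z ->] : exists z, c = expR z by exists (ln c); rewrite lnK.
have E (t p : R) : expR t `^ p = expR (p * t) by rewrite /powR gt_eqF ?expR_gt0// expRK.
rewrite -!expRD !E -!expRD -powR_mulrn ?expR_ge0// !E -!expRN -!expRD; congr expR.
by rewrite -natr1; field.
Qed.

Lemma energy_corr (R : realType) d (s : R -> R) (omega : set 'rV[R]_d.-1) (eps : R)
    (u : pt R d -> R) : (1 < d)%N -> 0 < eps -> 0 < s eps -> measurable omega ->
  measurable_fun (cylinder omega eps) u ->
  (energy s omega eps u = \int[lebR]_h \int[lebesgue_rV d.-1]_xi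
    ((`|h| `^ (- 1 - 2 * s eps) * wt (s eps) xi)%:E *
     corr (cylinder omega 1) (scaled eps u) ((eps * `|h|) *: xi, h)%R))%E.
Proof.
move=> d1 e0 s0 mo mu; have mD := @measurable_cylinder R d omega eps mo.
pose q := d%:R + 2 * s eps.
pose f (z : pt R d) := ((norm2 z `^ q)^-1%:E * corr (cylinder omega eps) u z)%E.
have f0 z : (0 <= f z)%E by rewrite mule_ge0 ?corr_ge0// lee_fin invr_ge0 powR_ge0.
have mf : measurable_fun setT f.
  apply: emeasurable_funM.
    apply/measurable_EFinP; apply: (eq_measurable_fun (fun z : pt R d => norm2 z `^ (- q))).
      by move=> z _; rewrite powRN.
    by apply: measurable_powR_fun; exact: measurable_norm2.
  pose w := u \_ (cylinder omega eps).
  have mw : measurable_fun setT w by apply/(measurable_restrictT u).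
  apply: (eq_measurable_fun (corr (cylinder omega eps) w)); last exact: measurable_corr.
  by move=> z _; apply: corr_congr => x Dx; rewrite /w patchE mem_set.
rewrite /energy gagliardo_corr// -/q -/f (leb_anisotropic e0 mf f0).
have mg : measurable_fun setT (fun p : R * 'rV[R]_d.-1 =>
    ((eps * (eps * `|p.1|) ^+ d.-1)%:E * f ((eps * `|p.1|) *: p.2, eps * p.1)%R)%E).
  have mn : measurable_fun setT (fun p : R * 'rV[R]_d.-1 => eps * `|p.1|).
    by apply: measurable_funM => //; apply: (measurableT_comp (@normr_measurable R setT)).
  apply: emeasurable_funM.
    by apply/measurable_EFinP; apply: measurable_funM => //; exact: measurable_funX.
  apply: (measurableT_comp mf); apply/measurable_fun_pairP; split => /=.
    apply: measurable_fun_rVP => i /=; under eq_fun do rewrite mxE.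
    by apply: measurable_funM => //; apply: (measurableT_comp (measurable_rV_coord i)).
  by apply: measurable_funM.
have g0 (h : R) (xi : 'rV[R]_d.-1) :
    (0 <= (eps * (eps * `|h|) ^+ d.-1)%:E * f ((eps * `|h|) *: xi, eps * h)%R)%E.
  by rewrite mule_ge0// lee_fin mulr_ge0 ?(ltW e0)// exprn_ge0// mulr_ge0// ltW.
rewrite -ge0_integralZT; last 3 first.
- by apply: measurable_int_snd => [|h xi]; [exact: mg|exact: g0].
- by move=> h; apply: integral_ge0 => xi _; exact: g0.
- by rewrite invr_ge0 powR_ge0.
apply: eq_integral => h _; rewrite -ge0_integralZT; last 3 first.
- exact: (measurableT_comp mg (measurable_pair1 h)).
- by move=> xi; exact: g0.
- by rewrite invr_ge0 powR_ge0.
apply: eq_integral => xi _; rewrite /f corr_scale//.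
(* Both sides vanish at [h = 0]: the Jacobian because [d - 1 > 0], the weight because 0 to a nonzero
   power is 0, even a negative one. *)
have [->|h0] := eqVneq h 0.
  have dn : (d.-1 == 0)%N = false by case: (d) d1 => [|[]].
  rewrite normr0 mulr0 expr0n dn mulr0 mul0e mule0.
  by rewrite powR0 ?mul0r ?mul0e// lt_eqF// subr_lt0 (lt_trans (ltrN10 R))// mulr_gt0.
rewrite !muleA -!EFinM; congr (_%:E * _)%E.
have ah : 0 < `|h| by rewrite normr_gt0.
have c0 : 0 < 1 + dotp xi xi by rewrite ltr_pwDl// dotp_ge0.
rewrite /wt -[X in X%:R / 2](@prednK d) ?(ltnW d1)// -(@dilation_constant _ _ eps)//.
have -> : norm2 ((eps * `|h|) *: xi, eps * h) = eps * `|h| * (1 + dotp xi xi) `^ 2^-1; last first.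
  by rewrite /q (@prednK d) ?(ltnW d1)// !mulrA.
rewrite norm2E /= powR12_sqrt ?(ltW c0)//.
have -> : dotp ((eps * `|h|) *: xi) ((eps * `|h|) *: xi) + (eps * h) ^+ 2 =
    (eps * `|h|) ^+ 2 * (1 + dotp xi xi).
  rewrite mulrDr mulr1 !exprMn real_normK ?num_real// addrC; congr (_ + _).
  rewrite /dotp mulr_sumr; apply: eq_bigr => i _; rewrite !mxE.
  by rewrite -[in RHS](real_normK (num_real h)); ring.
rewrite sqrtrM ?sqr_ge0// sqrtr_sqr ger0_norm// mulr_ge0// ltW//.
Qed.

(** Substituting [x_d = y_d + h] gives the limit the shape of [energy_corr] with horizontal
    increment 0, where the weight in [xi] integrates to [Csd]. *)
Lemma limit_lt1_corr (R : realType) d (s0 : R) (omega : set 'rV[R]_d.-1) (v : pt R d -> R) :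
  measurable omega -> measurable_fun (cylinder omega 1) v ->
  (limit_lt1 s0 omega v = @Csd R d s0 *
    \int[lebR]_h ((`|h| `^ (- 1 - 2 * s0))%:E * corr (cylinder omega 1) v (0, h)%R))%E.
Proof.
move=> mo mv; rewrite /limit_lt1; congr (_ * _)%E.
have mD := @measurable_cylinder R d omega 1 mo.
set D := cylinder omega 1 in mD *.
pose w := v \_ D; have mw : measurable_fun setT w by apply/(measurable_restrictT v).
have corrE h : corr D v (0, h) = corr D w (0, h).
  by apply: corr_congr => x Dx; rewrite /w patchE mem_set.
under [RHS]eq_integral => h _ do rewrite corrE.
pose H (p : pt R d * R) := ((`|p.2| `^ (- 1 - 2 * s0))%:E *
  (\1_D p.1 * \1_D (p.1 + (0, p.2)) * (w (p.1 + (0, p.2)) - w p.1) ^+ 2)%:E)%E.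
have mtr : measurable_fun setT (fun p : pt R d * R => (p.1, ((0 : 'rV[R]_d.-1), p.2))).
  apply: measurable_fun_pair; first exact: measurable_fst.
  by apply: measurable_fun_pair; [exact: measurable_cst|exact: measurable_snd].
have mH : measurable_fun setT H.
  apply: emeasurable_funM; last exact: (measurableT_comp (measurable_corr2 mD mw) mtr).
  apply/measurable_EFinP; apply: measurable_powR_fun.
  by apply: (measurableT_comp (@normr_measurable R setT)).
have H0 p : (0 <= H p)%E.
  by rewrite mule_ge0// lee_fin ?powR_ge0// mulr_ge0 ?sqr_ge0// mulr_ge0.
transitivity (\int[lebR]_h \int[leb]_y H (y, h))%E; last first.
  apply: eq_integral => h _; rewrite /H /=; apply: ge0_integralZT; rewrite ?powR_ge0//.
  - exact: (measurableT_comp (measurable_corr2 mD mw) (measurable_pair2 _)).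
  - by move=> y; rewrite lee_fin mulr_ge0 ?sqr_ge0// mulr_ge0.
rewrite -(@fubini_tonelli _ _ _ _ _ (@leb R d) (@lebR R) H mH H0).
rewrite integral_leb; last 2 first.
- apply: measurable_int_snd => [|y h]; last exact: H0.
  by apply: (eq_measurable_fun H) => // -[].
- by move=> y; apply: integral_ge0.
rewrite integral_mkcond; apply: eq_integral => x _; rewrite patchE.
case: ifPn => [ox|nox]; last first.
  apply/esym/integral0_eq => t _; apply: integral0_eq => h _.
  by rewrite /H /= indicE /D /cylinder in_setX /= (negbTE nox) !mul0r mule0.
rewrite integral_mkcond; apply: eq_integral => t _; rewrite patchE.
case: ifPn => [ot|not_]; last first.
  apply/esym/integral0_eq => h _.
  by rewrite /H /= indicE /D /cylinder in_setX /= (negbTE not_) andbF !mul0r mule0.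
pose g (a : R) := (\1_(`]0, 1[%classic : set R) a * (w (x, a) - w (x, t)) ^+ 2 / `|a - t| `^ (1 + 2 * s0))%:E.
have mg : measurable_fun setT g.
  apply/measurable_EFinP; apply: measurable_funM.
    apply: measurable_funM; first exact: measurable_indicT.
    apply: measurable_funX; apply: measurable_funB => //.
    exact: (measurableT_comp mw (measurable_pair1 _)).
  apply: (eq_measurable_fun (fun a : R => `|a - t| `^ (- (1 + 2 * s0)))).
    by move=> a _; rewrite powRN.
  apply: measurable_powR_fun; apply: (measurableT_comp (@normr_measurable R setT)).
  exact: measurable_funB.
have g0 a : (0 <= g a)%E by rewrite lee_fin divr_ge0 ?powR_ge0// mulr_ge0 ?sqr_ge0.
transitivity (\int[lebR]_a g a)%E.
  rewrite integral_mkcond; apply: eq_integral => a _; rewrite patchE /g indicE.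
  case: ifPn => oa; last by rewrite !mul0r.
  rewrite mul1r real_normK ?num_real// /w !patchE.
  by rewrite !in_setX /= ox oa ot.
have := lebR_affine t ltr01 mg g0; rewrite invr1 mul1e => <-.
apply: eq_integral => h _; rewrite /g /H /= mul1r -EFinM; congr EFin.
have -> : (x, t) + (0, h) = (x, t + h) :> pt R d by congr pair; rewrite addr0.
rewrite !indicE /D /cylinder !in_setX /= ox ot /= mul1r [h + t]addrC.
have -> : t + h - t = h by rewrite addrC addKr.
rewrite [X in _ / X](_ : _ = (`|h| `^ (- 1 - 2 * s0))^-1) ?invrK; last first.
  by rewrite -powRN; congr (_ `^ _); ring.
by ring.
Qed.

(** * Weak convergence *)

Lemma L2_measurable (R : realType) d (K : set (pt R d)) v : L2 K v -> measurable_fun K v.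
Proof. by case. Qed.

Lemma L2S (R : realType) d (D K : set (pt R d)) v : measurable D -> measurable K ->
  K `<=` D -> L2 D v -> L2 K v.
Proof.
move=> mD mK KD [mv v2]; split; first exact: measurable_funS mv.
apply: le_lt_trans v2; apply: ge0_subset_integral => //.
- by apply/measurable_EFinP; exact: measurable_funX.
- by move=> x _; rewrite lee_fin sqr_ge0.
Qed.

Lemma L2M_integrable (R : realType) d (K : set (pt R d)) f g : measurable K ->
  L2 K f -> L2 K g -> (@leb R d).-integrable K (EFin \o (fun x => f x * g x)).
Proof.
move=> mK [mf f2] [mg g2].
have I (h : pt R d -> R) : measurable_fun K h -> (\int[leb]_(x in K) ((h x) ^+ 2)%:E < +oo)%E ->
    (@leb R d).-integrable K (EFin \o (fun x => h x ^+ 2)).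
  move=> mh h2; apply/integrableP; split.
    by apply/measurable_EFinP; exact: measurable_funX.
  apply: le_lt_trans h2; apply: ge0_le_integral => //.
  - by apply: measurableT_comp => //; apply/measurable_EFinP; exact: measurable_funX.
  - by apply/measurable_EFinP; exact: measurable_funX.
  - by move=> x _; rewrite /= ger0_norm// sqr_ge0.
apply: (@le_integrable _ _ _ _ _ mK _ ((EFin \o (fun x => f x ^+ 2)%R) \+ (EFin \o (fun x => g x ^+ 2)%R))%E).
- by apply/measurable_EFinP; exact: measurable_funM.
- move=> x _ /=; rewrite lee_fin normrM [leRHS]ger0_norm ?addr_ge0 ?sqr_ge0//.
  rewrite -[f x ^+ 2]real_normK ?num_real// -[g x ^+ 2]real_normK ?num_real//.
  by have := sqr_ge0 (`|f x| - `|g x|); nra.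
- by apply: integrableD => //; exact: I.
Qed.

Lemma bounded_L2 (R : realType) d (K : set (pt R d)) (g : pt R d -> R) (M : R) : measurable K ->
  (leb K < +oo)%E -> measurable_fun K g -> (forall x, `|g x| <= M) -> L2 K g.
Proof.
move=> mK Kf mg gM; split => //.
apply: (@le_lt_trans _ _ (\int[leb]_(x in K) (M ^+ 2)%:E)%E).
  apply: ge0_le_integral => //.
  - by move=> x _; rewrite lee_fin sqr_ge0.
  - by apply/measurable_EFinP; exact: measurable_funX.
  - move=> x _; rewrite lee_fin -[leLHS]real_normK ?num_real//.
    have /= := gM x; have := normr_ge0 (g x); nra.
by rewrite integral_cst// lte_mul_pinfty// ?lee_fin ?sqr_ge0.
Qed.

Lemma L2_integrable (R : realType) d (K : set (pt R d)) v : measurable K ->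
  (leb K < +oo)%E -> L2 K v -> (@leb R d).-integrable K (EFin \o v).
Proof.
move=> mK Kf v2; have := L2M_integrable mK v2 (@bounded_L2 _ _ _ (cst 1) 1 mK Kf _ _).
move=> H; rewrite (_ : EFin \o v = EFin \o (fun x => v x * cst 1 x)).
  by apply: H => [|x] //=; rewrite normr1.
by apply/funext => x /=; rewrite mulr1.
Qed.

Lemma compact_rVR_bounded (R : realType) n (K : set ('rV[R]_n * R)) : compact K ->
  exists2 M, 0 < M & forall x, K x -> `|x| <= M.
Proof.
move=> /compact_bounded[M [_ HM]]; exists (Num.max (M + 1) 1).
  by rewrite lt_max ltr01 orbT.
by move=> x; apply: HM; rewrite lt_max ltrDl ltr01.
Qed.

Lemma compact_measurable_rVR (R : realType) n (K : set ('rV[R]_n * R)) : compact K -> measurable K.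
Proof. by move=> cK; apply: closed_measurable_rVR; apply: compact_closed. Qed.

Lemma rV_norm_le (R : realType) n (x : 'rV[R]_n) (M : R) : 0 <= M ->
  (forall i, `|x ord0 i| <= M) -> `|x| <= M.
Proof.
move=> M0 xM; rewrite [leLHS]mx_normrE; apply/bigmax_leP; split => //= -[i j] _ /=.
by rewrite (ord1 i).
Qed.

Lemma leb_compact_lty (R : realType) d (K : set (pt R d)) : compact K -> (leb K < +oo)%E.
Proof.
move=> cK; have [M M0 KM] := compact_rVR_bounded cK.
pose B := [set x : 'rV[R]_d.-1 | forall i, `|x ord0 i - (0 : 'rV[R]_d.-1) ord0 i| < M + 1].
have mB : measurable B by exact: measurable_cube.
apply: (@le_lt_trans _ _ (leb (B `*` `[- M, M]%classic))).
  apply: le_measure; rewrite ?inE//; first exact: compact_measurable_rVR.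
    exact: measurableX.
  move=> x /KM; rewrite prod_normE /= ge_max => /andP[x1 x2]; split => /=.
    by move=> i; rewrite mxE subr0 (le_lt_trans (coord_le_norm _ _))// (le_lt_trans x1)// ltrDl.
  by rewrite in_itv /= -ler_norml.
rewrite /leb product_measure1E//; apply: lte_mul_pinfty; rewrite ?measure_ge0//.
  rewrite ge0_fin_numE ?measure_ge0//; apply: lebesgue_rV_bounded => //.
  exists (M + 1); split; first exact: num_real.
  move=> N MN x /= Bx; apply: rV_norm_le => [|i].
    by rewrite (le_trans _ (ltW MN))// addr_ge0// ltW.
  by rewrite (le_trans _ (ltW MN))//; have := Bx i; rewrite mxE subr0 => /ltW.
rewrite -[X in (X < _)%E]/(lebesgue_measure `[- M, M]%classic) lebesgue_measure_itv /= lte_fin gtrN//.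
by rewrite ltry.
Qed.

Lemma geometric_series_bound (R : realType) (f : nat -> R) (m : nat) (C : R) : 0 <= C ->
  (forall i, (m <= i)%N -> `|f i| <= C * 2^-1 ^+ i.+1) ->
  forall n, (m <= n)%N -> `|\sum_(m <= i < n) f i| <= C * 2^-1 ^+ m.
Proof.
(* This sharper bound is the one that survives induction on [n]. *)
move=> C0 fC n mn; suff : `|\sum_(m <= i < n) f i| <= C * (2^-1 ^+ m - 2^-1 ^+ n).
  by move=> /le_trans; apply; rewrite ler_wpM2l// lerBlDr lerDl exprn_ge0// invr_ge0.
elim: n mn => [|n IH]; first by rewrite leqn0 => /eqP ->; rewrite big_geq// subrr mulr0 normr0.
rewrite leq_eqVlt => /predU1P[->|]; first by rewrite big_geq// subrr mulr0 normr0.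
rewrite ltnS => mn; rewrite big_nat_recr//= (le_trans (ler_normD _ _))//.
have := lerD (IH mn) (fC n mn); move/le_trans; apply.
by rewrite exprS; lra.
Qed.

Lemma geometric_series_cvg (R : realType) (f : nat -> R) (C : R) : 0 <= C ->
  (forall i, `|f i| <= C * 2^-1 ^+ i.+1) -> cvgn (series f).
Proof.
move=> C0 fC; apply: normed_cvg.
apply: (@series_le_cvg _ _ (fun i => C * 2^-1 ^+ i.+1)) => [n /=|n /=|n /=|]; [by []| |exact: fC|].
  by rewrite mulr_ge0// exprn_ge0// invr_ge0.
rewrite (_ : (fun i => C * 2^-1 ^+ i.+1) = geometric (C / 2) 2^-1).
  by apply: is_cvg_geometric_series; rewrite ger0_norm ?invr_ge0// invf_lt1// ltr1n.
by apply/funext => i /=; rewrite exprS mulrA.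
Qed.

Lemma geometric_series_tail (R : realType) (f : nat -> R) (m : nat) (C : R) : 0 <= C ->
  cvgn (series f) -> (forall i, (m <= i)%N -> `|f i| <= C * 2^-1 ^+ i.+1) ->
  `|limn (series f) - series f m| <= C * 2^-1 ^+ m.
Proof.
move=> C0 cf fC.
have cd : `|series f n - series f m| @[n --> \oo] --> `|limn (series f) - series f m|.
  by apply: cvg_norm; apply: cvgB; [exact: cf|exact: cvg_cst].
rewrite -(cvg_lim _ cd)//; apply: limr_le; first by apply/cvg_ex; eexists; exact: cd.
near=> n; have mn : (m <= n)%N by near: n; exact: nbhs_infty_ge.
by rewrite sub_series_geq//; exact: geometric_series_bound.
Unshelve. all: end_near. Qed.

Lemma Rintegral_bound (R : realType) d (K : set (pt R d)) (v f : pt R d -> R) (M : R) :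
  measurable K -> (leb K < +oo)%E -> L2 K v -> measurable_fun K f ->
  (forall x, `|f x| <= M) ->
  `|\int[leb]_(x in K) (v x * f x)| <= (\int[leb]_(x in K) `|v x|) * M.
Proof.
move=> mK Kf v2 mf fM.
have iv : (@leb R d).-integrable K (EFin \o v) by exact: L2_integrable.
have ivf := L2M_integrable mK v2 (bounded_L2 mK Kf mf fM).
have ivn : (@leb R d).-integrable K (EFin \o (fun x => `|v x|)) by exact: (integrable_norm iv).
apply: (le_trans (le_normr_Rintegral _ ivf)) => //.
rewrite -RintegralZr//; apply: le_Rintegral => //.
- exact: (integrable_norm ivf).
- by have := integrableZr mK M ivn.
- by move=> x _; rewrite normrM ler_wpM2l.
Qed.

(* A sliding hump: otherwise a sparse subsequence of [psi] would be summable,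
   and pairing [v_] with its sum would contradict weak convergence. This avoids
   the uniform boundedness principle. *)
Lemma weak_pairing_vanish (R : realType) d (D K : set (pt R d)) (v_ : nat -> pt R d -> R) v
    (psi : nat -> pt R d -> R) (eta : nat -> R) :
  weak_L2loc D v_ v -> compact K -> K `<=` D -> (forall j, L2 K (v_ j)) -> L2 K v ->
  (forall j, measurable_fun setT (psi j)) -> (forall j x, `|psi j x| <= eta j) ->
  eta @ \oo --> 0 ->
  (fun j => \int[leb]_(x in K) (v_ j x * psi j x)) @ \oo --> 0.
Proof.
move=> wv cK KD v_2 v2 mpsi psib eta0.
have mK : measurable K by exact: compact_measurable_rVR.
have Kf : (leb K < +oo)%E by exact: leb_compact_lty.
apply: contrapT => /cvgrPdist_le H.
have [e e0 freq] : exists2 e, 0 < e & forall N, exists2 j, (N <= j)%N &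
    e < `|\int[leb]_(x in K) (v_ j x * psi j x)|.
  apply: contrapT => H'; apply: H => e e0; apply: contrapT => nn.
  apply: H'; exists e => // N; apply: contrapT => nj; apply: nn.
  exists N => // j /= Nj; rewrite sub0r normrN leNgt; apply/negP => ej.
  by apply: nj; exists j.
pose a j f := \int[leb]_(x in K) (v_ j x * f x).
pose L f := \int[leb]_(x in K) (v x * f x).
pose N_ j := \int[leb]_(x in K) `|v_ j x|.
have N0 j : 0 <= N_ j by apply: Rintegral_ge0.
pose S (l : seq nat) x := \sum_(i <- l) psi i x.
have mS l : measurable_fun setT (S l).
  by apply: measurable_sum => i; exact: mpsi.
have bS l : exists M, forall x, `|S l x| <= M.
  exists (\sum_(i <- l) eta i) => x; rewrite (le_trans (ler_norm_sum _ _ _))//.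
  by apply: ler_sum => i _; exact: psib.
have S2 l : L2 K (S l).
  by have [M SM] := bS l; apply: bounded_L2 (measurable_funTS (mS l)) SM.
have e80 : 0 < e / 8 by rewrite divr_gt0.
have cpos l : 0 < 1 + \sum_(i <- l) N_ i by rewrite ltr_pwDl// sumr_ge0.
have N1 j : 0 < 1 + N_ j by rewrite ltr_pwDl.
(* Given the indices [l] chosen so far, the next one has a large pairing, sees their sum as the
   limit does, and has [eta j] so small that all later humps together hardly affect the pairings
   with the earlier [v_ i]. *)
have /choice[nx nxP] (l : seq nat) : exists j, [/\ (size l <= j)%N, e < `|a j (psi j)|,
    `|a j (S l) - L (S l)| <= e / 8 &
    eta j <= (e / 8) / (1 + \sum_(i <- l) N_ i) * 2^-1 ^+ (size l).+1].
  have /cvgrPdist_le/(_ _ e80)[n1 _ Hn1] := wv K cK KD (S l) (S2 l).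
  have c0 : 0 < (e / 8) / (1 + \sum_(i <- l) N_ i) * 2^-1 ^+ (size l).+1.
    by rewrite mulr_gt0 ?divr_gt0// exprn_gt0// invr_gt0.
  have /cvgrPdist_le/(_ _ c0)[n2 _ Hn2] := eta0.
  have [j jN je] := freq (maxn (size l) (maxn n1 n2)).
  move: jN; rewrite !geq_max => /and3P[j1 j2 j3].
  exists j; split => //; first by rewrite distrC; exact: Hn1.
  by have := Hn2 j j3; rewrite sub0r normrN; apply: le_trans; exact: ler_norm.
pose l := fix l k := if k is k'.+1 then rcons (l k') (nx (l k')) else [::].
pose sg k := nx (l k).
have sl k : size (l k) = k by elim: k => //= k IH; rewrite size_rcons IH.
have SE k x : S (l k) x = series (fun i => psi (sg i) x) k.
  rewrite /S /series /=; elim: k => [|k IH]; first by rewrite big_nil big_geq.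
  by rewrite /= -cats1 big_cat big_seq1 IH big_nat_recr.
have Nl k i : (i < k)%N -> N_ (sg i) <= \sum_(j <- l k) N_ j.
  elim: k => // k IH; rewrite ltnS leq_eqVlt /= -cats1 big_cat big_seq1 /=.
  case/predU1P => [->|/IH ik]; first by rewrite lerDr sumr_ge0.
  by rewrite (le_trans ik)// lerDl.
have psi1 k x : `|psi (sg k) x| <= e / 8 * 2^-1 ^+ k.+1.
  have [_ _ _] := nxP (l k); rewrite sl => H1.
  apply: (le_trans (psib _ _)); apply: (le_trans H1).
  rewrite ler_wpM2r ?exprn_ge0 ?invr_ge0// ler_pdivrMr//.
  by rewrite ler_peMr ?(ltW e80)// lerDl sumr_ge0.
have psi2 k i x : (k < i)%N -> `|psi (sg i) x| <= (e / 8) / (1 + N_ (sg k)) * 2^-1 ^+ i.+1.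
  move=> ki; have [_ _ _] := nxP (l i); rewrite sl => H1.
  apply: (le_trans (psib _ _)); apply: (le_trans H1).
  rewrite ler_wpM2r ?exprn_ge0 ?invr_ge0// ler_wpM2l ?(ltW e80)//.
  by rewrite lef_pV2 ?posrE ?cpos ?N1// lerD2l Nl.
have cser x : cvgn (series (fun i => psi (sg i) x)).
  by apply: (geometric_series_cvg (ltW e80)) => i; exact: psi1.
pose h x := limn (series (fun i => psi (sg i) x)).
have mh : measurable_fun setT h.
  apply: (measurable_fun_cvg (fun n => mS (l n))) => x _.
  by under eq_fun do rewrite SE; exact: cser.
have hS k x : `|h x - S (l k) x| <= e / 8 * 2^-1 ^+ k.
  by rewrite SE; apply: geometric_series_tail; rewrite ?(ltW e80)// => i _; exact: psi1.
have hb x : `|h x| <= e / 8 by have := hS 0%N x; rewrite /S big_nil subr0 expr0 mulr1.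
have h2 : L2 K h := bounded_L2 mK Kf (measurable_funTS mh) hb.
have htail k x : `|h x - S (l k.+1) x| <= (e / 8) / (1 + N_ (sg k)).
  have cC : 0 <= e / 8 / (1 + N_ (sg k)) by apply: divr_ge0; exact: ltW.
  rewrite SE; apply: (@le_trans _ _ ((e / 8) / (1 + N_ (sg k)) * 2^-1 ^+ k.+1)).
    by apply: geometric_series_tail => // i ki; exact: psi2.
  rewrite ler_piMr//.
  by rewrite exprn_ile1 ?invr_ge0// invf_le1// ler1n.
have aB w f g : L2 K w -> L2 K f -> L2 K g -> \int[leb]_(x in K) (w x * (f x - g x)) =
    \int[leb]_(x in K) (w x * f x) - \int[leb]_(x in K) (w x * g x).
  move=> w2 f2 g2; rewrite -RintegralB//; try exact: L2M_integrable.
  by apply: eq_Rintegral => x _; rewrite mulrBr.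
have /cvgrPdist_le/(_ _ e80)[n1 _ Hn1] := wv K cK KD h h2.
pose Nv := \int[leb]_(x in K) `|v x|.
have Nv0 : 0 <= Nv by apply: Rintegral_ge0.
have [n2 Hn2] : exists n2, Nv * (e / 8 * 2^-1 ^+ n2) <= e / 8.
  have : Nv * (e / 8 * 2^-1 ^+ n) @[n --> \oo] --> Nv * (e / 8 * 0).
    apply: cvgM; first exact: cvg_cst.
    apply: cvgM; first exact: cvg_cst.
    by apply: cvg_expr; rewrite ger0_norm ?invr_ge0// invf_lt1// ltr1n.
  rewrite !mulr0 => /cvgrPdist_le/(_ _ e80)[n2 _ Hn2]; exists n2.
  by have := Hn2 n2 (leqnn _); rewrite sub0r normrN; apply: le_trans; exact: ler_norm.
pose k := maxn n1 n2.
have [skj ske aS _] := nxP (l k); rewrite -/(sg k) sl in skj ske aS.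
have b1 : `|L h - a (sg k) h| <= e / 8.
  by apply: Hn1 => /=; rewrite (leq_trans _ skj)// leq_maxl.
have b2 : `|L h - L (S (l k))| <= e / 8.
  rewrite /L -aB//; apply: (@le_trans _ _ (Nv * (e / 8 * 2^-1 ^+ k))).
    apply: Rintegral_bound => //.
    by apply: measurable_funTS; exact: measurable_funB.
  apply: le_trans Hn2; rewrite ler_wpM2l// ler_wpM2l ?(ltW e80)//.
  by rewrite ler_wiXn2l ?invr_ge0 ?invf_le1 ?ler1n ?leq_maxr.
have b3 : `|a (sg k) h - a (sg k) (S (l k.+1))| <= e / 8.
  rewrite /a -aB//; apply: (@le_trans _ _ (N_ (sg k) * ((e / 8) / (1 + N_ (sg k))))).
    apply: Rintegral_bound => //.
    by apply: measurable_funTS; exact: measurable_funB.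
  rewrite mulrA ler_pdivrMr ?N1// mulrC ler_wpM2l ?(ltW e80)//.
  by rewrite lerDr.
(* The large pairing is a difference of consecutive partial sums. Passing from [a S_(k+1)] to [a h],
   [L h], [L S_k] and [a S_k] costs at most [e / 8] each time, which contradicts the lower bound
   [e]. *)
have b4 : a (sg k) (S (l k.+1)) - a (sg k) (S (l k)) = a (sg k) (psi (sg k)).
  rewrite /a -aB//; apply: eq_Rintegral => x _.
  by rewrite /S /= -cats1 big_cat big_seq1 /= [X in X - _]addrC addrK.
have := ske; rewrite -b4 ltNge; move/negP; apply.
move: b1 b2 b3 aS e0; rewrite !ler_norml => /andP[? ?] /andP[? ?] /andP[? ?] /andP[? ?] e0.
by apply/andP; split; lra.
Qed.

Lemma Rleb_translate (R : realType) d (f : pt R d -> R) z :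
  measurable_fun setT f -> \int[leb]_x f (x + z) = \int[leb]_x f x.
Proof.
move=> mf; have mE : measurable_fun setT (EFin \o f) by exact/measurable_EFinP.
rewrite /Rintegral; congr fine; rewrite [LHS]integralE [RHS]integralE.
congr (_ - _)%E.
  have H := @leb_translate _ _ ((EFin \o f)^\+)%E z (measurable_funepos mE) (funepos_ge0 _).
  by apply: etrans H; apply: eq_integral => x _; rewrite !funeposE.
have H := @leb_translate _ _ ((EFin \o f)^\-)%E z (measurable_funeneg mE) (funeneg_ge0 _).
by apply: etrans H; apply: eq_integral => x _; rewrite !funenegE.
Qed.

Lemma integrable_subr d (T : measurableType d) (R : realType) (mu : {measure set T -> \bar R})
    (D : set T) (f g : T -> R) : measurable D -> mu.-integrable D (EFin \o f) ->
  mu.-integrable D (EFin \o g) -> mu.-integrable D (EFin \o (fun x => f x - g x)).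
Proof. by move=> mD fi gi; exact: (integrableB mD fi gi). Qed.

Lemma integrable_mulrl d (T : measurableType d) (R : realType) (mu : {measure set T -> \bar R})
    (D : set T) (c : R) (f : T -> R) : measurable D -> mu.-integrable D (EFin \o f) ->
  mu.-integrable D (EFin \o (fun x => c * f x)).
Proof. by move=> mD fi; exact: (integrableZl mD c fi). Qed.

Lemma Rintegral_support (R : realType) d (K : set (pt R d)) (f : pt R d -> R) :
  measurable K -> (forall x, ~ K x -> f x = 0) ->
  \int[leb]_(x in K) f x = \int[leb]_x f x.
Proof.
move=> mK f0; rewrite Rintegral_mkcond; apply: eq_Rintegral => x _.
by rewrite patchE; case: ifPn => // /negP; rewrite inE => /f0.
Qed.

Lemma L2_restrict (R : realType) d (D : set (pt R d)) v : measurable D -> L2 D v ->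
  L2 setT (v \_ D).
Proof.
move=> mD [mv v2]; split; first by apply/(measurable_restrictT v).
rewrite integral_mkcond in v2; apply: le_lt_trans v2.
rewrite le_eqVlt; apply/orP; left; apply/eqP; apply: eq_integral => x _.
by rewrite !patchE; case: ifP => //; rewrite expr0n.
Qed.

Lemma L2_translate (R : realType) d v z : @L2 R d setT v -> @L2 R d setT (fun x => v (x + z)).
Proof.
move=> [mv v2]; split; first by apply: (measurableT_comp mv); exact: measurable_ptDr.
rewrite (@leb_translate _ _ (fun x => (v x ^+ 2)%:E))//.
  by apply/measurable_EFinP; exact: measurable_funX.
by move=> x; rewrite lee_fin sqr_ge0.
Qed.

Lemma L2_setT_support (R : realType) d (K : set (pt R d)) (f : pt R d -> R) :
  measurable K -> measurable_fun setT f -> (forall x, ~ K x -> f x = 0) -> L2 K f -> L2 setT f.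
Proof.
move=> mK mf f0 f2; rewrite (_ : f = f \_ K); first exact: L2_restrict.
by apply/funext => x; rewrite patchE; case: ifPn => // /negP; rewrite inE => /f0.
Qed.

Lemma L2Z (R : realType) d (K : set (pt R d)) (c : R) f : measurable K -> L2 K f -> L2 K (fun x => c * f x).
Proof.
move=> mK [mf f2]; split; first exact: measurable_funM.
under eq_integral do rewrite exprMn EFinM.
rewrite ge0_integralZl//.
- by apply: lte_mul_pinfty; rewrite ?lee_fin ?sqr_ge0.
- by apply/measurable_EFinP; exact: measurable_funX.
- by move=> x _; rewrite lee_fin sqr_ge0.
- by rewrite lee_fin sqr_ge0.
Qed.

Lemma L2D (R : realType) d (K : set (pt R d)) f g : measurable K -> L2 K f -> L2 K g -> L2 K (fun x => f x + g x).
Proof.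
move=> mK [mf f2] [mg g2]; split; first exact: measurable_funD.
apply: (@le_lt_trans _ _ (\int[leb]_(x in K) (2%:E * (f x ^+ 2)%:E + 2%:E * (g x ^+ 2)%:E))%E).
  apply: ge0_le_integral => //.
  - by move=> x _; rewrite lee_fin sqr_ge0.
  - by apply/measurable_EFinP; apply: measurable_funX; exact: measurable_funD.
  - by apply: emeasurable_funD; apply: measurable_funeM; apply/measurable_EFinP; exact: measurable_funX.
  - by move=> x _; rewrite -!EFinM -EFinD lee_fin; have := sqr_ge0 (f x - g x); nra.
rewrite ge0_integralD//; last 4 first.
- by move=> x _; rewrite mule_ge0// lee_fin sqr_ge0.
- by apply: measurable_funeM; apply/measurable_EFinP; exact: measurable_funX.
- by move=> x _; rewrite mule_ge0// lee_fin sqr_ge0.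
- by apply: measurable_funeM; apply/measurable_EFinP; exact: measurable_funX.
rewrite !ge0_integralZl//; try (by apply/measurable_EFinP; exact: measurable_funX);
  try (by move=> x _; rewrite lee_fin sqr_ge0).
by apply: lte_add_pinfty; apply: lte_mul_pinfty.
Qed.

Lemma L2B (R : realType) d (K : set (pt R d)) f g : measurable K -> L2 K f -> L2 K g -> L2 K (fun x => f x - g x).
Proof.
move=> mK f2 g2; have := L2D mK f2 (L2Z (-1) mK g2).
by under [X in L2 K X -> _]eq_fun do rewrite mulN1r.
Qed.

Lemma fine_L2 (R : realType) d (K : set (pt R d)) f : measurable K -> L2 K f ->
  (\int[leb]_(x in K) (f x ^+ 2)%:E = (\int[leb]_(x in K) (f x ^+ 2))%:E)%E.
Proof.
move=> mK [mf f2]; rewrite /Rintegral fineK// ge0_fin_numE//.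
by apply: integral_ge0 => x _; rewrite lee_fin sqr_ge0.
Qed.

(** Pointwise [2 a phi - phi^2 <= a^2] with [a = (v(x + z) - v(x)) / c]. Translating the integral
    moves the increment onto [phi], which leaves an expression linear in [v]. The divisor [c] is 1
    for increments that stay away from 0 and [h] for difference quotients. *)
Lemma corr_dual (R : realType) d (D K : set (pt R d)) (v phi : pt R d -> R) (z : pt R d) (c : R) :
  measurable D -> measurable K -> K `<=` D -> L2 D v -> L2 setT phi -> c != 0 ->
  (forall x, phi x != 0 -> K x /\ K (x + z)) ->
  ((2 * \int[leb]_(x in K) (v x * ((phi (x - z) - phi x) / c)) -
     \int[leb]_x (phi x ^+ 2))%:E <= corr D v z * (c ^- 2)%:E)%E.
Proof.
move=> mD mK KD v2 p2 c0 pK.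
pose w := v \_ D; have w2 : L2 setT w by exact: L2_restrict.
have [mw _] := w2; have [mp _] := p2.
have wz2 := L2_translate z w2; have pz2 := L2_translate (- z) p2.
have iwp := L2M_integrable measurableT w2 p2.
have iwzp := L2M_integrable measurableT wz2 p2.
have ipp := L2M_integrable measurableT p2 p2.
have iwpz := L2M_integrable measurableT w2 pz2.
have -> : \int[leb]_(x in K) (v x * ((phi (x - z) - phi x) / c)) =
    c^-1 * (\int[leb]_x (w (x + z) * phi x) - \int[leb]_x (w x * phi x)).
  rewrite -(@Rleb_translate _ _ (fun x => w (x + z) * phi x) (- z)); last first.
    by apply: measurable_funM => //; have [] := wz2.
  under [X in c^-1 * (X - _)]eq_Rintegral do rewrite subrK.
  rewrite -RintegralB// -RintegralZl//; last exact: integrable_subr.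
  rewrite -(@Rintegral_support _ _ K)//.
    apply: eq_Rintegral => x; rewrite inE => Kx.
    rewrite /w patchE mem_set; last exact: KD.
    by rewrite /=; ring.
  move=> x nK; rewrite -mulrBr.
  have -> : phi x = 0 by apply: contra_notP nK => /eqP /pK[].
  have -> : phi (x - z) = 0 by apply: contra_notP nK => /eqP /pK[]; rewrite subrK.
  by rewrite subrr !mulr0.
rewrite (@corr_congr _ _ _ _ w); last by move=> x Dx; rewrite /w patchE mem_set.
have mF := measurableT_comp (measurable_corr2 mD mw) (measurable_pair2 z).
have iF (f : pt R d -> \bar R) : (@leb R d).-integrable setT f -> (\int[leb]_x f x)%E = (fine (\int[leb]_x f x))%:E.
  by move=> fi; rewrite fineK//; exact: integrable_fin_num.
pose g x := 2 * (c^-1 * (w (x + z) * phi x - w x * phi x)) - phi x * phi x.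
have ig : (@leb R d).-integrable setT (EFin \o g).
  apply: integrable_subr => //; apply: integrable_mulrl => //; apply: integrable_mulrl => //.
  exact: integrable_subr.
have -> : 2 * (c^-1 * (\int[leb]_x (w (x + z) * phi x) - \int[leb]_x (w x * phi x))) -
    \int[leb]_x (phi x ^+ 2) = \int[leb]_x g x.
  rewrite /g RintegralB//; last first.
    apply: integrable_mulrl => //; apply: integrable_mulrl => //; exact: integrable_subr.
  rewrite RintegralZl//; last by apply: integrable_mulrl => //; exact: integrable_subr.
  rewrite RintegralZl//; last exact: integrable_subr.
  by rewrite RintegralB.
rewrite muleC -ge0_integralZT; last 3 first.
- exact: mF.
- by move=> y; rewrite lee_fin mulr_ge0 ?sqr_ge0// mulr_ge0.
- by rewrite invr_ge0 sqr_ge0.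
(* Comparing with the signed function [g] needs integrability of the right-hand side; if it is
   infinite, the claim is trivial. *)
have [fin|] := ltP (\int[leb]_x ((c ^- 2)%:E * (\1_D x * \1_D (x + z) * (w (x + z) - w x) ^+ 2)%:E))%E +oo%E; last first.
  by rewrite leye_eq => /eqP ->; exact: leey.
rewrite /Rintegral -iF//; apply: le_integral => //.
  apply/integrableP; split.
    by apply: measurable_funeM; exact: mF.
  apply: le_lt_trans fin; apply: ge0_le_integral => //.
  - by apply: measurableT_comp => //; apply: measurable_funeM; exact: mF.
  - by apply: measurable_funeM; exact: mF.
  - move=> x _; rewrite -EFinM abse_EFin ger0_norm// mulr_ge0 ?invr_ge0 ?sqr_ge0//.
    by rewrite mulr_ge0 ?sqr_ge0// mulr_ge0.
move=> x _; rewrite -EFinM lee_fin /g.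
have [p0|pn0] := eqVneq (phi x) 0.
  rewrite p0 !mulr0 subrr !mulr0 subrr mulr_ge0 ?invr_ge0 ?sqr_ge0//.
  by rewrite mulr_ge0 ?sqr_ge0// mulr_ge0.
have [Kx Kxz] := pK x pn0.
rewrite !indicE !mem_set; [|exact: KD..].
rewrite /= !mul1r -exprVn.
have := sqr_ge0 (c^-1 * (w (x + z) - w x) - phi x).
nra.
Qed.

(** Weak convergence handles the fixed function [psi]; the error [psi_ j - psi] has sup norms
    tending to 0 and falls under [weak_pairing_vanish]. *)
Lemma weak_pairing_uniform (R : realType) d (D K : set (pt R d)) (v_ : nat -> pt R d -> R) v
    (psi_ : nat -> pt R d -> R) (psi : pt R d -> R) :
  weak_L2loc D v_ v -> compact K -> K `<=` D -> (forall j, L2 K (v_ j)) -> L2 K v ->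
  (forall j, measurable_fun setT (psi_ j)) -> (forall j, exists M : R, forall x, `|psi_ j x| <= M) ->
  measurable_fun setT psi -> (exists M : R, forall x, `|psi x| <= M) ->
  (forall e : R, 0 < e -> \forall j \near \oo, forall x, `|psi_ j x - psi x| <= e) ->
  (fun j => \int[leb]_(x in K) (v_ j x * psi_ j x)) @ \oo --> \int[leb]_(x in K) (v x * psi x).
Proof.
move=> wv cK KD v_2 v2 mpsi_ bpsi_ mpsi [M bpsi] upsi.
have mK : measurable K by exact: compact_measurable_rVR.
have Kf : (leb K < +oo)%E by exact: leb_compact_lty.
have psi2 : L2 K psi := bounded_L2 mK Kf (measurable_funTS mpsi) bpsi.
pose h j x := psi_ j x - psi x.
have mh j : measurable_fun setT (h j) by exact: measurable_funB.
have bh j : has_sup (range (fun x => `|h j x|)).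
  split; first by exists `|h j 0|; exists 0.
  have [Mj Hj] := bpsi_ j; exists (Mj + M) => _ [x _ <-].
  by rewrite (le_trans (ler_normB _ _))// lerD.
have := @weak_pairing_vanish _ _ D K v_ v h (fun j => sup (range (fun x => `|h j x|))) wv cK KD v_2 v2 mh.
have H1 : (forall j x, `|h j x| <= sup (range (fun x => `|h j x|))).
  by move=> j x; apply: ub_le_sup; [by case: (bh j)|exists x].
move=> /(_ H1) H.
have {}H : (fun j => \int[leb]_(x in K) (v_ j x * h j x)) @ \oo --> 0.
  apply: H; apply/cvgrPdist_le => e e0; near=> j.
  rewrite sub0r normrN ger0_norm; last by rewrite (le_trans _ (H1 j 0)).
  apply: ge_sup; first by exists `|h j 0|; exists 0.
  by move=> _ [x _ <-]; move: x; near: j; exact: upsi.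
have H2 : (fun j => \int[leb]_(x in K) (v_ j x * h j x) + \int[leb]_(x in K) (v_ j x * psi x)) @ \oo -->
    0 + \int[leb]_(x in K) (v x * psi x) by apply: cvgD => //; exact: wv.
rewrite add0r in H2; apply: cvg_trans H2; apply: near_eq_cvg; near=> j => /=.
have hj2 : L2 K (h j).
  have [Mj Hj] := bpsi_ j; apply: L2B => //.
  exact: bounded_L2 mK Kf (measurable_funTS (mpsi_ j)) Hj.
rewrite -RintegralD//; try exact: L2M_integrable.
by apply: eq_Rintegral => x _; rewrite /h -mulrDr subrK.
Unshelve. all: end_near. Qed.

(** The common core of both lower bounds: [corr_lsc] takes [c_ j = 1], [corr_quotient_liminf] takes
    [c_ j = h_ j]. Strict inequality in the limit absorbs the error of the pairing. *)
Lemma corr_dual_liminf (R : realType) d (D K : set (pt R d)) (v_ : nat -> pt R d -> R)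
    (v phi psi : pt R d -> R) (z_ : nat -> pt R d) (c_ : nat -> R) (a : R) :
  measurable D -> compact K -> K `<=` D -> weak_L2loc D v_ v -> (forall j, L2 D (v_ j)) -> L2 D v ->
  measurable_fun setT phi -> (exists M : R, forall x, `|phi x| <= M) ->
  measurable_fun setT psi -> (exists M : R, forall x, `|psi x| <= M) ->
  (forall j, c_ j != 0) ->
  (\forall j \near \oo, forall x, phi x != 0 -> K x /\ K (x + z_ j)) ->
  (forall e : R, 0 < e -> \forall j \near \oo, forall x, `|(phi (x - z_ j) - phi x) / c_ j - psi x| <= e) ->
  a < 2 * (\int[leb]_(x in K) (v x * psi x)) - \int[leb]_x (phi x ^+ 2) ->
  \forall j \near \oo, (a%:E <= corr D (v_ j) (z_ j) * (c_ j ^- 2)%:E)%E.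
Proof.
move=> mD cK KD wv v_2 v2 mphi [M bphi] mpsi bpsi c0 supp uphi av.
have mK : measurable K by exact: compact_measurable_rVR.
have Kf : (leb K < +oo)%E by exact: leb_compact_lty.
have mtr z : measurable_fun setT (fun x : pt R d => phi (x - z)).
  by apply: (measurableT_comp mphi); exact: measurable_ptDr.
have := @weak_pairing_uniform _ _ D K v_ v (fun j x => (phi (x - z_ j) - phi x) / c_ j) psi wv cK KD.
have v_2K j : L2 K (v_ j) by exact: L2S (v_2 j).
have v2K : L2 K v by exact: L2S v2.
move=> /(_ v_2K v2K) H.
have {}H : (fun j => \int[leb]_(x in K) (v_ j x * ((phi (x - z_ j) - phi x) / c_ j))) @ \oo --> \int[leb]_(x in K) (v x * psi x).
  apply: H => // j; first by apply: measurable_funM => //; exact: measurable_funB.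
  exists ((M + M) / `|c_ j|) => x; rewrite normrM normfV ler_wpM2r ?invr_ge0//.
  by rewrite (le_trans (ler_normB _ _))// lerD.
pose e := (2 * (\int[leb]_(x in K) (v x * psi x)) - \int[leb]_x (phi x ^+ 2) - a) / 2.
have e0 : 0 < e by rewrite divr_gt0// subr_gt0.
move/cvgrPdist_le : H => /(_ _ e0) H.
have [J _ suppJ] := supp.
have phi2 : L2 setT phi.
  apply: (@L2_setT_support _ _ K) => //.
  - move=> x nK; apply: contra_notP nK => /eqP px.
    by have [] := suppJ J (leqnn J) x px.
  - exact: bounded_L2 mK Kf (measurable_funTS mphi) bphi.
near=> j.
have suppj : forall x, phi x != 0 -> K x /\ K (x + z_ j) by near: j; exact: supp.
apply: (le_trans _ (@corr_dual _ _ D K (v_ j) phi (z_ j) (c_ j) mD mK KD (v_2 j) phi2 (c0 j) suppj)).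
rewrite lee_fin.
have : `|\int[leb]_(x in K) (v x * psi x) - \int[leb]_(x in K) (v_ j x * ((phi (x - z_ j) - phi x) / c_ j))| <= e.
  by near: j; exact: H.
by rewrite ler_norml /e => /andP[_ ?]; lra.
Unshelve. all: end_near. Qed.

(** * Square integrable functions *)

Lemma cvg_limn_einf (R : realType) (u : nat -> \bar R) (l : \bar R) :
  u @ \oo --> l -> limn_einf u = l.
Proof. by move=> /cvg_limn_einf_sup[]. Qed.

Definition ip (R : realType) d (f g : pt R d -> R) : R := \int[leb]_x (f x * g x).

Lemma ipC (R : realType) d (f g : pt R d -> R) : ip f g = ip g f.
Proof. by apply: eq_Rintegral => x _; rewrite mulrC. Qed.

Lemma ip_ge0 (R : realType) d (f : pt R d -> R) : 0 <= ip f f.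
Proof. by apply: Rintegral_ge0 => x _; rewrite -expr2 sqr_ge0. Qed.

Lemma ipDl (R : realType) d (f g h : pt R d -> R) : L2 setT f -> L2 setT g -> L2 setT h ->
  ip (fun x => f x + g x) h = ip f h + ip g h.
Proof.
move=> f2 g2 h2; rewrite /ip -RintegralD//; try exact: L2M_integrable.
by apply: eq_Rintegral => x _; rewrite mulrDl.
Qed.

Lemma ipZl (R : realType) d (c : R) (f h : pt R d -> R) : L2 setT f -> L2 setT h ->
  ip (fun x => c * f x) h = c * ip f h.
Proof.
move=> f2 h2; rewrite /ip -RintegralZl//; last exact: L2M_integrable.
by apply: eq_Rintegral => x _; rewrite mulrA.
Qed.

Lemma ipE (R : realType) d (f : pt R d -> R) : L2 setT f ->
  (\int[leb]_x (f x ^+ 2)%:E = (ip f f)%:E)%E.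
Proof. by move=> f2; rewrite fine_L2//; congr EFin; apply: eq_Rintegral => x _; rewrite expr2. Qed.

Lemma ip_lin (R : realType) d (a b : R) (f g h : pt R d -> R) : L2 setT f -> L2 setT g -> L2 setT h ->
  ip (fun x => a * f x + b * g x) h = a * ip f h + b * ip g h.
Proof. by move=> f2 g2 h2; rewrite ipDl ?ipZl//; exact: L2Z. Qed.

Lemma L2_lin (R : realType) d (a b : R) (f g : pt R d -> R) : L2 setT f -> L2 setT g ->
  L2 setT (fun x => a * f x + b * g x).
Proof. by move=> f2 g2; apply: L2D => //; exact: L2Z. Qed.

Lemma nrm2_lin (R : realType) d (a b : R) (f g : pt R d -> R) : L2 setT f -> L2 setT g ->
  ip (fun x => a * f x + b * g x) (fun x => a * f x + b * g x) =
  a ^+ 2 * ip f f + 2 * a * b * ip f g + b ^+ 2 * ip g g.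
Proof.
move=> f2 g2; rewrite ip_lin//; last exact: L2_lin.
have hf : ip f (fun x => a * f x + b * g x) = a * ip f f + b * ip f g by rewrite ipC ip_lin// (ipC g f).
have hg : ip g (fun x => a * f x + b * g x) = a * ip f g + b * ip g g by rewrite ipC ip_lin.
by rewrite hf hg; ring.
Qed.

Lemma nrm2B (R : realType) d (f g : pt R d -> R) : L2 setT f -> L2 setT g ->
  ip (fun x => f x - g x) (fun x => f x - g x) = ip f f - 2 * ip f g + ip g g.
Proof.
move=> f2 g2; rewrite (_ : (fun x => f x - g x) = (fun x => 1 * f x + (-1) * g x)).
  by rewrite nrm2_lin//; ring.
by apply/funext => x; rewrite mul1r mulN1r.
Qed.

Lemma ip_cauchy_schwarz (R : realType) d (f g : pt R d -> R) : L2 setT f -> L2 setT g ->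
  ip f g ^+ 2 <= ip f f * ip g g.
Proof.
move=> f2 g2; have g0 := ip_ge0 g.
have H a b : 0 <= a ^+ 2 * ip f f + 2 * a * b * ip f g + b ^+ 2 * ip g g.
  by rewrite -nrm2_lin//; exact: ip_ge0.
have [g00|gn0] := eqVneq (ip g g) 0; last first.
  have gp : 0 < ip g g by rewrite lt_neqAle eq_sym gn0.
  have := H (ip g g) (- ip f g); nra.
have [->|fgn0] := eqVneq (ip f g) 0; first by rewrite expr0n/= g00 mulr0.
(* With [ip g g = 0] the quadratic form is affine in [b], and this [b] gives it the value -1. *)
have := H 1 (- (ip f f + 1) / (2 * ip f g)); rewrite g00.
rewrite (_ : _ + _ = -1); first by rewrite ler0N1.
by field.
Qed.

(** The rate [16^-n] leaves room for the weights [4^k]: the weighted sum of [|f_(k+1) - f_k|^2] has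
    finite integral, so almost everywhere the increments are [O(2^-k)] and the whole sequence
    converges without extraction. *)
Lemma L2_complete (R : realType) d (f_ : nat -> pt R d -> R) (C : R) :
  (forall n, L2 setT (f_ n)) ->
  (forall n m, (n <= m)%N -> ip (fun x => f_ n x - f_ m x) (fun x => f_ n x - f_ m x) <= C * 16^-1 ^+ n) ->
  exists2 w, L2 setT w & forall n, ip (fun x => f_ n x - w x) (fun x => f_ n x - w x) <= C * 16^-1 ^+ n.
Proof.
move=> f2 fC.
have C0 : 0 <= C by have := le_trans (ip_ge0 _) (fC 0%N 0%N (leqnn _)); rewrite expr0 mulr1.
have mf n := L2_measurable (f2 n).
pose S x : \bar R := (\sum_(0 <= k <oo) (4 ^+ k * (f_ k.+1 x - f_ k x) ^+ 2)%:E)%E.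
have mt k : measurable_fun setT (fun x => (4 ^+ k * (f_ k.+1 x - f_ k x) ^+ 2)%:E).
  by apply/measurable_EFinP; apply: measurable_funM => //; apply: measurable_funX; exact: measurable_funB.
have t0 k x : (0 <= (4 ^+ k * (f_ k.+1 x - f_ k x) ^+ 2)%:E)%E.
  by rewrite lee_fin mulr_ge0 ?sqr_ge0// exprn_ge0.
have mS : measurable_fun setT S by apply: ge0_emeasurable_sum.
have iS : (\int[leb]_x S x <= (C * 2)%:E)%E.
  rewrite integral_nneseries//; apply: lime_le.
    by apply: is_cvg_nneseries => k _ _; apply: integral_ge0.
  near=> n.
  under eq_bigr => k _.
    under eq_integral do rewrite EFinM.
    rewrite ge0_integralZT ?lee_fin ?exprn_ge0//; last 2 first.
      by apply/measurable_EFinP; apply: measurable_funX; exact: measurable_funB.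
      by move=> x; rewrite lee_fin sqr_ge0.
    rewrite (ipE (L2B measurableT (f2 _) (f2 _))) -EFinM.
    over.
  rewrite sumEFin lee_fin.
  have := @geometric_series_bound _ (fun k => 4 ^+ k * ip (fun x => f_ k.+1 x - f_ k x) (fun x => f_ k.+1 x - f_ k x)) 0%N (C * 2).
  move=> /(_ _ _ n (leq0n n)); rewrite expr0 mulr1 => H; apply: le_trans (ler_norm _) (H _ _).
    by rewrite mulr_ge0.
  move=> i _; rewrite ger0_norm; last by rewrite mulr_ge0 ?exprn_ge0 ?ip_ge0.
  rewrite exprS mulrA mulfK//.
  have := fC i i.+1 (leqnSn i).
  rewrite (_ : ip _ _ = ip (fun x => f_ i.+1 x - f_ i x) (fun x => f_ i.+1 x - f_ i x)); last first.
    by apply: eq_Rintegral => x _; rewrite -!expr2 -sqrrN opprB.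
  move=> Hi; apply: (@le_trans _ _ (4 ^+ i * (C * 16^-1 ^+ i))); first by rewrite ler_wpM2l// exprn_ge0.
  rewrite mulrCA ler_wpM2l// -exprMn (_ : 4 * 16^-1 = 4^-1 :> R); last by field.
  by apply: lerXn2r; rewrite ?nnegrE ?invr_ge0// lef_pV2 ?posrE// ler_nat.
pose G := [set x | (S x < +oo)%E].
have mG : measurable G.
  by rewrite /G -[X in measurable X]setTI; exact: (emeasurable_fun_infty_o measurableT mS).
have aeG : {ae leb, forall x, G x}.
  have : (@leb R d).-integrable setT S.
    apply/integrableP; split => //.
    apply: le_lt_trans (le_trans _ iS) (ltry _).
    by apply: ge0_le_integral => //; [exact: measurableT_comp|move=> x _; rewrite gee0_abs// nneseries_ge0].
  move=> /(integrable_ae measurableT); apply: filterS => x /(_ I).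
  by rewrite /G/= => H; rewrite ltey_eq H.
(* Truncation to the good set turns convergence almost everywhere into convergence everywhere, so
   that the limit is measurable. *)
pose h n x := \1_G x * f_ n x.
have mh n : measurable_fun setT (h n) by apply: measurable_funM => //; exact: measurable_indicT.
have hcvg x : cvgn (h ^~ x).
  have [Gx|nGx] := pselect (G x); last first.
    rewrite (_ : h ^~ x = cst 0); first exact: is_cvg_cst.
    by apply/funext => n; rewrite /h indicE memNset// mul0r.
  rewrite (_ : h ^~ x = fun n => f_ n x); last first.
    by apply/funext => n; rewrite /h indicE mem_set// mul1r.
  have S0 : (0 <= S x)%E by exact: nneseries_ge0.
  have Sf : S x \is a fin_num by rewrite ge0_fin_numE.
  have H k : `|f_ k.+1 x - f_ k x| <= (2 * Num.sqrt (fine (S x))) * 2^-1 ^+ k.+1.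
    rewrite exprS mulrACA divff// mul1r exprVn ler_pdivlMr ?exprn_gt0// mulrC.
    have : ((4 ^+ k * (f_ k.+1 x - f_ k x) ^+ 2)%:E <= S x)%E.
      rewrite /S (nneseriesD1 (n := k))//.
      by rewrite leeDl// nneseries_ge0.
    rewrite -(fineK Sf) lee_fin -ler_sqrt ?fine_ge0//.
    rewrite (_ : 4 ^+ k * _ = (2 ^+ k * (f_ k.+1 x - f_ k x)) ^+ 2); last first.
      by rewrite [RHS]exprMn -[in RHS]exprM mulnC exprM (_ : 2 ^+ 2 = 4 :> R)// -natrX.
    by rewrite sqrtr_sqr normrM ger0_norm ?exprn_ge0.
  have := geometric_series_cvg (mulr_ge0 (ler0n _ 2) (sqrtr_ge0 _)) H.
  rewrite (_ : series _ = fun n => f_ n x - f_ 0%N x); last first.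
    by apply/funext => n; rewrite /series/= telescope_sumr.
  move=> /(is_cvgD)/(_ (is_cvg_cst (f_ 0%N x))).
  by apply: (eq_ind _ (fun u : nat -> R => cvgn u -> _) id); apply/funext => n /=; rewrite [RHS]/GRing.add /= subrK.
pose w x := limn (h ^~ x).
have mw : measurable_fun setT w by apply: (measurable_fun_cvg mh) => x _; exact: hcvg.
have key n : (\int[leb]_x ((f_ n x - w x) ^+ 2)%:E <= (C * 16^-1 ^+ n)%:E)%E.
  have mfh m : measurable_fun setT (fun x => ((f_ n x - h m x) ^+ 2)%:E).
    by apply/measurable_EFinP; apply: measurable_funX; exact: measurable_funB.
  (* Fatou's lemma in [m] hands the Cauchy rate over to the limit. *)
  have := @fatou _ _ _ (@leb R d) _ measurableT (fun m x => ((f_ n x - h m x) ^+ 2)%:E) mfh.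
  move=> /(_ (fun m x _ => _)) H; apply: le_trans (le_trans (H _) _).
  - rewrite le_eqVlt; apply/orP; left; apply/eqP; apply: eq_integral => x _.
    apply/esym/cvg_limn_einf; apply/cvg_EFin; first by apply: nearW.
    by apply: cvgM; apply: cvgB; try exact: cvg_cst; exact: hcvg.
  - by move=> m x; rewrite lee_fin sqr_ge0.
  apply: le_trans (limn_einf_sup _) (limn_esup_leP _) => a Ca; near=> m.
  apply: le_trans (ltW Ca).
  rewrite (@ge0_ae_eq_integral _ _ _ _ _ _ (fun x => ((f_ n x - f_ m x) ^+ 2)%:E))//.
  - rewrite (ipE (L2B measurableT (f2 _) (f2 _))) lee_fin; apply: fC.
    by near: m; exists n.
  - by apply/measurable_EFinP; apply: measurable_funX; exact: measurable_funB.
  - by move=> x _; rewrite lee_fin sqr_ge0.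
  - by move=> x _; rewrite lee_fin sqr_ge0.
  - by apply: filterS aeG => x Gx _; rewrite /h indicE mem_set// mul1r.
have d2 n : L2 setT (fun x => f_ n x - w x).
  by split; [exact: measurable_funB|exact: le_lt_trans (key n) (ltry _)].
exists w => [|n]; last by rewrite -lee_fin -ipE.
rewrite (_ : w = fun x => f_ 0%N x - (f_ 0%N x - w x)); first exact: L2B.
by apply/funext => x; rewrite opprB addrC subrK.
Unshelve. all: end_near. Qed.

(** The upper bound on [2 l f - |f|^2] replaces continuity of [l]. A minimizing sequence of
    [|f|^2 - 2 l f] is Cauchy by the parallelogram identity, and its limit represents [l] by the
    Euler-Lagrange equation. The sequence itself is returned because [test_dense] needs the
    approximants in [T]. *)
Lemma riesz_minimization (R : realType) d (T : set (pt R d -> R)) (l : (pt R d -> R) -> R) (M : R) :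
  T `<=` L2 setT -> T (cst 0) ->
  (forall a b f g, T f -> T g -> T (fun x => a * f x + b * g x)) ->
  (forall a b f g, T f -> T g -> l (fun x => a * f x + b * g x) = a * l f + b * l g) ->
  (forall f, T f -> 2 * l f - ip f f <= M) ->
  exists w, [/\ L2 setT w, forall f, T f -> ip w f = l f &
    exists2 f_ : nat -> pt R d -> R, forall n, T (f_ n) &
      forall n, ip (fun x => f_ n x - w x) (fun x => f_ n x - w x) <= 4 * 16^-1 ^+ n].
Proof.
move=> T2 T0 Tlin llin lM.
pose J f := ip f f - 2 * l f.
pose m := inf [set J f | f in T].
have hi : has_inf [set J f | f in T].
  by split; [exists (J (cst 0)), (cst 0)|exists (- M) => _ [f Tf <-]; rewrite lerNl /J opprB; exact: lM].
have mJ f : T f -> m <= J f by move=> Tf; apply: ge_inf; [case: hi|exists f].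
have /choice[f_ f_P] : forall n, exists f, T f /\ J f <= m + 16^-1 ^+ n.
  move=> n; have [_ [f Tf <-] Jf] := @inf_adherent _ _ (16^-1 ^+ n) (exprn_gt0 n (ltac:(by rewrite invr_gt0) : 0 < 16^-1 :> R)) hi.
  by exists f; split => //; exact: ltW.
have Tf n := (f_P n).1; have f2 n : L2 setT (f_ n) := T2 _ (Tf n).
(* [|f_n - f_k|^2 = 2 J(f_n) + 2 J(f_k) - 4 J((f_n + f_k) / 2)], and the last term is at most
   [-4 m]. *)
have fC n k : (n <= k)%N -> ip (fun x => f_ n x - f_ k x) (fun x => f_ n x - f_ k x) <= 4 * 16^-1 ^+ n.
  move=> nk; rewrite nrm2B//.
  have := mJ _ (Tlin 2^-1 2^-1 _ _ (Tf n) (Tf k)); rewrite /J nrm2_lin// llin//.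
  have := (f_P n).2; have := (f_P k).2; rewrite /J.
  have : (16^-1 : R) ^+ k <= 16^-1 ^+ n by rewrite ler_wiXn2l// ?invr_ge0// invf_le1// ler1n.
  have -> : (2^-1 : R) ^+ 2 = 4^-1 by rewrite exprVn -natrX.
  have : 4 * 4^-1 = 1 :> R by field.
  have : 2 * 2^-1 = 1 :> R by field.
  move: (4^-1) (2^-1 : R) => q h; nra.
have [w w2 wP] := L2_complete f2 fC.
exists w; split => //; last by exists f_.
move=> g Tg; have g2 := T2 _ Tg.
(* The competitor [f_n - a g / (b + 1)] cannot beat the infimum; dividing by [b + 1] rather than [b]
   allows [g] to be null. *)
have st n : (ip (f_ n) g - l g) ^+ 2 <= 16^-1 ^+ n * (ip g g + 1).
  have b0 := ip_ge0 g; set b := ip g g in b0 *; set a := _ - _.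
  have := mJ _ (Tlin 1 (- a / (b + 1)) _ _ (Tf n) Tg); rewrite /J nrm2_lin// llin// -/b.
  have := (f_P n).2; rewrite /J => H1 H2.
  have {}H2 : 0 <= 16^-1 ^+ n - 2 * a / (b + 1) * a + (a / (b + 1)) ^+ 2 * b.
    have key (e c F u L v : R) : F - 2 * L <= m + e ->
        m <= 1 ^+ 2 * F + 2 * 1 * - c * u + (- c) ^+ 2 * b - 2 * (1 * L + - c * v) ->
        0 <= e - 2 * c * (u - v) + c ^+ 2 * b by move=> *; lra.
    by rewrite mulNr in H2; have := key _ _ _ _ _ _ H1 H2; rewrite [2 * (a / _)]mulrA.
  have b1 : 0 < b + 1 by lra.
  have : 0 <= (16^-1 ^+ n - 2 * a / (b + 1) * a + (a / (b + 1)) ^+ 2 * b) * (b + 1) by rewrite mulr_ge0// ltW.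
  have -> : (16^-1 ^+ n - 2 * a / (b + 1) * a + (a / (b + 1)) ^+ 2 * b) * (b + 1) =
    16^-1 ^+ n * (b + 1) - a ^+ 2 - a ^+ 2 / (b + 1) by field; exact: lt0r_neq0.
  have : 0 <= a ^+ 2 / (b + 1) by rewrite divr_ge0 ?sqr_ge0// ltW.
  lra.
have cs n : (ip (f_ n) g - ip w g) ^+ 2 <= 16^-1 ^+ n * (4 * ip g g).
  have -> : ip (f_ n) g - ip w g = ip (fun x => f_ n x - w x) g.
    rewrite (_ : (fun x => _) = fun x => 1 * f_ n x + (-1) * w x); first by rewrite ip_lin//; ring.
    by apply/funext => x; rewrite mul1r mulN1r.
  apply: le_trans (ip_cauchy_schwarz (L2B measurableT (f2 n) w2) g2) _.
  by rewrite mulrA [16^-1 ^+ n * 4]mulrC ler_wpM2r ?ip_ge0.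
(* [(p - q)^2 <= 2 p^2 + 2 q^2] applied to [st] and [cs]. *)
have E n : (ip w g - l g) ^+ 2 <= 16^-1 ^+ n * (10 * ip g g + 2).
  have := st n; have := cs n; have : 0 <= (16^-1 : R) ^+ n by rewrite exprn_ge0// invr_ge0.
  by have := sqr_ge0 (ip (f_ n) g - l g + (ip (f_ n) g - ip w g)); nra.
have c0 : (fun n : nat => (16^-1 : R) ^+ n * (10 * ip g g + 2)) @ \oo --> (0 : R) * (10 * ip g g + 2).
  by apply: cvgM; [apply: cvg_expr; rewrite ger0_norm ?invr_ge0// invf_lt1// ltr1n|exact: cvg_cst].
rewrite mul0r in c0.
have : (ip w g - l g) ^+ 2 <= 0.
  by rewrite -(cvg_lim _ c0)//; apply: limr_ge; [exact: cvgP c0|exact: nearW].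
by move=> H; apply/eqP; rewrite -subr_eq0 -sqrf_eq0 eq_le H sqr_ge0.
Qed.

(** * Uniform estimates on compact sets, differentiation along lines, smoothness classes *)

Lemma compact_unif_near (R : realType) (V : normedModType R) (K : set V) (P : V -> V -> Prop) :
  compact K -> (forall x, K x -> \forall y \near x & z \near (0 : V), P y z) ->
  exists2 r : R, 0 < r & forall x z, K x -> `|z| < r -> P x z.
Proof.
move=> /compact_near_coveringP cK KP.
have := cK _ (nbhs (0 : V)) (fun z x => P x z) _ KP.
move=> /(_ _)/nbhs_normP[r /= r0 rP]; exists r => // x z Kx zr.
by apply: rP Kx; rewrite /ball_/= sub0r normrN.
Qed.

Lemma compact_support_unif (R : realType) (V : normedModType R) (K : set V) (f : V -> R) (e : R) :
  compact K -> continuous f -> (forall x, ~ K x -> f x = 0) -> 0 < e ->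
  exists2 r : R, 0 < r & forall x z, `|z| < r -> `|f (x + z) - f x| <= e.
Proof.
move=> cK cf f0 e0.
have [|r r0 rP] := @compact_unif_near _ _ K (fun x z => `|f (x + z) - f x| <= e) cK.
  move=> x _; have e2 : 0 < e / 2 by rewrite divr_gt0.
  have := cf x => /cvgrPdist_lt /(_ _ e2) /nbhs_normP[r /= r0 rP].
  exists (ball x (r / 2), ball 0 (r / 2)); first by split; apply: nbhsx_ballx; rewrite divr_gt0.
  move=> [y z] [/= yB zB].
  move: yB zB; rewrite -!ball_normE /= => yB; rewrite sub0r normrN => zB.
  have H1 : `|f x - f y| < e / 2.
    by apply: rP => /=; rewrite (lt_trans yB)// ltr_pdivrMr// ltr_pMr// ltr1n.
  have H2 : `|f x - f (y + z)| < e / 2.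
    apply: rP => /=; rewrite opprD addrA (le_lt_trans (ler_normB _ _))//.
    by rewrite [ltRHS](splitr r) ltrD.
  rewrite (_ : _ - f y = (f x - f y) - (f x - f (y + z))); last by ring.
  by rewrite (le_trans (ler_normB _ _))// [leRHS](splitr e) lerD// ltW.
exists r => // x z zr; have [Kx|nKx] := pselect (K x); first exact: rP.
have [Kxz|nKxz] := pselect (K (x + z)); last by rewrite !f0// subr0 normr0 ltW.
(* When only the endpoint lies in [K], the estimate is read backwards from it. *)
have := rP (x + z) (- z) Kxz; rewrite normrN addrK distrC => H; exact: H.
Qed.

(** Makes room for shifts that vary with the index, so that one compact [K] carries all pairings
    from some index on. It is the sum of [S] and a small closed ball. *)
Lemma compact_thicken (R : realType) n (S U : set ('rV[R]_n * R)) : compact S -> open U -> S `<=` U ->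
  exists r K, [/\ 0 < r, compact K, K `<=` U, S `<=` K & forall x z, S x -> `|z| < r -> K (x + z)].
Proof.
move=> cS oU SU.
have [x Sx|r r0 rP] := @compact_unif_near _ _ S (fun x z => U (x + z)) cS.
  have := open_nbhs_nbhs (conj oU (SU x Sx)) => /nbhs_normP[r /= r0 rP].
  exists (ball x (r / 2), ball 0 (r / 2)); first by split; apply: nbhsx_ballx; rewrite divr_gt0.
  move=> [y z] [/= yB zB].
  move: yB zB; rewrite -!ball_normE /= => yB; rewrite sub0r normrN => zB.
  apply: rP => /=; rewrite opprD addrA (le_lt_trans (ler_normB _ _))//.
  by rewrite [ltRHS](splitr r) ltrD.
have r2 : 0 < r / 2 by rewrite divr_gt0.
pose B := [set x : 'rV[R]_n | `|x| <= r / 2] `*` `[- (r / 2), r / 2]%classic.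
have cB : compact B.
  apply: compact_setX; last exact: segment_compact.
  apply: bounded_closed_compact.
    by exists (r / 2); split; [exact: num_real|move=> M rM x /= /le_trans; apply; exact: ltW].
  by apply: (@closed_comp _ _ (fun x : 'rV[R]_n => `|x|) [set y | y <= r / 2]);
    [move=> x _; exact: norm_continuous|exact: closed_le].
have BE z : B z <-> `|z| <= r / 2.
  rewrite prod_normE /= ge_max; split => [[/= -> /=]|/andP[h1 h2]].
    by rewrite in_itv/= ler_norml.
  by split => //=; rewrite in_itv/= -ler_norml.
exists (r / 2), ((fun p : ('rV[R]_n * R) * ('rV[R]_n * R) => p.1 + p.2) @` (S `*` B)); split => //.
- apply: continuous_compact; last exact: compact_setX.
  by apply: continuous_subspaceT => x; exact: add_continuous.
- move=> _ [[x z] [/= Sx /BE Bz] <-]; apply: rP => //.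
  by rewrite (le_lt_trans Bz)// ltr_pdivrMr// ltr_pMr// ltr1n.
- move=> x Sx; exists (x, 0); last by rewrite addr0.
  by split => //=; apply/BE; rewrite normr0 ltW.
- by move=> x z Sx zr; exists (x, z) => //; split => //=; apply/BE; exact: ltW.
Qed.

Lemma is_derive_line (R : realType) (V : normedModType R) (f : V -> R) (x e : V) (l : R) :
  is_derive (0 : R) (1 : R) (fun t : R => f (x + t *: e)) l <-> is_derive x e f l.
Proof.
have E : (fun h : R => h^-1 *: (((fun t : R => f (x + t *: e)) \o shift 0) (h *: (1 : R)) - f (x + 0 *: e))) =
   (fun h : R => h^-1 *: ((f \o shift x) (h *: e) - f x)).
  by apply/funext => h /=; rewrite addr0 scale0r addr0 /GRing.scale/= mulr1 [_ + x]addrC.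
by split => -[H1 H2]; constructor; move: H1 H2; rewrite /derivable /derive E.
Qed.

Lemma is_derive_lineT (R : realType) (V : normedModType R) (f : V -> R) (x e : V) (t : R) :
  derivable f (x + t *: e) e ->
  is_derive t (1 : R) (fun t : R => f (x + t *: e)) ('D_e f (x + t *: e)).
Proof.
move=> df; apply/is_derive_line.
have := is_derive_line f (x + t *: e) e ('D_e f (x + t *: e)).
move=> [_]; have : is_derive (x + t *: e) e f ('D_e f (x + t *: e)) by constructor.
move=> H /(_ H); congr (is_derive _ _ _ _); apply/funext => h.
by rewrite scalerDl addrA [h *: 1]mulr1.
Qed.

(** Taken with [L = 0] it is a Lipschitz estimate, with [L] the derivative at [x] an estimate of the
    Taylor remainder. *)
Lemma mvt_bound (R : realType) (V : normedModType R) (f : V -> R) (e : V) x (t L B : R) :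
  (forall x, derivable f x e) ->
  (forall c, `|c| <= `|t| -> `|'D_e f (x + c *: e) - L| <= B) ->
  `|f (x + t *: e) - f x - t * L| <= `|t| * B.
Proof.
move=> df H.
have D (c : R) : is_derive c (1 : R) (fun c => f (x + c *: e) - c * L) ('D_e f (x + c *: e) - L).
  apply: is_deriveB; first exact: is_derive_lineT.
  rewrite (_ : *%R^~ L = L *: id); last by apply/funext => y; rewrite /GRing.scale/= mulrC.
  by apply: (is_derive_eq (is_deriveZ L (is_derive_id c 1))); rewrite /GRing.scale/= mulr1.
have cont a b : {within `[a, b], continuous (fun c : R => f (x + c *: e) - c * L)}.
  by apply: derivable_within_continuous => c _; case: (D c).
have [t0|t0] := leP 0 t.
  have [c] := MVT_segment t0 (fun c _ => D c) (cont _ _).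
  rewrite in_itv/= scale0r addr0 mul0r !subr0 => /andP[c0 ct].
  rewrite addrAC => ->; rewrite normrM mulrC ler_wpM2l// H// !ger0_norm//.
have [c] := MVT_segment (ltW t0) (fun c _ => D c) (cont _ _).
rewrite in_itv/= scale0r addr0 mul0r subr0 sub0r => /andP[c0 ct] E.
rewrite addrAC -normrN opprB E normrM normrN mulrC ler_wpM2l// H// !ler0_norm ?lerN2//; exact: ltW.
Qed.

Lemma CkS (R : realType) d k (f : pt R d -> R) : Ck k.+1 f -> Ck k f.
Proof.
elim: k f => [f [//]|k IH f [cf H]]; split => // e; have [d1 d2] := H e.
by split => //; exact: IH.
Qed.

Lemma Ck_continuous (R : realType) d k (f : pt R d -> R) : Ck k f -> continuous f.
Proof. by case: k => [//|k []]. Qed.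

Lemma Ck_cst (R : realType) d k (c : R) : Ck k (cst c : pt R d -> R).
Proof.
elim: k c => [c|k IH c]; first by move=> x; exact: cvg_cst.
split=> [|e]; first by move=> x; exact: cvg_cst.
split=> [x|]; first exact: derivable_cst.
rewrite (_ : (fun x => _) = cst 0)//; by apply/funext => x; rewrite derive_cst.
Qed.

Lemma CkD (R : realType) d k (f g : pt R d -> R) : Ck k f -> Ck k g -> Ck k (fun x => f x + g x).
Proof.
elim: k f g => [f g cf cg x|k IH f g [cf Hf] [cg Hg]].
  by apply: cvgD; [exact: cf|exact: cg].
split=> [x|e]; first by apply: cvgD; [exact: cf|exact: cg].
have [df f1] := Hf e; have [dg g1] := Hg e; split=> [x|]; first exact: derivableD.
rewrite (_ : (fun x => _) = fun x => 'D_e f x + 'D_e g x); first exact: IH.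
by apply/funext => x; rewrite (deriveD (df x) (dg x)).
Qed.

Lemma CkM (R : realType) d k (f g : pt R d -> R) : Ck k f -> Ck k g -> Ck k (fun x => f x * g x).
Proof.
elim: k f g => [f g cf cg x|k IH f g Cf Cg].
  by apply: cvgM; [exact: cf|exact: cg].
have [cf Hf] := Cf; have [cg Hg] := Cg.
split=> [x|e]; first by apply: cvgM; [exact: cf|exact: cg].
have [df f1] := Hf e; have [dg g1] := Hg e; split=> [x|]; first exact: derivableM.
rewrite (_ : (fun x => _) = fun x => f x * 'D_e g x + g x * 'D_e f x).
  by apply: CkD; apply: IH => //; exact: CkS.
by apply/funext => x; rewrite (deriveM (df x) (dg x)).
Qed.

(** The powers [t^-k] make the family closed under differentiation, so that smoothness of all
    members is proved by one induction. *)
Definition flat (R : realType) (k : nat) (t : R) : R := if 0 < t then t ^- k * expR (- t^-1) else 0.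

Lemma flat_ge0 (R : realType) k (t : R) : 0 <= flat k t.
Proof.
by rewrite /flat; case: ifPn => // t0; rewrite mulr_ge0 ?expR_ge0// invr_ge0 exprn_ge0// ltW.
Qed.

(** [exp(1 / t)] dominates the term of degree [k + 1] of its series. *)
Lemma flat_le (R : realType) k (t : R) : flat k t <= k.+1`!%:R * `|t|.
Proof.
rewrite /flat; case: ifPn => [t0|_]; last by rewrite mulr_ge0.
rewrite gtr0_norm// expRN.
have x0 : 0 <= t^-1 by rewrite invr_ge0 ltW.
have H : (t ^+ k.+1)^-1 / k.+1`!%:R <= expR t^-1.
  by rewrite -exprVn; apply: le_trans (expR_ge1Dxn k x0); rewrite lerDr.
have F : 0 < k.+1`!%:R :> R by rewrite ltr0n fact_gt0.
rewrite ler_pdivrMr ?expR_gt0//.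
apply: le_trans (ler_wpM2l (mulr_ge0 (ltW F) (ltW t0)) H).
rewrite exprS; have p0 : t ^+ k != 0 by rewrite expf_neq0// lt0r_neq0.
rewrite le_eqVlt; apply/orP; left; apply/eqP.
by field; rewrite p0 !lt0r_neq0.
Qed.

Lemma flat_derive (R : realType) k (t : R) :
  is_derive t 1 (flat k : R -> R) (- k%:R * flat k.+1 t + flat k.+2 t).
Proof.
have [t0|t0|t0] := ltgtP t 0.
- rewrite /flat !(lt_gtF t0) mulr0 addr0.
  apply: near_eq_is_derive (is_derive_cst 0 t 1).
  by near=> y; rewrite ifF//; apply/negbTE; rewrite -leNgt ltW//; near: y; exact: lt_nbhsl.
- have tn0 : t != 0 by exact: lt0r_neq0.
  apply: (@near_eq_is_derive _ _ _ (fun y : R => y ^- k * expR (- y^-1))).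
    by near=> y; rewrite /flat ifT//; near: y; exact: lt_nbhsr.
  have dV : is_derive t 1 (fun y : R => y^-1) (- t ^- 2 *: 1).
    by apply: (@is_deriveV _ id).
  have dX : is_derive t 1 (fun y : R => y ^- k) (- (t ^+ k) ^- 2 *: (k%:R * t ^+ k.-1)).
    apply: (@is_deriveV _ (fun y => y ^+ k)); first by rewrite expf_neq0.
    rewrite (_ : (GRing.exp (R:=R))^~ k = id ^+ k); last by apply/funext => y; rewrite exprfctE.
    by apply: (is_derive_eq (is_deriveX k (is_derive_id t 1))); rewrite /GRing.scale/= mulr1 -mulr_natl.
  have dE : is_derive t 1 (fun y : R => expR (- y^-1)) (expR (- t^-1) * (- (- t ^- 2 *: 1))).
    by apply: (@is_derive1_comp _ expR (fun y => - y^-1)).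
  apply: (is_derive_eq (is_deriveM dX dE)).
  rewrite /flat t0 /GRing.scale/= !mulr1 opprK.
  case: k {dX} => [|k]; first by rewrite /= expr0 invr1 mul1r !mul0r oppr0 !mul0r mulr0 mulr0 add0r addr0 expr2 mulrC.
  rewrite [k.+1.-1]/=; have p0 : t ^+ k != 0 by rewrite expf_neq0.
  rewrite !exprS expr0 !mulr1; move: p0; move: (t ^+ k) (k.+1%:R : R) (expR _) => p c q p0.
  by field; rewrite p0 tn0.
- have c0 : (fun h : R => h^-1 *: ((flat k \o shift t) (h *: (1 : R)) - flat k t)) @ 0^' --> (0 : R).
    apply/cvgrPdist_le => e e0; near=> h.
    rewrite t0 /= addr0 /GRing.scale/= mulr1 sub0r normrN {2}/flat ltxx subr0 normrM normfV.
    have hn0 : h != 0 by near: h; exact: nbhs_dnbhs_neq.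
    rewrite ler_pdivrMl ?normr_gt0// ger0_norm ?flat_ge0//.
    (* At 0 the difference quotient is dominated by the next member of the family, which tends to 0
       by [flat_le]. *)
    have H : flat k h <= `|h| * flat k.+1 h.
      rewrite /flat; case: ifPn => [h0|]; last by rewrite mulr0.
      by rewrite gtr0_norm// exprS invfM mulrA mulrA divff// mul1r.
    apply: le_trans H _; rewrite ler_wpM2l//; apply: le_trans (flat_le _ _) _.
    rewrite mulrC -ler_pdivlMr ?ltr0n ?fact_gt0//.
    near: h; apply: dnbhs0_le; by rewrite divr_gt0// ltr0n fact_gt0.
  rewrite {1}t0 in c0.
  rewrite t0 {2 3}/flat !ltxx mulr0 addr0; constructor; rewrite ?/derivable ?/derive t0 in c0 *.
    exact: cvgP c0.
  by apply: cvg_lim c0.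
Unshelve. all: end_near. Qed.

(** * Test functions *)

Lemma Ck_flat (R : realType) d (L : pt R d -> R) (a b : R) k m :
  (forall x y, L (x + y) = L x + L y) -> (forall c x, L (c *: x) = c * L x) -> continuous L ->
  Ck k (fun x => flat m (a * L x + b)).
Proof.
move=> LD LZ cL.
have cf j : continuous (flat j : R -> R).
  by move=> t; apply/differentiable_continuous/derivable1_diffP; case: (flat_derive j t).
have cm j : continuous (fun x => flat j (a * L x + b)).
  move=> x; apply: (@continuous_comp _ _ _ (fun x => a * L x + b) (flat j)); last exact: cf.
  by apply: cvgD; [apply: cvgM; [exact: cvg_cst|exact: cL]|exact: cvg_cst].
have dm j e x : is_derive x e (fun x => flat j (a * L x + b))
    ((- j%:R * flat j.+1 (a * L x + b) + flat j.+2 (a * L x + b)) * (a * L e)).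
  apply/is_derive_line.
  have dl : is_derive (0 : R) (1 : R) (fun t : R => a * L (x + t *: e) + b) (a * L e).
    rewrite (_ : (fun t => _) = cst (a * L x + b) + (a * L e) *: id); last first.
      by apply/funext => t; rewrite LD LZ; transitivity (a * L x + b + (a * L e) * t); [ring|by []].
    apply: (is_derive_eq (is_deriveD (is_derive_cst _ _ _) (is_deriveZ _ (is_derive_id _ _)))).
    by rewrite add0r /GRing.scale/= mulr1.
  have df : is_derive (a * L (x + 0 *: e) + b) 1 (flat j : R -> R)
      (- j%:R * flat j.+1 (a * L x + b) + flat j.+2 (a * L x + b)).
    by rewrite scale0r addr0; exact: flat_derive.
  exact: (@is_derive1_comp _ (flat j) (fun t : R => a * L (x + t *: e) + b) 0 _ _ df dl).
elim: k m => [m|k IH m]; first exact: cm.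
split=> [|e]; first exact: cm.
split=> [x|]; first by case: (dm m e x).
rewrite (_ : (fun x => _) = fun x => (cst (- m%:R) x * flat m.+1 (a * L x + b) +
    flat m.+2 (a * L x + b)) * cst (a * L e) x); last first.
  by apply/funext => x; have [_ ->] := dm m e x.
by apply: CkM; [apply: CkD; [apply: CkM; [exact: Ck_cst|exact: IH]|exact: IH]|exact: Ck_cst].
Qed.

Definition obox (R : realType) d (lo hi : pt R d) : set (pt R d) :=
  [set x : pt R d | (forall i, lo.1 ord0 i < x.1 ord0 i < hi.1 ord0 i) /\ lo.2 < x.2 < hi.2].

Definition cbox (R : realType) d (lo hi : pt R d) : set (pt R d) :=
  [set x : pt R d | (forall i, lo.1 ord0 i <= x.1 ord0 i <= hi.1 ord0 i) /\ lo.2 <= x.2 <= hi.2].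

(** A smooth function that is positive exactly on []a, b[] and tends to 1 there as [k] grows;
    products of such functions approximate indicators of boxes. *)
Definition slope (R : realType) (k : nat) (a b t : R) : R :=
  flat 0 (k.+1%:R * t + - (k.+1%:R * a)) * flat 0 (- k.+1%:R * t + k.+1%:R * b).

Definition bump (R : realType) d (lo hi : pt R d) (k : nat) (x : pt R d) : R :=
  (\prod_(i < d.-1) slope k (lo.1 ord0 i) (hi.1 ord0 i) (x.1 ord0 i)) * slope k lo.2 hi.2 x.2.

Lemma flat0_gt0 (R : realType) (t : R) : (flat 0 t != 0) = (0 < t).
Proof.
by rewrite /flat; case: ifPn => [t0|_]; rewrite ?eqxx// expr0 invr1 mul1r lt0r_neq0// expR_gt0.
Qed.

Lemma flat0_le1 (R : realType) (t : R) : flat 0 t <= 1.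
Proof.
rewrite /flat; case: ifPn => // t0; rewrite expr0 invr1 mul1r -[leRHS]expR0 ler_expR.
by rewrite oppr_le0 invr_ge0 ltW.
Qed.

Lemma slope_neq0 (R : realType) k (a b t : R) : (slope k a b t != 0) = (a < t < b).
Proof.
have k0 : 0 < k.+1%:R :> R by [].
rewrite mulf_eq0 negb_or !flat0_gt0 -mulrN -mulrDr pmulr_rgt0// subr_gt0.
by rewrite mulNr addrC -mulrBr pmulr_rgt0// subr_gt0.
Qed.

Lemma slope_itv (R : realType) k (a b t : R) : 0 <= slope k a b t <= 1.
Proof.
by rewrite mulr_ge0 ?flat_ge0//= mulr_ile1 ?flat_ge0 ?flat0_le1.
Qed.

Lemma cvg_flat0_scaled (R : realType) (c : R) : 0 < c ->
  (fun k : nat => flat 0 (k.+1%:R * c)) @ \oo --> (1 : R).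
Proof.
move=> c0.
have -> : (fun k : nat => flat 0 (k.+1%:R * c)) = fun k : nat => expR (- (c^-1 * k.+1%:R^-1)).
  by apply/funext => k; rewrite /flat mulr_gt0// expr0 invr1 mul1r invfM mulrC.
have H : (fun k : nat => - (c^-1 * k.+1%:R^-1)) @ \oo --> - (c^-1 * 0 : R).
  by apply: cvgN; apply: cvgM; [exact: cvg_cst|exact: cvg_harmonic].
rewrite mulr0 oppr0 in H; rewrite -[X in _ --> X](@expR0 R).
exact: (continuous_cvg _ (@continuous_expR R 0) H).
Qed.

Lemma cvg_slope (R : realType) (a b t : R) : a < t < b -> (fun k => slope k a b t) @ \oo --> (1 : R).
Proof.
move=> /andP[at_ tb]; rewrite -[X in _ --> X](mulr1 1).
rewrite (_ : (fun k => _) = fun k => flat 0 (k.+1%:R * (t - a)) * flat 0 (k.+1%:R * (b - t))); last first.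
  by apply/funext => k; rewrite /slope -mulrN -mulrDr mulNr [- _ + _]addrC -mulrBr.
by apply: cvgM; apply: cvg_flat0_scaled; rewrite subr_gt0.
Qed.

Lemma Ck_prod (R : realType) d k (I : Type) (r : seq I) (F : I -> pt R d -> R) :
  (forall i, Ck k (F i)) -> Ck k (fun x => \prod_(i <- r) F i x).
Proof.
move=> CF; elim: r => [|i r IH].
  by rewrite (_ : (fun x => _) = cst 1); [exact: Ck_cst|apply/funext => x; rewrite big_nil].
rewrite (_ : (fun x => _) = fun x => F i x * \prod_(i <- r) F i x); first exact: CkM.
by apply/funext => x; rewrite big_cons.
Qed.

Lemma Ck_slope (R : realType) d k j (L : pt R d -> R) (a b : R) :
  (forall x y, L (x + y) = L x + L y) -> (forall c x, L (c *: x) = c * L x) -> continuous L ->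
  Ck k (fun x => slope j a b (L x)).
Proof. by move=> *; apply: CkM; exact: Ck_flat. Qed.

Lemma Ck_bump (R : realType) d (lo hi : pt R d) j k : Ck k (bump lo hi j).
Proof.
apply: CkM; last first.
  by apply: Ck_slope => // x; exact: cvg_snd.
apply: Ck_prod => i; apply: (@Ck_slope _ _ _ _ (fun x : pt R d => x.1 ord0 i)).
- by move=> x y /=; rewrite mxE.
- by move=> c x /=; rewrite mxE.
- move=> x; apply: (@continuous_comp _ _ _ (fun x : pt R d => x.1) (fun y : 'rV[R]_d.-1 => y ord0 i)).
    exact: cvg_fst.
  exact: coord_continuous.
Qed.

Lemma bump_neq0 (R : realType) d (lo hi : pt R d) k x : (bump lo hi k x != 0) <-> obox lo hi x.
Proof.
rewrite mulf_eq0 negb_or slope_neq0; split.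
  by move=> /andP[/prodf_neq0 h1 h2]; split => // i; have := h1 i isT; rewrite slope_neq0.
by move=> [h1 h2]; rewrite h2 andbT; apply/prodf_neq0 => i _; rewrite slope_neq0.
Qed.

Lemma bump_itv (R : realType) d (lo hi : pt R d) k x : 0 <= bump lo hi k x <= 1.
Proof.
have h i := slope_itv k (lo.1 ord0 i) (hi.1 ord0 i) (x.1 ord0 i).
have /andP[s0 s1] := slope_itv k lo.2 hi.2 x.2.
have p0 : 0 <= \prod_(i < d.-1) slope k (lo.1 ord0 i) (hi.1 ord0 i) (x.1 ord0 i).
  by apply: prodr_ge0 => i _; case/andP: (h i).
by rewrite mulr_ge0//= mulr_ile1//; apply: prodr_ile1.
Qed.

Lemma cvg_bump (R : realType) d (lo hi : pt R d) x : obox lo hi x ->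
  (fun k => bump lo hi k x) @ \oo --> (1 : R).
Proof.
move=> [h1 h2]; rewrite -[X in _ --> X](mulr1 1); apply: cvgM; last exact: cvg_slope.
rewrite -[X in _ --> X](_ : \prod_(i < d.-1) (1 : R) = 1); last by rewrite big1.
elim: (index_enum 'I_d.-1) => [|i r IH].
  by rewrite big_nil; under eq_fun do rewrite big_nil; exact: cvg_cst.
rewrite big_cons; under eq_fun do rewrite big_cons.
by apply: cvgM => //; exact: cvg_slope.
Qed.

Lemma closed_cbox (R : realType) d (lo hi : pt R d) : closed (cbox lo hi).
Proof.
have c2 (f : pt R d -> R) a b : continuous f -> closed [set x | a <= f x <= b].
  move=> cf; rewrite (_ : [set x | _] = f @^-1` `[a, b]%classic); last first.
    by apply/seteqP; split => x /=; rewrite in_itv.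
  by apply: closed_comp => [x _|]; [exact: cf|exact: itv_closed].
rewrite (_ : cbox lo hi = (\bigcap_(i in [set: 'I_d.-1]) [set x : pt R d | lo.1 ord0 i <= x.1 ord0 i <= hi.1 ord0 i])
   `&` [set x | lo.2 <= x.2 <= hi.2]).
  apply: closedI; last by apply: c2 => x; exact: cvg_snd.
  apply: closed_bigI => i _; apply: (c2 (fun x : pt R d => x.1 ord0 i)) => x.
  apply: (@continuous_comp _ _ _ (fun x : pt R d => x.1) (fun y : 'rV[R]_d.-1 => y ord0 i)).
    exact: cvg_fst.
  exact: coord_continuous.
by apply/seteqP; split => x [h1 h2]; split => // i; [move=> _; exact: h1|exact: h1 i I].
Qed.

Lemma measurable_obox (R : realType) d (lo hi : pt R d) : measurable (obox lo hi).
Proof.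
have c2 (f : pt R d -> R) a b : measurable_fun setT f -> measurable [set x | a < f x < b].
  move=> mf; rewrite (_ : [set x | _] = f @^-1` `]a, b[%classic); last first.
    by apply/seteqP; split => x /=; rewrite in_itv.
  by rewrite -[X in measurable X]setTI; exact: mf.
rewrite (_ : obox lo hi = (\bigcap_(i in [set: 'I_d.-1]) [set x : pt R d | lo.1 ord0 i < x.1 ord0 i < hi.1 ord0 i])
   `&` [set x | lo.2 < x.2 < hi.2]).
  apply: measurableI; last exact: c2.
  apply: fin_bigcap_measurable => // i _.
  apply: (c2 (fun x : pt R d => x.1 ord0 i)).
  exact: (measurableT_comp (measurable_rV_coord i) measurable_fst).
by apply/seteqP; split => x [h1 h2]; split => // i; [move=> _; exact: h1|exact: h1 i I].
Qed.

Lemma compact_cbox (R : realType) d (lo hi : pt R d) : compact (cbox lo hi).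
Proof.
pose M := `|lo.1| + `|hi.1|.
have cB : compact ([set x : 'rV[R]_d.-1 | `|x| <= M] `*` `[lo.2, hi.2]%classic).
  apply: compact_setX; last exact: segment_compact.
  apply: bounded_closed_compact.
    by exists M; split; [exact: num_real|move=> N MN x /= /le_trans; apply; exact: ltW].
  by apply: (@closed_comp _ _ (fun x : 'rV[R]_d.-1 => `|x|) [set y | y <= M]);
    [move=> x _; exact: norm_continuous|exact: closed_le].
apply: (subclosed_compact (@closed_cbox _ _ lo hi) cB) => x [h1 h2]; split; last by rewrite /= in_itv.
apply: rV_norm_le; first by rewrite addr_ge0.
move=> i; have /andP[l h] := h1 i.
have H1 := le_trans (ler_norm _) (coord_le_norm hi.1 i).
have H2 : - `|lo.1| <= lo.1 ord0 i.
  by rewrite lerNl; apply: le_trans (coord_le_norm lo.1 i); rewrite -normrN ler_norm.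
have n1 := normr_ge0 lo.1; have n2 := normr_ge0 hi.1.
by rewrite ler_norml /M; apply/andP; split; lra.
Qed.

Lemma obox_cbox (R : realType) d (lo hi : pt R d) : obox lo hi `<=` cbox lo hi.
Proof.
move=> x [h1 h2]; split => [i|]; first by have /andP[? ?] := h1 i; rewrite !ltW.
by have /andP[? ?] := h2; rewrite !ltW.
Qed.

Lemma bump_test (R : realType) d (D : set (pt R d)) (lo hi : pt R d) k :
  cbox lo hi `<=` D -> test_function D (bump lo hi k).
Proof.
move=> boxD.
have sub : closure [set x | bump lo hi k x != 0] `<=` cbox lo hi.
  rewrite [X in _ `<=` X](closure_id _).1; last exact: closed_cbox.
  by apply: closure_subset => x /bump_neq0; exact: obox_cbox.
split; [by move=> j; exact: Ck_bump| |exact: subset_trans sub boxD].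
exact: (subclosed_compact (@closed_closure _ _) (compact_cbox (lo := lo) (hi := hi)) sub).
Qed.

(** The inclusion of closed boxes matters: an intersection with an arbitrary box stays inside a
    domain that contains the second one. *)
Lemma oboxI_sub (R : realType) d (l1 h1 l2 h2 : pt R d) : exists l h,
  obox l1 h1 `&` obox l2 h2 = obox l h /\ cbox l h `<=` cbox l2 h2.
Proof.
exists (\row_i Num.max (l1.1 ord0 i) (l2.1 ord0 i), Num.max l1.2 l2.2).
exists (\row_i Num.min (h1.1 ord0 i) (h2.1 ord0 i), Num.min h1.2 h2.2).
split.
  apply/seteqP; split => x.
    move=> [[a1 a2] [b1 b2]]; split => [i|] /=; rewrite ?mxE gt_max lt_min.
      by have /andP[-> ->] := a1 i; have /andP[-> ->] := b1 i.
    by move: a2 b2 => /andP[-> ->] /andP[-> ->].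
  move=> [a1 a2]; split; split.
  - by move=> i; have := a1 i; rewrite !mxE gt_max lt_min => /andP[/andP[-> _] /andP[-> _]].
  - by move: a2; rewrite /= gt_max lt_min => /andP[/andP[-> _] /andP[-> _]].
  - by move=> i; have := a1 i; rewrite !mxE gt_max lt_min => /andP[/andP[_ ->] /andP[_ ->]].
  - by move: a2; rewrite /= gt_max lt_min => /andP[/andP[_ ->] /andP[_ ->]].
move=> x [a1 a2]; split.
  by move=> i; have := a1 i; rewrite !mxE ge_max le_min => /andP[/andP[_ ->] /andP[_ ->]].
by move: a2; rewrite /= ge_max le_min => /andP[/andP[_ ->] /andP[_ ->]].
Qed.

Lemma oboxI (R : realType) d : setI_closed [set B | exists lo hi : pt R d, B = obox lo hi].
Proof.
move=> _ _ [l1 [h1 ->]] [l2 [h2 ->]]; have [l [h [E _]]] := oboxI_sub l1 h1 l2 h2.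
by exists l, h.
Qed.

Lemma leb_obox_lty (R : realType) d (lo hi : pt R d) : (leb (obox lo hi) < +oo)%E.
Proof.
have cB : compact (cbox lo hi) by exact: compact_cbox.
apply: le_lt_trans (leb_compact_lty cB); apply: le_measure; rewrite ?inE.
- exact: measurable_obox.
- exact: compact_measurable_rVR.
- exact: obox_cbox.
Qed.

(** Open boxes are stable under intersection; that they also generate is what the Dynkin argument of
    [ae_eq0_obox] asks for. A coordinate half-space is the countable union of boxes whose remaining
    bounds are [-k] and [k]. *)
Lemma measurable_obox_gen (R : realType) d :
  @measurable _ (pt R d) = <<s [set B | exists lo hi : pt R d, B = obox lo hi] >>.
Proof.
set G := [set B | _]; apply/seteqP; split; last first.
  apply: smallest_sub; first exact: sigma_algebra_measurable.
  by move=> _ [lo [hi ->]]; exact: measurable_obox.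
have mid (f : pt R d -> R) : (forall a, <<s G >> [set x | a < f x]) ->
    measurable_fun [set: g_sigma_algebraType G] (f : g_sigma_algebraType G -> R).
  move=> H mT; apply: (measurability _ (RGenOInfty.measurableE R)) => //.
  move=> _ [_ [a ->] <-]; rewrite setTI.
  rewrite (_ : f @^-1` _ = [set x | a < f x]); first exact: H.
  by apply/seteqP; split => x /=; rewrite in_itv/= andbT.
have bnd (x : pt R d) : exists2 k : nat, (forall i, - k%:R < x.1 ord0 i < k%:R) & - k%:R < x.2 < k%:R.
  exists (Num.truncn `|x|).+1; last first.
    by rewrite -ltr_norml (le_lt_trans _ (truncnS_gt _))// prod_normE le_max lexx orbT.
  move=> i; rewrite -ltr_norml (le_lt_trans _ (truncnS_gt _))//.
  by rewrite prod_normE le_max coord_le_norm.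
have bigU (F : nat -> set (pt R d)) : (forall k, G (F k)) -> <<s G >> (\bigcup_k F k).
  by move=> GF; apply: sigma_algebra_bigcup => k; exact: sub_sigma_algebra.
have lt0S (k : nat) : - k.+1%:R < k.+1%:R :> R by rewrite gtrN.
have idm : measurable_fun [set: g_sigma_algebraType G] (id : g_sigma_algebraType G -> pt R d).
  apply/measurable_fun_pairP; split.
    apply: measurable_fun_rVP => i; apply: (mid (fun x : pt R d => x.1 ord0 i)) => a.
    rewrite (_ : [set x | _] = \bigcup_k obox
       ((\row_j (if j == i then a else - k%:R), - k%:R) : pt R d) (const_mx k%:R, k%:R)).
      by apply: bigU => k; eexists; eexists.
    apply/seteqP; split => x /=.
      move=> ax; have [k k1 k2] := bnd x; exists k => //; split => //= j; rewrite !mxE.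
      by have /andP[h1 h2] := k1 j; rewrite h2 andbT; case: eqP => [->|].
    by move=> [k _ [/(_ i)]]; rewrite !mxE eqxx => /andP[].
  apply: (mid (fun x : pt R d => x.2)) => a.
  rewrite (_ : [set x | _] = \bigcup_k obox
     ((const_mx (- k%:R), a) : pt R d) (const_mx k%:R, k%:R)).
    by apply: bigU => k; eexists; eexists.
  apply/seteqP; split => x /=.
    move=> ax; have [k k1 k2] := bnd x; exists k => //; split => //= [j|]; rewrite ?mxE//.
    by rewrite ax; case/andP: k2.
  by move=> [k _ [_ /andP[]]].
by move=> A mA; have := idm measurableT A mA; rewrite setTI.
Qed.

(** The bumps are test functions converging boundedly to the indicator of the box, so dominated
    convergence applies. *)
Lemma integral_obox_eq0 (R : realType) d (D : set (pt R d)) (r : pt R d -> R) lo hi :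
  L2 setT r -> (forall f, test_function D f -> ip r f = 0) -> cbox lo hi `<=` D ->
  (\int[leb]_(x in obox lo hi) (r x)%:E = 0)%E.
Proof.
move=> r2 ort boxD; have mr := L2_measurable r2.
have mB := measurable_obox lo hi.
have Bf : (leb (obox lo hi) < +oo)%E by exact: leb_obox_lty.
have ri : (@leb R d).-integrable (obox lo hi) (EFin \o r).
  by apply: L2_integrable => //; exact: L2S r2.
have [|||||_ _ H] := @dominated_convergence _ _ _ (@leb R d) (obox lo hi) mB
   (fun k x => (r x * bump lo hi k x)%:E) (fun x => (r x)%:E) (fun x => `|r x|%:E).
- move=> k; apply/measurable_EFinP; apply: measurable_funM; first exact: measurable_funTS.
  by apply: measurable_funTS; apply: continuous_measurable_rVR; exact: (Ck_continuous (Ck_bump lo hi k 0)).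
- by apply/measurable_EFinP; exact: measurable_funTS.
- apply: aeW => x Bx; apply/cvg_EFin; first exact: nearW.
  rewrite -[X in _ --> X]mulr1; apply: cvgM; first exact: cvg_cst.
  exact: cvg_bump.
- exact: (integrable_norm ri).
- apply: aeW => x k Bx; rewrite lee_fin normrM ler_piMr//.
  by have /andP[h1 h2] := bump_itv lo hi k x; rewrite ger0_norm.
rewrite -(cvg_lim _ H)//; rewrite (_ : (fun k => _) = cst 0%E); first by rewrite lim_cst.
apply/funext => k /=; have := ort _ (bump_test k boxD); rewrite /ip.
rewrite -(Rintegral_support (measurable_obox lo hi)) => [|x nx]; last first.
  case: (eqVneq (bump lo hi k x) 0) => [->|/bump_neq0//]; by rewrite mulr0.
have : (@leb R d).-integrable (obox lo hi) (EFin \o (fun x => r x * bump lo hi k x)).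
  apply: L2M_integrable => //; first exact: L2S r2.
  apply: (@bounded_L2 _ _ _ _ 1) => // [|x].
    by apply: measurable_funTS; apply: continuous_measurable_rVR; exact: (Ck_continuous (Ck_bump lo hi k 0)).
  by have /andP[h1 h2] := bump_itv lo hi k x; rewrite ger0_norm.
move=> /(integrable_fin_num mB) fin0 E; rewrite -[LHS]fineK//.
by rewrite [X in X%:E]E.
Qed.

(** The fundamental lemma of the calculus of variations: vanishing integrals over boxes extend to
    all measurable sets by Dynkin's theorem, in particular to the set where the function is
    positive. *)
Lemma ae_eq0_obox (R : realType) d (D : set (pt R d)) (r : pt R d -> R) lo hi :
  L2 setT r -> (forall f, test_function D f -> ip r f = 0) -> cbox lo hi `<=` D ->
  {ae leb, forall x, obox lo hi x -> r x = 0}.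
Proof.
move=> r2 ort boxD; have mr := L2_measurable r2.
have mB := measurable_obox lo hi.
have Bf : (leb (obox lo hi) < +oo)%E by exact: leb_obox_lty.
pose g := r \_ (obox lo hi).
have ri : (@leb R d).-integrable (obox lo hi) (EFin \o r).
  by apply: L2_integrable => //; exact: L2S r2.
have gi A : measurable A -> (@leb R d).-integrable A (EFin \o g).
  move=> mA; apply: (@integrableS _ _ _ _ setT) => //.
  by rewrite /g -restrict_EFin; apply/(integrable_mkcond _ mB).
have mg : measurable_fun setT g by apply/(measurable_restrictT r) => //; exact: measurable_funTS.
have gA A : measurable A -> (\int[leb]_(x in A) (g x)%:E = 0)%E.
  move=> mA; have mA' := mA; rewrite measurable_obox_gen in mA'.
  pose P A := (\int[leb]_(x in A) (g x)%:E = 0)%E.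
  suff : P A by [].
  have gT : P setT.
    rewrite /P -(integral_obox_eq0 r2 ort boxD) [RHS]integral_mkcond.
    by apply: eq_integral => x _; rewrite /g restrict_EFin.
  apply: (@dynkin_induction _ (pt R d) _ P (@measurable_obox_gen R d) (@oboxI R d)) => //; last 2 first.
  - move=> S mS PS; move: gT; rewrite /P -(setUv S) integral_setU_EFin//.
    + by rewrite PS add0e.
    + exact: measurableC.
    + exact: measurable_funTS.
    + by apply/disj_setPS; rewrite setICr.
  - move=> F mF tF PF; rewrite /P integral_bigcup//; last by apply: gi; exact: bigcupT_measurable.
    by apply: eseries0 => k _ _; exact: PF.
  move=> _ [l [h ->]]; rewrite /P.
  have -> : (\int[leb]_(x in obox l h) (g x)%:E = \int[leb]_(x in obox l h `&` obox lo hi) (r x)%:E)%E.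
    by rewrite [RHS]integral_mkcondr; apply: eq_integral => x _; rewrite /g restrict_EFin.
  have [l' [h' [-> sub]]] := oboxI_sub l h lo hi.
  by apply: integral_obox_eq0 r2 ort _; exact: subset_trans sub boxD.
pose A := [set x | 0 < g x].
have mA : measurable A.
  rewrite (_ : A = g @^-1` `]0, +oo[%classic); first by rewrite -[X in measurable X]setTI; exact: mg.
  by apply/seteqP; split => x /=; rewrite in_itv/= andbT.
have : (\int[leb]_(x in setT) `|(g x)%:E| = 0)%E.
  rewrite -(setUv A) ge0_integral_setU//=.
  - rewrite (_ : (\int[leb]_(x in A) `|(g x)%:E| = 0)%E); last first.
      rewrite -(gA A mA); apply: eq_integral => x; rewrite inE => Ax.
      by rewrite abse_EFin ger0_norm// ltW.
    rewrite add0e.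
    have mC := measurableC mA.
    rewrite -(mule0 (-1)%:E) -(gA _ mC) -(integralZl mC (gi _ mC)).
    apply: eq_integral => x; rewrite inE => Ax.
    by rewrite /= -EFinM mulN1r ler0_norm// leNgt; apply/negP.
  - exact: measurableC.
  - by rewrite setUv; apply/measurable_EFinP; exact: (measurableT_comp (@normr_measurable R setT) mg).
  - by apply/disj_setPS; rewrite setICr.
have mE : measurable_fun setT (fun x => (g x)%:E) by exact/measurable_EFinP.
move=> /(ae_eq_integral_abs _ measurableT mE); apply: filterS => x /(_ I) [gx] Bx.
by move: gx; rewrite /g patchE mem_set.
Qed.

Lemma ae_eq0_open (R : realType) d (D : set (pt R d)) (r : pt R d -> R) :
  open D -> L2 setT r -> (forall f, test_function D f -> ip r f = 0) ->
  {ae leb, forall x, D x -> r x = 0}.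
Proof.
move=> oD r2 ort.
pose I := ('rV[rat]_d.-1 * rat * nat)%type.
pose lo (q : I) : pt R d := (\row_i (ratr (q.1.1 ord0 i) - q.2.+1%:R^-1), ratr q.1.2 - q.2.+1%:R^-1).
pose hi (q : I) : pt R d := (\row_i (ratr (q.1.1 ord0 i) + q.2.+1%:R^-1), ratr q.1.2 + q.2.+1%:R^-1).
(* Enumeration of rational boxes; a box whose closure leaves [D], or a code that denotes no box,
   yields the empty set. *)
pose B (n : nat) : set (pt R d) := if unpickle n is Some q then
  [set x | obox (lo q) (hi q) x /\ cbox (lo q) (hi q) `<=` D] else set0.
have H n : {ae leb, forall x, B n x -> r x = 0}.
  rewrite /B; case: unpickle => [q|]; last by apply: aeW.
  have [sub|nsub] := pselect (cbox (lo q) (hi q) `<=` D); last by apply: aeW => x [].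
  by have := ae_eq0_obox r2 ort sub; apply: filterS => x h [/h].
have : {ae leb, forall x n, B n x -> r x = 0} by exact/ae_foralln.
apply: filterS => x h Dx.
have /nbhs_ballP[e /= e0 xeU] : nbhs x D by exact: open_nbhs_nbhs.
have [k ke] : exists k : nat, (k.+1%:R^-1 < e / 2 :> R).
  have [k _ /(_ k (leqnn k))] := near_infty_natSinv_lt (PosNum (divr_gt0 e0 (ltr0n _ 2))).
  by exists k.
have kp : 0 < k.+1%:R^-1 :> R by rewrite invr_gt0.
have /choice[q qx] : forall i, exists q : rat, `|x.1 ord0 i - ratr q| < k.+1%:R^-1.
  by move=> i; exact: ratr_approx.
have [t tx] := ratr_approx x.2 kp.
apply: (h (pickle ((\row_i q i, t, k) : I))); rewrite /B pickleK /=; split.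
  split => [i|] /=; rewrite ?mxE; [have := qx i|have := tx];
  by rewrite ltr_distl.
move=> y [y1 y2]; apply: xeU; split.
  split => // i j; rewrite (ord1 i) /ball /=.
  have := y1 j; rewrite !mxE -ler_distl => yq.
  rewrite (le_lt_trans (ler_distD (ratr (q j)) _ _))//.
  by rewrite [e]splitr ltrD ?(lt_trans (qx j))// distrC (le_lt_trans yq).
rewrite /ball /= (le_lt_trans (ler_distD (ratr t) _ _))//.
rewrite [e]splitr ltrD ?(lt_trans tx)//.
by rewrite distrC (le_lt_trans _ ke)// ler_distl.
Qed.

Lemma test_lin (R : realType) d (D : set (pt R d)) (a b : R) (f g : pt R d -> R) :
  test_function D f -> test_function D g -> test_function D (fun x => a * f x + b * g x).
Proof.
move=> [Cf cf fD] [Cg cg gD].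
have sub : closure [set x | a * f x + b * g x != 0] `<=`
    closure [set x | f x != 0] `|` closure [set x | g x != 0].
  rewrite -closureU; apply: closure_subset => x /=.
  have [->|fx] := eqVneq (f x) 0; last by left.
  have [->|gx] := eqVneq (g x) 0; last by right.
  by rewrite !mulr0 addr0 eqxx.
split.
- by move=> k; apply: CkD; (apply: CkM; [exact: Ck_cst|by []]).
- exact: (subclosed_compact (@closed_closure _ _) (compactU cf cg) sub).
- by move=> x /sub[/fD|/gD].
Qed.

Lemma test0 (R : realType) d (D : set (pt R d)) : test_function D (cst 0).
Proof.
have E : closure [set x : pt R d | cst (0 : R) x != 0] = set0.
  rewrite (_ : [set x | _] = set0) ?closure0//.
  by apply/seteqP; split => x //=; rewrite eqxx.
split; [by move=> k; exact: Ck_cst|by rewrite E; exact: compact0|by rewrite E].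
Qed.

Lemma test_continuous (R : realType) d (D : set (pt R d)) f : test_function D f -> continuous f.
Proof. by move=> [/(_ 0%N)]. Qed.

Lemma test_eq0 (R : realType) d (D : set (pt R d)) (f : pt R d -> R) x : test_function D f ->
  ~ closure [set x | f x != 0] x -> f x = 0.
Proof.
by move=> _ nx; apply/eqP; apply: contrapT => /negP fx; apply: nx; exact: subset_closure.
Qed.

Lemma continuous_compact_support_bounded (R : realType) d (K : set (pt R d)) (f : pt R d -> R) :
  compact K -> continuous f -> (forall x, ~ K x -> f x = 0) ->
  exists2 M : R, 0 <= M & forall x, `|f x| <= M.
Proof.
move=> cK cf f0.
have /compact_bounded[M [_ HM]] : compact (f @` K).
  by apply: continuous_compact => //; exact: continuous_subspaceT.
exists (Num.max (M + 1) 0) => [|x]; first by rewrite le_max lexx orbT.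
have [Kx|nKx] := pselect (K x); last by rewrite f0// normr0 le_max lexx orbT.
by rewrite le_max HM ?ltrDl//; exists x.
Qed.

Lemma test_bounded (R : realType) d (D : set (pt R d)) (f : pt R d -> R) :
  test_function D f -> exists2 M : R, 0 <= M & forall x, `|f x| <= M.
Proof.
move=> tf; have [_ cf _] := tf; apply: continuous_compact_support_bounded cf _ _.
  exact: test_continuous tf.
by move=> x; exact: test_eq0 tf.
Qed.

Lemma test_measurable (R : realType) d (D : set (pt R d)) (f : pt R d -> R) :
  test_function D f -> measurable_fun setT f.
Proof. by move=> tf; apply: continuous_measurable_rVR; exact: test_continuous tf. Qed.

Lemma continuous_compact_support_L2 (R : realType) d (K : set (pt R d)) (f : pt R d -> R) :
  compact K -> continuous f -> (forall x, ~ K x -> f x = 0) -> L2 setT f.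
Proof.
move=> cK cf f0; have [M M0 fM] := continuous_compact_support_bounded cK cf f0.
have mK := compact_measurable_rVR cK.
have mf : measurable_fun setT f by exact: continuous_measurable_rVR.
apply: (L2_setT_support mK mf f0); apply: (bounded_L2 mK) fM; first exact: leb_compact_lty.
exact: measurable_funTS.
Qed.

Lemma test_L2 (R : realType) d (D : set (pt R d)) (f : pt R d -> R) :
  test_function D f -> L2 setT f.
Proof.
move=> tf; have [_ cf _] := tf; apply: (continuous_compact_support_L2 cf).
  exact: test_continuous tf.
by move=> x; exact: test_eq0 tf.
Qed.

(** Riesz minimization for the functional [ip g] yields the projection [w] of [g] on the closure of
    the test functions. The remainder [g - w] is orthogonal to all of them, hence null in [D], and
    the minimizing sequence approximates [g]. *)
Lemma test_dense (R : realType) d (D : set (pt R d)) (g : pt R d -> R) (e : R) :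
  open D -> L2 setT g -> (forall x, ~ D x -> g x = 0) -> 0 < e ->
  exists2 f, test_function D f & ip (fun x => f x - g x) (fun x => f x - g x) < e.
Proof.
move=> oD g2 g0 e0.
have [] := @riesz_minimization R d (test_function D) (ip g) (ip g g) _ (@test0 R d D)
  (fun a b f g => @test_lin R d D a b f g).
- by move=> f; exact: test_L2.
- move=> a b f h tf th; have f2 := test_L2 tf; have h2 := test_L2 th.
  by rewrite ipC ip_lin// (ipC f) (ipC h).
- move=> f tf; have f2 := test_L2 tf; have := ip_ge0 (fun x => g x - f x).
  by rewrite nrm2B//; lra.
move=> w [w2 wP [f_ tf fw]].
have r2 := L2B measurableT g2 w2.
have rort f : test_function D f -> ip (fun x => g x - w x) f = 0.
  move=> tt; rewrite (_ : (fun x => _) = fun x => 1 * g x + (-1) * w x); last first.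
    by apply/funext => x; rewrite mul1r mulN1r.
  by rewrite ip_lin// ?wP//; [ring|exact: test_L2 tt].
have aeD := ae_eq0_open oD r2 rort.
have f_0 n x : ~ D x -> f_ n x = 0.
  move=> nx; apply: test_eq0 (tf n) _; have [_ _ sub] := tf n; by move=> /sub.
have [n] : exists n : nat, 4 * 16^-1 ^+ n < e.
  have H : (fun n : nat => 4 * (16^-1 : R) ^+ n) @ \oo --> (4 * 0 : R).
    apply: cvgM; first exact: cvg_cst.
    by apply: cvg_expr; rewrite ger0_norm ?invr_ge0// invf_lt1// ltr1n.
  rewrite mulr0 in H; have /cvgrPdist_lt /(_ e e0) [n _ /(_ n (leqnn n))] := H.
  by rewrite sub0r normrN ger0_norm => [?|]; [exists n|rewrite mulr_ge0// exprn_ge0// invr_ge0].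
move=> ne; exists (f_ n) => //; apply: le_lt_trans (le_trans _ (fw n)) ne.
have f2 := test_L2 (tf n).
rewrite -lee_fin -!ipE; try exact: L2B.
rewrite (@ge0_ae_eq_integral _ _ _ _ _ _ (fun x => (\1_D x * (f_ n x - w x) ^+ 2)%:E))//.
- apply: ge0_le_integral => //.
  + by move=> x _; rewrite lee_fin mulr_ge0 ?sqr_ge0.
  + apply/measurable_EFinP; apply: measurable_funM; first by apply: measurable_indicT; exact: open_measurable_rVR.
    by apply: measurable_funX; exact: (L2_measurable (L2B measurableT f2 w2)).
  + by apply/measurable_EFinP; apply: measurable_funX; exact: (L2_measurable (L2B measurableT f2 w2)).
  + by move=> x _; rewrite lee_fin ler_piMl ?sqr_ge0// indicE; case: (x \in D).
- by apply/measurable_EFinP; apply: measurable_funX; exact: (L2_measurable (L2B measurableT f2 g2)).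
- apply/measurable_EFinP; apply: measurable_funM; first by apply: measurable_indicT; exact: open_measurable_rVR.
  by apply: measurable_funX; exact: (L2_measurable (L2B measurableT f2 w2)).
- by move=> x _; rewrite lee_fin sqr_ge0.
- by move=> x _; rewrite lee_fin mulr_ge0 ?sqr_ge0.
- apply: filterS aeD => x Dx _; rewrite indicE.
  case: (boolP (x \in D)) => [|/negP]; rewrite inE => xD.
    by have /eqP := Dx xD; rewrite subr_eq0 => /eqP ->; rewrite mul1r.
  by rewrite mul0r f_0// g0// subrr expr0n.
Qed.

(** [2 <g, f> - |f|^2 = |g|^2 - |f - g|^2], so density is all that is needed. *)
Lemma dual_attained (R : realType) d (D : set (pt R d)) (g : pt R d -> R) (a : R) :
  open D -> L2 setT g -> (forall x, ~ D x -> g x = 0) -> a < ip g g ->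
  exists2 f, test_function D f & a < 2 * ip g f - ip f f.
Proof.
move=> oD g2 g0 ag; have e0 : 0 < ip g g - a by rewrite subr_gt0.
have [f tf] := test_dense oD g2 g0 e0; have f2 := test_L2 tf.
by rewrite nrm2B// => H; exists f => //; rewrite ipC; lra.
Qed.

(** * Lower bound *)

Lemma corr_nrm2 (R : realType) d (D : set (pt R d)) (v : pt R d -> R) z : measurable D -> L2 D v ->
  let g := fun y => \1_D y * \1_D (y + z) * (v (y + z) - v y) in
  L2 setT g /\ corr D v z = (ip g g)%:E.
Proof.
move=> mD v2 g; pose w := v \_ D; have w2 : L2 setT w by exact: L2_restrict.
pose h y := w (y + z) - w y.
have h2 : L2 setT h by apply: L2B => //; exact: L2_translate.
have gE y : g y = \1_D y * \1_D (y + z) * h y.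
  rewrite /g /h /w !patchE !indicE.
  by case: (y \in D); case: (y + z \in D); rewrite ?mul0r ?mulr0 ?mul0r.
have mi : measurable_fun setT (fun y : pt R d => \1_D y * \1_D (y + z) : R).
  apply: measurable_funM; first exact: measurable_indicT.
  by apply: (measurableT_comp (measurable_indicT mD)); exact: measurable_ptDr.
have mg : measurable_fun setT g.
  rewrite (_ : g = fun y => \1_D y * \1_D (y + z) * h y); last by apply/funext.
  by apply: measurable_funM => //; exact: L2_measurable h2.
have gh y : g y ^+ 2 <= h y ^+ 2.
  rewrite gE exprMn; apply: ler_piMl; rewrite ?sqr_ge0// !indicE.
have g2 : L2 setT g.
  split => //; have [mh hf] := h2; apply: le_lt_trans hf.
  apply: ge0_le_integral => //.
  - by move=> x _; rewrite lee_fin sqr_ge0.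
  - by apply/measurable_EFinP; exact: measurable_funX.
  - by apply/measurable_EFinP; exact: measurable_funX.
  - by move=> x _; rewrite lee_fin.
split; first exact: g2.
rewrite -(ipE g2); apply: eq_integral => y _; congr EFin.
rewrite /g exprMn; congr (_ * _); rewrite !indicE.
by case: (y \in D); case: (y + z \in D); rewrite ?mulr0 ?mul0r ?mulr1 ?expr1n ?expr0n.
Qed.

Lemma cvg_norm_near (R : realType) (V : normedModType R) (z_ : nat -> V) (z : V) (e : R) :
  z_ @ \oo --> z -> 0 < e -> \forall j \near \oo, `|z_ j - z| < e.
Proof.
by move=> /cvgrPdist_lt zz e0; have := zz _ e0; apply: filterS => j; rewrite distrC.
Qed.

(** Test functions are taken in the open set [U] of points with both ends in [D]; this is where the
    increment of [v] lives. *)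
Lemma corr_lsc (R : realType) d (D : set (pt R d)) (v_ : nat -> pt R d -> R) v
    (z_ : nat -> pt R d) z :
  open D -> weak_L2loc D v_ v -> (forall j, L2 D (v_ j)) -> L2 D v -> z_ @ \oo --> z ->
  (corr D v z <= limn_einf (fun j => corr D (v_ j) (z_ j)))%E.
Proof.
move=> oD wv v_2 v2 zz; have mD : measurable D by exact: open_measurable_rVR.
have [g2 cE] := corr_nrm2 z mD v2.
move: g2 cE; set g := (fun y => _) => g2 cE.
pose U := [set y | D y /\ D (y + z)].
have oU : open U.
  apply: openI => //; apply: open_comp => // x _.
  by apply: cvgD; [exact: cvg_id|exact: cvg_cst].
have g0 x : ~ U x -> g x = 0.
  move=> nU; rewrite /g !indicE; case: (boolP (x \in D)) => [|_]; rewrite ?mul0r//.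
  rewrite inE => xD; case: (boolP (x + z \in D)) => [|_]; rewrite ?mulr0 ?mul0r//.
  by rewrite inE => xzD; case: nU.
apply: limn_einf_geP => a; rewrite cE lte_fin => ag.
have [phi tphi] := dual_attained oU g2 g0 ag.
have [_ cS SU] := tphi; set S := closure _ in cS SU.
have phi0 x : ~ S x -> phi x = 0 by move=> nS; exact: test_eq0 tphi nS.
have cphi := test_continuous tphi; have mphi := test_measurable tphi.
have [M M0 phiM] := test_bounded tphi; have phi2 := test_L2 tphi.
have phiS x : phi x != 0 -> S x.
  by move=> px; apply: contrapT => nS; rewrite phi0// eqxx in px.
(* After the shift has moved to [phi], the pairing involves [phi] and its translate by [z], so both
   supports must fit into one compact. *)
pose S' := S `|` ((fun y => y + z) @` S).
have cS' : compact S'.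
  apply: compactU => //; apply: continuous_compact => //.
  by apply: continuous_subspaceT => x; apply: cvgD; [exact: cvg_id|exact: cvg_cst].
have S'D : S' `<=` D.
  by move=> x [/SU[]//|[y /SU[_ yD] <-]].
have [r [K [r0 cK KD S'K KP]]] := compact_thicken cS' oD S'D.
pose psi x := phi (x - z) - phi x.
have psiK x : ~ K x -> psi x = 0.
  move=> nK; rewrite /psi (phi0 x) => [|Sx]; last by apply: nK; apply: S'K; left.
  rewrite phi0 ?subr0// => Sx; apply: nK; apply: S'K; right; exists (x - z) => //.
  by rewrite subrK.
have mpsi : measurable_fun setT psi.
  apply: measurable_funB => //; apply: (measurableT_comp mphi).
  exact: measurable_ptDr.
move=> ag2.
have := @corr_dual_liminf R d D K v_ v phi psi z_ (fun=> 1) a mD cK KD wv v_2 v2 mphi.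
move=> /(_ _ mpsi) H.
have {H} := H (ex_intro _ M phiM).
under [X in _ -> _ -> _ -> _ -> _ -> X]eq_near => j do rewrite expr1n invr1 mule1.
apply => //.
- exists (M + M) => x; rewrite (le_trans (ler_normB _ _))// lerD//.
- have : \forall j \near \oo, `|z_ j - z| < r by exact: cvg_norm_near.
  apply: filterS => j zj x px; split; first by apply: S'K; left; exact: phiS.
  rewrite (_ : x + z_ j = (x + z) + (z_ j - z)); last by rewrite -addrA [z + _]addrC subrK.
  by apply: KP => //; right; exists x => //; exact: phiS.
- move=> e e0; have [r' r'0 rP] := compact_support_unif cS cphi phi0 e0.
  have : \forall j \near \oo, `|z_ j - z| < r' by exact: cvg_norm_near.
  apply: filterS => j zj x; rewrite divr1 /psi opprB addrA subrK.
  rewrite (_ : x - z_ j = (x - z) + (z - z_ j)); last by rewrite addrA subrK.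
  by apply: rP; rewrite distrC.
have -> : \int[leb]_(x in K) (v x * psi x) = ip g phi.
  pose w := v \_ D; have w2 : L2 setT w by exact: L2_restrict.
  have mK : measurable K by exact: compact_measurable_rVR.
  have -> : \int[leb]_(x in K) (v x * psi x) = \int[leb]_x (w x * psi x).
    rewrite -(Rintegral_support mK); last by move=> x /psiK ->; rewrite mulr0.
    apply: eq_Rintegral => x; rewrite inE => Kx.
    by rewrite /w patchE mem_set//; exact: KD.
  have phiz2 : L2 setT (fun x => phi (x - z)) by exact: L2_translate.
  under eq_Rintegral do rewrite /psi mulrBr.
  rewrite RintegralB//; try exact: L2M_integrable.
  have mw := L2_measurable w2.
  rewrite -(@Rleb_translate _ _ (fun x => w x * phi (x - z)) z); last first.
    by apply: measurable_funM => //; exact: L2_measurable phiz2.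
  under eq_Rintegral do rewrite addrK.
  have wz2 : L2 setT (fun x => w (x + z)) by exact: L2_translate.
  rewrite -RintegralB//; try exact: L2M_integrable.
  apply: eq_Rintegral => x _; rewrite -mulrBl.
  have [->|px] := eqVneq (phi x) 0; first by rewrite !mulr0.
  have [Dx Dxz] := SU _ (phiS _ px).
  by rewrite /w /g !patchE !indicE !mem_set// !mul1r.
by rewrite (_ : \int[leb]_x phi x ^+ 2 = ip phi phi)//; apply: eq_Rintegral => x _; rewrite expr2.
Qed.

Lemma open_cylinder (R : realType) d (omega : set 'rV[R]_d.-1) (h : R) : open omega ->
  open (@cylinder R d omega h).
Proof.
move=> oo; apply: openI.
  by apply: open_comp => // x _; exact: cvg_fst.
by apply: open_comp => [x _|]; [exact: cvg_snd|exact: itv_open].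
Qed.

Lemma measurable_fun_limn_einf d (T : measurableType d) (R : realType) (D : set T)
    (f : nat -> T -> \bar R) : (forall n, measurable_fun D (f n)) ->
  measurable_fun D (fun x => limn_einf (f^~ x)).
Proof.
move=> mf; rewrite (_ : (fun x => _) = fun x => (- limn_esup (fun n => - f n x))%E).
  by apply: measurableT_comp => //; apply: measurable_fun_limn_esup => n; exact: measurableT_comp.
apply/funext => x; rewrite -limn_einfN; congr limn_einf.
by apply/funext => n /=; rewrite oppeK.
Qed.

(** The bound [c] may be infinite. If [a = 0] the left-hand side is 0, also for infinite [c], so
    positivity of the product may be assumed. *)
Lemma limn_einfM_ge (R : realType) (a_ : nat -> R) (a : R) (x_ : nat -> \bar R) (c : \bar R) :
  (forall j, 0 <= a_ j) -> (forall j, 0 <= x_ j)%E -> a_ @ \oo --> a ->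
  (0 <= c)%E -> (c <= limn_einf x_)%E ->
  (a%:E * c <= limn_einf (fun j => (a_ j)%:E * x_ j))%E.
Proof.
move=> a0 x0 aa c0 cx; apply: limn_einf_geP => b bac.
have p0 j : (0 <= (a_ j)%:E * x_ j)%E by rewrite mule_ge0 ?lee_fin.
have [b0|b0] := leP b 0.
  by apply: nearW => j; apply: le_trans (p0 j); rewrite lee_fin.
have age0 : 0 <= a.
  by rewrite -(cvg_lim _ aa)//; apply: limr_ge; [exact: cvgP aa|exact: nearW].
have agt0 : 0 < a.
  rewrite lt_neqAle age0 andbT eq_sym; apply/eqP => a00; move: bac.
  by rewrite a00 mul0e lte_fin ltNge (ltW b0).
have bac' : ((b / a)%:E < c)%E.
  by rewrite EFinM muleC; move: bac; rewrite lte_pdivrMl.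
have [c' bc' c'c] : exists2 c' : R, b / a < c' & (c'%:E < c)%E.
  move: bac' {cx bac c0}; case: c => [c||//]; rewrite ?lte_fin => H.
    by exists ((b / a + c) / 2); rewrite ?lte_fin midf_lt.
  by exists (b / a + 1); rewrite ?ltrDl ?ltry.
have c'0 : 0 < c' by apply: lt_trans bc'; rewrite divr_gt0.
have H1 : \forall j \near \oo, b / c' < a_ j.
  by apply: cvgr_gt aa _ _; rewrite ltr_pdivrMr// mulrC -ltr_pdivrMr.
have H2 : \forall j \near \oo, (c'%:E < x_ j)%E.
  by apply: limn_einf_gt_near; exact: lt_le_trans c'c cx.
near=> j.
have h1 : b / c' < a_ j by near: j.
have h2 : (c'%:E < x_ j)%E by near: j.
rewrite -(divfK (lt0r_neq0 c'0) b) EFinM lee_pmul//; try exact: ltW.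
- by rewrite lee_fin divr_ge0// ltW.
Unshelve. all: end_near. Qed.

Lemma cvg_powR_exponent (R : realType) (T : Type) (F : set_system T) (FF : Filter F) (x p : R) (p_ : T -> R) :
  0 < x -> p_ @ F --> p -> (fun j => x `^ (p_ j)) @ F --> x `^ p.
Proof.
move=> x0 pp; rewrite /powR (gt_eqF x0).
apply: continuous_cvg; first exact: continuous_expR.
by apply: cvgM => //; exact: cvg_cst.
Qed.

Lemma cvg_wt (R : realType) d (s_ : nat -> R) (s : R) (xi : 'rV[R]_d.-1) :
  s_ @ \oo --> s -> (fun j => wt (s_ j) xi) @ \oo --> wt s xi.
Proof.
move=> ss; apply: cvg_powR_exponent; first by rewrite ltr_pwDl// dotp_ge0.
by apply: cvgB => //; exact: cvg_cst.
Qed.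

Lemma wt_fatou (R : realType) d (s_ : nat -> R) (s : R) (F : nat -> 'rV[R]_d.-1 -> \bar R) (c : \bar R) :
  s_ @ \oo --> s -> (forall j, measurable_fun setT (F j)) -> (forall j xi, 0 <= F j xi)%E ->
  (0 <= c)%E -> (forall xi, c <= limn_einf (fun j => F j xi))%E ->
  (@Csd R d s * c <= limn_einf (fun j => \int[lebesgue_rV d.-1]_xi ((wt (s_ j) xi)%:E * F j xi)))%E.
Proof.
move=> ss mF F0 c0 cF.
have mW j : measurable_fun setT (fun xi => (wt (s_ j) xi)%:E * F j xi)%E.
  by apply: emeasurable_funM => //; apply/measurable_EFinP; exact: measurable_wt.
have W0 j xi : setT xi -> (0 <= (wt (s_ j) xi)%:E * F j xi)%E by rewrite mule_ge0 ?lee_fin ?wt_ge0.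
apply: le_trans (fatou (lebesgue_rV d.-1) measurableT mW W0).
rewrite CsdE -ge0_integralZr//.
- apply: ge0_le_integral => //.
  + by move=> xi _; rewrite mule_ge0// lee_fin wt_ge0.
  + by apply: emeasurable_funM => //; apply/measurable_EFinP; exact: measurable_wt.
  + exact: measurable_fun_limn_einf.
  + move=> xi _; apply: limn_einfM_ge => // [j|]; [exact: wt_ge0|exact: cvg_wt].
- by apply/measurable_EFinP; exact: measurable_wt.
- by move=> xi _; rewrite lee_fin wt_ge0.
Qed.

(** The share of the vertical increment [h] in the energy, without the power of [|h|]; for [s0 = 1]
    it is to be compared with [h ^+ 2]. *)
Definition slice (R : realType) d (s eps : R) (omega : set 'rV[R]_d.-1) (v : pt R d -> R) (h : R) : \bar R :=
  (\int[lebesgue_rV d.-1]_xi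
    ((wt s xi)%:E * corr (cylinder omega 1) v ((eps * `|h|) *: xi, h)%R))%E.

Lemma measurable_corr_slice (R : realType) d (eps : R) (omega : set 'rV[R]_d.-1) (v : pt R d -> R) :
  measurable omega -> measurable_fun (cylinder omega 1) v ->
  measurable_fun setT (fun p : R * 'rV[R]_d.-1 =>
    corr (cylinder omega 1) v ((eps * `|p.1|) *: p.2, p.1)).
Proof.
move=> mo mv; have mD := @measurable_cylinder R d omega 1 mo.
pose w := v \_ (cylinder omega 1).
have mw : measurable_fun setT w by apply/(measurable_restrictT v).
have mc : measurable_fun setT (corr (cylinder omega 1) v).
  apply: (eq_measurable_fun (corr (cylinder omega 1) w)); last exact: measurable_corr.
  by move=> z _; apply: corr_congr => x Dx; rewrite /w patchE mem_set.
apply: (measurableT_comp mc); apply: measurable_fun_pair; last exact: measurable_fst.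
apply: measurable_fun_rVP => i /=; under eq_fun do rewrite mxE.
apply: measurable_funM; last exact: (measurableT_comp (measurable_rV_coord i)).
by apply: measurable_funM => //; apply: (measurableT_comp (@normr_measurable R setT)); exact: measurable_fst.
Qed.

Lemma slice_ge0 (R : realType) d (s eps : R) (omega : set 'rV[R]_d.-1) (v : pt R d -> R) (h : R) :
  (0 <= slice s eps omega v h)%E.
Proof. by apply: integral_ge0 => xi _; rewrite mule_ge0 ?corr_ge0// lee_fin wt_ge0. Qed.

Lemma measurable_slice (R : realType) d (s eps : R) (omega : set 'rV[R]_d.-1) (v : pt R d -> R) :
  measurable omega -> measurable_fun (cylinder omega 1) v ->
  measurable_fun setT (slice s eps omega v).
Proof.
move=> mo mv; apply: measurable_int_snd => [|h xi]; last first.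
  by rewrite mule_ge0 ?corr_ge0// lee_fin wt_ge0.
apply: emeasurable_funM; last exact: measurable_corr_slice.
by apply/measurable_EFinP; apply: (measurableT_comp (@measurable_wt _ _ _)).
Qed.

Lemma measurable_scaled (R : realType) d (omega : set 'rV[R]_d.-1) (eps : R) (u : pt R d -> R) :
  0 < eps -> measurable omega -> measurable_fun (cylinder omega eps) u ->
  measurable_fun (cylinder omega 1) (scaled eps u).
Proof.
move=> e0 mo mu.
have mD := @measurable_cylinder R d omega eps mo.
pose w := u \_ (cylinder omega eps); have mw : measurable_fun setT w by apply/(measurable_restrictT u).
have ms : measurable_fun setT (scaled eps w).
  apply: (measurableT_comp mw); apply: measurable_fun_pair; first exact: measurable_fst.
  by apply: measurable_funM.
apply: (eq_measurable_fun (scaled eps w)); last exact: measurable_funTS.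
move=> x; rewrite inE => -[x1 x2]; rewrite /scaled /w patchE mem_set//; split => //=.
move: x2; rewrite /= !in_itv/= => /andP[x0 x1']; rewrite mulr_gt0//=.
by rewrite -[ltRHS]mulr1 ltr_pM2l.
Qed.

Lemma scaled_L2 (R : realType) d (omega : set 'rV[R]_d.-1) (eps : R) (u : pt R d -> R) :
  0 < eps -> measurable omega -> L2 (cylinder omega eps) u -> L2 (cylinder omega 1) (scaled eps u).
Proof.
move=> e0 mo [mu u2]; split; first exact: measurable_scaled.
have mD := @measurable_cylinder R d omega eps mo.
pose w := u \_ (cylinder omega eps); have mw : measurable_fun setT w by apply/(measurable_restrictT u).
pose f (x : pt R d) := ((w x) ^+ 2)%:E.
have mf : measurable_fun setT f by apply/measurable_EFinP; exact: measurable_funX.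
have f0 x : (0 <= f x)%E by rewrite lee_fin sqr_ge0.
have H := leb_affine 0 0 ltr01 e0 mf f0.
have fin : (\int[leb]_x f (1 *: x.1 + 0, eps * x.2 + 0)%R < +oo)%E.
  rewrite H; apply: lte_mul_pinfty => //.
    by rewrite lee_fin mulr_ge0// ?invr_ge0 ?exprn_ge0// ltW.
  apply: le_lt_trans u2; rewrite [leRHS]integral_mkcond le_eqVlt; apply/orP; left; apply/eqP.
  by apply: eq_integral => x _; rewrite /f /w !patchE; case: ifP => //; rewrite expr0n.
apply: le_lt_trans fin; rewrite integral_mkcond; apply: ge0_le_integral => //.
- by move=> x _; rewrite patchE; case: ifP => //; rewrite lee_fin sqr_ge0.
- apply/(measurable_restrictT (fun x => (scaled eps u x ^+ 2)%:E)); first exact: measurable_cylinder.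
  by apply/measurable_EFinP; apply: measurable_funX; exact: measurable_scaled.
- apply: (measurableT_comp mf); apply/measurable_fun_pairP; split => /=.
    exact: (measurableT_comp (measurable_rV_affine 1 0) measurable_fst).
  by apply: measurable_funD => //; exact: measurable_funM.
- move=> x _; rewrite patchE; case: ifPn => [|_]; last exact: f0.
  rewrite inE => -[x1 x2]; rewrite /f /w scale1r !addr0 patchE mem_set//; split => //=.
  move: x2; rewrite /= !in_itv/= => /andP[x0 x1']; rewrite mulr_gt0//=.
  by rewrite -[ltRHS]mulr1 ltr_pM2l.
Qed.

Lemma energy_slice (R : realType) d (s : R -> R) (omega : set 'rV[R]_d.-1) (eps : R)
    (u : pt R d -> R) : (1 < d)%N -> 0 < eps -> 0 < s eps -> measurable omega ->
  measurable_fun (cylinder omega eps) u ->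
  (energy s omega eps u = \int[lebR]_h
    ((`|h| `^ (- 1 - 2 * s eps))%:E * slice (s eps) eps omega (scaled eps u) h))%E.
Proof.
move=> d1 e0 s0 mo mu; rewrite energy_corr//; apply: eq_integral => h _.
rewrite /slice -ge0_integralZT; last 3 first.
- apply: emeasurable_funM; first by apply/measurable_EFinP; exact: measurable_wt.
  exact: (measurableT_comp (measurable_corr_slice eps mo (measurable_scaled e0 mo mu)) (measurable_pair1 h)).
- by move=> xi; rewrite mule_ge0 ?corr_ge0// lee_fin wt_ge0.
- exact: powR_ge0.
by apply: eq_integral => xi _; rewrite muleA EFinM.
Qed.

Lemma cvg_slice_arg (R : realType) d (e_ h_ : nat -> R) (h : R) (xi : 'rV[R]_d.-1) :
  e_ @ \oo --> 0 -> h_ @ \oo --> h ->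
  (fun j => ((e_ j * `|h_ j|) *: xi, h_ j) : pt R d) @ \oo --> ((0, h) : pt R d).
Proof.
move=> e0 hh.
have H : (fun j => (e_ j * `|h_ j|) *: xi) @ \oo --> (0 : 'rV[R]_d.-1).
  rewrite -[X in _ --> X](scale0r xi); apply: cvgZ; last exact: cvg_cst.
  by rewrite -[X in _ --> X](mul0r `|h|); apply: cvgM => //; exact: cvg_norm.
exact: (cvg_pair H hh).
Qed.

(** Fatou's lemma is applied twice, in [h] here and in [xi] inside [wt_fatou], to correlations along
    [(eps_j |h| xi, h)], whose limit [(0, h)] no longer depends on [xi]. *)
Lemma liminf_lt1 (R : realType) d (omega : set 'rV[R]_d.-1) (s : R -> R) (s0 : R) (eps : nat -> R)
    (u : nat -> pt R d -> R) (v : pt R d -> R) :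
  (1 < d)%N -> open omega -> 0 <= s0 -> (forall e, 0 < e -> 0 < s e < 1) ->
  (forall j, 0 < eps j) -> eps @ \oo --> 0 -> (fun j => s (eps j)) @ \oo --> s0 ->
  (forall j, L2 (cylinder omega (eps j)) (u j)) -> L2 (cylinder omega 1) v ->
  weak_L2loc (cylinder omega 1) (fun j => scaled (eps j) (u j)) v ->
  (limit_lt1 s0 omega v <= limn_einf (fun j => energy s omega (eps j) (u j)))%E.
Proof.
move=> d1 oo s00 s01 eps0 epsc sc u2 v2 wv.
have mo : measurable omega by exact: open_measurable_rV.
have oD : open (@cylinder R d omega 1) by exact: open_cylinder.
have sv2 j : L2 (cylinder omega 1) (scaled (eps j) (u j)) by exact: scaled_L2.
rewrite limit_lt1_corr//; last exact: L2_measurable v2.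
have sp j : 0 < s (eps j) by have /andP[] := s01 _ (eps0 j).
have -> : (fun j => energy s omega (eps j) (u j)) = fun j => (\int[lebR]_h
    ((`|h| `^ (- 1 - 2 * s (eps j)))%:E * slice (s (eps j)) (eps j) omega (scaled (eps j) (u j)) h))%E.
  by apply/funext => j; rewrite energy_slice//; exact: L2_measurable (u2 j).
have mI j : measurable_fun setT (fun h : R => ((`|h| `^ (- 1 - 2 * s (eps j)))%:E *
    slice (s (eps j)) (eps j) omega (scaled (eps j) (u j)) h)%E).
  apply: emeasurable_funM; last by apply: measurable_slice => //; exact: L2_measurable (sv2 j).
  by apply/measurable_EFinP; apply: measurable_powR_fun; exact: normr_measurable.
have I0 j h : setT h -> (0 <= (`|h| `^ (- 1 - 2 * s (eps j)))%:E *
    slice (s (eps j)) (eps j) omega (scaled (eps j) (u j)) h)%E.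
  by move=> _; rewrite mule_ge0 ?slice_ge0// lee_fin powR_ge0.
apply: le_trans (fatou (@lebR R) measurableT mI I0).
have C0 : (0 <= @Csd R d s0)%E by rewrite CsdE; apply: integral_ge0 => xi _; rewrite lee_fin wt_ge0.
have mv : measurable_fun setT (fun h : R => corr (cylinder omega 1) v (0, h)).
  have := measurable_corr_slice 0 mo (L2_measurable v2).
  move=> /(fun mf => measurableT_comp mf (measurable_pair2 (0 : 'rV[R]_d.-1))).
  by apply: eq_measurable_fun => h _ /=; rewrite mul0r scale0r.
rewrite -ge0_integralZl//; last 2 first.
- apply: emeasurable_funM => //.
  by apply/measurable_EFinP; apply: measurable_powR_fun; exact: normr_measurable.
- by move=> h _; rewrite mule_ge0 ?corr_ge0// lee_fin powR_ge0.
apply: ge0_le_integral => //.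
- by move=> h _; rewrite !mule_ge0 ?corr_ge0// lee_fin powR_ge0.
- apply: measurable_funeM; apply: emeasurable_funM => //.
  by apply/measurable_EFinP; apply: measurable_powR_fun; exact: normr_measurable.
- exact: measurable_fun_limn_einf.
move=> h _; rewrite muleCA; apply: limn_einfM_ge.
- by move=> j; exact: powR_ge0.
- by move=> j; exact: slice_ge0.
- have [->|h0] := eqVneq h 0.
    rewrite normr0 powR0; last by rewrite lt_eqF// subr_lt0 (lt_le_trans (ltrN10 R))// mulr_ge0.
    rewrite (_ : (fun j => _) = cst 0); first exact: cvg_cst.
    by apply/funext => j; rewrite powR0// lt_eqF// subr_lt0 (lt_trans (ltrN10 R))// mulr_gt0.
  apply: cvg_powR_exponent; first by rewrite normr_gt0.
  by apply: cvgB; [exact: cvg_cst|apply: cvgM => //; exact: cvg_cst].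
- by rewrite mule_ge0 ?corr_ge0.
- apply: wt_fatou => //; last 2 first.
  + exact: corr_ge0.
  + move=> xi; apply: corr_lsc => //.
    by apply: (@cvg_slice_arg _ _ eps (fun=> h)) => //; exact: cvg_cst.
  + move=> j; exact: (measurableT_comp (measurable_corr_slice (eps j) mo (L2_measurable (sv2 j))) (measurable_pair1 h)).
  + by move=> j xi; exact: corr_ge0.
Qed.

Lemma derive_eq0_support (R : realType) d (f : pt R d -> R) (e x : pt R d) :
  ~ closure [set x | f x != 0] x -> 'D_e f x = 0.
Proof.
move=> nx; rewrite -(derive_cst (0 : R) x e); apply: near_eq_derive.
have : nbhs x (~` closure [set x | f x != 0]).
  by apply: open_nbhs_nbhs; split => //; apply: closed_openC; exact: closed_closure.
apply: filterS => y ny; apply/eqP; apply: contrapT => /negP fy.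
by apply: ny; exact: subset_closure.
Qed.

Lemma test_derive (R : realType) d (D : set (pt R d)) (f : pt R d -> R) (e : pt R d) :
  test_function D f -> [/\ forall x, derivable f x e, continuous (fun x => 'D_e f x),
    L2 setT (fun x => 'D_e f x) & exists2 M : R, 0 <= M & forall x, `|'D_e f x| <= M].
Proof.
move=> [Cf cf fD]; have [_ /(_ e)[df C1]] := Cf 1%N.
have c1 : continuous (fun x => 'D_e f x) := C1.
split => //.
  by apply: (continuous_compact_support_L2 cf) => // x; exact: derive_eq0_support.
by apply: (continuous_compact_support_bounded cf) => // x; exact: derive_eq0_support.
Qed.

Definition edir (R : realType) d : pt R d := (0, 1).

Lemma slice_arg_split (R : realType) d (a h : R) (xi : 'rV[R]_d.-1) (x : pt R d) :
  x - (a *: xi, h) = x + (- h) *: edir R d + (- a) *: ((xi, 0) : pt R d).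
Proof.
rewrite -addrA; congr (x + _); rewrite /edir; congr pair => /=.
  by rewrite scaler0 add0r scaleNr.
by rewrite [X in _ + X]mulr0 addr0 [RHS]mulr1.
Qed.

(** The horizontal part of the increment is [e_j |h_j| xi]; divided by [h_j] it contributes
    [O(e_j)]. The vertical part gives minus the derivative, by uniform continuity. *)
Lemma difference_quotient_cvg (R : realType) d (D : set (pt R d)) (phi : pt R d -> R)
    (e_ h_ : nat -> R) (xi : 'rV[R]_d.-1) (e : R) :
  test_function D phi -> e_ @ \oo --> 0 -> h_ @ \oo --> 0 -> (forall j, h_ j != 0) -> 0 < e ->
  \forall j \near \oo, forall x,
    `|(phi (x - ((e_ j * `|h_ j|) *: xi, h_ j)) - phi x) / h_ j - (- 'D_(edir R d) phi x)| <= e.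
Proof.
move=> tphi ec hc h0 e0.
have [d1 c1 _ _] := test_derive (edir R d) tphi.
have [d2 _ _ [M M0 DM]] := test_derive ((xi, 0) : pt R d) tphi.
have [_ cphi _] := tphi.
have e2 : 0 < e / 2 by rewrite divr_gt0.
have [r r0 rP] := compact_support_unif cphi c1 (fun x => @derive_eq0_support _ _ _ _ x) e2.
have eM : 0 < e / 2 / (M + 1) by rewrite divr_gt0// ltr_wpDl.
have H1 := cvg_norm_near ec eM; have H2 := cvg_norm_near hc r0.
near=> j; move=> x.
have h1 : `|e_ j| < e / 2 / (M + 1) by rewrite -[e_ j]subr0; near: j.
have h2 : `|h_ j| < r by rewrite -[h_ j]subr0; near: j.
rewrite slice_arg_split; set y := x + _.
have B1 : `|phi (y + (- (e_ j * `|h_ j|)) *: (xi, 0)) - phi y - (- (e_ j * `|h_ j|)) * 0| <=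
    `|(- (e_ j * `|h_ j|))| * M.
  by apply: mvt_bound => // c _; rewrite subr0.
have B2 : `|phi y - phi x - (- h_ j) * 'D_(edir R d) phi x| <= `|- h_ j| * (e / 2).
  apply: mvt_bound => // c; rewrite normrN => ch; apply: rP.
  rewrite normrZ [X in _ * X](_ : _ = 1); first by rewrite mulr1 (le_lt_trans ch).
  by rewrite prod_normE /= normr0 normr1; apply/max_idPr.
have hj : 0 < `|h_ j| by rewrite normr_gt0.
rewrite mulr0 subr0 normrN normrM normr_id in B1; rewrite normrN in B2.
set A := phi (y + _) in B1 *; set B := phi y in B1 B2; set C := phi x in B2 *; set L := 'D_(edir R d) phi x in B2 *.
have -> : (A - C) / h_ j - - L = ((A - B) + (B - C - - h_ j * L)) / h_ j by field.
rewrite normrM normfV ler_pdivrMr// (le_trans (ler_normD _ _))//.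
apply: le_trans (lerD B1 B2) _.
have : `|e_ j| * M <= e / 2.
  apply: (@le_trans _ _ (`|e_ j| * (M + 1))); first by rewrite ler_wpM2l// lerDl.
  by rewrite -ler_pdivlMr ?ltW// ltr_wpDl.
move=> /(ler_wpM2r (ltW hj)); move: (`|e_ j|) (`|h_ j|) => p q; lra.
Unshelve. all: end_near. Qed.

(** The distributional derivative of [v] in [x_d], as a linear functional of [f]. *)
Definition lin_dxd (R : realType) d (D : set (pt R d)) (v f : pt R d -> R) : R :=
  - ip (v \_ D) (fun x => 'D_(edir R d) f x).

Lemma corr_quotient_liminf (R : realType) d (D : set (pt R d)) (v_ : nat -> pt R d -> R)
    (v phi : pt R d -> R) (e_ h_ : nat -> R) (xi : 'rV[R]_d.-1) :
  open D -> weak_L2loc D v_ v -> (forall j, L2 D (v_ j)) -> L2 D v -> test_function D phi ->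
  e_ @ \oo --> 0 -> h_ @ \oo --> 0 -> (forall j, h_ j != 0) ->
  ((2 * lin_dxd D v phi - ip phi phi)%:E <=
    limn_einf (fun j => corr D (v_ j) ((e_ j * `|h_ j|) *: xi, h_ j) * (h_ j ^- 2)%:E))%E.
Proof.
move=> oD wv v_2 v2 tphi ec hc h0; have mD : measurable D by exact: open_measurable_rVR.
apply: limn_einf_geP => a; rewrite lte_fin => al.
have [_ cS SD] := tphi; set S := closure _ in cS SD.
have phi0 x : ~ S x -> phi x = 0 by move=> nS; exact: test_eq0 tphi nS.
have phiS x : phi x != 0 -> S x.
  by move=> px; apply: contrapT => nS; rewrite phi0// eqxx in px.
have mphi := test_measurable tphi.
have [M M0 phiM] := test_bounded tphi.
have [d1 c1 D2 [M1 M10 DM]] := test_derive (edir R d) tphi.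
have [r [K [r0 cK KD SK KP]]] := compact_thicken cS oD SD.
have mK : measurable K by exact: compact_measurable_rVR.
have zc := cvg_slice_arg xi ec hc.
apply: (@corr_dual_liminf R d D K v_ v phi (fun x => - 'D_(edir R d) phi x)
  (fun j => ((e_ j * `|h_ j|) *: xi, h_ j)) h_ a) => //.
- by exists M.
- by apply: measurableT_comp => //; exact: L2_measurable D2.
- by exists M1 => x; rewrite normrN.
- have : \forall j \near \oo, `|(((e_ j * `|h_ j|) *: xi, h_ j) : pt R d) - (0, 0)| < r.
    exact: cvg_norm_near zc r0.
  apply: filterS => j zj x px; split; first by apply: SK; exact: phiS.
  by apply: KP; [exact: phiS|move: zj; rewrite subr0].
- by move=> e e0; exact: difference_quotient_cvg tphi ec hc h0 e0.
apply: lt_le_trans al _; rewrite le_eqVlt; apply/orP; left; apply/eqP; congr (2 * _ - _).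
  rewrite /lin_dxd /ip -(Rintegral_support mK); last first.
    by move=> x nK; rewrite derive_eq0_support ?mulr0// => Sx; apply: nK; exact: SK.
  rewrite -mulN1r -RintegralZl//.
    apply: eq_Rintegral => x; rewrite inE => Kx; rewrite patchE mem_set; first by ring.
    exact: KD.
  apply: L2M_integrable => //; last exact: L2S D2.
  by apply: (L2S measurableT) => //; exact: L2_restrict.
Qed.

Lemma Csd_lty (R : realType) d (s : R) : (0 < d)%N -> 0 <= s -> (@Csd R d s < +oo)%E.
Proof.
move=> d0 s0; rewrite CsdE; have := @radial_int_lty R d.-1 (d%:R / 2 + s).
rewrite /radial_int /wt; under eq_integral do rewrite opprD; apply.
apply: (@lt_le_trans _ _ (d%:R / 2)); last by rewrite lerDl.
by rewrite ltr_pM2r ?invr_gt0// ltr_nat prednK.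
Qed.

Lemma Csd_gt0 (R : realType) d (s : R) : (0 < @Csd R d s)%E.
Proof.
rewrite lt_neqAle CsdE; apply/andP; split; last by apply: integral_ge0 => xi _; rewrite lee_fin wt_ge0.
apply/eqP => /esym E.
have mw : measurable_fun setT (fun xi : 'rV[R]_d.-1 => (wt s xi)%:E).
  by apply/measurable_EFinP; exact: measurable_wt.
have : (\int[lebesgue_rV d.-1]_xi `|(wt s xi)%:E| = 0)%E.
  by rewrite -[RHS]E; apply: eq_integral => xi _; rewrite gee0_abs// lee_fin wt_ge0.
move=> /(ae_eq_integral_abs _ measurableT mw)[N [mN N0 sub]].
have := @lebesgue_rV_prod R d.-1 (fun=> `[0, 1]%classic) (fun=> 1).
rewrite big1// => /(_ (fun=> measurable_itv _)) H.
pose Q := [set x : 'rV[R]_d.-1 | forall i, `[0, 1]%classic (x ord0 i)].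
have mQ : measurable Q.
  rewrite (_ : Q = \bigcap_(i in [set: 'I_d.-1]) ((fun x : 'rV[R]_d.-1 => x ord0 i) @^-1` `[0, 1]%classic)).
    by apply: fin_bigcap_measurable => // i _; rewrite -[X in measurable X]setTI; exact: measurable_rV_coord.
  by apply/seteqP; split => x h i; [move=> _|]; exact: h.
have : (lebesgue_rV d.-1 Q <= lebesgue_rV d.-1 N)%E.
  apply: le_measure; rewrite ?inE// => x _; apply: sub => /= /(_ I) [].
  by move=> h; have := wt_gt0 s x; rewrite h ltxx.
rewrite H ?N0 ?lee_fin ?ler10// => _.
by rewrite /lebR lebesgue_measure_itv /= lte_fin ltr01 -EFinD subr0.
Qed.

Lemma slice_liminf (R : realType) d (omega : set 'rV[R]_d.-1) (v_ : nat -> pt R d -> R)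
    (v phi : pt R d -> R) (s_ e_ h_ : nat -> R) (c : R) :
  open omega -> weak_L2loc (cylinder omega 1) v_ v -> (forall j, L2 (cylinder omega 1) (v_ j)) ->
  L2 (cylinder omega 1) v -> test_function (cylinder omega 1) phi ->
  s_ @ \oo --> (1 : R) -> e_ @ \oo --> 0 -> h_ @ \oo --> 0 -> (forall j, h_ j != 0) ->
  0 <= c -> c <= 2 * lin_dxd (cylinder omega 1) v phi - ip phi phi ->
  (@Csd R d 1 * c%:E <=
    limn_einf (fun j => slice (s_ j) (e_ j) omega (v_ j) (h_ j) * (h_ j ^- 2)%:E))%E.
Proof.
move=> oo wv v_2 v2 tphi sc ec hc h0 c0 cle.
have mo : measurable omega by exact: open_measurable_rV.
have oD : open (@cylinder R d omega 1) by exact: open_cylinder.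
pose F j (xi : 'rV[R]_d.-1) := (corr (cylinder omega 1) (v_ j) ((e_ j * `|h_ j|) *: xi, h_ j) * (h_ j ^- 2)%:E)%E.
have mC j := measurableT_comp (measurable_corr_slice (e_ j) mo (L2_measurable (v_2 j))) (measurable_pair1 (h_ j)).
have h20 j : (0 <= (h_ j ^- 2)%:E)%E by rewrite lee_fin invr_ge0 sqr_ge0.
have -> : (fun j => slice (s_ j) (e_ j) omega (v_ j) (h_ j) * (h_ j ^- 2)%:E)%E =
    (fun j => \int[lebesgue_rV d.-1]_xi ((wt (s_ j) xi)%:E * F j xi))%E.
  apply/funext => j; rewrite /slice -ge0_integralZr//.
  - by apply: eq_integral => xi _; rewrite /F muleA.
  - apply: emeasurable_funM; last exact: mC.
    by apply/measurable_EFinP; exact: measurable_wt.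
  - by move=> xi _; rewrite mule_ge0 ?corr_ge0// lee_fin wt_ge0.
apply: wt_fatou => //.
- by move=> j; apply: emeasurable_funM => //; exact: mC.
- by move=> j xi; rewrite mule_ge0 ?corr_ge0.
- move=> xi; apply: le_trans (corr_quotient_liminf xi oD wv v_2 v2 tphi ec hc h0).
  by rewrite lee_fin.
Qed.

(** The point is uniformity in small [h]. If it failed, bad pairs [(j_k, h_k)] with [j_k >= k] and
    [|h_k| < 1 / (k + 1)] would contradict [slice_liminf], since weak convergence is inherited along
    [j_k]. *)
Lemma slice_lower (R : realType) d (omega : set 'rV[R]_d.-1) (v_ : nat -> pt R d -> R)
    (v phi : pt R d -> R) (s_ e_ : nat -> R) (c B : R) :
  open omega -> weak_L2loc (cylinder omega 1) v_ v -> (forall j, L2 (cylinder omega 1) (v_ j)) ->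
  L2 (cylinder omega 1) v -> test_function (cylinder omega 1) phi ->
  s_ @ \oo --> (1 : R) -> e_ @ \oo --> 0 ->
  0 <= c -> c <= 2 * lin_dxd (cylinder omega 1) v phi - ip phi phi ->
  (B%:E < @Csd R d 1 * c%:E)%E ->
  exists2 eta : R, 0 < eta & \forall j \near \oo, forall h, h != 0 -> `|h| < eta ->
    ((B * h ^+ 2)%:E <= slice (s_ j) (e_ j) omega (v_ j) h)%E.
Proof.
move=> oo wv v_2 v2 tphi sc ec c0 cle Bc; apply: contrapT => H.
have /choice[jh jhP] : forall k : nat, exists jh : nat * R, [/\ (k <= jh.1)%N, jh.2 != 0, `|jh.2| < k.+1%:R^-1 &
    (slice (s_ jh.1) (e_ jh.1) omega (v_ jh.1) jh.2 < (B * jh.2 ^+ 2)%:E)%E].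
  move=> k; apply: contrapT => nk; apply: H; exists k.+1%:R^-1; first by rewrite invr_gt0.
  exists k => // j /= kj h h0 hk; rewrite leNgt; apply/negP => sl; apply: nk.
  by exists (j, h).
pose j_ k := (jh k).1; pose h_ k := (jh k).2.
have jc : j_ @ \oo --> \oo.
  move=> A [N _ NA]; exists N => // k /= Nk; apply: NA => /=; have [kj _ _ _] := jhP k.
  exact: leq_trans Nk kj.
have hc : h_ @ \oo --> 0.
  apply/cvgrPdist_lt => e e0; have [N _ NP] := near_infty_natSinv_lt (PosNum e0).
  exists N => // k /= Nk; rewrite sub0r normrN; have [_ _ hk _] := jhP k.
  exact: lt_trans hk (NP k Nk).
have wv' : weak_L2loc (cylinder omega 1) (fun k => v_ (j_ k)) v.
  by move=> K cK KD g g2; exact: (@cvg_comp _ _ _ j_ _ _ _ _ jc (wv K cK KD g g2)).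
have := @slice_liminf R d omega (fun k => v_ (j_ k)) v phi (fun k => s_ (j_ k)) (fun k => e_ (j_ k)) h_ c oo wv'.
have sc' : (fun k => s_ (j_ k)) @ \oo --> (1 : R) by exact: (@cvg_comp _ _ _ j_ s_ _ _ _ jc sc).
have ec' : (fun k => e_ (j_ k)) @ \oo --> (0 : R) by exact: (@cvg_comp _ _ _ j_ e_ _ _ _ jc ec).
move=> /(_ (fun k => v_2 (j_ k)) v2 tphi sc' ec' hc) H1.
have h0 k : h_ k != 0 by have [] := jhP k.
have {}H1 := H1 h0 c0 cle.
have := limn_einf_gt_near (lt_le_trans Bc H1) => -[N _ /(_ N (leqnn N))].
rewrite -/(j_ N) -/(h_ N); have [_ _ _ +] := jhP N; rewrite -/(j_ N) -/(h_ N).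
have hN : 0 < h_ N ^+ 2 by rewrite lt_neqAle sqr_ge0 eq_sym sqrf_eq0 h0.
move=> sl; rewrite ltNge => /negP; apply.
rewrite -(@lee_pmul2r _ (h_ N ^+ 2)%:E)// ?lte_fin// -muleA -EFinM mulVf ?lt0r_neq0// mule1.
by rewrite -EFinM; exact: ltW.
Qed.

(** The concentration of the weight is explicit: [(1 - s)] times the integral of [|h|^(1 - 2 s)]
    over []-eta, eta[] equals [eta^(2 - 2 s)], which tends to 1 for fixed [eta]. So only the bound
    on [slice] near [h = 0] is used. *)
Lemma energy_lower (R : realType) d (omega : set 'rV[R]_d.-1) (s : R -> R) (eps : nat -> R)
    (u : nat -> pt R d -> R) (v phi : pt R d -> R) (c B : R) :
  (1 < d)%N -> open omega -> (forall e, 0 < e -> 0 < s e < 1) ->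
  (forall j, 0 < eps j) -> eps @ \oo --> 0 -> (fun j => s (eps j)) @ \oo --> (1 : R) ->
  (forall j, L2 (cylinder omega (eps j)) (u j)) -> L2 (cylinder omega 1) v ->
  weak_L2loc (cylinder omega 1) (fun j => scaled (eps j) (u j)) v ->
  test_function (cylinder omega 1) phi ->
  0 <= c -> c <= 2 * lin_dxd (cylinder omega 1) v phi - ip phi phi ->
  (B%:E < @Csd R d 1 * c%:E)%E ->
  \forall j \near \oo, (B%:E <= (1 - s (eps j))%:E * energy s omega (eps j) (u j))%E.
Proof.
move=> d1 oo s01 eps0 epsc sc u2 v2 wv tphi c0 cle Bc.
have mo : measurable omega by exact: open_measurable_rV.
have sv2 j : L2 (cylinder omega 1) (scaled (eps j) (u j)) by exact: scaled_L2.
have sp j : 0 < s (eps j) by have /andP[] := s01 _ (eps0 j).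
have s1 j : s (eps j) < 1 by have /andP[] := s01 _ (eps0 j).
have E0 j : (0 <= (1 - s (eps j))%:E * energy s omega (eps j) (u j))%E.
  rewrite energy_slice//; last exact: L2_measurable (u2 j).
  rewrite mule_ge0//; first by rewrite lee_fin subr_ge0 ltW.
  by apply: integral_ge0 => h _; rewrite mule_ge0 ?slice_ge0// lee_fin powR_ge0.
have [B0|B0] := leP B 0.
  by apply: nearW => j; apply: le_trans (E0 j); rewrite lee_fin.
have Cf : @Csd R d 1 \is a fin_num.
  by rewrite ge0_fin_numE ?Csd_lty ?(ltnW d1)// ltW// Csd_gt0.
have [B' BB' B'c] : exists2 B' : R, B < B' & (B'%:E < @Csd R d 1 * c%:E)%E.
  move: Bc; rewrite -(fineK Cf) -EFinM lte_fin => Bc.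
  by exists ((B + fine (@Csd R d 1) * c) / 2); rewrite ?lte_fin midf_lt.
have [eta eta0 slow] := slice_lower oo wv sv2 v2 tphi sc epsc c0 cle B'c.
have B'0 : 0 < B' by exact: lt_trans BB'.
have lim : (fun j => B' * eta `^ (2 - 2 * s (eps j))) @ \oo --> B' * eta `^ (2 - 2 * 1).
  apply: cvgM; first exact: cvg_cst.
  apply: cvg_powR_exponent => //; apply: cvgB; first exact: cvg_cst.
  by apply: cvgM => //; exact: cvg_cst.
rewrite mulr1 subrr powRr0 mulr1 in lim.
have n1 : \forall j \near \oo, B < B' * eta `^ (2 - 2 * s (eps j)) by exact: cvgr_gt lim _ _.
(* Keeps the exponent [1 - 2 s] nonzero: the comparison of integrands at [h = 0] would fail for the
   value 1 of 0 to the power 0. *)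
have n2 : \forall j \near \oo, 2^-1 < s (eps j).
  by apply: cvgr_gt sc _ _; rewrite invf_lt1// ltr1n.
near=> j.
have h1 : B < B' * eta `^ (2 - 2 * s (eps j)) by near: j.
have h2 : 2^-1 < s (eps j) by near: j.
have h3 : forall h, h != 0 -> `|h| < eta ->
    ((B' * h ^+ 2)%:E <= slice (s (eps j)) (eps j) omega (scaled (eps j) (u j)) h)%E by near: j.
apply: (@le_trans _ _ (B' * eta `^ (2 - 2 * s (eps j)))%:E); first by rewrite lee_fin ltW.
have p0 : 0 < 2 - 2 * s (eps j) by rewrite subr_gt0 gtr_pMr.
have s1j : 0 < 1 - s (eps j) by rewrite subr_gt0.
have -> : (B' * eta `^ (2 - 2 * s (eps j)))%:E =
  ((1 - s (eps j))%:E * (B'%:E * \int[lebR]_(h in `](- eta)%R, eta[) (`|h| `^ (2 - 2 * s (eps j) - 1))%:E))%E.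
  rewrite integral_powR_sym// -!EFinM; congr EFin.
  by field; rewrite lt0r_neq0.
rewrite lee_pmul2l ?lte_fin// energy_slice//; last exact: L2_measurable (u2 j).
have mP : measurable_fun setT (fun h : R => (`|h| `^ (2 - 2 * s (eps j) - 1))%:E).
  by apply/measurable_EFinP; apply: measurable_powR_fun; exact: normr_measurable.
have mI : measurable_fun setT (fun h : R => ((`|h| `^ (- 1 - 2 * s (eps j)))%:E *
    slice (s (eps j)) (eps j) omega (scaled (eps j) (u j)) h)%E).
  apply: emeasurable_funM; last by apply: measurable_slice => //; exact: L2_measurable (sv2 j).
  by apply/measurable_EFinP; apply: measurable_powR_fun; exact: normr_measurable.
rewrite -ge0_integralZl//; last 2 first.
- exact: measurable_funTS.
- by rewrite lee_fin ltW.
apply: (@le_trans _ _ (\int[lebR]_(h in `](- eta)%R, eta[) ((`|h| `^ (- 1 - 2 * s (eps j)))%:E *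
    slice (s (eps j)) (eps j) omega (scaled (eps j) (u j)) h))%E); last first.
  apply: ge0_subset_integral => //.
  by move=> h _; rewrite mule_ge0 ?slice_ge0// lee_fin powR_ge0.
apply: ge0_le_integral => //.
- by move=> h _; rewrite mule_ge0// lee_fin ?powR_ge0// ltW.
- by apply: measurable_funeM; exact: measurable_funTS.
- exact: measurable_funTS.
move=> h; rewrite /= in_itv/= -ltr_norml => heta.
have [->|hn0] := eqVneq h 0.
  rewrite normr0 powR0 ?mule0 ?mule_ge0 ?slice_ge0// ?lee_fin ?powR_ge0//.
  have h2' : 1 < 2 * s (eps j) by rewrite -ltr_pdivrMl// mulr1.
  by rewrite lt_eqF//; lra.
have hp : 0 < `|h| by rewrite normr_gt0.
apply: le_trans (lee_wpmul2l _ (h3 _ hn0 heta)); last by rewrite lee_fin powR_ge0.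
rewrite -!EFinM lee_fin mulrCA ler_wpM2l ?(ltW B'0)//.
rewrite -[h ^+ 2]real_normK ?num_real// -powR_mulrn ?normr_ge0// -powRD; last by rewrite (gt_eqF hp) implybT.
by rewrite le_eqVlt; apply/orP; left; apply/eqP; congr (_ `^ _); ring.
Unshelve. all: end_near. Qed.

Lemma integral_cylinder (R : realType) d (omega : set 'rV[R]_d.-1) (w : pt R d -> R) :
  measurable omega -> measurable_fun (cylinder omega 1) w ->
  (\int[lebesgue_rV d.-1]_(x' in omega) \int[lebR]_(xd in `]0%R, 1%R[) (`|w (x', xd)| ^+ 2)%:E =
   \int[leb]_x ((w \_ (cylinder omega 1)) x ^+ 2)%:E)%E.
Proof.
move=> mo mw; have mD := @measurable_cylinder R d omega 1 mo.
have m1 : measurable_fun setT (w \_ (cylinder omega 1)) by apply/(measurable_restrictT w).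
rewrite integral_leb; last 2 first.
- by apply/measurable_EFinP; exact: measurable_funX.
- by move=> x; rewrite lee_fin sqr_ge0.
rewrite integral_mkcond; apply: eq_integral => x _; rewrite patchE.
case: ifPn => xo; last first.
  apply/esym/integral0_eq => t _; rewrite patchE /cylinder in_setX /= (negbTE xo).
  by rewrite expr0n.
rewrite integral_mkcond; apply: eq_integral => t _; rewrite !patchE /cylinder in_setX /= xo /=.
by case: ifP => _; rewrite ?expr0n// real_normK ?num_real.
Qed.

Lemma lin_dxd_lin (R : realType) d (D : set (pt R d)) (v : pt R d -> R) (a b : R) f g :
  measurable D -> L2 D v -> test_function D f -> test_function D g ->
  lin_dxd D v (fun x => a * f x + b * g x) = a * lin_dxd D v f + b * lin_dxd D v g.
Proof.
move=> mD v2 tf tg; have w2 := L2_restrict mD v2.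
have [df _ Df2 _] := test_derive (edir R d) tf.
have [dg _ Dg2 _] := test_derive (edir R d) tg.
have E : 'D_(edir R d) (fun x => a * f x + b * g x) = (fun x => a * 'D_(edir R d) f x + b * 'D_(edir R d) g x).
  apply/funext => x; have -> : (fun x => a * f x + b * g x) = (a *: f + b *: g) by [].
  by rewrite deriveD ?deriveZ//; apply: derivableZ.
by rewrite /lin_dxd !(ipC (v \_ D)) E (ip_lin a b Df2 Dg2 w2) opprD !mulrN.
Qed.

Lemma is_weak_dxd_lin (R : realType) d (D : set (pt R d)) (v w : pt R d -> R) :
  measurable D -> (is_weak_dxd D v w <->
    forall f, test_function D f -> lin_dxd D v f = ip (w \_ D) f).
Proof.
move=> mD.
have E (a b : pt R d -> R) : \int[leb]_(x in D) (a x * b x) = ip (a \_ D) b.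
  rewrite Rintegral_mkcond; apply: eq_Rintegral => x _; rewrite !patchE.
  by case: ifP => //; rewrite mul0r.
rewrite /is_weak_dxd /lin_dxd /edir; split => H f tf.
  by have := H f tf; rewrite !E => ->; rewrite opprK.
by rewrite !E -(H f tf) opprK.
Qed.

Lemma liminf_eq1 (R : realType) d (omega : set 'rV[R]_d.-1) (s : R -> R) (eps : nat -> R)
    (u : nat -> pt R d -> R) (v : pt R d -> R) :
  (1 < d)%N -> (sphere_area R d * ((2 * d%:R)^-1)%:E = @Csd R d 1)%E ->
  open omega -> (forall e, 0 < e -> 0 < s e < 1) ->
  (forall j, 0 < eps j) -> eps @ \oo --> 0 -> (fun j => s (eps j)) @ \oo --> (1 : R) ->
  (forall j, L2 (cylinder omega (eps j)) (u j)) -> L2 (cylinder omega 1) v ->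
  weak_L2loc (cylinder omega 1) (fun j => scaled (eps j) (u j)) v ->
  (limit_eq1 omega v <= limn_einf (fun j => (1 - s (eps j))%:E * energy s omega (eps j) (u j)))%E.
Proof.
move=> d1 hS oo s01 eps0 epsc sc u2 v2 wv.
have mo : measurable omega by exact: open_measurable_rV.
have oD : open (@cylinder R d omega 1) by exact: open_cylinder.
have mD : measurable (@cylinder R d omega 1) by exact: measurable_cylinder.
have sp j : 0 < s (eps j) by have /andP[] := s01 _ (eps0 j).
have s1 j : s (eps j) < 1 by have /andP[] := s01 _ (eps0 j).
have E0 j : (0 <= (1 - s (eps j))%:E * energy s omega (eps j) (u j))%E.
  rewrite energy_slice//; last exact: L2_measurable (u2 j).
  rewrite mule_ge0//; first by rewrite lee_fin subr_ge0 ltW.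
  by apply: integral_ge0 => h _; rewrite mule_ge0 ?slice_ge0// lee_fin powR_ge0.
have Cf : @Csd R d 1 \is a fin_num.
  by rewrite ge0_fin_numE ?Csd_lty ?(ltnW d1)// ltW// Csd_gt0.
have C0 : 0 < fine (@Csd R d 1) by apply: fine_gt0; rewrite Csd_gt0 Csd_lty ?(ltnW d1).
set C := fine (@Csd R d 1) in C0.
have low phi a : test_function (cylinder omega 1) phi ->
    a < C * (2 * lin_dxd (cylinder omega 1) v phi - ip phi phi) ->
    \forall j \near \oo, (a%:E <= (1 - s (eps j))%:E * energy s omega (eps j) (u j))%E.
  move=> tphi aC; have [a0|a0] := leP a 0.
    by apply: nearW => j; apply: le_trans (E0 j); rewrite lee_fin.
  have c0 : 0 <= 2 * lin_dxd (cylinder omega 1) v phi - ip phi phi.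
    by rewrite -(pmulr_rge0 _ C0) ltW// (lt_trans a0).
  apply: (energy_lower d1 oo s01 eps0 epsc sc u2 v2 wv tphi c0 (lexx _)).
  by rewrite -(fineK Cf) -EFinM lte_fin.
apply: limn_einf_geP => a; rewrite /limit_eq1; case: pselect => [ex|nex].
  have [w2 wd] := xgetPex (cst 0%R) ex; set w := xget _ _ in w2 wd *.
  have wr2 := L2_restrict mD w2.
  rewrite integral_cylinder//; last exact: L2_measurable w2.
  rewrite (ipE wr2) hS -(fineK Cf) -EFinM lte_fin -/C => aC.
  have aC' : a / C < ip (w \_ (cylinder omega 1)) (w \_ (cylinder omega 1)) by rewrite ltr_pdivrMr// mulrC.
  have w0 x : ~ cylinder omega 1 x -> (w \_ (cylinder omega 1)) x = 0.
    by move=> nx; rewrite patchE memNset.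
  have [phi tphi] := dual_attained oD wr2 w0 aC'.
  rewrite -((is_weak_dxd_lin v w mD).1 wd _ tphi) ltr_pdivrMr// mulrC => H.
  exact: low tphi H.
(* If the energies are not eventually at least [a], then [low] bounds the dual expression by [a / C]
   for every test function; this is the hypothesis of [riesz_minimization], which then produces a
   weak derivative. *)
move=> _; apply: contrapT => nlow; apply: nex.
have bnd phi : test_function (cylinder omega 1) phi ->
    2 * lin_dxd (cylinder omega 1) v phi - ip phi phi <= a / C.
  by move=> tphi; rewrite leNgt; apply/negP; rewrite ltr_pdivrMr// mulrC => /(low _ _ tphi).
have [w [w2 wP _]] := riesz_minimization (@test_L2 R d (cylinder omega 1)) (@test0 R d _)
  (fun a b f g => @test_lin R d _ a b f g) (fun a b f g => @lin_dxd_lin R d _ v a b f g mD v2) bnd.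
exists w; split; first exact: (L2S measurableT).
apply/(is_weak_dxd_lin v w mD) => f tf; rewrite -wP//; apply: eq_Rintegral => x _.
have [Dx|nDx] := pselect (cylinder omega 1 x); first by rewrite patchE mem_set.
have [_ _ sub] := tf; rewrite (test_eq0 tf) ?mulr0//.
by move=> /sub.
Qed.

(** * Mollification and recovery sequences *)

(** The weight is signed, because it will be the kernel or a difference of two translated
    kernels. *)
Lemma weighted_cauchy_schwarz (R : realType) d (q f : pt R d -> R) :
  L2 setT q -> L2 setT f -> (exists M : R, forall x, `|q x| <= M) ->
  (@leb R d).-integrable setT (EFin \o q) ->
  (((\int[leb]_x (q x * f x)) ^+ 2)%:E <=
    (\int[leb]_x `|q x|)%:E * \int[leb]_x (`|q x| * f x ^+ 2)%:E)%E.
Proof.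
move=> q2 f2 [M qM] qi; have mq := L2_measurable q2; have mf := L2_measurable f2.
have M0 : 0 <= M by exact: le_trans (qM 0).
have maq : measurable_fun setT (fun x => `|q x|) by apply: measurableT_comp.
have ff : (@leb R d).-integrable setT (EFin \o (fun x => `|q x| * f x ^+ 2)).
  apply: (@le_integrable _ _ _ _ _ _ _ (EFin \o (fun x => M * (f x * f x)))) => //.
  - by apply/measurable_EFinP; apply: measurable_funM => //; exact: measurable_funX.
  - move=> x _; rewrite lee_fin normrM normr_id -expr2 normrX.
    rewrite normrM (ger0_norm M0) [`|f x ^+ 2|]normrX.
    by rewrite ler_wpM2r// sqr_ge0.
  - by apply: integrable_mulrl => //; exact: L2M_integrable.
have fi : (@leb R d).-integrable setT (EFin \o (fun x => `|q x| * `|f x|)).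
  rewrite (_ : _ \o _ = abse \o (EFin \o (fun x => q x * f x))); last first.
    by apply/funext => x /=; rewrite normrM.
  by apply: integrable_abse; exact: L2M_integrable.
have ai : (@leb R d).-integrable setT (EFin \o (fun x => `|q x|)).
  exact: (integrable_abse qi).
set A := \int[leb]_x `|q x|; pose B := \int[leb]_x (`|q x| * `|f x|).
pose C := \int[leb]_x (`|q x| * f x ^+ 2).
have CE : (\int[leb]_x (`|q x| * f x ^+ 2)%:E = C%:E)%E.
  by rewrite /C /Rintegral fineK//; exact: (integrable_fin_num measurableT ff).
have A0 : 0 <= A by apply: Rintegral_ge0.
have C0 : 0 <= C by apply: Rintegral_ge0 => x _; rewrite mulr_ge0 ?sqr_ge0.
have quad t : 0 <= C - 2 * t * B + t ^+ 2 * A.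
  have -> : C - 2 * t * B + t ^+ 2 * A = \int[leb]_x (`|q x| * (`|f x| - t) ^+ 2).
    rewrite /C /B /A -RintegralZl// -RintegralZl// -RintegralB//; last exact: integrable_mulrl.
    rewrite -RintegralD//; last 2 first.
    - by apply: integrable_subr => //; exact: integrable_mulrl.
    - exact: integrable_mulrl.
    apply: eq_Rintegral => x _; rewrite -[f x ^+ 2]real_normK ?num_real//; ring.
  by apply: Rintegral_ge0 => x _; rewrite mulr_ge0 ?sqr_ge0.
have BB : B ^+ 2 <= A * C.
  have [A00|An0] := eqVneq A 0; last first.
    have Ap : 0 < A by rewrite lt_neqAle eq_sym An0.
    have := quad (B / A); have -> : C - 2 * (B / A) * B + (B / A) ^+ 2 * A = (A * C - B ^+ 2) / A by field.
    by rewrite pmulr_lge0 ?invr_gt0// subr_ge0.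
  have [->|Bn0] := eqVneq B 0; first by rewrite expr0n mulr_ge0.
  have := quad ((C + 1) / (2 * B)); rewrite A00 mulr0 addr0.
  have -> : C - 2 * ((C + 1) / (2 * B)) * B = -1 by field.
  by rewrite ler0N1.
rewrite CE -EFinM lee_fin; apply: le_trans BB.
rewrite -[leLHS]real_normK ?num_real// ler_pXn2r ?nnegrE//.
  apply: le_trans (le_normr_Rintegral measurableT (L2M_integrable measurableT q2 f2)) _.
  by rewrite le_eqVlt; apply/orP; left; apply/eqP; apply: eq_Rintegral => x _; rewrite normrM.
by apply: Rintegral_ge0.
Qed.

(** Centre at height [1 / 2] and radius [1 / 2] confine the support to heights in []0, 1[], as the
    convexity argument of [corr_mol_vertical] requires. A Lipschitz kernel is smooth enough, since
    only first differences are estimated. *)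
Definition tent (R : realType) d (x : pt R d) : R := Num.max 0 (2^-1 - `|x - (0, 2^-1)|).

Lemma tent_ge0 (R : realType) d (x : pt R d) : 0 <= tent x.
Proof. by rewrite /tent le_max lexx. Qed.

Lemma tent_lip (R : realType) d (x y : pt R d) : `|tent x - tent y| <= `|x - y|.
Proof.
have H (a b : R) : `|Num.max 0 a - Num.max 0 b| <= `|a - b|.
  rewrite /Num.max; case: (ltP 0 a) => a0; case: (ltP 0 b) => b0.
  - by [].
  - by rewrite subr0 (gtr0_norm a0) ger0_norm; lra.
  - by rewrite sub0r normrN (gtr0_norm b0) ler0_norm; lra.
  - by rewrite subrr normr0.
apply: le_trans (H _ _) _.
set p : pt R d := (0, 2^-1).
rewrite (_ : _ - (2^-1 - `|y - p|) = `|y - p| - `|x - p|); last by ring.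
apply: le_trans (ler_dist_dist _ _) _.
by rewrite (_ : y - p - (x - p) = y - x) 1?distrC// opprB addrA subrK.
Qed.

Lemma tent_support (R : realType) d (x : pt R d) : tent x != 0 -> 0 < x.2 < 1 /\ `|x| <= 1.
Proof.
rewrite /tent /Num.max; case: ifPn => [|_]; last by rewrite eqxx.
rewrite subr_gt0 => H _; split.
  have : `|x.2 - 2^-1| < 2^-1.
    by apply: le_lt_trans H; rewrite [leRHS]prod_normE le_max lexx orbT.
  by rewrite ltr_distl => /andP[h1 h2]; apply/andP; split; lra.
rewrite -(subrK ((0, 2^-1) : pt R d) x) (le_trans (ler_normD _ _))//.
have -> : `|((0, 2^-1) : pt R d)| = 2^-1.
  rewrite prod_normE /= normr0 ger0_norm ?invr_ge0//; apply/max_idPr; by rewrite invr_ge0.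
by rewrite [leRHS](splitr 1) mul1r lerD// ltW.
Qed.

Lemma tent_continuous (R : realType) d : continuous (@tent R d).
Proof.
move=> x; apply/cvgrPdist_lt => e e0; near=> y.
apply: le_lt_trans (tent_lip x y) _; near: y.
by apply: (@cvgr_dist_lt _ _ _ _ _ id x).
Unshelve. all: end_near. Qed.

Definition tent_dom (R : realType) d : set (pt R d) :=
  cbox ((const_mx (-1), -1) : pt R d) (const_mx 1, 1).

Lemma tent_dom_norm (R : realType) d (x : pt R d) : `|x| <= 1 -> tent_dom x.
Proof.
rewrite prod_normE /= ge_max => /andP[h1 h2]; split => [i|] /=.
  by rewrite !mxE -ler_norml (le_trans (coord_le_norm _ _)).
by rewrite -ler_norml.
Qed.

Lemma tent_L2 (R : realType) d : L2 setT (@tent R d).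
Proof.
apply: (@continuous_compact_support_L2 R d (@tent_dom R d)).
- exact: compact_cbox.
- exact: tent_continuous.
- move=> x nx; apply/eqP; apply: contrapT => /negP /tent_support [_ H]; apply: nx.
  exact: tent_dom_norm.
Qed.

Lemma tent_le1 (R : realType) d (x : pt R d) : tent x <= 1.
Proof.
rewrite /tent ge_max ler01/=; have := normr_ge0 (x - (0, 2^-1)).
have : 2^-1 <= 1 :> R by rewrite invf_le1// ler1n.
lra.
Qed.

Lemma tent_integrable (R : realType) d : (@leb R d).-integrable setT (EFin \o @tent R d).
Proof.
have cK := @compact_cbox R d ((const_mx (-1), -1) : pt R d) (const_mx 1, 1).
have mK := compact_measurable_rVR cK.
have := L2_integrable mK (leb_compact_lty cK) (L2S measurableT mK (@subsetT _ _) (@tent_L2 R d)).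
move=> /(integrable_mkcond _ mK); rewrite (_ : _ \_ _ = EFin \o @tent R d)//.
apply/funext => x; rewrite patchE; case: ifPn => // /negP; rewrite inE => nx.
rewrite /= (_ : tent x = 0)//; apply/eqP; apply: contrapT => /negP /tent_support [_ H]; apply: nx.
exact: tent_dom_norm.
Qed.

Lemma leb_obox (R : realType) d (lo hi : pt R d) :
  (forall i, lo.1 ord0 i < hi.1 ord0 i) -> lo.2 < hi.2 ->
  leb (obox lo hi) = ((\prod_(i < d.-1) (hi.1 ord0 i - lo.1 ord0 i)) * (hi.2 - lo.2))%:E.
Proof.
move=> h1 h2; have litv (a b : R) : a < b -> lebR `]a, b[%classic = (b - a)%:E.
  by move=> ab; rewrite /lebR lebesgue_measure_itv /= lte_fin ab -EFinD.
pose J i := `]lo.1 ord0 i, hi.1 ord0 i[%classic.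
have mJ i : measurable (J i) by exact: measurable_itv.
have -> : obox lo hi = [set x : 'rV[R]_d.-1 | forall i, J i (x ord0 i)] `*` `]lo.2, hi.2[%classic.
  apply/seteqP; split => x [a1 a2]; split => [i|].
  - by have := a1 i; rewrite /J /= in_itv.
  - by rewrite /= in_itv.
  - by have := a1 i; rewrite /J /= in_itv.
  - by move: a2; rewrite /= in_itv.
rewrite /leb product_measure1E//.
  have H := lebesgue_rV_prod mJ (fun i => litv _ _ (h1 i)).
  rewrite EFinM; congr (_ * _)%E; [exact: H|exact: litv].
rewrite (_ : [set x : 'rV[R]_d.-1 | _] = \bigcap_(i in [set: 'I_d.-1]) ((fun x : 'rV[R]_d.-1 => x ord0 i) @^-1` J i)).
  by apply: fin_bigcap_measurable => // i _; rewrite -[X in measurable X]setTI; exact: measurable_rV_coord.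
by apply/seteqP; split => x h i; [move=> _|]; exact: h.
Qed.

Lemma tent_mass_gt0 (R : realType) d : 0 < \int[leb]_x (@tent R d x).
Proof.
pose lo : pt R d := (const_mx (- 4^-1), 4^-1); pose hi : pt R d := (const_mx 4^-1, 3 * 4^-1).
have mB : measurable (obox lo hi) by exact: measurable_obox.
have tB x : obox lo hi x -> 4^-1 <= tent x.
  move=> [h1 h2]; rewrite /tent le_max; apply/orP; right.
  suff : `|x - (0, 2^-1)| <= 4^-1 by lra.
  rewrite prod_normE /= ge_max subr0; apply/andP; split.
    apply: rV_norm_le => [|i]; first by rewrite invr_ge0.
    by rewrite ler_norml; have := h1 i; rewrite !mxE => /andP[? ?]; rewrite !ltW.
  by rewrite ler_distl; move: h2 => /= /andP[? ?]; apply/andP; split; lra.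
have lB : leb (obox lo hi) = (2^-1 ^+ d.-1 * 2^-1)%:E.
  rewrite leb_obox => [|i|]; rewrite ?mxE /=.
  - by under eq_bigr do rewrite !mxE; rewrite prodr_const card_ord; congr (_ ^+ _ * _)%:E; field.
  - by lra.
  - by lra.
rewrite -lte_fin /Rintegral fineK; last exact: (integrable_fin_num measurableT (@tent_integrable R d)).
apply: (@lt_le_trans _ _ (\int[leb]_(x in obox lo hi) (4^-1)%:E)%E).
  by rewrite integral_cst// [X in (_ * X)%E]lB -EFinM lte_fin !mulr_gt0// ?exprn_gt0// invr_gt0.
have mt : measurable_fun setT (EFin \o @tent R d) by case/integrableP: (@tent_integrable R d).
apply: (@le_trans _ _ (\int[leb]_(x in obox lo hi) (tent x)%:E)%E).
  by apply: ge0_le_integral => //; exact: measurable_funTS.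
apply: ge0_subset_integral => //.
by move=> x _; rewrite lee_fin tent_ge0.
Qed.

Definition ker (R : realType) d (x : pt R d) : R := tent x / \int[leb]_x (@tent R d x).

Lemma ker_ge0 (R : realType) d (x : pt R d) : 0 <= ker x.
Proof. by rewrite divr_ge0 ?tent_ge0// ltW// tent_mass_gt0. Qed.

Lemma ker_bounded (R : realType) d : exists M : R, forall x : pt R d, `|ker x| <= M.
Proof.
exists (\int[leb]_x (@tent R d x))^-1 => x; rewrite ger0_norm ?ker_ge0// ler_piMl ?tent_le1//.
by rewrite invr_ge0 ltW// tent_mass_gt0.
Qed.

Lemma kerE (R : realType) d : @ker R d = fun x => (\int[leb]_x (@tent R d x))^-1 * tent x.
Proof. by apply/funext => x; rewrite mulrC. Qed.

Lemma ker_L2 (R : realType) d : L2 setT (@ker R d).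
Proof. by rewrite kerE; apply: L2Z => //; exact: tent_L2. Qed.

Lemma ker_integrable (R : realType) d : (@leb R d).-integrable setT (EFin \o @ker R d).
Proof. by rewrite kerE; apply: integrable_mulrl => //; exact: tent_integrable. Qed.

Lemma ker_mass (R : realType) d : \int[leb]_x (@ker R d x) = 1.
Proof.
rewrite kerE RintegralZl//; last exact: tent_integrable.
by rewrite mulVf// lt0r_neq0// tent_mass_gt0.
Qed.

Lemma ker_support (R : realType) d (x : pt R d) : ker x != 0 -> 0 < x.2 < 1 /\ `|x| <= 1.
Proof. by rewrite mulf_eq0 negb_or => /andP[/tent_support]. Qed.

Lemma integrable_translate (R : realType) d (f : pt R d -> R) z :
  (@leb R d).-integrable setT (EFin \o f) ->
  (@leb R d).-integrable setT (EFin \o (fun x => f (x + z))).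
Proof.
move=> /integrableP[mf fi]; apply/integrableP; split.
  by apply: (measurableT_comp mf); exact: measurable_ptDr.
rewrite (@leb_translate _ _ (fun x => `|(f x)%:E|%E))//.
exact: measurableT_comp.
Qed.

Lemma leb_tent_dom (R : realType) d : (leb (@tent_dom R d) < +oo)%E.
Proof. by apply: leb_compact_lty; exact: compact_cbox. Qed.

(* The kernel is Lipschitz with support in the compact [tent_dom]; hence its translates are
   Lipschitz in L^1. *)
Lemma ker_L1_lip (R : realType) d : exists2 C : R, 0 <= C &
  forall z : pt R d, \int[leb]_x `|ker (x + z) - ker x| <= C * `|z|.
Proof.
pose m := \int[leb]_x (@tent R d x); have m0 : 0 < m by exact: tent_mass_gt0.
pose A := @tent_dom R d; have mA : measurable A by apply: compact_measurable_rVR; exact: compact_cbox.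
pose a := fine (leb A); have aE : leb A = a%:E.
  by rewrite /a fineK// ge0_fin_numE ?measure_ge0// leb_tent_dom.
have a0 : 0 <= a by rewrite /a fine_ge0// measure_ge0.
exists (2 * a / m) => [|z]; first by rewrite divr_ge0 ?mulr_ge0// ltW.
have ki := integrable_translate z (@ker_integrable R d).
have di := integrable_subr measurableT ki (@ker_integrable R d).
have dai : (@leb R d).-integrable setT (EFin \o (fun x => `|ker (x + z) - ker x|)) by exact: (integrable_abse di).
rewrite -lee_fin /Rintegral fineK; last exact: (integrable_fin_num measurableT dai).
have mi (B : set (pt R d)) : measurable B -> measurable_fun setT (fun x => (\1_B x : R)%:E).
  by move=> mB; apply/measurable_EFinP; exact: measurable_indicT.
have mAz : measurable_fun setT (fun x : pt R d => (\1_A (x + z) : R)%:E).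
  by apply: (measurableT_comp (mi _ mA)); exact: measurable_ptDr.
apply: (@le_trans _ _ (\int[leb]_x ((`|z| / m)%:E * ((\1_A (x + z))%:E + (\1_A x)%:E)))%E).
  apply: ge0_le_integral => //.
  - by case/integrableP: dai.
  - by apply: measurable_funeM; apply: emeasurable_funD => //; exact: mi.
  move=> x _; rewrite -EFinD -EFinM lee_fin.
  have [E|] := eqVneq (ker (x + z) - ker x) 0.
    by rewrite E normr0 mulr_ge0// ?divr_ge0// ?ltW// addr_ge0.
  (* The difference can be nonzero only if one of the two points lies in the support; elsewhere the
     bound by indicators costs nothing. *)
  move=> nE; have one : 1 <= \1_A (x + z) + \1_A x :> R.
    have [k1|k1] := eqVneq (ker (x + z)) 0.
      have [k2|k2] := eqVneq (ker x) 0; first by rewrite k1 k2 subrr eqxx in nE.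
      rewrite [X in _ + X]indicE mem_set ?lerDr//.
      by have [_ /tent_dom_norm] := ker_support k2.
    rewrite [X in X + _]indicE mem_set ?lerDl//.
    by have [_ /tent_dom_norm] := ker_support k1.
  apply: (@le_trans _ _ (`|z| / m)); last first.
    by apply: ler_peMr => //; rewrite divr_ge0// ltW.
  rewrite /ker -mulrBl normrM normfV (gtr0_norm m0) ler_wpM2r ?invr_ge0 ?(ltW m0)//.
  by apply: le_trans (tent_lip _ _) _; rewrite addrAC subrr add0r.
rewrite ge0_integralZT; last 3 first.
- by apply: emeasurable_funD => //; exact: mi.
- by move=> x; rewrite -EFinD lee_fin addr_ge0.
- by rewrite divr_ge0// ltW.
rewrite ge0_integralD//; try exact: mi.
rewrite (@leb_translate _ _ (fun x => (\1_A x)%:E))//; last exact: mi.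
rewrite integral_indic// setIT [X in (_ * (X + _))%E]aE [X in (_ * (_ + X))%E]aE -EFinD -EFinM lee_fin.
by rewrite le_eqVlt; apply/orP; left; apply/eqP; field; rewrite lt0r_neq0.
Qed.

Definition shrink (R : realType) d (delta : R) (x : pt R d) : pt R d := (x.1, (1 - delta) * x.2).

Lemma shrinkD (R : realType) d (delta : R) (x y : pt R d) :
  shrink delta (x + y) = shrink delta x + shrink delta y.
Proof. by rewrite /shrink; congr pair => /=; rewrite mulrDr. Qed.

(** For heights of [x] and [z] in []0, 1[] the evaluation point has height
    [(1 - delta) x_d + delta z_d], a convex combination, so the average never looks above or below
    the cylinder. *)
Definition mol (R : realType) d (delta : R) (w : pt R d -> R) (x : pt R d) : R :=
  \int[leb]_z (ker z * w (shrink delta x + delta *: z)).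

Lemma L2_dilate (R : realType) d (delta : R) (w : pt R d -> R) (y : pt R d) : 0 < delta ->
  L2 setT w -> L2 setT (fun z => w (y + delta *: z)).
Proof.
move=> d0 [mw w2]; have E : (fun z : pt R d => w (y + delta *: z)) = fun z => w (delta *: z.1 + y.1, delta * z.2 + y.2).
  by apply/funext => z; congr w; rewrite addrC.
have mg : measurable_fun setT (fun z : pt R d => (delta *: z.1 + y.1, delta * z.2 + y.2)).
  apply: measurable_fun_pair.
    exact: (measurableT_comp (measurable_rV_affine delta y.1) measurable_fst).
  by apply: measurable_funD => //; exact: measurable_funM.
rewrite E; split; first exact: (measurableT_comp mw mg).
rewrite (@leb_affine _ _ (fun x => (w x ^+ 2)%:E) delta delta y.1 y.2)//.
- by apply: lte_mul_pinfty; rewrite ?lee_fin// mulr_ge0// ?invr_ge0 ?exprn_ge0// ltW.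
- by apply/measurable_EFinP; exact: measurable_funX.
- by move=> x; rewrite lee_fin sqr_ge0.
Qed.

Lemma measurable_shrink_dilate (R : realType) d (delta : R) :
  measurable_fun setT (fun p : pt R d * pt R d => shrink delta p.1 + delta *: p.2).
Proof.
apply: measurable_fun_pair => /=.
  apply: measurable_fun_rVP => i /=; under eq_fun do rewrite !mxE.
  apply: measurable_funD.
    exact: (measurableT_comp (measurable_rV_coord i) (measurableT_comp measurable_fst measurable_fst)).
  apply: measurable_funM => //.
  exact: (measurableT_comp (measurable_rV_coord i) (measurableT_comp measurable_fst measurable_snd)).
apply: measurable_funD; apply: measurable_funM => //.
  exact: (measurableT_comp measurable_snd measurable_fst).
exact: (measurableT_comp measurable_snd measurable_snd).
Qed.

Lemma measurable_mol (R : realType) d (delta : R) (w : pt R d -> R) :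
  measurable_fun setT w -> measurable_fun setT (mol delta w).
Proof.
move=> mw; pose F (p : pt R d * pt R d) := (ker p.2 * w (shrink delta p.1 + delta *: p.2))%:E.
have mF : measurable_fun setT F.
  apply/measurable_EFinP; apply: measurable_funM.
    exact: (measurableT_comp (L2_measurable (@ker_L2 R d)) measurable_snd).
  exact: (measurableT_comp mw (@measurable_shrink_dilate _ _ _)).
have mI : measurable_fun setT (fun x => \int[leb]_z F (x, z))%E.
  under eq_fun do rewrite integralE.
  apply: emeasurable_funB.
    apply: (@measurable_int_snd _ _ _ _ _ (@leb R d) (fun x z => (fun z => F (x, z))^\+ z)%E) => //.
    apply: (eq_measurable_fun (F^\+)%E); last exact: measurable_funepos.
    by move=> -[x z] _ /=; rewrite !funeposE.
  apply: (@measurable_int_snd _ _ _ _ _ (@leb R d) (fun x z => (fun z => F (x, z))^\- z)%E) => //.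
  apply: (eq_measurable_fun (F^\-)%E); last exact: measurable_funeneg.
  by move=> -[x z] _ /=; rewrite !funenegE.
exact: (measurableT_comp (@fine_measurable R setT measurableT) mI).
Qed.

(* Tonelli and the change of variables [y = shrink delta x + delta *: z]. *)
Lemma mol_convolution_bound (R : realType) d (delta : R) (q : pt R d -> R) (f : pt R d -> R)
    (g : pt R d -> R) : 0 < delta -> delta < 1 ->
  L2 setT q -> (exists M : R, forall x, `|q x| <= M) ->
  (@leb R d).-integrable setT (EFin \o q) -> L2 setT f -> measurable_fun setT g ->
  (forall x, `|g x| <= `|\int[leb]_z (q z * f (shrink delta x + delta *: z))|) ->
  (\int[leb]_x (g x ^+ 2)%:E <=
    ((\int[leb]_x `|q x|) ^+ 2 / (1 - delta))%:E * \int[leb]_x (f x ^+ 2)%:E)%E.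
Proof.
move=> d0 d1 q2 bq qi f2 mg gle; have d1' : 0 < 1 - delta by lra.
have mq := L2_measurable q2; have mf := L2_measurable f2.
pose A := \int[leb]_x `|q x|; have A0 : 0 <= A by exact: Rintegral_ge0.
pose H (p : pt R d * pt R d) := (`|q p.2| * f (shrink delta p.1 + delta *: p.2) ^+ 2)%:E.
have mH : measurable_fun setT H.
  apply/measurable_EFinP; apply: measurable_funM.
    by apply: (measurableT_comp (@normr_measurable R setT)); exact: (measurableT_comp mq measurable_snd).
  by apply: measurable_funX; exact: (measurableT_comp mf (@measurable_shrink_dilate _ _ _)).
have H0 p : (0 <= H p)%E by rewrite lee_fin mulr_ge0 ?sqr_ge0.
have mHx : measurable_fun setT (fun x => \int[leb]_z H (x, z))%E.
  by apply: (@measurable_int_snd _ _ _ _ _ (@leb R d) (fun x z => H (x, z))) => //; apply: (eq_measurable_fun H) => // -[].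
apply: (@le_trans _ _ (\int[leb]_x (A%:E * \int[leb]_z H (x, z)))%E).
  apply: ge0_le_integral => //.
  - by move=> x _; rewrite lee_fin sqr_ge0.
  - by apply/measurable_EFinP; exact: measurable_funX.
  - exact: measurable_funeM.
  move=> x _; apply: le_trans (weighted_cauchy_schwarz q2 (L2_dilate (shrink delta x) d0 f2) bq qi).
  by rewrite lee_fin -[leLHS]real_normK ?num_real// -[leRHS]real_normK ?num_real// ler_pXn2r ?nnegrE.
rewrite ge0_integralZT//; last by move=> x; apply: integral_ge0.
rewrite (@fubini_tonelli _ _ _ _ _ (@leb R d) (@leb R d) (fun p => H p))//.
have inner z : (\int[leb]_x H (x, z) = ((1 - delta)^-1 * `|q z|)%:E * \int[leb]_x (f x ^+ 2)%:E)%E.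
  rewrite /H /=; under eq_integral do rewrite EFinM.
  rewrite ge0_integralZT; last 3 first.
  - apply/measurable_EFinP; apply: measurable_funX.
    exact: (measurableT_comp mf (measurableT_comp (@measurable_shrink_dilate _ _ _) (measurable_pair2 z))).
  - by move=> x; rewrite lee_fin sqr_ge0.
  - by [].
  have := @leb_affine R d (fun x => (f x ^+ 2)%:E) 1 (1 - delta) (delta *: z).1 (delta *: z).2 ltr01 d1'.
  rewrite expr1n invr1 mul1r mulrC EFinM -muleA => <- //.
  - by congr (_ * _)%E; apply: eq_integral => x _; rewrite scale1r.
  - by apply/measurable_EFinP; exact: measurable_funX.
  - by move=> x; rewrite lee_fin sqr_ge0.
under eq_integral do rewrite inner.
have [C0 CE] : 0 <= ip f f /\ (\int[leb]_x (f x ^+ 2)%:E = (ip f f)%:E)%E by split; [exact: ip_ge0|exact: ipE].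
rewrite CE; under eq_integral do rewrite -EFinM -mulrA mulrC -mulrA mulrC EFinM.
rewrite ge0_integralZT; last 3 first.
- by apply/measurable_EFinP; apply: (measurableT_comp (@normr_measurable R setT)).
- by move=> x; rewrite lee_fin.
- by rewrite mulr_ge0// invr_ge0 ltW.
have -> : (\int[leb]_x `|q x|%:E = A%:E)%E.
  by rewrite /A /Rintegral fineK//; exact: (integrable_fin_num measurableT (integrable_abse qi)).
rewrite -!EFinM lee_fin le_eqVlt; apply/orP; left; apply/eqP.
by rewrite -/A; field; rewrite lt0r_neq0.
Qed.

Lemma mol_L2_bound (R : realType) d (delta : R) (w : pt R d -> R) : 0 < delta -> delta < 1 ->
  L2 setT w ->
  (\int[leb]_x (mol delta w x ^+ 2)%:E <= ((1 - delta)^-1 * ip w w)%:E)%E.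
Proof.
move=> d0 d1 w2.
have := mol_convolution_bound d0 d1 (@ker_L2 R d) (@ker_bounded R d) (@ker_integrable R d) w2
  (measurable_mol delta (L2_measurable w2)) (fun x => lexx _).
rewrite (ipE w2) -EFinM (_ : \int[leb]_x `|ker x| = 1).
  by rewrite expr1n mul1r.
by rewrite -(@ker_mass R d); apply: eq_Rintegral => x _; rewrite ger0_norm// ker_ge0.
Qed.

Lemma mol_L2 (R : realType) d (delta : R) (w : pt R d -> R) : 0 < delta -> delta < 1 ->
  L2 setT w -> L2 setT (mol delta w).
Proof.
move=> d0 d1 w2; split; first exact: measurable_mol (L2_measurable w2).
exact: le_lt_trans (mol_L2_bound d0 d1 w2) (ltry _).
Qed.

Lemma mol_linB (R : realType) d (delta : R) (w f : pt R d -> R) x : 0 < delta ->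
  L2 setT w -> L2 setT f ->
  mol delta (fun x => w x - f x) x = mol delta w x - mol delta f x.
Proof.
move=> d0 w2 f2; rewrite /mol -RintegralB//.
- by apply: eq_Rintegral => z _; rewrite mulrBr.
- by apply: L2M_integrable => //; [exact: ker_L2|exact: L2_dilate].
- by apply: L2M_integrable => //; [exact: ker_L2|exact: L2_dilate].
Qed.

Lemma shrink_norm_le (R : realType) d (delta : R) (z : pt R d) : 0 < delta -> delta < 1 ->
  `|shrink delta z| <= `|z|.
Proof.
move=> d0 d1; rewrite !prod_normE /= ge_max le_max lexx /= le_max normrM.
by apply/orP; right; rewrite ler_piMl// ger0_norm; lra.
Qed.

(** A substitution moves the increment from [w] to the kernel, where [ker_L1_lip] controls it. *)
Lemma mol_translate (R : realType) d (delta : R) (w : pt R d -> R) (x z : pt R d) : 0 < delta ->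
  L2 setT w ->
  mol delta w (x + z) - mol delta w x =
  \int[leb]_y ((ker (y + (- delta^-1) *: shrink delta z) - ker y) * w (shrink delta x + delta *: y)).
Proof.
move=> d0 w2; set a := (- delta^-1) *: shrink delta z.
have k2 := @ker_L2 R d.
have ka2 : L2 setT (fun y : pt R d => ker (y + a)) by exact: L2_translate.
have f2 := L2_dilate (shrink delta x) d0 w2.
under [RHS]eq_Rintegral do rewrite mulrBl.
rewrite RintegralB//; try exact: L2M_integrable.
congr (_ - _); rewrite /mol.
have fz2 := L2_dilate (shrink delta (x + z)) d0 w2.
rewrite -(@Rleb_translate _ _ (fun y => ker y * w (shrink delta (x + z) + delta *: y)) a); last first.
  by apply: measurable_funM; [exact: L2_measurable k2|exact: L2_measurable fz2].
apply: eq_Rintegral => y _; congr (_ * w _).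
rewrite shrinkD scalerDr /a scalerA mulrN divff ?lt0r_neq0// scaleN1r.
by rewrite addrACA subrr addr0.
Qed.

(** The constant grows like [delta^-2], which is harmless as [delta] is fixed before [eps] tends to
    0. *)
Lemma mol_lipschitz (R : realType) d (delta : R) (w : pt R d -> R) : 0 < delta -> delta < 1 ->
  L2 setT w -> exists2 K : R, 0 <= K & forall z : pt R d,
  (\int[leb]_x ((mol delta w (x + z) - mol delta w x) ^+ 2)%:E <= (K * `|z| ^+ 2)%:E)%E.
Proof.
move=> d0 d1 w2; have [C C0 CP] := @ker_L1_lip R d.
have d1' : 0 < 1 - delta by lra.
exists ((C / delta) ^+ 2 / (1 - delta) * ip w w).
  by rewrite mulr_ge0 ?ip_ge0// divr_ge0 ?sqr_ge0// ltW.
move=> z; set a := (- delta^-1) *: shrink delta z.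
have k2 := @ker_L2 R d.
have ka2 : L2 setT (fun y : pt R d => ker (y + a)) by exact: L2_translate.
have q2 := L2B measurableT ka2 k2.
have [M kM] := @ker_bounded R d.
have qb : exists M : R, forall y : pt R d, `|ker (y + a) - ker y| <= M.
  by exists (M + M) => y; rewrite (le_trans (ler_normB _ _))// lerD.
have qi : (@leb R d).-integrable setT (EFin \o (fun y => ker (y + a) - ker y)).
  by apply: integrable_subr => //; [exact: integrable_translate (@ker_integrable R d)|exact: ker_integrable].
have m2 := mol_L2 d0 d1 w2; have mz2 := L2_translate z m2.
have mg : measurable_fun setT (fun x : pt R d => mol delta w (x + z) - mol delta w x).
  by apply: measurable_funB; [exact: L2_measurable mz2|exact: L2_measurable m2].
have gle x : `|mol delta w (x + z) - mol delta w x| <=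
    `|\int[leb]_y ((ker (y + a) - ker y) * w (shrink delta x + delta *: y))|.
  by rewrite mol_translate.
apply: le_trans (mol_convolution_bound d0 d1 q2 qb qi w2 mg gle) _.
rewrite (ipE w2) -EFinM lee_fin.
have -> : (C / delta) ^+ 2 / (1 - delta) * ip w w * `|z| ^+ 2 = (C / delta * `|z|) ^+ 2 / (1 - delta) * ip w w.
  by rewrite exprMn; ring.
have A0 : 0 <= \int[leb]_y `|ker (y + a) - ker y| by exact: Rintegral_ge0.
have B0 : 0 <= C / delta * `|z| by rewrite mulr_ge0// divr_ge0// ltW.
rewrite ler_wpM2r ?ip_ge0// ler_wpM2r ?invr_ge0 ?(ltW d1')// ler_pXn2r ?nnegrE//.
apply: le_trans (CP a) _; rewrite -mulrA ler_wpM2l// normrZ normrN gtr0_norm ?invr_gt0//.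
by rewrite ler_wpM2l ?invr_ge0 ?(ltW d0)// shrink_norm_le.
Qed.

(** A vertical increment of the mollified function is an average of vertical increments of [v], by
    the shrunk amount [(1 - delta) h]. The factor is the Jacobian of [shrink]. *)
Lemma corr_mol_vertical (R : realType) d (omega : set 'rV[R]_d.-1) (delta h : R) (v : pt R d -> R) :
  0 < delta -> delta < 1 -> measurable omega -> L2 (cylinder omega 1) v ->
  (corr (cylinder omega 1) (mol delta (v \_ (cylinder omega 1))) (0, h)%R <=
    ((1 - delta)^-1)%:E * corr (cylinder omega 1) v (0, (1 - delta) * h)%R)%E.
Proof.
move=> d0 d1 mo v2; set D := cylinder omega 1; have mD : measurable D by exact: measurable_cylinder.
have d1' : 0 < 1 - delta by lra.
pose w := v \_ D; have w2 : L2 setT w by exact: L2_restrict.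
pose z' : pt R d := (0, (1 - delta) * h).
have [g2 gE] := corr_nrm2 z' mD v2; set g := (fun y => _) in g2 gE.
rewrite gE -(ipE g2).
have m2 := mol_L2 d0 d1 w2.
have [c2 cE] := corr_nrm2 (0, h) mD (L2S measurableT mD (@subsetT _ D) m2).
rewrite cE -(ipE c2).
have key (x : pt R d) : `|\1_D x * \1_D (x + (0, h)) * (mol delta w (x + (0, h)) - mol delta w x)| <=
    `|\int[leb]_y (ker y * g (shrink delta x + delta *: y))|.
  case: (pselect (D x)) => [Dx|nDx]; last by rewrite indicE memNset// !mul0r normr0.
  case: (pselect (D (x + (0, h)))) => [Dxh|nDxh]; last first.
    by rewrite [X in _ * X * _]indicE memNset// mulr0 mul0r normr0.
  rewrite !indicE !mem_set// !mul1r /mol -RintegralB//; last 2 first.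
  - by apply: L2M_integrable => //; [exact: ker_L2|exact: L2_dilate].
  - by apply: L2M_integrable => //; [exact: ker_L2|exact: L2_dilate].
  rewrite le_eqVlt; apply/orP; left; apply/eqP; congr (`|_|); apply: eq_Rintegral => y _.
  rewrite -mulrBr; have [->|ky] := eqVneq (ker y) 0; first by rewrite !mul0r.
  congr (_ * _); have [/andP[y0 y1] _] := ker_support ky.
  have -> : shrink delta (x + (0, h)) + delta *: y = shrink delta x + delta *: y + z'.
    rewrite shrinkD addrAC; congr (_ + _).
  set p := shrink delta x + delta *: y.
  move: Dx Dxh => [x1 x2] [xh1 xh2].
  have {}x2 : 0 < x.2 < 1 by move: x2; rewrite /= in_itv.
  have {}xh2 : 0 < x.2 + h < 1 by move: xh2; rewrite /= in_itv.
  have conv (a b : R) : 0 < a < 1 -> 0 < b < 1 -> 0 < (1 - delta) * a + delta * b < 1.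
    move=> /andP[a0 a1] /andP[b0 b1]; apply/andP; split; first by rewrite addr_gt0// mulr_gt0.
    have h1 : (1 - delta) * a < 1 - delta by rewrite gtr_pMr.
    have h2 : delta * b < delta by rewrite gtr_pMr.
    lra.
  have y01 : 0 < y.2 < 1 by rewrite y0 y1.
  have p2 : 0 < p.2 < 1 by exact: conv.
  have pz2 : 0 < (p + z').2 < 1.
    rewrite (_ : (p + z').2 = (1 - delta) * (x.2 + h) + delta * y.2); first exact: conv.
    by rewrite /p /z' /= /GRing.scale /=; ring.
  have pz1 : (p + z').1 = p.1 by rewrite /z' /= addr0.
  have [op|nop] := pselect (omega p.1).
    have Dp : D p by split => //=; rewrite in_itv.
    have Dpz : D (p + z') by split; [rewrite pz1|rewrite /= in_itv].
    by rewrite /g /w !patchE !indicE !mem_set// !mul1r.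
  (* Beside the cylinder both ends of the increment are outside, since it keeps the horizontal
     position: the zero extension creates no vertical jump. *)
  have nDp : ~ D p by case.
  have nDpz : ~ D (p + z') by case; rewrite pz1.
  by rewrite /g /w !patchE !indicE !memNset// !mul0r subrr.
have := mol_convolution_bound d0 d1 (@ker_L2 R d) (@ker_bounded R d) (@ker_integrable R d) g2
  (L2_measurable c2) key.
rewrite (_ : \int[leb]_x `|ker x| = 1); first by rewrite expr1n mul1r.
by rewrite -(@ker_mass R d); apply: eq_Rintegral => x _; rewrite ger0_norm// ker_ge0.
Qed.

(** On a test function the error is uniformly small, because the evaluation points move by at most
    [2 delta]; density and the [L^2] bound on [mol] reduce the general case to this one. *)
Lemma mol_cvg (R : realType) d (omega : set 'rV[R]_d.-1) (v : pt R d -> R) (e : R) :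
  open omega -> bounded_set omega -> L2 (cylinder omega 1) v -> 0 < e ->
  exists2 r : R, 0 < r & forall delta, 0 < delta -> delta < r -> delta < 2^-1 ->
  (\int[leb]_(x in cylinder omega 1)
     ((mol delta (v \_ (cylinder omega 1)) x - v x) ^+ 2)%:E <= e%:E)%E.
Proof.
move=> oo bo v2 e0; have mo : measurable omega by exact: open_measurable_rV.
set D := cylinder omega 1; have mD : measurable D by exact: measurable_cylinder.
have oD : open D by exact: open_cylinder.
pose a := fine (leb D); have aE : leb D = a%:E.
  by rewrite /a fineK// ge0_fin_numE ?measure_ge0// leb_cylinder_lty.
have a0 : 0 <= a by rewrite /a fine_ge0// measure_ge0.
pose w := v \_ D; have w2 : L2 setT w by exact: L2_restrict.
have w0 x : ~ D x -> w x = 0 by move=> nx; rewrite /w patchE memNset.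
(* Budget: the two terms in [f] amount to [(6 + 3) ip f f <= e / 2], the uniform error to
   [3 b^2 a <= e / 2]. *)
have e1 : 0 < e / 18 by rewrite divr_gt0.
have [phi tphi phiw] := test_dense oD w2 w0 e1.
have phi2 := test_L2 tphi; have cphi := test_continuous tphi.
have [_ cS SD] := tphi.
pose b := Num.sqrt (e / (6 * (a + 1))).
have b0 : 0 < b by rewrite sqrtr_gt0 divr_gt0// mulr_gt0// ltr_wpDl.
have [r r0 rP] := compact_support_unif cS cphi (fun x => @test_eq0 _ _ D phi x tphi) b0.
exists (r / 2); first by rewrite divr_gt0.
move=> delta d0 dr dh.
have d1 : delta < 1 by apply: lt_trans dh _; rewrite invf_lt1// ltr1n.
have d1' : 0 < 1 - delta by rewrite subr_gt0.
pose f x := w x - phi x; have f2 : L2 setT f by exact: L2B.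
have fE : ip f f < e / 18.
  rewrite (_ : ip f f = ip (fun x => phi x - w x) (fun x => phi x - w x))//.
  by apply: eq_Rintegral => x _; rewrite /f -!expr2 -sqrrN opprB.
have mf2 := mol_L2 d0 d1 f2; have mp2 := mol_L2 d0 d1 phi2; have mw2 := mol_L2 d0 d1 w2.
have unif x : D x -> (mol delta phi x - phi x) ^+ 2 <= b ^+ 2.
  move=> [x1 x2]; have {}x2 : 0 < x.2 < 1 by move: x2; rewrite /= in_itv.
  rewrite -[leLHS]real_normK ?num_real// ler_pXn2r ?nnegrE ?(ltW b0)//.
  have kd2 := L2_dilate (shrink delta x) d0 phi2.
  have ki := L2M_integrable measurableT (@ker_L2 R d) kd2.
  rewrite -[phi x]mul1r -(@ker_mass R d) -RintegralZr//; last exact: ker_integrable.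
  have kpi : (@leb R d).-integrable setT (EFin \o (fun z => ker z * phi x)).
    rewrite (_ : (fun z => _) = fun z => phi x * ker z); last by apply/funext => z; rewrite mulrC.
    by apply: integrable_mulrl => //; exact: ker_integrable.
  rewrite /mol -RintegralB//.
  have di := integrable_subr measurableT ki kpi.
  apply: le_trans (le_normr_Rintegral measurableT di) _.
  rewrite -[leRHS]mulr1 -(@ker_mass R d) -RintegralZl//; last exact: ker_integrable.
  apply: le_Rintegral => //.
  - exact: (integrable_abse di).
  - by apply: integrable_mulrl => //; exact: ker_integrable.
  move=> z _; rewrite -mulrBr normrM ger0_norm ?ker_ge0// mulrC.
  have [->|kz] := eqVneq (ker z) 0; first by rewrite !mulr0.
  rewrite ler_wpM2r ?ker_ge0//; have [_ z1] := ker_support kz.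
  rewrite (_ : shrink delta x + delta *: z = x + (delta *: z + (0, - delta * x.2))).
    apply: rP; apply: le_lt_trans (ler_normD _ _) _.
    rewrite [ltRHS](splitr r); apply: ltr_leD.
      by rewrite normrZ gtr0_norm//; apply: le_lt_trans dr; rewrite ler_piMr// ltW.
    rewrite prod_normE /= normr0 ge_max; apply/andP; split; first by rewrite ltW// divr_gt0.
    rewrite mulNr normrN normrM gtr0_norm// gtr0_norm; last by case/andP: x2.
    by apply: ltW; apply: le_lt_trans dr; rewrite ler_piMr ?(ltW d0)//; case/andP: x2 => _ /ltW.
  rewrite [RHS]addrCA [LHS]addrC; congr (_ + _).
  by rewrite /shrink; congr pair => /=; [rewrite addr0|ring].
pose F (x : pt R d) := 3 * mol delta f x ^+ 2 + 3 * (\1_D x * b ^+ 2) + 3 * f x ^+ 2.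
have m1 : measurable_fun setT (fun x => (3 * mol delta f x ^+ 2)%:E).
  by apply/measurable_EFinP; apply: measurable_funM => //; apply: measurable_funX; exact: L2_measurable mf2.
have m2 : measurable_fun setT (fun x : pt R d => (3 * (\1_D x * b ^+ 2))%:E).
  by apply/measurable_EFinP; apply: measurable_funM => //; apply: measurable_funM => //; exact: measurable_indicT.
have m3 : measurable_fun setT (fun x => (3 * f x ^+ 2)%:E).
  by apply/measurable_EFinP; apply: measurable_funM => //; apply: measurable_funX; exact: L2_measurable f2.
have p1 x : (0 <= (3 * mol delta f x ^+ 2)%:E)%E by rewrite lee_fin mulr_ge0 ?sqr_ge0.
have p2 x : (0 <= (3 * (\1_D x * b ^+ 2))%:E)%E.
  by rewrite lee_fin; apply: mulr_ge0 => //; apply: mulr_ge0 => //; exact: sqr_ge0.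
have p3 x : (0 <= (3 * f x ^+ 2)%:E)%E by rewrite lee_fin mulr_ge0 ?sqr_ge0.
apply: (@le_trans _ _ (\int[leb]_x ((3 * mol delta f x ^+ 2)%:E + (3 * (\1_D x * b ^+ 2))%:E + (3 * f x ^+ 2)%:E))%E).
  rewrite integral_mkcond; apply: ge0_le_integral => //.
  - by move=> x _; rewrite patchE; case: ifP => // _; rewrite lee_fin sqr_ge0.
  - apply/(measurable_restrictT (fun x => ((mol delta w x - v x) ^+ 2)%:E)) => //.
    apply/measurable_EFinP; apply: measurable_funX; apply: measurable_funB; last exact: L2_measurable v2.
    by apply: measurable_funTS; exact: L2_measurable mw2.
  - by apply: emeasurable_funD => //; exact: emeasurable_funD.
  move=> x _; rewrite patchE; case: ifPn => [|_]; last by rewrite !adde_ge0.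
  rewrite inE => Dx; rewrite -!EFinD lee_fin.
  have -> : v x = w x by rewrite /w patchE mem_set.
  have -> : mol delta w x - w x = mol delta f x + (mol delta phi x - phi x) - f x.
    by rewrite /f mol_linB//; ring.
  have := unif x Dx; rewrite indicE mem_set// mul1r.
  move: (mol delta f x) (mol delta phi x - phi x) (f x) => A B C.
  have := sqr_ge0 (A - B); have := sqr_ge0 (A + C); have := sqr_ge0 (B + C); nra.
rewrite ge0_integralD//; last by apply: emeasurable_funD.
  rewrite ge0_integralD//.
  have -> : (\int[leb]_x (3 * mol delta f x ^+ 2)%:E = 3%:E * \int[leb]_x (mol delta f x ^+ 2)%:E)%E.
    rewrite -ge0_integralZT//; first by apply/measurable_EFinP; apply: measurable_funX; exact: L2_measurable mf2.
    by move=> x; rewrite lee_fin sqr_ge0.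
  have -> : (\int[leb]_x (3 * f x ^+ 2)%:E = 3%:E * \int[leb]_x (f x ^+ 2)%:E)%E.
    rewrite -ge0_integralZT//; first by apply/measurable_EFinP; apply: measurable_funX; exact: L2_measurable f2.
    by move=> x; rewrite lee_fin sqr_ge0.
  have -> : (\int[leb]_x (3 * (\1_D x * b ^+ 2))%:E = (3 * b ^+ 2)%:E * leb D)%E.
    rewrite -[in RHS](setIT D) -integral_indic// -ge0_integralZT//.
    - by apply: eq_integral => x _; rewrite -EFinM; congr EFin; ring.
    - by apply/measurable_EFinP; exact: measurable_indicT.
    - by rewrite mulr_ge0 ?sqr_ge0.
  rewrite (ipE f2) (ipE mf2) aE -!EFinM -!EFinD lee_fin.
  have H1 : ip (mol delta f) (mol delta f) <= 2 * ip f f.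
    rewrite -lee_fin -(ipE mf2); apply: le_trans (mol_L2_bound d0 d1 f2) _.
    rewrite lee_fin ler_wpM2r ?ip_ge0// -[leRHS]invrK lef_pV2 ?posrE ?invr_gt0//.
    by move: dh; lra.
  have H2 : b ^+ 2 * a <= e / 6.
    rewrite /b sqr_sqrtr; last by rewrite divr_ge0 ?(ltW e0)// mulr_ge0// addr_ge0.
    have a1 : 0 < a + 1 by rewrite ltr_wpDl.
    rewrite (_ : _ * a = e / 6 * (a / (a + 1))); last by field; rewrite lt0r_neq0.
    by rewrite ler_piMr ?divr_ge0 ?(ltW e0)// ler_pdivrMr// mul1r lerDl.
  have := ip_ge0 f; nra.
by move=> x _; rewrite adde_ge0.
Qed.

Lemma coord_sqr_le_dotp (R : realType) n (x : 'rV[R]_n) : `|x| ^+ 2 <= dotp x x.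
Proof.
have H : `|x| <= Num.sqrt (dotp x x).
  apply: rV_norm_le => [|i]; first exact: sqrtr_ge0.
  rewrite -sqrtr_sqr ler_wsqrtr// /dotp (bigD1 i)//= -expr2 lerDl.
  by apply: sumr_ge0 => j _; rewrite -expr2 sqr_ge0.
rewrite -(sqr_sqrtr (dotp_ge0 x)) ler_pXn2r ?nnegrE ?sqrtr_ge0//.
Qed.

Lemma dotpZ (R : realType) n (c : R) (x : 'rV[R]_n) : dotp (c *: x) (c *: x) = c ^+ 2 * dotp x x.
Proof. by rewrite /dotp mulr_sumr; apply: eq_bigr => i _; rewrite !mxE; ring. Qed.

(** Young's inequality along the path [x], [x + (0, h)], [x + (z, h)]. The large factor goes to the
    horizontal part, which will carry a power of [eps]. *)
Lemma corr_split (R : realType) d (omega : set 'rV[R]_d.-1) (V : pt R d -> R) (theta : R)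
    (z : 'rV[R]_d.-1) (h : R) : 0 < theta -> measurable omega -> L2 setT V ->
  (corr (cylinder omega 1) V (z, h)%R <= (1 + theta)%:E * corr (cylinder omega 1) V (0, h)%R +
    (1 + theta^-1)%:E * \int[leb]_x ((V (x + (z, 0)) - V x) ^+ 2)%:E)%E.
Proof.
move=> t0 mo V2; set D := cylinder omega 1; have mD : measurable D by exact: measurable_cylinder.
have mV := L2_measurable V2; have ti : 0 < theta^-1 by rewrite invr_gt0.
pose G (x : pt R d) := ((V (x + (z, 0)) - V x) ^+ 2)%:E.
have mtr (p : pt R d) : measurable_fun setT (fun y : pt R d => V (y + p)).
  by apply: (measurableT_comp mV); exact: measurable_ptDr.
have mG : measurable_fun setT G.
  by apply/measurable_EFinP; apply: measurable_funX; apply: measurable_funB.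
have G0 x : (0 <= G x)%E by rewrite lee_fin sqr_ge0.
rewrite -(leb_translate (0, h) mG G0).
have mind (p : pt R d) : measurable_fun setT (fun y : pt R d => (\1_D y * \1_D (y + p) * (V (y + p) - V y) ^+ 2)%:E).
  exact: (measurableT_comp (measurable_corr2 mD mV) (measurable_pair2 p)).
rewrite /corr -ge0_integralZT//; last 2 first.
- by move=> y; rewrite lee_fin mulr_ge0 ?sqr_ge0// mulr_ge0.
- by rewrite addr_ge0// ltW.
have mGt : measurable_fun setT (fun x : pt R d => G (x + (0, h))).
  by apply: (measurableT_comp mG); exact: measurable_ptDr.
rewrite -[X in (_ <= _ + X)%E]ge0_integralZT//; last by rewrite addr_ge0// ltW.
rewrite -ge0_integralD//; last 4 first.
- by move=> y _; rewrite mule_ge0// lee_fin ?addr_ge0 ?(ltW t0)// mulr_ge0 ?sqr_ge0// mulr_ge0.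
- by apply: measurable_funeM; exact: mind.
- by move=> y _; rewrite mule_ge0// lee_fin addr_ge0// ltW.
- exact: measurable_funeM.
apply: ge0_le_integral => //.
- by move=> y _; rewrite lee_fin mulr_ge0 ?sqr_ge0// mulr_ge0.
- by apply: emeasurable_funD; apply: measurable_funeM => //; exact: mind.
move=> y _; rewrite /G -!EFinM -EFinD lee_fin.
have p0 : 0 <= (1 + theta) * (\1_D y * \1_D (y + (0, h)) * (V (y + (0, h)) - V y) ^+ 2).
  by rewrite mulr_ge0 ?addr_ge0 ?(ltW t0)// mulr_ge0 ?sqr_ge0// mulr_ge0.
have p1 : 0 <= (1 + theta^-1) * (V (y + (0, h) + (z, 0)) - V (y + (0, h))) ^+ 2.
  by rewrite mulr_ge0 ?sqr_ge0// addr_ge0// ltW.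
have [Dy|nDy] := pselect (D y); last first.
  by rewrite [X in X * _ * _ <= _]indicE memNset// !mul0r addr_ge0.
have [Dyz|nDyz] := pselect (D (y + (z, h))); last first.
  by rewrite [X in _ * X * _ <= _]indicE memNset// mulr0 mul0r addr_ge0.
(* The intermediate point has the horizontal part of [y] and the height of [y + (z, h)]; the product
   form of the cylinder puts it inside. *)
have Dyh : D (y + (0, h)).
  by split; [case: Dy => + _ /=; rewrite addr0|case: Dyz].
rewrite !indicE !mem_set// !mul1r.
have -> : y + (0, h) + (z, 0) = y + (z, h) :> pt R d.
  by rewrite -addrA; congr (y + _); congr pair => /=; rewrite ?add0r ?addr0.
set A := V (y + (z, h)); set B := V (y + (0, h)); set C := V y.
have -> : A - C = (B - C) + (A - B) by ring.
move: (B - C) (A - B) => b a.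
have H : 0 <= theta * b ^+ 2 - 2 * a * b + theta^-1 * a ^+ 2.
  have -> : theta * b ^+ 2 - 2 * a * b + theta^-1 * a ^+ 2 = theta * (b - theta^-1 * a) ^+ 2.
    by field; rewrite lt0r_neq0.
  by rewrite mulr_ge0 ?sqr_ge0// ltW.
by lra.
Qed.

(** Interpolates between the Lipschitz bound for [|z| <= 1] and [4 |V|^2] beyond. The full power
    [|z|^2] need not be integrable against the weight in [xi], whereas a power [|z|^(2 a)] with [a]
    close to [s] is. *)
Lemma tangential_bound (R : realType) d (V : pt R d -> R) (K a : R) (z : 'rV[R]_d.-1) :
  L2 setT V -> 0 <= K -> 0 < a <= 1 ->
  (forall z : pt R d, (\int[leb]_x ((V (x + z) - V x) ^+ 2)%:E <= (K * `|z| ^+ 2)%:E)%E) ->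
  (\int[leb]_x ((V (x + (z, 0)) - V x) ^+ 2)%:E <= ((K + 4 * ip V V) * dotp z z `^ a)%:E)%E.
Proof.
move=> V2 K0 /andP[a0 a1] HK.
have N0 := ip_ge0 V.
have Vz2 := L2_translate ((z, 0) : pt R d) V2.
have [z1|z1] := leP (dotp z z) 1.
  apply: le_trans (HK (z, 0)) _; rewrite lee_fin.
  apply: (@le_trans _ _ (K * dotp z z `^ a)); last by rewrite ler_wpM2r ?powR_ge0// lerDl mulr_ge0.
  rewrite ler_wpM2l// prod_normE /= normr0.
  have -> : Num.max `|z| 0 = `|z| by apply/max_idPl.
  apply: le_trans (coord_sqr_le_dotp z) _.
  have [->|zn0] := eqVneq (dotp z z) 0; first by rewrite powR_ge0.
  have zp : 0 < dotp z z by rewrite lt_neqAle eq_sym zn0 dotp_ge0.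
  by rewrite -[leLHS]powRr1 ?dotp_ge0// ger_powR// zp z1.
have d2 := L2B measurableT Vz2 V2.
rewrite (ipE d2) nrm2B// lee_fin.
have E : ip (fun x => V (x + (z, 0))) (fun x => V (x + (z, 0))) = ip V V.
  rewrite /ip (@Rleb_translate _ _ (fun x => V x * V x))//.
  by apply: measurable_funM; exact: L2_measurable V2.
rewrite E; have := ip_ge0 (fun x => 1 * V (x + (z, 0)) + 1 * V x); rewrite nrm2_lin// E => H.
have p1 : 1 <= dotp z z `^ a.
  have := @ge0_ler_powR R a (ltW a0) 1 (dotp z z).
  by rewrite !nnegrE powR1 => -> //; [exact: dotp_ge0|exact: ltW].
have h : K + 4 * ip V V <= (K + 4 * ip V V) * dotp z z `^ a by rewrite ler_peMr// addr_ge0// mulr_ge0.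
lra.
Qed.

Lemma corr_height (R : realType) d (omega : set 'rV[R]_d.-1) (V : pt R d -> R) z (h : R) :
  1 <= `|h| -> corr (cylinder omega 1) V (z, h) = 0%E.
Proof.
move=> h1; apply: integral0_eq => y _; congr EFin; rewrite !indicE.
case: (boolP (y \in cylinder omega 1)) => [|_]; last by rewrite !mul0r.
case: (boolP (y + (z, h) \in cylinder omega 1)) => [|_]; last by rewrite mulr0 mul0r.
rewrite !inE => -[_ /=]; rewrite in_itv/= => /andP[a1 a2] [_ /=]; rewrite in_itv/= => /andP[b1 b2].
move: h1; have [h0|h0] := leP 0 h; first by rewrite ger0_norm//; lra.
by rewrite ltr0_norm//; lra.
Qed.

(** The integral is finite because [d - 3 / 4 > d - 1]. The number [3 / 8] is [1 / 4 + 1 / 8]: [a]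
    exceeds [s0] by at most [1 / 4], and [s] falls below [s0] by at most [1 / 8]. *)
Definition tail_const (R : realType) (d : nat) : R := fine (radial_int d.-1 (d%:R / 2 - 3 / 8) : \bar R).

Lemma tail_constE (R : realType) d : (0 < d)%N ->
  (radial_int d.-1 (d%:R / 2 - 3 / 8) = (tail_const R d)%:E)%E.
Proof.
move=> d0; rewrite /tail_const fineK// ge0_fin_numE; last first.
  by apply: integral_ge0 => x _; rewrite lee_fin powR_ge0.
have E : d%:R = d.-1%:R + 1 :> R by rewrite natr1 prednK.
apply: radial_int_lty; move: E; lra.
Qed.

(** The factor [|xi|^(2 a)] of the tangential bound is absorbed into the weight, whose decay remains
    at least that of [tail_const] since [s - a >= - 3 / 8]. *)
Lemma slice_upper (R : realType) d (s eps theta a K h : R) (omega : set 'rV[R]_d.-1) (V : pt R d -> R) :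
  (0 < d)%N -> 0 < eps -> 0 < theta -> 0 < a <= 1 -> - (3 / 8) <= s - a -> measurable omega -> L2 setT V ->
  0 <= K ->
  (forall z : pt R d, (\int[leb]_x ((V (x + z) - V x) ^+ 2)%:E <= (K * `|z| ^+ 2)%:E)%E) ->
  (slice s eps omega V h <= (1 + theta)%:E * (@Csd R d s * corr (cylinder omega 1) V (0, h)%R) +
    ((1 + theta^-1) * (K + 4 * ip V V) * (eps * `|h|) `^ (2 * a) * tail_const R d)%:E)%E.
Proof.
move=> d0 e0 t0 a01 sa mo V2 K0 HK.
have ti : 0 < theta^-1 by rewrite invr_gt0.
have N0 := ip_ge0 V.
set c := (1 + theta^-1) * (K + 4 * ip V V) * (eps * `|h|) `^ (2 * a).
have c0 : 0 <= c by rewrite !mulr_ge0 ?powR_ge0// ?addr_ge0 ?(ltW ti)// mulr_ge0.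
pose W (xi : 'rV[R]_d.-1) := ((1 + dotp xi xi) `^ (- (d%:R / 2 - 3 / 8)))%:E.
have mW : measurable_fun setT W by exact: measurable_radial.
have W0 xi : (0 <= W xi)%E by rewrite lee_fin powR_ge0.
rewrite EFinM -(tail_constE R d0) /radial_int -/W -ge0_integralZT//.
have mwt : measurable_fun setT (fun xi : 'rV[R]_d.-1 => (wt s xi)%:E).
  by apply/measurable_EFinP; exact: measurable_wt.
have wt0 (xi : 'rV[R]_d.-1) : (0 <= (wt s xi)%:E)%E by rewrite lee_fin wt_ge0.
have -> : ((1 + theta)%:E * (@Csd R d s * corr (cylinder omega 1) V (0, h)%R) =
   \int[lebesgue_rV d.-1]_xi ((wt s xi)%:E * ((1 + theta)%:E * corr (cylinder omega 1) V (0, h)%R)))%E.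
  rewrite ge0_integralZr//; first by rewrite CsdE muleCA.
  by rewrite mule_ge0 ?corr_ge0// lee_fin addr_ge0// ltW.
rewrite -ge0_integralD//; last 3 first.
- exact: emeasurable_funM.
- by move=> xi _; rewrite mule_ge0// lee_fin powR_ge0.
- exact: measurable_funeM.
have mV := L2_measurable V2.
apply: ge0_le_integral => //.
- by move=> xi _; rewrite mule_ge0 ?corr_ge0.
- apply: emeasurable_funM => //.
  exact: (measurableT_comp (measurable_corr_slice eps mo (measurable_funTS mV)) (measurable_pair1 h)).
- by apply: emeasurable_funD; [exact: emeasurable_funM|exact: measurable_funeM].
move=> xi _; apply: (@le_trans _ _ ((wt s xi)%:E * ((1 + theta)%:E * corr (cylinder omega 1) V (0, h)%R +
    (1 + theta^-1)%:E * ((K + 4 * ip V V) * dotp ((eps * `|h|) *: xi) ((eps * `|h|) *: xi) `^ a)%:E))%E).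
  apply: lee_wpmul2l => //; apply: le_trans (corr_split _ _ t0 mo V2) _.
  apply: leeD => //; apply: lee_wpmul2l; first by rewrite lee_fin addr_ge0// ltW.
  exact: tangential_bound V2 K0 a01 HK.
rewrite ge0_muleDr; last 2 first.
- by rewrite mule_ge0 ?corr_ge0// lee_fin addr_ge0// ltW.
- by rewrite mule_ge0// lee_fin ?addr_ge0 ?(ltW ti)// mulr_ge0 ?powR_ge0// addr_ge0// mulr_ge0.
apply: leeD => //; rewrite /W -!EFinM lee_fin /c.
have eh : 0 <= eps * `|h| by rewrite mulr_ge0// ltW.
rewrite dotpZ powRM ?sqr_ge0 ?dotp_ge0// -powR_mulrn// -powRrM.
rewrite [X in X <= _](_ : _ = (1 + theta^-1) * (K + 4 * ip V V) * (eps * `|h|) `^ (2 * a) *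
   (wt s xi * dotp xi xi `^ a)); last by ring.
rewrite ler_wpM2l// /wt.
have D0 := dotp_ge0 xi; have D1 : 0 < 1 + dotp xi xi by lra.
have [a0 _] := andP a01.
apply: (@le_trans _ _ ((1 + dotp xi xi) `^ (- (d%:R / 2) - s) * (1 + dotp xi xi) `^ a)).
  by rewrite ler_wpM2l ?powR_ge0// ge0_ler_powR ?nnegrE ?(ltW a0)// ?(ltW D1)// lerDr.
rewrite -powRD; last by rewrite (gt_eqF D1) implybT.
  by rewrite ler_powR; lra.
by move=> xi _; rewrite mule_ge0// mule_ge0 ?corr_ge0// lee_fin addr_ge0// ltW.
Qed.

Definition unscale (R : realType) d (eps : R) (V : pt R d -> R) : pt R d -> R :=
  fun x => V (x.1, eps^-1 * x.2).

Lemma unscaleK (R : realType) d (eps : R) (V : pt R d -> R) : 0 < eps ->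
  scaled eps (unscale eps V) = V.
Proof.
move=> e0; apply/funext => -[x t]; rewrite /scaled /unscale /=.
by rewrite mulrA mulVf ?mul1r// lt0r_neq0.
Qed.

Lemma unscale_L2 (R : realType) d (eps : R) (D : set (pt R d)) (V : pt R d -> R) : 0 < eps ->
  measurable D -> L2 setT V -> L2 D (unscale eps V).
Proof.
move=> e0 mD [mV V2]; apply: (L2S measurableT) => //.
have e1 : 0 < eps^-1 by rewrite invr_gt0.
have mu : measurable_fun setT (unscale eps V).
  apply: (measurableT_comp mV); apply: measurable_fun_pair; first exact: measurable_fst.
  exact: measurable_funM.
split => //.
have mf : measurable_fun setT (fun x => (V x ^+ 2)%:E).
  by apply/measurable_EFinP; exact: measurable_funX.
have f0 x : (0 <= (V x ^+ 2)%:E)%E by rewrite lee_fin sqr_ge0.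
have := leb_affine 0 0 ltr01 e1 mf f0.
rewrite (_ : (\int[leb]_x _)%E = (\int[leb]_x (unscale eps V x ^+ 2)%:E)%E); last first.
  by apply: eq_integral => x _; rewrite /unscale scale1r !addr0.
move=> ->; apply: lte_mul_pinfty => //.
by rewrite lee_fin mulr_ge0// ?invr_ge0 ?exprn_ge0// ltW.
Qed.

(** The interval []-1, 1[] loses nothing, as the cylinder has height 1 ([corr_height]), and it makes
    powers of [|h|] integrable. *)
Definition vint (R : realType) d (s : R) (omega : set 'rV[R]_d.-1) (V : pt R d -> R) : \bar R :=
  (\int[lebR]_(h in `](-1)%R, 1%R[) ((`|h| `^ (- 1 - 2 * s))%:E * corr (cylinder omega 1) V (0, h)%R))%E.

Lemma measurable_corr_vertical (R : realType) d (omega : set 'rV[R]_d.-1) (v : pt R d -> R) :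
  measurable omega -> measurable_fun (cylinder omega 1) v ->
  measurable_fun setT (fun h : R => corr (cylinder omega 1) v (0, h)%R).
Proof.
move=> mo mv; have := measurable_corr_slice 0 mo mv.
move=> /(fun mf => measurableT_comp mf (measurable_pair2 (0 : 'rV[R]_d.-1))).
by apply: eq_measurable_fun => h _ /=; rewrite mul0r scale0r.
Qed.

Lemma measurable_absr_powR (R : realType) (p : R) (D : set R) : measurable_fun D (fun h : R => (`|h| `^ p)%:E).
Proof.
apply/measurable_EFinP/measurable_funTS; apply: measurable_powR_fun; exact: normr_measurable.
Qed.

(** The horizontal remainder leaves the integral of [|h|^(2 (a - s) - 1)] over []-1, 1[], which is
    [1 / (a - s)]; hence [s < a]. When [s0 = 1] and [a = 1], this is compensated by the factor
    [1 - s] of the functional. *)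
Lemma energy_upper (R : realType) d (s : R -> R) (eps theta a K : R) (omega : set 'rV[R]_d.-1) (V : pt R d -> R) :
  (1 < d)%N -> 0 < eps -> 0 < s eps -> 0 < theta -> 0 < a <= 1 -> s eps < a ->
  - (3 / 8) <= s eps - a -> measurable omega -> L2 setT V -> 0 <= K ->
  (forall z : pt R d, (\int[leb]_x ((V (x + z) - V x) ^+ 2)%:E <= (K * `|z| ^+ 2)%:E)%E) ->
  (energy s omega eps (unscale eps V) <= (1 + theta)%:E * (@Csd R d (s eps) * vint (s eps) omega V) +
    ((1 + theta^-1) * (K + 4 * ip V V) * tail_const R d * eps `^ (2 * a) / (a - s eps))%:E)%E.
Proof.
move=> d1 e0 s0 t0 a01 sa sa2 mo V2 K0 HK; have mV := L2_measurable V2.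
have mD := @measurable_cylinder R d omega 1 mo.
have uL2 := unscale_L2 e0 (@measurable_cylinder R d omega eps mo) V2.
have ti : 0 < theta^-1 by rewrite invr_gt0.
have N0 := ip_ge0 V; have [a0 _] := andP a01.
have tc0 : 0 <= tail_const R d.
  by rewrite /tail_const fine_ge0//; apply: integral_ge0 => x _; rewrite lee_fin powR_ge0.
rewrite energy_slice//; last exact: L2_measurable uL2.
rewrite unscaleK//.
set c := (1 + theta^-1) * (K + 4 * ip V V) * tail_const R d * eps `^ (2 * a).
have c0 : 0 <= c by rewrite !mulr_ge0 ?powR_ge0// ?addr_ge0 ?(ltW ti)// mulr_ge0.
have mc : measurable_fun setT (fun h : R => corr (cylinder omega 1) V (0, h)%R).
  by apply: measurable_corr_vertical => //; exact: measurable_funTS.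
have Cs0 : (0 <= @Csd R d (s eps))%E by rewrite ltW// Csd_gt0.
pose F (h : R) := ((`|h| `^ (- 1 - 2 * s eps))%:E * corr (cylinder omega 1) V (0, h)%R)%E.
have mF : measurable_fun setT F by apply: emeasurable_funM => //; exact: measurable_absr_powR.
have F0 h : (0 <= F h)%E by rewrite mule_ge0 ?corr_ge0// lee_fin powR_ge0.
pose G (h : R) := (`|h| `^ (2 * (a - s eps) - 1))%:E.
have mG D : measurable_fun D G by exact: measurable_absr_powR.
have G0 h : (0 <= G h)%E by rewrite lee_fin powR_ge0.
have kap0 : (0 <= (1 + theta)%:E * @Csd R d (s eps))%E.
  by rewrite mule_ge0// lee_fin addr_ge0// ltW.
have H0 : (\int[lebR]_h ((`|h| `^ (- 1 - 2 * s eps))%:E * slice (s eps) eps omega V h) <=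
   \int[lebR]_(h in `](-1)%R, 1%R[) ((1 + theta)%:E * @Csd R d (s eps) * F h + c%:E * G h))%E.
  rewrite [leRHS]integral_mkcond; apply: ge0_le_integral => //.
  - by move=> h _; rewrite mule_ge0 ?slice_ge0// lee_fin powR_ge0.
  - apply: emeasurable_funM; first exact: measurable_absr_powR.
    by apply: measurable_slice => //; exact: measurable_funTS.
  - apply/(measurable_restrictT (fun h => (1 + theta)%:E * @Csd R d (s eps) * F h + c%:E * G h)%E) => //.
    apply: measurable_funTS; apply: emeasurable_funD; apply: measurable_funeM => //; exact: mG.
  move=> h _; rewrite patchE; case: ifPn => [_|/negP]; last first.
    rewrite inE /= in_itv/= => /negP h1; rewrite /slice.
    rewrite integral0_eq ?mule0// => xi _; rewrite corr_height ?mule0// leNgt.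
    by apply/negP => hl; move: h1; rewrite -ltr_norml hl.
  have [->|hn0] := eqVneq h 0.
    rewrite normr0 powR0 ?mul0e; last by rewrite lt_eqF//; lra.
    by rewrite adde_ge0// mule_ge0.
  have hp : 0 < `|h| by rewrite normr_gt0.
  apply: le_trans (lee_wpmul2l _ (slice_upper h (ltnW d1) e0 t0 a01 sa2 mo V2 K0 HK)) _.
    by rewrite lee_fin powR_ge0.
  rewrite ge0_muleDr; last 2 first.
  - by rewrite !mule_ge0 ?corr_ge0// lee_fin addr_ge0// ltW.
  - by rewrite lee_fin !mulr_ge0 ?powR_ge0// ?addr_ge0 ?(ltW ti)// mulr_ge0.
  apply: leeD; first by rewrite /F le_eqVlt; apply/orP; left; apply/eqP; rewrite muleCA -!muleA; congr (_ * _)%E; rewrite muleCA.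
  rewrite /G -!EFinM lee_fin /c powRM ?(ltW e0)//.
  rewrite [X in X <= _](_ : _ = (1 + theta^-1) * (K + 4 * ip V V) * tail_const R d * eps `^ (2 * a) *
    (`|h| `^ (- 1 - 2 * s eps) * `|h| `^ (2 * a))); last by ring.
  rewrite -powRD; last by rewrite (gt_eqF hp) implybT.
  by rewrite le_eqVlt; apply/orP; left; apply/eqP; congr (_ * _ `^ _); ring.
apply: le_trans H0 _.
rewrite ge0_integralD//; last 4 first.
- by move=> h _; rewrite mule_ge0.
- by apply: measurable_funeM; exact: measurable_funTS.
- by move=> h _; rewrite mule_ge0.
- by apply: measurable_funeM; exact: mG.
have Cf : @Csd R d (s eps) \is a fin_num by rewrite ge0_fin_numE ?Csd_lty ?(ltnW d1)// ltW.
apply: leeD.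
  have E : ((1 + theta)%:E * @Csd R d (s eps) = ((1 + theta) * fine (@Csd R d (s eps)))%:E)%E by rewrite EFinM fineK.
  rewrite muleA E ge0_integralZl//; first exact: measurable_funTS.
  by rewrite lee_fin mulr_ge0 ?addr_ge0 ?(ltW t0)// fine_ge0.
rewrite ge0_integralZl//.
rewrite integral_powR_sym//; last by rewrite mulr_gt0// subr_gt0.
rewrite powR1 -EFinM lee_fin /c le_eqVlt; apply/orP; left; apply/eqP.
by rewrite mulr1 invfM (mulrA 2) divff// mul1r.
Qed.

(** * Increments of a function with a weak vertical derivative *)

Lemma derive_translate (R : realType) d (f : pt R d -> R) (e z x : pt R d) :
  (derivable f (x + z) e -> derivable (fun x => f (x + z)) x e) /\
  'D_e (fun x => f (x + z)) x = 'D_e f (x + z).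
Proof.
have E : (fun h : R => h^-1 *: (((fun x => f (x + z)) \o shift x) (h *: e) - f (x + z))) =
    (fun h : R => h^-1 *: ((f \o shift (x + z)) (h *: e) - f (x + z))).
  by apply/funext => h /=; rewrite addrA.
by split; [rewrite /derivable E|rewrite /derive E].
Qed.

Lemma Ck_translate (R : realType) d k (f : pt R d -> R) (z : pt R d) :
  Ck k f -> Ck k (fun x => f (x + z)).
Proof.
have cs : continuous (fun x : pt R d => x + z) by move=> x; apply: cvgD; [exact: cvg_id|exact: cvg_cst].
elim: k f => [f cf x|k IH f [cf Hf]].
  exact: (continuous_comp (cs x) (cf _)).
split=> [x|e].
  exact: (continuous_comp (cs x) (cf _)).
have [df Df] := Hf e; split=> [x|]; first exact: (derive_translate f e z x).1.
rewrite (_ : (fun x => _) = fun x => 'D_e f (x + z)); first exact: (IH (fun x => 'D_e f x)).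
by apply/funext => x; exact: (derive_translate f e z x).2.
Qed.

Lemma test_translate (R : realType) d (D D' : set (pt R d)) (f : pt R d -> R) (z : pt R d) :
  test_function D f -> (forall x, closure [set x | f x != 0] x -> D' (x + z)) ->
  test_function D' (fun x => f (x - z)).
Proof.
move=> [Cf cf _] fD.
set S := closure [set x | f x != 0] in cf fD.
have cS : compact ((fun y => y + z) @` S).
  apply: continuous_compact => //.
  by apply: continuous_subspaceT => x; apply: cvgD; [exact: cvg_id|exact: cvg_cst].
have sub : closure [set x | f (x - z) != 0] `<=` (fun y => y + z) @` S.
  rewrite [X in _ `<=` X](closure_id _).1; last by apply: compact_closed.
  apply: closure_subset => x /= fx; exists (x - z); last by rewrite subrK.
  exact: subset_closure.
split.
- by move=> k; exact: Ck_translate.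
- exact: (subclosed_compact (@closed_closure _ _) cS sub).
- by move=> x /sub [y Sy <-]; exact: fD.
Qed.

Lemma corr_pairing (R : realType) d (D : set (pt R d)) (v phi : pt R d -> R) (z : pt R d) :
  measurable D -> L2 D v -> L2 setT phi -> (forall x, phi x != 0 -> D x /\ D (x + z)) ->
  ip (fun y => \1_D y * \1_D (y + z) * (v (y + z) - v y)) phi =
  ip (v \_ D) (fun x => phi (x - z)) - ip (v \_ D) phi.
Proof.
move=> mD v2 phi2 supp; have w2 := L2_restrict mD v2; set w := v \_ D in w2 *.
have phiz2 : L2 setT (fun x => phi (x - z)) by exact: L2_translate.
have wz2 : L2 setT (fun x => w (x + z)) by exact: L2_translate.
rewrite /ip -[X in _ = X - _](@Rleb_translate _ _ (fun x => w x * phi (x - z)) z); last first.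
  by apply: measurable_funM; [exact: L2_measurable w2|exact: L2_measurable phiz2].
under [X in _ = X - _]eq_Rintegral do rewrite addrK.
rewrite -RintegralB//; try exact: L2M_integrable.
apply: eq_Rintegral => x _; rewrite -mulrBl.
have [->|px] := eqVneq (phi x) 0; first by rewrite !mulr0.
have [Dx Dxz] := supp _ px.
by rewrite /w !patchE !indicE !mem_set// !mul1r.
Qed.

(** The Taylor remainder of [phi] is uniformly small relative to [h]; integrability of [w] turns
    this into an estimate of the pairing. *)
Lemma is_derive_pairing (R : realType) d (D : set (pt R d)) (w phi : pt R d -> R) (k : R) :
  L2 setT w -> (@leb R d).-integrable setT (EFin \o w) -> test_function D phi ->
  is_derive k 1 (fun k : R => ip w (fun x => phi (x - k *: edir R d)))
    (- ip w (fun x => 'D_(edir R d) phi (x - k *: edir R d))).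
Proof.
move=> w2 wi tphi; have phi2 := test_L2 tphi.
have [d1 c1 Dphi2 _] := test_derive (edir R d) tphi.
have [_ cphi _] := tphi.
have phik2 (k' : R) : L2 setT (fun x => phi (x - k' *: edir R d)) by exact: L2_translate.
have Dk2 : L2 setT (fun x => 'D_(edir R d) phi (x - k *: edir R d)) by exact: (L2_translate (- (k *: edir R d)) Dphi2).
pose A := \int[leb]_x `|w x|.
have A0 : 0 <= A by exact: Rintegral_ge0.
have wai : (@leb R d).-integrable setT (EFin \o (fun x => `|w x|)) by exact: (integrable_abse wi).
pose m (k : R) := ip w (fun x => phi (x - k *: edir R d)).
have c : (fun h : R => h^-1 *: ((m \o shift k) (h *: (1 : R)) - m k)) @ 0^' -->
    (- ip w (fun x => 'D_(edir R d) phi (x - k *: edir R d)) : R).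
  apply/cvgrPdist_le => e e0.
  have eA : 0 < e / (A + 1) by rewrite divr_gt0// ltr_wpDl.
  have [r r0 rP] := compact_support_unif cphi c1 (fun x => @derive_eq0_support _ _ _ _ x) eA.
  near=> h.
  have hn0 : h != 0 by near: h; exact: nbhs_dnbhs_neq.
  have hr : `|h| < r by near: h; exact: dnbhs0_lt.
  rewrite /= /GRing.scale/= mulr1 [h + k]addrC distrC opprK.
  set q := ip w (fun x => 'D_(edir R d) phi _).
  have -> : h^-1 * (m (k + h) - m k) + q = h^-1 * (m (k + h) - m k + h * q) by field.
  rewrite normrM normfV ler_pdivrMl ?normr_gt0//.
  have d2 := L2B measurableT (phik2 (k + h)) (phik2 k).
  pose b x := phi (x - (k + h) *: edir R d) - phi (x - k *: edir R d) + h * 'D_(edir R d) phi (x - k *: edir R d).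
  have b2 : L2 setT b by apply: L2D => //; exact: L2Z.
  have -> : m (k + h) - m k + h * q = ip w b.
    rewrite /m /q ![ip w _]ipC; rewrite /b (ipDl d2 (L2Z h measurableT Dk2) w2) (ipZl h Dk2 w2).
    congr (_ + _); rewrite (_ : (fun x => phi _ - phi _) = (fun x => 1 * phi (x - (k + h) *: edir R d) + (-1) * phi (x - k *: edir R d))).
      by rewrite ip_lin//; ring.
    by apply/funext => x; rewrite mul1r mulN1r.
  have bb x : `|b x| <= `|h| * (e / (A + 1)).
    rewrite /b (_ : x - (k + h) *: edir R d = x - k *: edir R d + (- h) *: edir R d); last first.
      by rewrite scalerDl opprD addrA scaleNr.
    rewrite (_ : h * _ = - (- h * 'D_(edir R d) phi (x - k *: edir R d))); last by ring.
    rewrite -[`|h|]normrN; apply: mvt_bound => // c; rewrite normrN => ch; apply: rP.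
    rewrite normrZ [X in _ * X](_ : _ = 1); first by rewrite mulr1 (le_lt_trans ch).
    by rewrite prod_normE /= normr0 normr1; apply/max_idPr.
  have bi := L2M_integrable measurableT w2 b2.
  apply: le_trans (le_normr_Rintegral measurableT bi) _.
  apply: (@le_trans _ _ (\int[leb]_x ((`|h| * (e / (A + 1))) * `|w x|))).
    apply: le_Rintegral => //.
    - exact: (integrable_abse bi).
    - exact: integrable_mulrl.
    by move=> x _; rewrite normrM mulrC ler_wpM2r.
  rewrite RintegralZl// -/A -mulrA ler_wpM2l// mulrAC ler_pdivrMr ?ltr_wpDl//.
  by rewrite ler_wpM2l ?(ltW e0)// lerDl.
constructor; first exact: cvgP c.
by apply: (cvg_lim _ c).
Unshelve. all: end_near. Qed.

(** No representative that is absolutely continuous on lines is used. A test function detecting a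
    violation is translated vertically, and the mean value theorem for the pairing as a function of
    the translation reduces the claim to the definition of the weak derivative. *)
Lemma corr_weak_derivative (R : realType) d (omega : set 'rV[R]_d.-1) (v w : pt R d -> R) (h : R) :
  open omega -> bounded_set omega -> L2 (cylinder omega 1) v -> L2 (cylinder omega 1) w ->
  is_weak_dxd (cylinder omega 1) v w ->
  (corr (cylinder omega 1) v (0, h)%R <=
    (h ^+ 2 * ip (w \_ (cylinder omega 1)) (w \_ (cylinder omega 1)))%:E)%E.
Proof.
move=> oo bo v2 w2 wd; have mo : measurable omega by exact: open_measurable_rV.
set D := cylinder omega 1; have mD : measurable D by exact: measurable_cylinder.
have oD : open D by exact: open_cylinder.
have Df : (leb D < +oo)%E by exact: leb_cylinder_lty.
have vr2 := L2_restrict mD v2; have wr2 := L2_restrict mD w2.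
have vi : (@leb R d).-integrable setT (EFin \o (v \_ D)).
  by rewrite -restrict_EFin; apply/(integrable_mkcond _ mD); exact: L2_integrable.
have [g2 gE] := corr_nrm2 (0, h) mD v2; rewrite gE lee_fin leNgt; apply/negP => hg.
pose U := [set y : pt R d | D y /\ D (y + (0, h))].
have oU : open U.
  apply: openI => //; apply: open_comp => // x _.
  by apply: cvgD; [exact: cvg_id|exact: cvg_cst].
have g0 x : ~ U x -> (fun y => \1_D y * \1_D (y + (0, h)) * (v (y + (0, h)) - v y)) x = 0.
  move=> nU; rewrite /= !indicE; case: (boolP (x \in D)) => [|_]; rewrite ?mul0r//.
  rewrite inE => xD; case: (boolP (x + (0, h) \in D)) => [|_]; rewrite ?mulr0 ?mul0r//.
  by rewrite inE => xzD; case: nU.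
have [phi tphi] := dual_attained oU g2 g0 hg.
have phi2 := test_L2 tphi; have [_ cS SU] := tphi.
have phiS x : phi x != 0 -> closure [set x | phi x != 0] x by move=> px; exact: subset_closure.
rewrite corr_pairing//; last by move=> x /phiS /SU.
have zE : ((0, h) : pt R d) = h *: edir R d by rewrite /edir; congr pair => /=; rewrite ?scaler0 ?[RHS]mulr1.
rewrite zE.
pose m (k : R) := ip (v \_ D) (fun x => phi (x - k *: edir R d)).
have E0 : ip (v \_ D) phi = m 0.
  by rewrite /m; congr ip; apply/funext => x; rewrite scale0r subr0.
rewrite E0 -/(m h).
pose m' (k : R) := - ip (v \_ D) (fun x => 'D_(edir R d) phi (x - k *: edir R d)).
have dm (k : R) : is_derive k 1 m (m' k) by exact: is_derive_pairing tphi.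
(* The translate by [k] between 0 and [h] is still a test function of the cylinder, because its
   support lies between two sets inside it; then [2 h <w, psi> - |psi|^2 <= h^2 |w|^2]. *)
have m'le (k : R) : 0 <= k <= h \/ h <= k <= 0 ->
    2 * (h * m' k) - ip phi phi <= h ^+ 2 * ip (w \_ D) (w \_ D).
  move=> kh; pose psi x := phi (x - k *: edir R d).
  have tpsi : test_function D psi.
    apply: (test_translate tphi) => x Sx; have [[x1 x2] [_ xh2]] := SU x Sx.
    split; first by rewrite /= scaler0 addr0.
    move: x2 xh2; rewrite /= !in_itv/= /GRing.scale/= mulr1 => /andP[? ?] /andP[? ?].
    by apply/andP; case: kh => /andP[? ?]; split; lra.
  have psi2 := test_L2 tpsi.
  have -> : m' k = ip (w \_ D) psi.
    rewrite -((is_weak_dxd_lin v w mD).1 wd _ tpsi) /lin_dxd /m'; congr (- ip _ _).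
    by apply/funext => x; rewrite /psi (derive_translate phi (edir R d) (- (k *: edir R d)) x).2.
  have -> : ip phi phi = ip psi psi.
    rewrite /ip -(@Rleb_translate _ _ (fun x => phi x * phi x) (- (k *: edir R d)))//.
    by apply: measurable_funM; exact: L2_measurable phi2.
  have := ip_ge0 (fun x => h * (w \_ D) x + (-1) * psi x); rewrite nrm2_lin//; lra.
have cm a b : {within `[a, b], continuous m} by apply: derivable_within_continuous => c _; case: (dm c).
have [h0|h0] := leP 0 h.
  have [c] := MVT_segment h0 (fun c _ => dm c) (cm _ _).
  rewrite in_itv/= subr0 => ch -> H.
  by have := m'le c (or_introl ch); move: H; rewrite mulrC [_ * h]mulrC; lra.
have [c] := MVT_segment (ltW h0) (fun c _ => dm c) (cm _ _).
rewrite in_itv/= sub0r => ch E H.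
have := m'le c (or_intror ch); move: H; have -> : m h - m 0 = m' c * h by rewrite -[LHS]opprB E; ring.
lra.
Qed.

(** * Limits of the upper bounds and recovery sequences *)

Lemma corr_le_lip (R : realType) d (D : set (pt R d)) (V : pt R d -> R) (K : R) (z : pt R d) :
  measurable D -> measurable_fun setT V ->
  (\int[leb]_x ((V (x + z) - V x) ^+ 2)%:E <= (K * `|z| ^+ 2)%:E)%E ->
  (corr D V z <= (K * `|z| ^+ 2)%:E)%E.
Proof.
move=> mD mV; apply: le_trans; apply: ge0_le_integral => //.
- by move=> x _; rewrite lee_fin mulr_ge0 ?sqr_ge0// mulr_ge0.
- exact: (measurableT_comp (measurable_corr2 mD mV) (measurable_pair2 z)).
- apply/measurable_EFinP; apply: measurable_funX; apply: measurable_funB => //.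
  by apply: (measurableT_comp mV); exact: measurable_ptDr.
by move=> x _; rewrite lee_fin ler_piMl ?sqr_ge0// !indicE.
Qed.

Lemma norm_vertical (R : realType) d (h : R) : `|((0, h) : pt R d)| = `|h|.
Proof. by rewrite prod_normE /= normr0; apply/max_idPr. Qed.

Lemma vint_le (R : realType) d (s K : R) (omega : set 'rV[R]_d.-1) (V : pt R d -> R) :
  measurable omega -> measurable_fun (cylinder omega 1) V -> 0 < s < 1 -> 0 <= K ->
  (forall h : R, (corr (cylinder omega 1) V (0, h)%R <= (K * h ^+ 2)%:E)%E) ->
  (vint s omega V <= (K / (1 - s))%:E)%E.
Proof.
move=> mo mV /andP[s0 s1] K0 HK.
have p0 : 0 < 2 - 2 * s by lra.
apply: (@le_trans _ _ (\int[lebR]_(h in `](-1)%R, 1%R[) (K%:E * (`|h| `^ (2 - 2 * s - 1))%:E))%E).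
  apply: ge0_le_integral => //.
  - by move=> h _; rewrite mule_ge0 ?corr_ge0// lee_fin powR_ge0.
  - apply: emeasurable_funM; first exact: measurable_absr_powR.
    by apply: measurable_funTS; exact: measurable_corr_vertical.
  - by apply: measurable_funeM; exact: measurable_absr_powR.
  move=> h _; have [->|hn0] := eqVneq h 0.
    rewrite normr0 powR0 ?mul0e ?mule_ge0 ?lee_fin ?powR_ge0//.
    by rewrite lt_eqF//; lra.
  have hp : 0 < `|h| by rewrite normr_gt0.
  apply: le_trans (lee_wpmul2l _ (HK h)) _; first by rewrite lee_fin powR_ge0.
  rewrite -!EFinM lee_fin mulrCA ler_wpM2l//.
  rewrite -[h ^+ 2]real_normK ?num_real// -powR_mulrn ?normr_ge0// -powRD; last by rewrite (gt_eqF hp) implybT.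
  by rewrite le_eqVlt; apply/orP; left; apply/eqP; congr (_ `^ _); ring.
rewrite ge0_integralZl//; last exact: measurable_absr_powR.
rewrite integral_powR_sym// powR1 -EFinM lee_fin le_eqVlt; apply/orP; left; apply/eqP.
have s10 : 1 - s != 0 by rewrite subr_eq0 gt_eqF.
have s20 : 2 - 2 * s != 0 by rewrite lt0r_neq0.
by field; rewrite s10 s20.
Qed.

(** Finiteness of the seminorm is read off [energy_upper]. Any admissible [a] will do;
    [min 1 (s + 1 / 4)] lies above [s] and respects [s - a >= - 3 / 8]. *)
Lemma unscale_Hs (R : realType) d (s : R -> R) (eps K : R) (omega : set 'rV[R]_d.-1) (V : pt R d -> R) :
  (1 < d)%N -> 0 < eps -> 0 < s eps < 1 -> measurable omega -> L2 setT V -> 0 <= K ->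
  (forall z : pt R d, (\int[leb]_x ((V (x + z) - V x) ^+ 2)%:E <= (K * `|z| ^+ 2)%:E)%E) ->
  Hs (s eps) (cylinder omega eps) (unscale eps V).
Proof.
move=> d1 e0 s01 mo V2 K0 HK; have [s0 s1] := andP s01.
have mV := L2_measurable V2; have mD := @measurable_cylinder R d omega 1 mo.
split; first by apply: unscale_L2 => //; exact: measurable_cylinder.
pose a := Num.min 1 (s eps + 4^-1).
have q0 : 0 < 4^-1 :> R by rewrite invr_gt0.
have a01 : 0 < a <= 1 by rewrite /a lt_min ltr01 ge_min lexx/= andbT addr_gt0.
have sa : s eps < a by rewrite /a lt_min s1 ltrDl.
have sa2 : - (3 / 8) <= s eps - a.
  have : a <= s eps + 4^-1 by rewrite /a ge_min lexx orbT.
  lra.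
have := energy_upper d1 e0 s0 ltr01 a01 sa sa2 mo V2 K0 HK.
have vi : (vint (s eps) omega V <= (K / (1 - s eps))%:E)%E.
  apply: vint_le => // [|h]; first exact: measurable_funTS.
  by have := corr_le_lip mD mV (HK (0, h)); rewrite norm_vertical real_normK ?num_real.
move=> /le_lt_trans H; have {}H : (energy s omega eps (unscale eps V) < +oo)%E.
  apply: H; rewrite lte_add_pinfty ?ltry//; apply: lte_mul_pinfty => //.
  apply: lte_mul_pinfty; first by rewrite ltW// Csd_gt0.
  - by rewrite ge0_fin_numE ?Csd_lty ?(ltnW d1)// ltW// Csd_gt0.
  - exact: le_lt_trans vi (ltry _).
have c0 : 0 < (eps `^ (1 - 2 * s eps))^-1 by rewrite invr_gt0 powR_gt0.
rewrite ltNge leye_eq; apply/negP => /eqP E.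
by move: H; rewrite /energy E gt0_muley// lte_fin.
Qed.

Lemma cvg_Csd (R : realType) d (s_ : nat -> R) (s : R) : (0 < d)%N ->
  (forall j, 0 <= s_ j) -> 0 <= s -> s_ @ \oo --> s ->
  (fun j => fine (@Csd R d (s_ j))) @ \oo --> fine (@Csd R d s).
Proof.
move=> d0 s0 ss0 ss.
have Cf t : 0 <= t -> @Csd R d t \is a fin_num.
  by move=> t0; rewrite ge0_fin_numE ?Csd_lty// ltW// Csd_gt0.
have mw t D : measurable_fun D (fun xi : 'rV[R]_d.-1 => (wt t xi)%:E).
  by apply: measurable_funTS; apply/measurable_EFinP; exact: measurable_wt.
have [|||||_ _ H] := @dominated_convergence _ _ _ (lebesgue_rV d.-1) setT measurableT
   (fun j xi => (wt (s_ j) xi)%:E) (fun xi => (wt s xi)%:E) (fun xi => (wt 0 xi)%:E).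
- by move=> j; exact: mw.
- exact: mw.
- by apply: aeW => xi _; apply/cvg_EFin; [exact: nearW|exact: cvg_wt].
- apply/integrableP; split; first exact: mw.
  have := Cf 0 (lexx 0); rewrite CsdE ge0_fin_numE; last first.
    by apply: integral_ge0 => xi _; rewrite lee_fin wt_ge0.
  apply: le_lt_trans; rewrite le_eqVlt; apply/orP; left; apply/eqP.
  by apply: eq_integral => xi _; rewrite gee0_abs// lee_fin wt_ge0.
- apply: aeW => xi j _; rewrite gee0_abs ?lee_fin ?wt_ge0// /wt.
  by rewrite ler_powR ?lerDl ?dotp_ge0// lerD2l lerN2.
apply: fine_cvg; rewrite fineK ?Cf// CsdE; apply: cvg_trans H.
by apply: near_eq_cvg; apply: nearW => j; rewrite CsdE.
Qed.

Lemma cvg_vint (R : realType) d (s_ : nat -> R) (s K : R) (omega : set 'rV[R]_d.-1) (V : pt R d -> R) :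
  measurable omega -> measurable_fun (cylinder omega 1) V -> 0 <= K -> 0 <= s < 1 ->
  (forall j, 0 < s_ j) ->
  (forall h : R, (corr (cylinder omega 1) V (0, h)%R <= (K * h ^+ 2)%:E)%E) ->
  s_ @ \oo --> s ->
  vint s omega V \is a fin_num /\ (vint (s_ j) omega V @[j --> \oo] --> vint s omega V).
Proof.
move=> mo mV K0 /andP[s0 s1] sp HK ss.
(* An exponent strictly between [s] and 1 gives an integrable majorant that does not depend on [j];
   it is valid only from the index [N] on, whence the shifted sequence below. *)
pose s1' := (s + 1) / 2.
have s1'1 : s1' < 1 by rewrite /s1'; lra.
have ss1' : s < s1' by rewrite /s1'; lra.
have [N _ NP] : \forall j \near \oo, s_ j < s1' by exact: cvgr_lt ss _ _.
have mc := measurable_corr_vertical mo mV.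
have mF t : measurable_fun (`](-1)%R, 1%R[%classic : set R) (fun h : R => (`|h| `^ (- 1 - 2 * t))%:E * corr (cylinder omega 1) V (0, h)%R)%E.
  by apply: emeasurable_funM; [exact: measurable_absr_powR|exact: measurable_funTS].
have p0 : 0 < 2 - 2 * s1' by lra.
have [|||||ifin _ H] := @dominated_convergence _ _ _ (@lebR R) (`](-1)%R, 1%R[%classic : set R) (measurable_itv _)
   (fun j h => (`|h| `^ (- 1 - 2 * s_ (j + N)%N))%:E * corr (cylinder omega 1) V (0, h)%R)%E
   (fun h => (`|h| `^ (- 1 - 2 * s))%:E * corr (cylinder omega 1) V (0, h)%R)%E
   (fun h => K%:E * (`|h| `^ (2 - 2 * s1' - 1))%:E)%E.
- by move=> j; exact: mF.
- exact: mF.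
- apply: aeW => h _.
  have cf : corr (cylinder omega 1) V (0, h) \is a fin_num.
    by rewrite ge0_fin_numE ?corr_ge0//; exact: le_lt_trans (HK h) (ltry _).
  rewrite -(fineK cf) -EFinM; under eq_fun do rewrite -EFinM.
  apply/cvg_EFin; first exact: nearW.
  rewrite /comp /=; apply: cvgM; last exact: cvg_cst.
  have [->|hn0] := eqVneq h 0.
    rewrite normr0 powR0; last by rewrite lt_eqF//; lra.
    rewrite (_ : (fun j => _) = cst 0); first exact: cvg_cst.
    by apply/funext => j; rewrite powR0// lt_eqF//; have := sp (j + N)%N; lra.
  apply: cvg_powR_exponent; first by rewrite normr_gt0.
  apply: cvgB; first exact: cvg_cst.
  apply: cvgM; first exact: cvg_cst.
  by rewrite (cvg_shiftn N s_).
- apply/integrableP; split; first by apply: measurable_funeM; exact: measurable_absr_powR.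
  rewrite (_ : (\int[_]_(x in _) _)%E = (\int[lebR]_(x in `](-1)%R, 1%R[) (K%:E * (`|x| `^ (2 - 2 * s1' - 1))%:E))%E).
    by rewrite ge0_integralZl ?integral_powR_sym -?EFinM ?ltry//; exact: measurable_absr_powR.
  by apply: eq_integral => h _; rewrite gee0_abs// mule_ge0// lee_fin powR_ge0.
- apply: aeW => h j /=; rewrite in_itv/= -ltr_norml => h1.
  rewrite gee0_abs; last by rewrite mule_ge0 ?corr_ge0// lee_fin powR_ge0.
  have [->|hn0] := eqVneq h 0.
    rewrite normr0 powR0 ?mul0e ?mule_ge0 ?lee_fin ?powR_ge0//.
    by rewrite lt_eqF//; have := sp (j + N)%N; lra.
  have hp : 0 < `|h| by rewrite normr_gt0.
  apply: le_trans (lee_wpmul2l _ (HK h)) _; first by rewrite lee_fin powR_ge0.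
  rewrite -!EFinM lee_fin mulrCA ler_wpM2l//.
  rewrite -[h ^+ 2]real_normK ?num_real// -powR_mulrn ?normr_ge0// -powRD; last by rewrite (gt_eqF hp) implybT.
  rewrite ger_powR ?hp ?ltW//; have := NP (j + N)%N (leq_addl _ _); lra.
split.
  exact: (integrable_fin_num _ ifin).
by rewrite -(cvg_shiftn N (fun j => vint (s_ j) omega V)); exact: H.
Qed.

(** Rescaling [h] by [1 - delta] turns the factor of [corr_mol_vertical] into
    [(1 - delta)^(2 s) <= 1]; the factor left in the statement is the Jacobian. *)
Lemma vint_mol_le (R : realType) d (omega : set 'rV[R]_d.-1) (s delta : R) (v : pt R d -> R) :
  0 <= s -> 0 < delta -> delta < 1 -> measurable omega -> L2 (cylinder omega 1) v ->
  (vint s omega (mol delta (v \_ (cylinder omega 1))) <= (1 - delta)^-1%:E *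
   \int[lebR]_h ((`|h| `^ (- 1 - 2 * s))%:E * corr (cylinder omega 1) v (0, h)%R))%E.
Proof.
move=> s0 d0 d1 mo v2; have c0 : 0 < 1 - delta by lra.
have mc := measurable_corr_vertical mo (L2_measurable v2).
have mp := @measurable_absr_powR R (- 1 - 2 * s) setT.
pose f h : \bar R := ((`|h| `^ (- 1 - 2 * s))%:E * corr (cylinder omega 1) v (0, h)%R)%E.
have f0 h : (0 <= f h)%E by rewrite mule_ge0 ?corr_ge0// lee_fin powR_ge0.
have mf : measurable_fun setT f by exact: emeasurable_funM.
have mfc : measurable_fun setT (fun h : R => f ((1 - delta) * h + 0)).
  by apply: (measurableT_comp mf); apply: measurable_funD => //; exact: measurable_funM.
set w := v \_ _.
have mV : measurable_fun setT (fun h : R => (`|h| `^ (- 1 - 2 * s))%:E * corr (cylinder omega 1) (mol delta w) (0, h)%R)%E.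
  apply: emeasurable_funM => //; apply: measurable_corr_vertical => //.
  apply: measurable_funTS; apply: L2_measurable; apply: mol_L2 => //.
  by apply: L2_restrict => //; exact: measurable_cylinder.
apply: (@le_trans _ _ (\int[lebR]_h (((1 - delta)^-1 * (1 - delta))%:E * f ((1 - delta) * h + 0)%R))%E).
  apply: (@le_trans _ _ (\int[lebR]_h ((`|h| `^ (- 1 - 2 * s))%:E * corr (cylinder omega 1) (mol delta w) (0, h)%R))%E).
    by apply: ge0_subset_integral => // h _; rewrite mule_ge0 ?corr_ge0// lee_fin powR_ge0.
  apply: ge0_le_integral => //.
  - by move=> h _; rewrite mule_ge0 ?corr_ge0// lee_fin powR_ge0.
  - by apply: emeasurable_funM.
  move=> h _; rewrite addr0 /f.
  apply: le_trans (lee_wpmul2l _ (corr_mol_vertical h d0 d1 mo v2)) _; first by rewrite lee_fin powR_ge0.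
  rewrite muleCA EFinM -muleA; apply: lee_wpmul2l; first by rewrite lee_fin invr_ge0 ltW.
  rewrite muleA -EFinM; apply: lee_wpmul2r; first exact: corr_ge0.
  rewrite lee_fin normrM (gtr0_norm c0) (powRM _ (ltW c0))// mulrA; apply: ler_peMl; first exact: powR_ge0.
  rewrite -{1}(powRr1 (ltW c0)) -powRD; last by rewrite (gt_eqF c0) implybT.
  have -> : 1 + (- 1 - 2 * s) = - (2 * s) :> R by ring.
  rewrite -[leLHS](powRr0 (1 - delta)); apply: ger_powR; last by rewrite oppr_le0 mulr_ge0.
  by rewrite c0/=; lra.
rewrite ge0_integralZT; [|exact: mfc|by move=> x; exact: f0|by rewrite mulVf// gt_eqF].
by rewrite lebR_affine// muleA -EFinM mulfK ?gt_eqF.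
Qed.

Lemma strong_weak_L2loc (R : realType) d (D : set (pt R d)) (v_ : nat -> pt R d -> R) v (e_ : nat -> R) :
  measurable D -> (forall j, L2 D (v_ j)) -> L2 D v ->
  (forall j, \int[leb]_(x in D) ((v_ j x - v x) ^+ 2)%:E <= (e_ j)%:E)%E -> e_ @ \oo --> 0 ->
  weak_L2loc D v_ v.
Proof.
move=> mD v_2 v2 ve e0 K cK KD g g2; have mK := compact_measurable_rVR cK.
have g2' := L2_restrict mK g2.
have N0 := ip_ge0 (g \_ K).
have key j : (\int[leb]_(x in K) (v_ j x * g x) - \int[leb]_(x in K) (v x * g x)) ^+ 2 <=
    e_ j * ip (g \_ K) (g \_ K).
  have v_2K := L2S mD mK KD (v_2 j); have v2K := L2S mD mK KD v2.
  rewrite -RintegralB//; try exact: L2M_integrable.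
  have d2 := L2_restrict mD (L2B mD (v_2 j) v2).
  have -> : \int[leb]_(x in K) (v_ j x * g x - v x * g x) = ip ((fun x => v_ j x - v x) \_ D) (g \_ K).
    rewrite Rintegral_mkcond; apply: eq_Rintegral => x _; rewrite !patchE.
    case: ifPn => xK; last by rewrite mulr0.
    by rewrite mem_set ?mulrBl//; apply: KD; rewrite inE in xK.
  apply: le_trans (ip_cauchy_schwarz d2 g2') _; rewrite ler_wpM2r//.
  rewrite -lee_fin -(ipE d2); apply: le_trans (ve j); rewrite [leRHS]integral_mkcond.
  rewrite le_eqVlt; apply/orP; left; apply/eqP; apply: eq_integral => x _.
  by rewrite !patchE; case: ifP => //; rewrite expr0n.
apply/cvgrPdist_lt => e ep.
have ep2 : 0 < e ^+ 2 / (ip (g \_ K) (g \_ K) + 1) by rewrite divr_gt0 ?exprn_gt0// ltr_wpDl.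
have n1 : \forall j \near \oo, e_ j < e ^+ 2 / (ip (g \_ K) (g \_ K) + 1) by exact: cvgr_lt e0 _ _.
near=> j.
have h1 : e_ j < e ^+ 2 / (ip (g \_ K) (g \_ K) + 1) by near: j.
rewrite distrC -(ltr_pXn2r (n := 2))// ?nnegrE ?(ltW ep)// real_normK ?num_real//.
apply: le_lt_trans (key j) _.
have e_0 : 0 <= e_ j by rewrite -lee_fin; apply: le_trans (ve j); apply: integral_ge0 => x _; rewrite lee_fin sqr_ge0.
apply: (@le_lt_trans _ _ (e_ j * (ip (g \_ K) (g \_ K) + 1))); first by rewrite ler_wpM2l// lerDl.
by rewrite -ltr_pdivlMr// ltr_wpDl.
Unshelve. all: end_near. Qed.

Lemma diagonal_index (N : nat -> nat) : exists2 i : nat -> nat,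
  forall M, \forall j \near \oo, (M <= i j)%N & \forall j \near \oo, (N (i j) <= j)%N.
Proof.
(* The largest admissible [m] up to [j]. Over an empty range the maximum is 0, which can only happen
   for [j < N 0]. *)
pose i j := \max_(m < j.+1 | (N m <= j)%N) m.
exists i => [M|].
  exists (maxn M (N M)) => // j /=; rewrite geq_max => /andP[Mj Nj].
  by apply: (@leq_bigmax_cond _ _ (fun m : 'I_j.+1 => m : nat) (Ordinal (Mj : (M < j.+1)%N))).
exists (N 0%N) => // j /= Nj.
have [m Nm ->] : exists2 m : 'I_j.+1, (N m <= j)%N & i j = m; last by [].
have c0 : (0 < #|[pred m : 'I_j.+1 | (N m <= j)%N]|)%N by apply/card_gt0P; exists ord0; rewrite inE.
have [m Hm E] := @eq_bigmax_cond _ [pred m : 'I_j.+1 | (N m <= j)%N] (fun m => m : nat) c0.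
by exists m => //; rewrite /i -E; apply: eq_bigl.
Qed.

(** The diagonal argument, shared by both regimes: [lam] is 1 when [s0 < 1] and [1 - s] when
    [s0 = 1]. Weak convergence follows from strong convergence of the approximants. *)
Lemma recovery_sequence (R : realType) d (s : R -> R) (omega : set 'rV[R]_d.-1) (eps lam : nat -> R)
    (v : pt R d -> R) (g : R) :
  (forall j, 0 < eps j) -> measurable omega -> L2 (cylinder omega 1) v ->
  (forall e : R, 0 < e -> exists V : pt R d -> R, [/\ L2 setT V,
    (\int[leb]_(x in cylinder omega 1) ((V x - v x) ^+ 2)%:E <= e%:E)%E,
    forall j, Hs (s (eps j)) (cylinder omega (eps j)) (unscale (eps j) V) &
    \forall j \near \oo, ((lam j)%:E * energy s omega (eps j) (unscale (eps j) V) <= (g + e)%:E)%E]) ->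
  exists u : nat -> pt R d -> R,
   [/\ forall j, Hs (s (eps j)) (cylinder omega (eps j)) (u j),
       weak_L2loc (cylinder omega 1) (fun j => scaled (eps j) (u j)) v &
       (limn_esup (fun j => (lam j)%:E * energy s omega (eps j) (u j)) <= g%:E)%E].
Proof.
move=> e0 mo v2 H; have mD := @measurable_cylinder R d omega 1 mo.
have /choice[V VP] : forall m : nat, exists V : pt R d -> R, [/\ L2 setT V,
    (\int[leb]_(x in cylinder omega 1) ((V x - v x) ^+ 2)%:E <= (m.+1%:R^-1)%:E)%E,
    forall j, Hs (s (eps j)) (cylinder omega (eps j)) (unscale (eps j) V) &
    \forall j \near \oo, ((lam j)%:E * energy s omega (eps j) (unscale (eps j) V) <= (g + m.+1%:R^-1)%:E)%E].
  by move=> m; apply: H; rewrite invr_gt0.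
have /choice[N NP] : forall m, exists N : nat, forall j, (N <= j)%N ->
    ((lam j)%:E * energy s omega (eps j) (unscale (eps j) (V m)) <= (g + m.+1%:R^-1)%:E)%E.
  by move=> m; have [_ _ _ [N _ NP]] := VP m; exists N.
have [i ioo iN] := diagonal_index N.
exists (fun j => unscale (eps j) (V (i j))); split.
- by move=> j; have [_ _ + _] := VP (i j); apply.
- rewrite (_ : (fun j => _) = fun j => V (i j)); last by apply/funext => j; rewrite unscaleK.
  apply: (@strong_weak_L2loc _ _ _ _ _ (fun j => (i j).+1%:R^-1)) => //.
  + by move=> j; have [V2 _ _ _] := VP (i j); exact: (L2S measurableT).
  + by move=> j; have [_ + _ _] := VP (i j).
  apply/cvgrPdist_lt => e ep; have [M _ MP] := near_infty_natSinv_lt (PosNum ep).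
  by apply: filterS (ioo M) => j Mj; rewrite sub0r normrN gtr0_norm ?invr_gt0//; exact: MP.
apply: limn_esup_leP => a; rewrite lte_fin => ga.
have ga0 : 0 < a - g by rewrite subr_gt0.
have [M _ MP] := near_infty_natSinv_lt (PosNum ga0).
near=> j.
have h1 : (N (i j) <= j)%N by near: j.
have h2 : (M <= i j)%N by near: j; exact: ioo.
apply: le_trans (NP _ _ h1) _; rewrite lee_fin.
have h3 : (i j).+1%:R^-1 < a - g := MP _ h2.
by rewrite addrC -lerBrDr ltW.
Unshelve. all: end_near. Qed.

Lemma cvg_powR0 (R : realType) (e_ : nat -> R) (p : R) : 0 < p -> (forall j, 0 < e_ j) ->
  e_ @ \oo --> 0 -> (fun j => e_ j `^ p) @ \oo --> 0.
Proof.
move=> p0 e0 ec; apply/cvgrPdist_lt => b b0.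
have c0 : 0 < b `^ p^-1 by rewrite powR_gt0.
have n1 : \forall j \near \oo, e_ j < b `^ p^-1 by exact: cvgr_lt ec _ _.
near=> j; have h : e_ j < b `^ p^-1 by near: j.
rewrite sub0r normrN ger0_norm ?powR_ge0//.
have -> : b = (b `^ p^-1) `^ p by rewrite -powRrM mulVf ?lt0r_neq0// powRr1// ltW.
by rewrite gt0_ltr_powR// nnegrE ltW.
Unshelve. all: end_near. Qed.

Lemma mol_approx (R : realType) d (omega : set 'rV[R]_d.-1) (v : pt R d -> R) (e r : R) :
  open omega -> bounded_set omega -> L2 (cylinder omega 1) v -> 0 < e -> 0 < r ->
  exists delta : R, [/\ 0 < delta, delta < r, delta < 2^-1 &
  (\int[leb]_(x in cylinder omega 1)
     ((mol delta (v \_ (cylinder omega 1)) x - v x) ^+ 2)%:E <= e%:E)%E].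
Proof.
move=> oo bo v2 e0 r0; have [r' r'0 H] := mol_cvg oo bo v2 e0.
pose q := Num.min (Num.min r r') 2^-1.
have q0 : 0 < q by rewrite !lt_min r0 r'0 invr_gt0/=.
have q2 : q / 2 < q by rewrite ltr_pdivrMr// ltr_pMr// ltr1n.
have [qr [qr' qh]] : q <= r /\ q <= r' /\ q <= 2^-1.
  by rewrite /q !ge_min !lexx ?orbT.
exists (q / 2); split.
- by rewrite divr_gt0.
- exact: lt_le_trans q2 qr.
- exact: lt_le_trans q2 qh.
- by apply: H; [rewrite divr_gt0|exact: lt_le_trans q2 qr'|exact: lt_le_trans q2 qh].
Qed.

(** The same [delta] is the mollification scale and the parameter [theta] of [corr_split], so the
    loss on the main term is the factor [(1 + delta) / (1 - delta)]. *)
Lemma limsup_lt1 (R : realType) d (omega : set 'rV[R]_d.-1) (s : R -> R) (s0 : R) (eps : nat -> R)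
    (v : pt R d -> R) :
  (1 < d)%N -> open omega -> bounded_set omega -> 0 <= s0 < 1 -> (forall e, 0 < e -> 0 < s e < 1) ->
  (forall j, 0 < eps j) -> eps @ \oo --> 0 -> (fun j => s (eps j)) @ \oo --> s0 ->
  L2 (cylinder omega 1) v -> (limit_lt1 s0 omega v < +oo)%E ->
  exists u : nat -> pt R d -> R,
   [/\ forall j, Hs (s (eps j)) (cylinder omega (eps j)) (u j),
       weak_L2loc (cylinder omega 1) (fun j => scaled (eps j) (u j)) v &
       (limn_esup (fun j => energy s omega (eps j) (u j)) <= limit_lt1 s0 omega v)%E].
Proof.
move=> d1 oo bo s001 s01 eps0 epsc sc v2 gfin; have [s00 s0l1] := andP s001.
have mo : measurable omega by exact: open_measurable_rV.
have mD := @measurable_cylinder R d omega 1 mo.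
have sp j : 0 < s (eps j) by have /andP[] := s01 _ (eps0 j).
have G0 : (0 <= limit_lt1 s0 omega v)%E.
  rewrite limit_lt1_corr//; last exact: L2_measurable v2.
  rewrite mule_ge0//; first by rewrite ltW// Csd_gt0.
  by apply: integral_ge0 => h _; rewrite mule_ge0 ?corr_ge0// lee_fin powR_ge0.
have Gf : limit_lt1 s0 omega v \is a fin_num by rewrite ge0_fin_numE.
pose g := fine (limit_lt1 s0 omega v); have gE : limit_lt1 s0 omega v = g%:E by rewrite fineK.
have g0 : 0 <= g by rewrite /g fine_ge0.
rewrite gE.
have [u [u1 u2 u3]] : exists u : nat -> pt R d -> R,
   [/\ forall j, Hs (s (eps j)) (cylinder omega (eps j)) (u j),
       weak_L2loc (cylinder omega 1) (fun j => scaled (eps j) (u j)) v &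
       (limn_esup (fun j => 1%:E * energy s omega (eps j) (u j)) <= g%:E)%E].
  2: by exists u; split => //; move: u3; under eq_fun do rewrite mul1e.
apply: (@recovery_sequence R d s omega eps (fun=> 1)) => // e e0.
have e2 : 0 < e / 2 by rewrite divr_gt0.
(* Chosen so that [(1 + delta) / (1 - delta) * g < g + e], that is [delta (2 g + e) < e], whenever
   [delta < r]. *)
pose r := Num.min 2^-1 (e / (16 * (g + 1))).
have g1 : 0 < g + 1 by lra.
have r0 : 0 < r by rewrite lt_min invr_gt0/= ltr0n divr_gt0// mulr_gt0.
have [delta [d0 dr dh app]] := mol_approx oo bo v2 e0 r0.
have d1' : delta < 1 by lra.
set w := v \_ (cylinder omega 1) in app *; have w2 : L2 setT w by exact: L2_restrict.
pose V := mol delta w; have V2 : L2 setT V by exact: mol_L2.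
have mV := L2_measurable V2.
have [K K0 HK] := mol_lipschitz d0 d1' w2.
have HKc (h : R) : (corr (cylinder omega 1) V (0, h)%R <= (K * h ^+ 2)%:E)%E.
  by have := corr_le_lip mD mV (HK (0, h)); rewrite norm_vertical real_normK ?num_real.
exists V; split.
- exact: V2.
- exact: app.
- by move=> j; exact: (unscale_Hs d1 (eps0 j) (s01 _ (eps0 j)) mo V2 K0 HK).

have [vf vc] := cvg_vint mo (measurable_funTS mV) K0 s001 sp HKc sc.
(* Strictly above [s0], so [a - s] stays away from 0 along the sequence and the horizontal remainder
   is [O(eps^(2 a))]. *)
pose a := Num.min 1 (s0 + 4^-1).
have q0 : 0 < 4^-1 :> R by rewrite invr_gt0.
have a01 : 0 < a <= 1 by rewrite /a lt_min ltr01 ge_min lexx/= andbT ltr_wpDl.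
have s0a : s0 < a by rewrite /a lt_min s0l1 ltrDl.
have a4 : a <= s0 + 4^-1 by rewrite /a ge_min lexx orbT.
have Cf : @Csd R d s0 \is a fin_num by rewrite ge0_fin_numE ?Csd_lty ?(ltnW d1)// ltW// Csd_gt0.
have Cc := cvg_Csd (ltnW d1) (fun j => ltW (sp j)) s00 sc.
set C := fine (@Csd R d s0) in Cc.
have C0 : 0 <= C by rewrite fine_ge0// ltW// Csd_gt0.
have v0 : 0 <= fine (vint s0 omega V).
  by rewrite fine_ge0//; apply: integral_ge0 => h _; rewrite mule_ge0 ?corr_ge0// lee_fin powR_ge0.
have main : C * fine (vint s0 omega V) <= (1 - delta)^-1 * g.
  rewrite -lee_fin EFinM fineK// fineK// EFinM -gE limit_lt1_corr//; last exact: L2_measurable v2.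
  rewrite muleCA; apply: lee_wpmul2l; first by rewrite ltW// Csd_gt0.
  exact: vint_mol_le.
have lim1 : (fun j => (1 + delta) * (fine (@Csd R d (s (eps j))) * fine (vint (s (eps j)) omega V))) @ \oo -->
    (1 + delta) * (C * fine (vint s0 omega V)).
  apply: cvgM; first exact: cvg_cst.
  by apply: cvgM => //; apply: fine_cvg; rewrite fineK.
pose c := (1 + delta^-1) * (K + 4 * ip V V) * tail_const R d.
have lim2 : (fun j => c * eps j `^ (2 * a) / (a - s (eps j))) @ \oo --> c * 0 / (a - s0).
  apply: cvgM.
    apply: cvgM; first exact: cvg_cst.
    by apply: cvg_powR0 => //; rewrite mulr_gt0//; case/andP: a01.
  apply: cvgV; first by rewrite subr_eq0 gt_eqF.
  by apply: cvgB => //; exact: cvg_cst.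
rewrite mulr0 mul0r in lim2.
have lim : (fun j => (1 + delta) * (fine (@Csd R d (s (eps j))) * fine (vint (s (eps j)) omega V)) +
    c * eps j `^ (2 * a) / (a - s (eps j))) @ \oo --> (1 + delta) * (C * fine (vint s0 omega V)).
  by rewrite -[X in _ --> X]addr0; exact: cvgD lim1 lim2.
have small : (1 + delta) * (C * fine (vint s0 omega V)) < g + e.
  apply: (@le_lt_trans _ _ ((1 + delta) * ((1 - delta)^-1 * g))).
    by rewrite ler_wpM2l// addr_ge0// ltW.
  have rd : delta * (16 * (g + 1)) < e.
    by rewrite -ltr_pdivlMr ?mulr_gt0//; apply: lt_le_trans dr _; rewrite /r ge_min lexx orbT.
  rewrite mulrCA mulrC ltr_pdivrMr; last by lra.
  nra.
have n1 : \forall j \near \oo, (1 + delta) * (fine (@Csd R d (s (eps j))) * fine (vint (s (eps j)) omega V)) +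
    c * eps j `^ (2 * a) / (a - s (eps j)) < g + e by exact: cvgr_lt lim _ small.
have n2 : \forall j \near \oo, s (eps j) < a by exact: cvgr_lt sc _ s0a.
have n3 : \forall j \near \oo, s0 - 8^-1 < s (eps j).
  by apply: cvgr_gt sc _ _; rewrite gtrBl invr_gt0.
have vfin j : vint (s (eps j)) omega V \is a fin_num.
  rewrite ge0_fin_numE; last by apply: integral_ge0 => h _; rewrite mule_ge0 ?corr_ge0// lee_fin powR_ge0.
  exact: le_lt_trans (vint_le mo (measurable_funTS mV) (s01 _ (eps0 j)) K0 HKc) (ltry _).
have Cfin j : @Csd R d (s (eps j)) \is a fin_num.
  by rewrite ge0_fin_numE ?Csd_lty ?(ltnW d1)// ltW// Csd_gt0.
near=> j.
have h1 : (1 + delta) * (fine (@Csd R d (s (eps j))) * fine (vint (s (eps j)) omega V)) +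
    c * eps j `^ (2 * a) / (a - s (eps j)) < g + e by near: j.
have h2 : s (eps j) < a by near: j.
have h3 : s0 - 8^-1 < s (eps j) by near: j.
have h4 : - (3 / 8) <= s (eps j) - a by move: h3 a4; clear; lra.
rewrite mul1e; apply: le_trans (energy_upper d1 (eps0 j) (sp j) d0 a01 h2 h4 mo V2 K0 HK) _.
rewrite -(fineK (vfin j)) -(fineK (Cfin j)) -!EFinM -EFinD lee_fin; exact: ltW.
Unshelve. all: end_near. Qed.

Lemma limsup_eq1 (R : realType) d (omega : set 'rV[R]_d.-1) (s : R -> R) (eps : nat -> R)
    (v : pt R d -> R) :
  (1 < d)%N -> (sphere_area R d * ((2 * d%:R)^-1)%:E = @Csd R d 1)%E ->
  open omega -> bounded_set omega -> (forall e, 0 < e -> 0 < s e < 1) ->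
  (forall j, 0 < eps j) -> eps @ \oo --> 0 -> (fun j => s (eps j)) @ \oo --> (1 : R) ->
  L2 (cylinder omega 1) v -> (limit_eq1 omega v < +oo)%E ->
  exists u : nat -> pt R d -> R,
   [/\ forall j, Hs (s (eps j)) (cylinder omega (eps j)) (u j),
       weak_L2loc (cylinder omega 1) (fun j => scaled (eps j) (u j)) v &
       (limn_esup (fun j => (1 - s (eps j))%:E * energy s omega (eps j) (u j)) <= limit_eq1 omega v)%E].
Proof.
move=> d1 hS oo bo s01 eps0 epsc sc v2.
have mo : measurable omega by exact: open_measurable_rV.
have mD := @measurable_cylinder R d omega 1 mo.
have sp j : 0 < s (eps j) by have /andP[] := s01 _ (eps0 j).
have s1 j : s (eps j) < 1 by have /andP[] := s01 _ (eps0 j).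
rewrite /limit_eq1; case: pselect => [ex|//] gfin.
have [v'2 wd] := xgetPex (cst 0%R) ex; set v' := xget _ _ in v'2 wd gfin *.
have wr2 := L2_restrict mD v'2.
have Cf : @Csd R d 1 \is a fin_num by rewrite ge0_fin_numE ?Csd_lty ?(ltnW d1)// ltW// Csd_gt0.
rewrite integral_cylinder//; last exact: L2_measurable v'2.
rewrite (ipE wr2) hS -(fineK Cf) -EFinM.
set C := fine (@Csd R d 1); set W := ip _ _; pose g := C * W; rewrite -/g.
have C0 : 0 <= C by rewrite fine_ge0// ltW// Csd_gt0.
have W0 : 0 <= W by exact: ip_ge0.
have g0 : 0 <= g by exact: mulr_ge0.
apply: recovery_sequence => // e e0.
pose r := e / (g + 1).
have g1 : 0 < g + 1 by lra.
have r0 : 0 < r by rewrite divr_gt0.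
have [delta [d0 dr dh app]] := mol_approx oo bo v2 e0 r0.
have d1' : delta < 1 by lra.
set w := v \_ (cylinder omega 1) in app *; have w2 : L2 setT w by exact: L2_restrict.
pose V := mol delta w; have V2 : L2 setT V by exact: mol_L2.
have mV := L2_measurable V2.
have [K K0 HK] := mol_lipschitz d0 d1' w2.
exists V; split.
- exact: V2.
- exact: app.
- by move=> j; exact: (unscale_Hs d1 (eps0 j) (s01 _ (eps0 j)) mo V2 K0 HK).

(* Unlike the constant [K], the bound [W] is independent of [delta]: the shrunk increment
   contributes [(1 - delta)^2], which outweighs the factor [(1 - delta)^-1]. *)
have HW (h : R) : (corr (cylinder omega 1) V (0, h)%R <= (W * h ^+ 2)%:E)%E.
  apply: le_trans (corr_mol_vertical h d0 d1' mo v2) _.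
  have d1p : 0 < 1 - delta by lra.
  apply: le_trans (lee_wpmul2l _ (corr_weak_derivative ((1 - delta) * h) oo bo v2 v'2 wd)) _.
    by rewrite lee_fin invr_ge0 ltW.
  rewrite -EFinM lee_fin -/W.
  have -> : (1 - delta)^-1 * (((1 - delta) * h) ^+ 2 * W) = (1 - delta) * (W * h ^+ 2).
    by field; rewrite lt0r_neq0.
  by apply: ler_piMl; [rewrite mulr_ge0 ?sqr_ge0|rewrite gerBl ltW].
have Cc := cvg_Csd (ltnW d1) (fun j => ltW (sp j)) ler01 sc.
rewrite -/C in Cc.
have lim1 : (fun j => (1 + delta) * (fine (@Csd R d (s (eps j))) * W)) @ \oo --> (1 + delta) * (C * W).
  by apply: cvgM; [exact: cvg_cst|apply: cvgM => //; exact: cvg_cst].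
pose c := (1 + delta^-1) * (K + 4 * ip V V) * tail_const R d.
have lim2 : (fun j => c * eps j `^ (2 * 1)) @ \oo --> c * 0.
  by apply: cvgM; [exact: cvg_cst|apply: cvg_powR0 => //; rewrite mulr1].
rewrite mulr0 in lim2.
have lim : (fun j => (1 + delta) * (fine (@Csd R d (s (eps j))) * W) + c * eps j `^ (2 * 1)) @ \oo -->
    (1 + delta) * (C * W).
  by rewrite -[X in _ --> X]addr0; exact: cvgD lim1 lim2.
have small : (1 + delta) * (C * W) < g + e.
  rewrite -/g mulrDl mul1r ltrD2l.
  have : delta * (g + 1) < e by rewrite -ltr_pdivlMr.
  by apply: le_lt_trans; rewrite ler_wpM2l ?lerDl// ltW.
have n1 : \forall j \near \oo, (1 + delta) * (fine (@Csd R d (s (eps j))) * W) + c * eps j `^ (2 * 1) < g + e.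
  exact: cvgr_lt lim _ small.
have n3 : \forall j \near \oo, 1 - 8^-1 < s (eps j).
  by apply: cvgr_gt sc _ _; rewrite gtrBl invr_gt0.
have Cfin j : @Csd R d (s (eps j)) \is a fin_num.
  by rewrite ge0_fin_numE ?Csd_lty ?(ltnW d1)// ltW// Csd_gt0.
near=> j.
have h1 : (1 + delta) * (fine (@Csd R d (s (eps j))) * W) + c * eps j `^ (2 * 1) < g + e by near: j.
have h3 : 1 - 8^-1 < s (eps j) by near: j.
have h4 : - (3 / 8) <= s (eps j) - 1 by move: h3; clear; lra.
have a01 : 0 < (1 : R) <= 1 by rewrite ltr01 lexx.
have s1j : 0 < 1 - s (eps j) by rewrite subr_gt0.
have E := energy_upper d1 (eps0 j) (sp j) d0 a01 (s1 j) h4 mo V2 K0 HK.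
apply: le_trans (lee_wpmul2l _ E) _; first by rewrite lee_fin ltW.
have vl := vint_le mo (measurable_funTS mV) (s01 _ (eps0 j)) W0 HW.
rewrite -(fineK (Cfin j)).
(* Both terms carry [1 / (1 - s)], the first from [vint_le] and the second from [energy_upper] with
   [a = 1]; the prefactor cancels it. *)
apply: (@le_trans _ _ ((1 - s (eps j))%:E * ((1 + delta) * (fine (@Csd R d (s (eps j))) * (W / (1 - s (eps j)))) +
   c * eps j `^ (2 * 1) / (1 - s (eps j)))%:E)%E).
  apply: lee_wpmul2l; first by rewrite lee_fin ltW.
  rewrite [X in (_ <= X)%E]EFinD; apply: leeD => //.
  rewrite [X in (_ <= X)%E]EFinM; apply: lee_wpmul2l; first by rewrite lee_fin addr_ge0// ltW.
  rewrite [X in (_ <= X)%E]EFinM; apply: lee_wpmul2l => //.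
  by rewrite lee_fin fine_ge0// ltW// Csd_gt0.
rewrite -EFinM lee_fin; apply: le_trans (ltW h1).
rewrite le_eqVlt; apply/orP; left; apply/eqP.
by field; rewrite lt0r_neq0.
Unshelve. all: end_near. Qed.

(** * Isodiametric inequality *)

Lemma dotpC (R : realType) n (x y : 'rV[R]_n) : dotp x y = dotp y x.
Proof. by apply: eq_bigr => i _; rewrite mulrC. Qed.

Lemma dotp_lin (R : realType) n (a b : R) (x y z : 'rV[R]_n) :
  dotp (a *: x + b *: y) z = a * dotp x z + b * dotp y z.
Proof.
by rewrite /dotp !mulr_sumr -big_split/=; apply: eq_bigr => i _; rewrite !mxE mulrDl !mulrA.
Qed.

Lemma dotpD (R : realType) n (x y : 'rV[R]_n) :
  dotp (x + y) (x + y) = dotp x x + 2 * dotp x y + dotp y y.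
Proof.
have E := fun z => dotp_lin 1 1 x y z; rewrite !scale1r in E.
rewrite E (dotpC x) (dotpC y) !E (dotpC y x); ring.
Qed.

Lemma dotpB (R : realType) n (x y : 'rV[R]_n) :
  dotp (x - y) (x - y) = dotp x x - 2 * dotp x y + dotp y y.
Proof.
have E := fun z => dotp_lin 1 (-1) x y z; rewrite scale1r scaleN1r in E.
rewrite E (dotpC x) (dotpC y) !E (dotpC y x); ring.
Qed.

Lemma dotpN (R : realType) n (x : 'rV[R]_n) : dotp (- x) (- x) = dotp x x.
Proof. by apply: eq_bigr => i _; rewrite !mxE mulrNN. Qed.

Lemma dotp_eq0 (R : realType) n (x : 'rV[R]_n) : dotp x x = 0 -> x = 0.
Proof.
move=> h; apply/rowP => i; rewrite mxE; apply/eqP; rewrite -sqrf_eq0 expr2; apply/eqP.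
by apply: (psumr_eq0P _ h) => // j _; rewrite -expr2 sqr_ge0.
Qed.

Lemma dotp_cauchy_schwarz (R : realType) n (x y : 'rV[R]_n) :
  dotp x y ^+ 2 <= dotp x x * dotp y y.
Proof.
have [/dotp_eq0 y0|y0] := eqVneq (dotp y y) 0.
  rewrite y0 [dotp x 0]big1 ?expr0n ?mulr_ge0 ?dotp_ge0// => i _.
  by rewrite mxE mulr0.
have yp : 0 < dotp y y by rewrite lt_neqAle eq_sym y0 dotp_ge0.
have := dotp_ge0 (dotp y y *: x - dotp x y *: y).
rewrite dotpB !dotpZ.
rewrite (_ : dotp (dotp y y *: x) (dotp x y *: y) = dotp y y * (dotp x y * dotp x y)); last first.
  rewrite -[_ *: x]addr0 -(scale0r x) dotp_lin mul0r addr0 dotpC.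
  by rewrite -[_ *: y]addr0 -(scale0r x) dotp_lin mul0r addr0 (dotpC y x).
rewrite (_ : _ + _ = dotp y y * (dotp x x * dotp y y - dotp x y ^+ 2)); last by ring.
by rewrite pmulr_rge0// subr_ge0.
Qed.

Lemma enorm_ge0 (R : realType) n (x : 'rV[R]_n) : 0 <= enorm x.
Proof. exact: sqrtr_ge0. Qed.

Lemma sqr_enorm (R : realType) n (x : 'rV[R]_n) : enorm x ^+ 2 = dotp x x.
Proof. by rewrite sqr_sqrtr ?dotp_ge0. Qed.

Lemma enormN (R : realType) n (x : 'rV[R]_n) : enorm (- x) = enorm x.
Proof. by rewrite /enorm dotpN. Qed.

Lemma enormZ (R : realType) n (a : R) (x : 'rV[R]_n) : enorm (a *: x) = `|a| * enorm x.
Proof. by rewrite /enorm dotpZ sqrtrM ?sqr_ge0// sqrtr_sqr. Qed.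

Lemma enorm_le (R : realType) n (x : 'rV[R]_n) (r : R) : 0 <= r ->
  (enorm x <= r) = (dotp x x <= r ^+ 2).
Proof. by move=> r0; rewrite -sqr_enorm ler_sqr ?nnegrE ?enorm_ge0. Qed.

Lemma dotp_le_enorm (R : realType) n (x y : 'rV[R]_n) : dotp x y <= enorm x * enorm y.
Proof.
apply: le_trans (ler_norm _) _.
rewrite -ler_sqr ?nnegrE ?mulr_ge0 ?enorm_ge0// exprMn !sqr_enorm real_normK ?num_real//.
exact: dotp_cauchy_schwarz.
Qed.

Lemma enormD (R : realType) n (x y : 'rV[R]_n) : enorm (x + y) <= enorm x + enorm y.
Proof.
rewrite enorm_le ?addr_ge0 ?enorm_ge0// dotpD sqrrD !sqr_enorm lerD2r lerD2l.
by rewrite -[leRHS]mulr_natl ler_pM2l// dotp_le_enorm.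
Qed.

Lemma coord_le_enorm (R : realType) n (x : 'rV[R]_n) i : `|x ord0 i| <= enorm x.
Proof.
rewrite -ler_sqr ?nnegrE ?enorm_ge0// sqr_enorm real_normK ?num_real//.
rewrite /dotp (bigD1 i)//= -expr2 lerDl sumr_ge0// => j _.
by rewrite -expr2 sqr_ge0.
Qed.

Lemma enorm_le_coord (R : realType) n (x : 'rV[R]_n) (M : R) : 0 <= M ->
  (forall i, `|x ord0 i| <= M) -> enorm x <= n%:R * M.
Proof.
move=> M0 h; rewrite enorm_le ?mulr_ge0//.
apply: (@le_trans _ _ (\sum_(i < n) M ^+ 2)).
  apply: ler_sum => i _; rewrite -expr2 -real_normK ?num_real//.
  by rewrite ler_sqr ?nnegrE.
rewrite sumr_const card_ord -[leLHS]mulr_natl exprMn; apply: ler_wpM2r; first exact: sqr_ge0.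
by rewrite -natrX ler_nat expnS expn1; case: n x h => // n _ _; rewrite leq_pmull.
Qed.

Lemma measurable_enorm_ball (R : realType) n (r : R) :
  measurable [set x : 'rV[R]_n | enorm x <= r].
Proof.
have [r0|r0] := leP 0 r; last first.
  rewrite (_ : [set _ | _] = set0)//; apply/seteqP; split => // x /= h.
  by move: (le_lt_trans h r0); rewrite ltNge enorm_ge0.
have -> : [set x : 'rV[R]_n | enorm x <= r] = (fun x : 'rV[R]_n => dotp x x) @^-1` `]-oo, r ^+ 2]%classic.
  by apply/seteqP; split => x /=; rewrite in_itv/= enorm_le.
rewrite -[X in measurable X]setTI; exact: measurable_dotp.
Qed.

Lemma lebesgue_rV_affine_set (R : realType) n (A : set 'rV[R]_n) (a : R) b : 0 < a -> measurable A ->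
  (lebesgue_rV n [set x : 'rV[R]_n | A (a *: x + b)%R] = (a ^- n)%:E * lebesgue_rV n A)%E.
Proof.
move=> a0 mA.
have mA' : measurable [set x : 'rV[R]_n | A (a *: x + b)].
  rewrite -[X in measurable X]setTI.
  exact: (measurable_rV_affine a b).
have E (B : set 'rV[R]_n) : measurable B -> lebesgue_rV n B = (\int[lebesgue_rV n]_x (\1_B x)%:E)%E.
  by move=> mB; rewrite integral_indic// setIT.
rewrite (E _ mA) (E _ mA').
rewrite -(lebesgue_rV_affine b)//; last first.
  by apply/measurable_EFinP; exact: measurable_indicT.
Qed.

Lemma lebesgue_rV_ball (R : realType) n (r : R) (a : 'rV[R]_n) : 0 <= r ->
  (lebesgue_rV n [set x : 'rV[R]_n | (enorm (x - a) <= r)%R] =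
   @ball_volume R n * (r ^+ n)%:E)%E.
Proof.
rewrite le_eqVlt => /predU1P[<-|r0]; last first.
  have -> : [set x : 'rV[R]_n | enorm (x - a) <= r] =
      [set x | [set y | enorm y <= 1] (r^-1 *: x + - (r^-1 *: a))].
    apply/seteqP; split => x /=; rewrite -scalerBr enormZ gtr0_norm ?invr_gt0//.
    - by rewrite ler_pdivrMl// mulr1.
    - by rewrite ler_pdivrMl// mulr1.
  rewrite lebesgue_rV_affine_set ?invr_gt0//; last exact: measurable_enorm_ball.
  by rewrite muleC /ball_volume exprVn invrK.
have -> : [set x : 'rV[R]_n | enorm (x - a) <= 0] = [set x : 'rV[R]_n | forall i, [set a ord0 i] (x ord0 i)].
  apply/seteqP; split => x /=.
    move=> h i; apply/eqP; rewrite -subr_eq0 -normr_eq0 eq_le normr_ge0 andbT.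
    by apply: le_trans h; have := coord_le_enorm (x - a) i; rewrite !mxE.
  by move=> h; rewrite (_ : x - a = 0) ?enorm_le ?expr0n/= /dotp ?big1// ?oppr0// => [i _|];
    [rewrite mxE mul0r|apply/rowP => i; rewrite !mxE h subrr].
rewrite (@lebesgue_rV_prod R n (fun i => [set a ord0 i]) (fun=> 0)) => [|//|i]; last exact: lebR_set1.
rewrite prodr_const card_ord.
case: n a => [|n] a; last by rewrite !expr0n/= mule0.
rewrite !expr0 mule1 /ball_volume.
have -> : [set x : 'rV[R]_0 | enorm x <= 1] = [set x : 'rV[R]_0 | forall i, [set a ord0 i] (x ord0 i)].
  by apply/seteqP; split => x /= h; [case|rewrite /enorm /dotp big_ord0 sqrtr0].
rewrite (@lebesgue_rV_prod R 0 (fun i => [set a ord0 i]) (fun=> 0)) => [|//|[]//].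
by rewrite prodr_const card_ord expr0.
Qed.

Lemma lebR_diam_le (R : realType) (A : set R) (c : R) : measurable A -> 0 <= c ->
  (forall x y, A x -> A y -> x - y <= c) -> (lebR A <= c%:E)%E.
Proof.
move=> mA c0 h; have [->|/set0P[a Aa]] := eqVneq A set0; first by rewrite measure0.
have lbA : has_inf A by split; [exists a|exists (a - c) => y Ay; have := h _ _ Aa Ay; lra].
apply: (@le_trans _ _ (lebR `[inf A, inf A + c]%classic)).
  apply: le_measure; rewrite ?inE// => x Ax /=; rewrite in_itv/=; apply/andP; split.
    by apply: ge_inf => //; case: lbA.
  rewrite -lerBlDr; apply: lb_le_inf; first by exists a.
  by move=> y Ay; have := h _ _ Ax Ay; lra.
rewrite /lebR lebesgue_measure_itv/=; case: ifP => _; last by rewrite lee_fin.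
by rewrite -EFinB lee_fin; lra.
Qed.

(** A set of length above [2 |t|] contains two points more than [2 |t|] apart, and likewise for [u].
    Pairing the upper point of each set with the lower point of the other and adding gives
    [|t| + |u| <= c]. *)
Lemma symmetrized_distance (R : realType) (A B : set R) (c t u : R) : measurable A -> measurable B ->
  (forall x y, A x -> B y -> `|x - y| <= c) ->
  ((2 * `|t|)%:E < lebR A)%E -> ((2 * `|u|)%:E < lebR B)%E -> `|t - u| <= c.
Proof.
move=> mA mB h.
have far (C : set R) (s : R) : measurable C -> ((2 * `|s|)%:E < lebR C)%E ->
    exists x y, [/\ C x, C y & 2 * `|s| < x - y].
  move=> mC; apply: contraPP => /forallNP H; apply/negP; rewrite -leNgt.
  apply: lebR_diam_le => // x y Cx Cy; rewrite leNgt; apply/negP => lt.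
  by apply: (H x); exists y.
move=> /(far _ _ mA)[x [y [Ax Ay xy]]] /(far _ _ mB)[x' [y' [Bx' By' xy']]].
apply: le_trans (ler_normB _ _) _.
have := h _ _ Ax By'; have := h _ _ Ay Bx'; rewrite !ler_distl => /andP[? ?] /andP[? ?].
lra.
Qed.

Lemma lebesgue_rVS (R : realType) n (A : set 'rV[R]_n.+1) :
  lebesgue_rV n.+1 A = (\int[lebR]_t lebesgue_rV n [set x | A (rV_cons (t, x))])%E.
Proof.
apply: eq_integral => t _ /=; congr (lebesgue_rV n _).
by apply/seteqP; split => x; rewrite /xsection /= inE.
Qed.

Lemma integral_sections d1 d2 (T1 : measurableType d1) (T2 : measurableType d2) (R : realType)
    (m1 : {sigma_finite_measure set T1 -> \bar R}) (m2 : {sigma_finite_measure set T2 -> \bar R})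
    (A : set (T1 * T2)) : measurable A ->
  (\int[m1]_x m2 [set y | A (x, y)] = \int[m2]_y m1 [set x | A (x, y)])%E.
Proof.
move=> mA; transitivity ((m1 \x m2)%E A).
  apply: eq_integral => x _ /=; congr (m2 _).
  by apply/seteqP; split => y; rewrite /xsection /= inE.
rewrite (@product_measure_unique _ _ _ _ _ m1 m2 (m1 \x^ m2)%E) => [|B C mB mC|//].
  apply: eq_integral => y _ /=; congr (m1 _).
  by apply/seteqP; split => x; rewrite /ysection /= inE.
exact: product_measure2E.
Qed.

Lemma lebR_symmetric_itv (R : realType) (M : \bar R) : (0 <= M)%E ->
  lebR [set t : R | ((2 * `|t|)%:E < M)%E] = M.
Proof.
case: M => [m| |//] m0.
  have -> : [set t : R | ((2 * `|t|)%:E < m%:E)%E] = `](- (m / 2)), (m / 2)[%classic.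
    apply/seteqP; split => t /=; rewrite in_itv/= lte_fin -ltr_norml.
    - by rewrite ltr_pdivlMr// mulrC.
    - by rewrite ltr_pdivlMr// mulrC.
  rewrite /lebR lebesgue_measure_itv/= lte_fin; rewrite lee_fin in m0.
  case: ltP => h; last by congr EFin; lra.
  by rewrite -EFinB; congr EFin; field.
have -> : [set t : R | ((2 * `|t|)%:E < +oo)%E] = setT.
  by apply/seteqP; split => t //= _; rewrite ltry.
by rewrite /lebR -set_itvNyy lebesgue_measure_itv.
Qed.

(* Steiner symmetrization in the first coordinate, after the other coordinates
   have been made symmetric. The parameter [y] carries the coordinates which
   are not to be symmetrized yet, and [D] what is left for the squared distance. *)
Lemma steiner_symmetrization (R : realType) n :
  forall d (Y : measurableType d) (D : Y -> Y -> R) (B : set (Y * 'rV[R]_n)), measurable B ->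
  (forall p q, B p -> B q -> dotp (p.2 - q.2) (p.2 - q.2) <= D p.1 q.1) ->
  exists S : set (Y * 'rV[R]_n), [/\ measurable S,
    forall y x, S (y, x) -> S (y, - x),
    forall y, lebesgue_rV n [set x | S (y, x)] = lebesgue_rV n [set x | B (y, x)] &
    forall p q, S p -> S q -> dotp (p.2 - q.2) (p.2 - q.2) <= D p.1 q.1].
Proof.
elim: n => [|n IHn] dY Y D B mB HB.
  by exists B; split => // y x; rewrite (_ : - x = x)//; apply/rowP => -[].
pose e (p : (Y * R) * 'rV[R]_n) := (p.1.1, rV_cons (p.1.2, p.2)).
have me : measurable_fun setT e.
  apply: measurable_fun_pair; first exact: (measurableT_comp measurable_fst measurable_fst).
  apply: (measurableT_comp (@measurable_rV_cons R n)).
  by apply: measurable_fun_pair => //; exact: (measurableT_comp measurable_snd measurable_fst).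
have consB (t u : R) (x z : 'rV[R]_n) : dotp (rV_cons (t, x) - rV_cons (u, z)) (rV_cons (t, x) - rV_cons (u, z)) =
    (t - u) ^+ 2 + dotp (x - z) (x - z).
  rewrite (_ : rV_cons (t, x) - rV_cons (u, z) = rV_cons (t - u, x - z)) ?dotp_rV_cons//.
  have := rV_cons_affine (-1) u t z x; rewrite !scaleN1r mulN1r addrC => ->.
  by rewrite addrC [- z + x]addrC.
(* The first coordinate joins the parameters and its share of the squared distance is subtracted
   from [D]; the induction hypothesis symmetrizes the others. *)
have [S1 [mS1 sS1 lS1 dS1]] := IHn _ (Y * R)%type (fun p q => D p.1 q.1 - (p.2 - q.2) ^+ 2)
  (e @^-1` B) (ltac:(by rewrite -[X in measurable X]setTI; exact: me)) (ltac:(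
   by move=> [[y t] x] [[z u] x'] /= h1 h2; have := HB _ _ h1 h2; rewrite /= consB; lra)).
pose m (p : Y * 'rV[R]_n) : \bar R := lebR [set t | S1 ((p.1, t), p.2)].
pose sw (q : (Y * 'rV[R]_n) * R) := ((q.1.1, q.2), q.1.2).
have msw : measurable_fun setT sw.
  apply: measurable_fun_pair; last exact: (measurableT_comp measurable_snd measurable_fst).
  by apply: measurable_fun_pair => //; exact: (measurableT_comp measurable_fst measurable_fst).
have msS : measurable (sw @^-1` S1) by rewrite -[X in measurable X]setTI; exact: msw.
have mm : measurable_fun setT m.
  have := @measurable_fun_xsection _ _ _ _ R (@lebR R) _ msS.
  congr measurable_fun; apply/funext => p; congr lebR.
  by apply/seteqP; split => t; rewrite /xsection /= inE.
have m0 p : (0 <= m p)%E by exact: measure_ge0.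
have mt p : measurable [set t | S1 ((p.1, t), p.2)].
  rewrite (_ : [set t | _] = xsection (sw @^-1` S1) p); first exact: measurable_xsection.
  by apply/seteqP; split => t; rewrite /xsection /= inE.
pose u (p : Y * 'rV[R]_n.+1) := (p.1, rV_uncons p.2).
have mu : measurable_fun setT u.
  apply: measurable_fun_pair => //.
  by apply: (measurableT_comp (@measurable_rV_uncons R n)).
(* Each section of [S1] in the first coordinate is replaced by the centred open interval of the
   same, possibly infinite, length. *)
pose S := [set p : Y * 'rV[R]_n.+1 | ((2 * `|(u p).2.1|)%:E < m ((u p).1, (u p).2.2))%E].
have SE y t x : S (y, rV_cons (t, x)) <-> ((2 * `|t|)%:E < m (y, x))%E.
  have E : u (y, rV_cons (t, x)) = (y, (t, x)) by rewrite /u rV_consK.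
  rewrite -[S _]/(is_true ((2 * `|(u (y, rV_cons (t, x))).2.1|)%:E <
    m ((u (y, rV_cons (t, x))).1, (u (y, rV_cons (t, x))).2.2))%E).
  by rewrite E.
have mS : measurable S.
  rewrite -[X in measurable X]setTI; apply: measurable_lte => //.
    apply/measurable_EFinP; apply: measurable_funM => //.
    apply: (measurableT_comp (@normr_measurable R setT)).
    by apply: (measurableT_comp (f := fun q : Y * (R * 'rV[R]_n) => q.2.1)) => //; exact: (measurableT_comp measurable_fst measurable_snd).
  apply: (measurableT_comp mm).
  apply: (measurableT_comp (f := fun q : Y * (R * 'rV[R]_n) => (q.1, q.2.2))) => //.
  by apply: measurable_fun_pair => //; exact: (measurableT_comp measurable_snd measurable_snd).
exists S; split => //.
- move=> y x; rewrite -(rV_unconsK x); case: (rV_uncons x) => t z.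
  rewrite (_ : - rV_cons (t, z) = rV_cons (- t, - z)); last first.
    have c0 : rV_cons (0 : R, 0 : 'rV[R]_n) = 0.
      apply: (addrI (rV_cons (0, 0))); rewrite addr0.
      have := rV_cons_affine 1 0 0 (0 : 'rV[R]_n) 0.
      by rewrite scale1r mulr0 scaler0 !addr0.
    have := rV_cons_affine (-1) t 0 z 0; rewrite c0 addr0 !scaleN1r => ->.
    by rewrite mulN1r !addr0.
  (* Symmetry under reflection of all coordinates needs the section lengths to be even in [z]; this
     is why the other coordinates come first. *)
  move=> /SE h; apply/SE; rewrite normrN (_ : m (y, - z) = m (y, z))//.
  congr lebR; apply/seteqP; split => s /= /sS1; by rewrite ?opprK.
- move=> y; rewrite !lebesgue_rVS.
  pose A := [set q : R * 'rV[R]_n | S (y, rV_cons q)].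
  have mA : measurable A.
    rewrite -[X in measurable X]setTI; apply: (_ : measurable_fun setT (fun q : R * 'rV[R]_n => (y, rV_cons q))) => //.
    by apply: measurable_fun_pair => //; exact: measurable_rV_cons.
  rewrite (integral_sections (@lebR R) (lebesgue_rV n) mA).
  transitivity (\int[lebesgue_rV n]_x m (y, x))%E.
    apply: eq_integral => x _; rewrite -[RHS]lebR_symmetric_itv//; congr lebR.
    by apply/seteqP; split => t /SE.
  pose A1 := [set q : R * 'rV[R]_n | S1 ((y, q.1), q.2)].
  have mA1 : measurable A1.
    rewrite -[X in measurable X]setTI; apply: (_ : measurable_fun setT (fun q : R * 'rV[R]_n => ((y, q.1), q.2))) => //.
    by apply: measurable_fun_pair => //; apply: measurable_fun_pair => //.
  rewrite -(integral_sections (@lebR R) (lebesgue_rV n) mA1).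
  by apply: eq_integral => t _; exact: (lS1 (y, t)).
- move=> [y x] [y' x']; rewrite -(rV_unconsK x) -(rV_unconsK x').
  case: (rV_uncons x) => t z; case: (rV_uncons x') => t' z' /SE h /SE h' /=.
  rewrite consB -lerBrDr; set c := D y y' - _.
  have near s s' : S1 ((y, s), z) -> S1 ((y', s'), z') -> (s - s') ^+ 2 <= c.
    by move=> h1 h2; have := dS1 _ _ h1 h2; rewrite /c /=; lra.
  have [s Ss] : exists s, S1 ((y, s), z).
    apply: contrapT => /forallNP H; move: h; rewrite /m (_ : [set _ | _] = set0) ?measure0 ?lte_fin.
      by rewrite ltNge mulr_ge0.
    by apply/seteqP; split => // s' /H.
  have [s' Ss'] : exists s, S1 ((y', s), z').
    apply: contrapT => /forallNP H; move: h'; rewrite /m (_ : [set _ | _] = set0) ?measure0 ?lte_fin.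
      by rewrite ltNge mulr_ge0.
    by apply/seteqP; split => // s'' /H.
  have c0 : 0 <= c := le_trans (sqr_ge0 _) (near _ _ Ss Ss').
  rewrite -[c]sqr_sqrtr// -[(t - t') ^+ 2]real_normK ?num_real// ler_sqr ?nnegrE ?sqrtr_ge0//.
  apply: (symmetrized_distance (mt (y, z)) (mt (y', z')) _ h h').
  move=> r r' h1 h2; rewrite -ler_sqr ?nnegrE ?sqrtr_ge0// real_normK ?num_real// sqr_sqrtr//.
  exact: near.
Qed.

(** The symmetrized set contains [-x] with [x], so its diameter bound gives [|2 x| <= D]: it fits
    into the ball of radius [D / 2]. *)
Lemma isodiametric (R : realType) n (A : set 'rV[R]_n) (D : R) : 0 <= D -> measurable A ->
  (forall x y, A x -> A y -> enorm (x - y) <= D) ->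
  (lebesgue_rV n A <= @ball_volume R n * ((D / 2) ^+ n)%:E)%E.
Proof.
move=> D0 mA h.
have [S [mS sS lS dS]] := @steiner_symmetrization R n _ unit (fun _ _ => D ^+ 2) (snd @^-1` A)
  (ltac:(by rewrite -[X in measurable X]setTI; exact: measurable_snd)) (ltac:(
   by move=> p q hp hq; rewrite -enorm_le//; exact: h)).
rewrite -(lebesgue_rV_ball 0) ?divr_ge0//.
have -> : A = [set x | (snd @^-1` A) (tt, x)] by [].
rewrite -lS; apply: le_measure; rewrite ?inE.
- rewrite (_ : [set _ | _] = xsection S tt); first exact: measurable_xsection.
  by apply/seteqP; split => t; rewrite /xsection /= inE.
- by under eq_set do rewrite subr0; exact: measurable_enorm_ball.
- move=> x Sx /=; have := dS _ _ Sx (sS _ _ Sx); rewrite /= opprK -mulr2n -scaler_nat dotpZ.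
  by rewrite subr0 enorm_le ?divr_ge0// expr_div_n ler_pdivlMr ?exprn_gt0// mulrC.
Qed.

(** * Covering cubes by balls *)

Definition box (R : realType) n (a : 'rV[R]_n) (h : R) : set 'rV[R]_n :=
  [set x | forall i, a ord0 i <= x ord0 i < a ord0 i + h].

Lemma measurable_box (R : realType) n (a : 'rV[R]_n) (h : R) : measurable (box a h).
Proof.
rewrite (_ : box a h = \bigcap_(i in [set: 'I_n])
    ((fun x : 'rV[R]_n => x ord0 i) @^-1` `[a ord0 i, a ord0 i + h[%classic)).
  apply: fin_bigcap_measurable => // i _; rewrite -[X in measurable X]setTI.
  exact: measurable_rV_coord.
apply/seteqP; split => x H i; first by move=> _ /=; rewrite in_itv/=; exact: H.
by have := H i I; rewrite /= in_itv.
Qed.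

Lemma lebesgue_rV_box (R : realType) n (a : 'rV[R]_n) (h : R) : 0 < h ->
  lebesgue_rV n (box a h) = (h ^+ n)%:E.
Proof.
move=> h0; rewrite (_ : box a h = [set x : 'rV[R]_n | forall i, `[a ord0 i, a ord0 i + h[%classic (x ord0 i)]).
  rewrite (@lebesgue_rV_prod R n (fun i => `[a ord0 i, a ord0 i + h[%classic) (fun=> h)) => [|i|i].
  - by rewrite prodr_const card_ord.
  - exact: measurable_itv.
  - rewrite /lebR lebesgue_measure_itv/= lte_fin ltrDl h0 -EFinB; congr EFin; ring.
by apply/seteqP; split => x H i; have := H i; rewrite /= in_itv.
Qed.

Lemma ball_volume_lty (R : realType) n : (@ball_volume R n < +oo)%E.
Proof.
apply: (@le_lt_trans _ _ (lebesgue_rV n (box (const_mx (-1) : 'rV[R]_n) 3))); last first.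
  by rewrite lebesgue_rV_box// ltry.
apply: le_measure; rewrite ?inE; [exact: measurable_enorm_ball|exact: measurable_box|].
move=> x /= x1 i; rewrite mxE; have := le_trans (coord_le_enorm x i) x1.
by rewrite ler_norml => /andP[? ?]; apply/andP; split; lra.
Qed.

Lemma box_enorm (R : realType) n (a x y : 'rV[R]_n) (h : R) : 0 < h -> box a h x -> box a h y ->
  enorm (x - y) <= n%:R * h.
Proof.
move=> h0 bx by'; apply: enorm_le_coord; first exact: ltW.
move=> i; rewrite !mxE ler_norml; have := bx i; have := by' i.
by move=> /andP[? ?] /andP[? ?]; apply/andP; split; lra.
Qed.

Lemma ball_volume_gt0 (R : realType) n : (0 < @ball_volume R n)%E.
Proof.
pose h : R := n.+1%:R^-1.
have h0 : 0 < h by rewrite invr_gt0.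
apply: (@lt_le_trans _ _ (lebesgue_rV n (box (0 : 'rV[R]_n) h))).
  by rewrite lebesgue_rV_box// lte_fin exprn_gt0.
apply: le_measure; rewrite ?inE; [exact: measurable_box|exact: measurable_enorm_ball|].
move=> x bx /=; have b0 : box (0 : 'rV[R]_n) h 0 by move=> i; rewrite mxE add0r lexx h0.
have := box_enorm h0 bx b0; rewrite subr0 => /le_trans; apply.
by rewrite /h ler_pdivrMr// mul1r ler_nat.
Qed.

Definition grid_cell (R : realType) n (a : 'rV[R]_n) (h : R) N (k : {ffun 'I_n -> 'I_N.+1}) : set 'rV[R]_n :=
  box (a + (h / N.+1%:R) *: (\row_i (k i)%:R)) (h / N.+1%:R).

Lemma grid_cellP (R : realType) n (a : 'rV[R]_n) (h : R) N (k : {ffun 'I_n -> 'I_N.+1}) x : 0 < h ->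
  grid_cell a h k x <->
  forall i, (k i)%:R <= (x ord0 i - a ord0 i) / (h / N.+1%:R) < (k i)%:R + 1.
Proof.
move=> h0; have : 0 < h / N.+1%:R by rewrite divr_gt0.
rewrite /grid_cell; move: (h / N.+1%:R) => e e0.
split => H i; have := H i; rewrite !mxE ler_pdivlMr// ltr_pdivrMr// => /andP[h1 h2];
  by apply/andP; split; nra.
Qed.

Lemma grid_cell_trivIset (R : realType) n (a : 'rV[R]_n) (h : R) N (k l : {ffun 'I_n -> 'I_N.+1}) x :
  0 < h -> grid_cell a h k x -> grid_cell a h l x -> k = l.
Proof.
move=> h0 /(grid_cellP _ _ _ h0) hk /(grid_cellP _ _ _ h0) hl; apply/ffunP => i; apply: val_inj => /=.
move: (hk i) (hl i) => /andP[h1 h2] /andP[h3 h4].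
have := le_lt_trans h1 h4; have := le_lt_trans h3 h2.
by rewrite !natr1 !ltr_nat !ltnS => h5 h6; apply/eqP; rewrite eqn_leq h5 h6.
Qed.

Lemma grid_cell_cover (R : realType) n (a : 'rV[R]_n) (h : R) N x : 0 < h ->
  box a h x -> exists k : {ffun 'I_n -> 'I_N.+1}, grid_cell a h k x.
Proof.
move=> h0 bx; pose y i := (x ord0 i - a ord0 i) / (h / N.+1%:R).
have e0 : 0 < h / N.+1%:R by rewrite divr_gt0.
have y0 i : 0 <= y i.
  by apply: divr_ge0; [rewrite subr_ge0; have /andP[] := bx i|exact: ltW].
have yN i : y i < N.+1%:R.
  rewrite ltr_pdivrMr// [X in _ < X]mulrC divfK ?pnatr_eq0//.
  by have /andP[_] := bx i; rewrite ltrBlDl.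
exists [ffun i => inord (Num.truncn (y i))]; apply/grid_cellP => // i.
have /andP[t1 t2] := truncn_itv (y0 i).
by rewrite ffunE inordK ?natr1 ?t1 ?t2// -(ltr_nat R) (le_lt_trans t1).
Qed.

Lemma grid_cell_sub (R : realType) n (a : 'rV[R]_n) (h : R) N (k : {ffun 'I_n -> 'I_N.+1}) :
  0 < h -> grid_cell a h k `<=` box a h.
Proof.
move=> h0 x /(grid_cellP _ _ _ h0) H i; have /andP[h1 h2] := H i.
have e0 : 0 < h / N.+1%:R by rewrite divr_gt0.
have k0 : 0 <= (k i)%:R :> R by [].
have kN : (k i)%:R + 1 <= N.+1%:R :> R by rewrite natr1 ler_nat.
move: (le_trans k0 h1) (lt_le_trans h2 kN); rewrite pmulr_lge0 ?invr_gt0//.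
by rewrite ltr_pdivrMr// [X in _ < X]mulrC divfK ?pnatr_eq0// => h3 h4; apply/andP; split; lra.
Qed.

(* [q] is the best constant in [nu (box a h) <= q h ^+ n]. Covering a box by its
   inscribed ball and by the cells of a fine grid which leave that ball gives
   [q <= c om 2 ^- n + (1 - om r ^+ n) q] for every [r < 1 / 2]. *)
Lemma box_content_le (R : realType) n (nu : set 'rV[R]_n -> \bar R) (c : R) : 0 <= c ->
  nu set0 = 0%E -> (forall A, 0 <= nu A)%E ->
  (forall A B C, A `<=` B `|` C -> (nu A <= nu B + nu C)%E) ->
  (forall x r, 0 < r ->
    (nu [set y | (enorm (y - x) <= r)%R] <= c%:E * (@ball_volume R n * (r ^+ n)%:E))%E) ->
  forall a h, 0 < h -> (nu (box a h) <= (c * h ^+ n)%:E)%E.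
Proof.
move=> c0 nu0 nup nuU nub.
have nuS A B : A `<=` B -> (nu A <= nu B)%E.
  by move=> AB; have := nuU A B set0; rewrite setU0 nu0 adde0; apply.
have nuF (I : eqType) (s : seq I) (F : I -> set 'rV[R]_n) A :
    (forall x, A x -> exists2 i, i \in s & F i x) -> (nu A <= \sum_(i <- s) nu (F i))%E.
  elim: s A => [|i s IHs] A AF.
    rewrite big_nil (_ : A = set0) ?nu0//.
    by apply/seteqP; split => // x /AF[].
  rewrite big_cons; apply: (@le_trans _ _ (nu (F i) + nu [set x | exists2 j, j \in s & F j x])%E).
    apply: nuU => x /AF[j]; rewrite inE => /predU1P[->|js] Fj; first by left.
    by right; exists j.
  by apply: leeD => //; apply: IHs.
set om := fine (@ball_volume R n).
have omE : @ball_volume R n = om%:E.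
  by rewrite fineK// ge0_fin_numE ?ball_volume_lty// ltW// ball_volume_gt0.
have om0 : 0 < om by rewrite -lte_fin -omE ball_volume_gt0.
rewrite omE in nub.
pose T := [set q : R | 0 <= q /\ forall a h, 0 < h -> (nu (box a h) <= (q * h ^+ n)%:E)%E].
have T0 : T !=set0.
  (* A crude constant from one ball around the box; [n + 1] instead of [n] keeps the radius positive
     in dimension 0. *)
  exists (c * om * n.+1%:R ^+ n); split; first by rewrite !mulr_ge0 ?exprn_ge0// ltW.
  move=> a h h0; have r0 : 0 < n.+1%:R * h :> R by rewrite mulr_gt0.
  apply: (@le_trans _ _ (nu [set y | enorm (y - a) <= n.+1%:R * h])).
    apply: nuS => x bx /=; have ba : box a h a by move=> i; rewrite lexx/= ltrDl.
    apply: le_trans (box_enorm h0 bx ba) _; by rewrite ler_pM2r// ler_nat.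
  by apply: le_trans (nub _ _ r0) _; rewrite -!EFinM lee_fin exprMn !mulrA.
have Tinf : has_inf T by split => //; exists 0 => q [].
have T1 (r : R) (q : R) : 0 < r -> r < 2^-1 -> T q -> T (c * om * 2^-1 ^+ n + (1 - om * r ^+ n) * q).
  move=> r0 r2 [q0 Hq].
  have main a h : 0 < h -> (nu (box a h) <= ((c * om * 2^-1 ^+ n + (1 - om * r ^+ n) * q) * h ^+ n)%:E)%E.
    (* Cells of diameter at most [(1 / 2 - r) h]: a cell that leaves the inscribed ball of radius
       [h / 2] cannot meet the concentric ball of radius [r h]. *)
    move=> h0; pose N := Num.truncn (n%:R / (2^-1 - r)).
    have d0 : 0 < 2^-1 - r by lra.
    have NP : n%:R / N.+1%:R <= 2^-1 - r.
      rewrite ler_pdivrMr// mulrC -ler_pdivrMr//; apply: ltW.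
      by have /andP[] := truncn_itv (x := n%:R / (2^-1 - r)) (divr_ge0 (ler0n _ _) (ltW d0)).
    pose z := a + const_mx (h / 2).
    pose bad (k : {ffun 'I_n -> 'I_N.+1}) := `[< ~ (grid_cell a h k `<=` [set y | enorm (y - z) <= h / 2]) >].
    pose s := [seq k <- enum {ffun 'I_n -> 'I_N.+1} | bad k].
    have e0 : 0 < h / N.+1%:R by rewrite divr_gt0.
    have far k x : bad k -> grid_cell a h k x -> r * h < enorm (x - z).
      move=> /asboolP nk kx; rewrite ltNge; apply/negP => xz; apply: nk => y ky /=.
      rewrite (_ : y - z = (y - x) + (x - z)); last by rewrite addrA subrK.
      apply: le_trans (enormD _ _) _; have := box_enorm e0 ky kx.
      have : n%:R * (h / N.+1%:R) <= (2^-1 - r) * h by rewrite mulrCA mulrC ler_pM2r.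
      by move: (_ * (h / _)) => u; lra.
    (* The bad cells are disjoint from each other and from the smaller ball, and all lie in the
       box. *)
    have vol : \sum_(k <- s) (h / N.+1%:R) ^+ n + om * (r * h) ^+ n <= h ^+ n.
      have -> : (\sum_(k <- s) (h / N.+1%:R) ^+ n) =
          fine (lebesgue_rV n (\bigcup_(k in [set` s]) grid_cell a h k)).
        rewrite measure_fin_bigcup//; last 2 first.
        - by move=> k l _ _ [x [kx lx]]; exact: (grid_cell_trivIset h0 kx lx).
        - by move=> k _; exact: measurable_box.
        rewrite -fsbig_seq; last by rewrite filter_uniq// enum_uniq.
        rewrite (eq_bigr (fun=> ((h / N.+1%:R) ^+ n)%:E)) => [|k _]; last exact: lebesgue_rV_box.
        by rewrite sumEFin.
      have mU : measurable (\bigcup_(k in [set` s]) grid_cell a h k).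
        by apply: fin_bigcup_measurable => // k _; exact: measurable_box.
      have Uf : lebesgue_rV n (\bigcup_(k in [set` s]) grid_cell a h k) \is a fin_num.
        rewrite ge0_fin_numE//; apply: (@le_lt_trans _ _ (lebesgue_rV n (box a h))).
          apply: le_measure; rewrite ?inE//; first exact: measurable_box.
          by move=> x [k _ kx]; exact: (grid_cell_sub h0 kx).
        by rewrite lebesgue_rV_box// ltry.
      rewrite -lee_fin EFinD fineK// EFinM -omE -(lebesgue_rV_ball z); last by rewrite mulr_ge0 ?ltW.
      have mB : measurable [set x : 'rV[R]_n | enorm (x - z) <= r * h].
        have := measurable_rV_affine 1 (- z) measurableT (measurable_enorm_ball (r * h)).
        rewrite setTI (_ : _ @^-1` _ = [set x : 'rV[R]_n | enorm (x - z) <= r * h])//.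
        by apply/seteqP; split => x /=; rewrite scale1r.
      rewrite -measureU//; last first.
        apply/seteqP; split => // x [[k /= ks kx] xz].
        move: ks; rewrite mem_filter => /andP[bk _].
        by move: (far _ _ bk kx); rewrite ltNge xz.
      rewrite -(lebesgue_rV_box a h0); apply: le_measure; rewrite ?inE//.
      - exact: measurableU.
      - exact: measurable_box.
      move=> x [[k _ kx]|/= xz]; first exact: (grid_cell_sub h0 kx).
      move=> i; have := le_trans (coord_le_enorm _ i) xz.
      rewrite !mxE ler_norml => /andP[h1 h2].
      have : r * h < h / 2 by rewrite mulrC ltr_pM2l.
      by move=> h3; apply/andP; split; lra.
    apply: (@le_trans _ _ (nu [set y | (enorm (y - z) <= h / 2)%R] + \sum_(k <- s) nu (grid_cell a h k))%E).
      apply: (@le_trans _ _ (nu [set y | (enorm (y - z) <= h / 2)%R] +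
          nu (\bigcup_(k in [set` s]) grid_cell a h k))%E).
        apply: nuU => x bx; have [k kx] := @grid_cell_cover R n a h N x h0 bx.
        have [bk|gk] := boolP (bad k); [right|left].
          by exists k => //=; rewrite mem_filter bk mem_enum.
        by move: gk => /asboolPn/contrapT; apply.
      by apply: leeD => //; apply: nuF => x [k]; exists k.
    apply: (@le_trans _ _ ((c * om * (h / 2) ^+ n)%:E + \sum_(k <- s) (q * (h / N.+1%:R) ^+ n)%:E)%E).
      apply: leeD; last by apply: lee_sum => k _; exact: Hq.
      by apply: le_trans (nub _ _ _) _; rewrite ?divr_gt0// -!EFinM lee_fin mulrA.
    rewrite sumEFin -EFinD lee_fin -mulr_sumr.
    have := ler_wpM2l q0 vol; rewrite [(h / 2) ^+ n]exprMn [(r * h) ^+ n]exprMn.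
    by move: (\sum_(i <- s) _) (h ^+ n) (r ^+ n) (2^-1 ^+ n) => u1 u2 u3 u4; lra.
  split => //; have := main 0 1 ltr01; rewrite expr1n mulr1.
  by move=> /(le_trans (nup _)); rewrite lee_fin.
pose q := inf T.
have Tq : T q.
  split; first by apply: lb_le_inf => // x [].
  move=> a h h0; have hn : 0 < h ^+ n by exact: exprn_gt0.
  have [Q [Q0 HQ]] := T0.
  have nf : nu (box a h) \is a fin_num.
    by rewrite ge0_fin_numE//; exact: le_lt_trans (HQ a h h0) (ltry _).
  rewrite -(fineK nf) lee_fin -ler_pdivrMr//; apply: lb_le_inf => // x [x0 Hx].
  by rewrite ler_pdivrMr// -lee_fin fineK//; exact: Hx.
(* Minimality of [q] against the improved constant [c om 2^-n + (1 - om r^n) q]; after [q] is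
   subtracted, [om] cancels. *)
have qle (r : R) : 0 < r -> r < 2^-1 -> q * r ^+ n <= c * 2^-1 ^+ n.
  move=> r0 r2; have /(ge_inf Tinf.2) := T1 r q r0 r2 Tq; rewrite -/q => H.
  rewrite -(ler_pM2l om0); lra.
have qc : q <= c.
  have p2 : 0 < 2^-1 ^+ n :> R by rewrite exprn_gt0 ?invr_gt0.
  rewrite -(ler_pM2r p2).
  have lim : (fun r : R => q * r ^+ n) @ (2^-1 : R)^'- --> q * 2^-1 ^+ n.
    apply: cvg_at_left_filter; apply: cvgM; first exact: cvg_cst.
    exact: exprn_continuous.
  apply: (cvgr_to_le lim).
  near=> r; apply: qle; first by near: r; apply: nbhs_left_gt; rewrite invr_gt0.
  by near: r; exact: nbhs_left_lt.
by move=> a h h0; apply: le_trans (Tq.2 a h h0) _; rewrite lee_fin ler_wpM2r ?exprn_ge0// ltW.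
Unshelve. all: end_near. Qed.

(** * Area of the sphere *)

(* Inverse stereographic projection from the north pole (0, 1). *)
Definition stereo (R : realType) d (y : 'rV[R]_d.-1) : pt R d :=
  ((2 / (1 + dotp y y)) *: y, (dotp y y - 1) / (1 + dotp y y)).

Lemma dotp1_gt0 (R : realType) n (y : 'rV[R]_n) : 0 < 1 + dotp y y.
Proof. by rewrite ltr_wpDr ?dotp_ge0. Qed.

Lemma norm2_ge0 (R : realType) d (x : pt R d) : 0 <= norm2 x.
Proof. exact: sqrtr_ge0. Qed.

Lemma sqr_norm2 (R : realType) d (x : pt R d) : norm2 x ^+ 2 = dotp x.1 x.1 + x.2 ^+ 2.
Proof. by rewrite norm2E sqr_sqrtr// addr_ge0 ?dotp_ge0 ?sqr_ge0. Qed.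

Lemma dotp_scale2 (R : realType) n (a b : R) (x y : 'rV[R]_n) : dotp (a *: x) (b *: y) = a * b * dotp x y.
Proof. by rewrite /dotp mulr_sumr; apply: eq_bigr => i _; rewrite !mxE; ring. Qed.

(** An exact formula; [stereo_lipschitz], [stereo_expand] and the diameter bound in
    [hausdorff_content_sphere_lower] are all read off it. *)
Lemma stereo_chord (R : realType) d (x y : 'rV[R]_d.-1) :
  norm2 (stereo x - stereo y : pt R d) =
  2 * enorm (x - y) / Num.sqrt ((1 + dotp x x) * (1 + dotp y y)).
Proof.
have X0 := dotp1_gt0 x; have Y0 := dotp1_gt0 y.
apply/eqP; rewrite -(@eqrXn2 _ 2) ?norm2_ge0 ?divr_ge0 ?mulr_ge0 ?enorm_ge0 ?sqrtr_ge0//.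
rewrite sqr_norm2 expr_div_n exprMn sqr_enorm sqr_sqrtr ?mulr_ge0 ?ltW//.
rewrite /= !dotpB !dotpZ dotp_scale2.
apply/eqP; field; by rewrite !gt_eqF.
Qed.

Lemma stereo_sphere (R : realType) d (y : 'rV[R]_d.-1) : norm2 (stereo y : pt R d) = 1.
Proof.
apply/eqP; rewrite -(@eqrXn2 _ 2 _ 1) ?norm2_ge0// expr1n sqr_norm2 /= dotpZ.
by apply/eqP; field; rewrite gt_eqF ?dotp1_gt0.
Qed.

Lemma stereo_onto (R : realType) d (x : pt R d) : norm2 x = 1 -> x <> (0, 1) ->
  exists y, stereo y = x.
Proof.
case: x => p t x1 xN.
have E : dotp p p + t ^+ 2 = 1 by rewrite -(sqr_norm2 (p, t)) x1 expr1n.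
have t1 : t != 1.
  apply/eqP => t1; apply: xN; rewrite t1; congr pair; apply: dotp_eq0.
  by move: E; rewrite t1 expr1n; lra.
have u0 : 1 - t != 0 by rewrite subr_eq0 eq_sym.
exists ((1 - t)^-1 *: p).
have -> : stereo ((1 - t)^-1 *: p) = ((2 / (1 + dotp ((1 - t)^-1 *: p) ((1 - t)^-1 *: p))) *: ((1 - t)^-1 *: p),
  (dotp ((1 - t)^-1 *: p) ((1 - t)^-1 *: p) - 1) / (1 + dotp ((1 - t)^-1 *: p) ((1 - t)^-1 *: p))) by [].
have pE : dotp p p = (1 - t) * (1 + t) by lra.
have D : dotp ((1 - t)^-1 *: p) ((1 - t)^-1 *: p) = (1 + t) / (1 - t).
  by rewrite dotpZ pE; field.
have S : 1 + (1 + t) / (1 - t) = 2 / (1 - t) by field.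
rewrite D S; congr pair; last by field; rewrite u0.
by rewrite scalerA (_ : _ * _ = 1) ?scale1r//; field; rewrite u0.
Qed.

(** Since [2 |y| <= 1 + |y|^2], the relative oscillation of [1 + |x|^2] depends on the distance
    only. One mesh size therefore works on cubes of any size. *)
Lemma radial_osc (R : realType) n (x y : 'rV[R]_n) :
  1 + dotp x x <= (1 + 2 * enorm (x - y) * (1 + enorm (x - y))) * (1 + dotp y y).
Proof.
have -> : x = y + (x - y) by rewrite addrC subrK.
rewrite [y + (x - y) - y]addrC addKr dotpD -!sqr_enorm.
have := dotp_le_enorm y (x - y); have := enorm_ge0 (x - y); have := enorm_ge0 y.
move: (enorm (x - y)) (enorm y) (dotp y _) => e r z r0 e0 zre.
have h1 : 0 <= e * (1 - r) ^+ 2 by rewrite mulr_ge0 ?sqr_ge0.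
have h2 : 0 <= (e * r) ^+ 2 by exact: sqr_ge0.
have h3 : 0 <= e * r ^+ 2 by rewrite mulr_ge0 ?sqr_ge0.
have h4 := sqr_ge0 e.
nra.
Qed.

Lemma diam_le (R : realType) (T : Type) (dist : T -> T -> R) (C : set T) (r : R) :
  (forall x y, C x -> C y -> dist x y <= r) -> (diam dist C <= r%:E)%E.
Proof. by move=> H; apply: ub_ereal_sup => _ [[x y] [/= Cx Cy] <-]; rewrite lee_fin; exact: H. Qed.

Lemma diam_ge (R : realType) (T : Type) (dist : T -> T -> R) (C : set T) x y :
  C x -> C y -> ((dist x y)%:E <= diam dist C)%E.
Proof. by move=> Cx Cy; apply: ereal_sup_ubound; exists (x, y). Qed.

Lemma diam_fineK (R : realType) (T : Type) (dist : T -> T -> R) (C : set T) x (r : R) :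
  C x -> (diam dist C <= r%:E)%E -> (fine (diam dist C))%:E = diam dist C.
Proof.
move=> Cx H; rewrite fineK// fin_numE -ltNye -lteey.
rewrite (le_lt_trans H (ltry _)) andbT; apply: lt_le_trans (diam_ge dist Cx Cx); exact: ltNyr.
Qed.

Lemma hausdorff_gauge_ge0 (R : realType) (T : Type) (dist : T -> T -> R) k (C : set T) :
  (forall x y, 0 <= dist x y) -> (0 <= hausdorff_gauge dist k C)%E.
Proof.
move=> d0; rewrite /hausdorff_gauge; case: eqP => // /eqP/set0P[x Cx].
apply: mule_ge0; first exact: ltW (ball_volume_gt0 _ _).
rewrite lee_fin exprn_ge0// divr_ge0// fine_ge0//.
by apply: le_trans (diam_ge dist Cx Cx); rewrite lee_fin.
Qed.

Lemma hausdorff_gauge_le (R : realType) (T : Type) (dist : T -> T -> R) k (C : set T) (r : R) :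
  (forall x y, 0 <= dist x y) -> 0 <= r -> (forall x y, C x -> C y -> dist x y <= r) ->
  (hausdorff_gauge dist k C <= @ball_volume R k * ((r / 2) ^+ k)%:E)%E.
Proof.
move=> d0 r0 H; rewrite /hausdorff_gauge; case: eqP => [_|/eqP/set0P[x Cx]].
  by rewrite mule_ge0 ?measure_ge0// lee_fin exprn_ge0// divr_ge0.
have D := diam_le H; have E := diam_fineK Cx D.
apply: lee_wpmul2l; first exact: measure_ge0.
have f0 : 0 <= fine (diam dist C) by rewrite fine_ge0//; apply: le_trans (diam_ge dist Cx Cx); rewrite lee_fin.
rewrite lee_fin lerXn2r ?nnegrE ?divr_ge0//.
by rewrite ler_pM2r ?invr_gt0// -lee_fin E.
Qed.

(* Finite covers suffice for upper bounds, and make subadditivity immediate. *)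
Definition finite_content (R : realType) (T : Type) (dist : T -> T -> R) k (delta : R) (A : set T) : \bar R :=
  ereal_inf [set (\sum_(C <- s) hausdorff_gauge dist k C)%E | s in [set s : seq (set T) |
    (forall x, A x -> exists2 C, C \in s & C x) /\ forall C, C \in s -> (diam dist C <= delta%:E)%E]].

Lemma finite_content_ge0 (R : realType) (T : Type) (dist : T -> T -> R) k delta (A : set T) :
  (forall x y, 0 <= dist x y) -> (0 <= finite_content dist k delta A)%E.
Proof.
move=> d0; apply: le_ereal_inf_tmp => _ [s _ <-].
by apply: sume_ge0 => C _; exact: hausdorff_gauge_ge0.
Qed.

Lemma finite_content1 (R : realType) (T : Type) (dist : T -> T -> R) k (delta r : R) (A : set T) :
  (forall x y, 0 <= dist x y) -> 0 <= r -> r <= delta -> (forall x y, A x -> A y -> dist x y <= r) ->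
  (finite_content dist k delta A <= @ball_volume R k * ((r / 2) ^+ k)%:E)%E.
Proof.
move=> d0 r0 rd H; apply: le_trans (hausdorff_gauge_le k d0 r0 H).
apply: ereal_inf_lbound; exists [:: A]; last by rewrite big_seq1.
split => [x Ax|C]; first by exists A; rewrite ?inE.
by rewrite inE => /eqP ->; apply: le_trans (diam_le H) _; rewrite lee_fin.
Qed.

Lemma finite_content0 (R : realType) (T : Type) (dist : T -> T -> R) k delta :
  (forall x y, 0 <= dist x y) -> finite_content dist k delta set0 = 0%E.
Proof.
move=> d0; apply/eqP; rewrite eq_le finite_content_ge0// andbT.
by apply: ereal_inf_lbound; exists [::]; rewrite ?big_nil//; split.
Qed.

Lemma finite_contentU (R : realType) (T : Type) (dist : T -> T -> R) k delta (A B C : set T) :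
  (forall x y, 0 <= dist x y) -> A `<=` B `|` C ->
  (finite_content dist k delta A <= finite_content dist k delta B + finite_content dist k delta C)%E.
Proof.
move=> d0 ABC; have B0 := finite_content_ge0 k delta B d0; have C0 := finite_content_ge0 k delta C d0.
have [->|Bf] := eqVneq (finite_content dist k delta B) +oo%E.
  by rewrite addye ?leey// gt_eqF// (lt_le_trans _ C0).
have [->|Cf] := eqVneq (finite_content dist k delta C) +oo%E.
  by rewrite addey ?leey// gt_eqF// (lt_le_trans _ B0).
apply/lee_addgt0Pr => e e0; have e2 : 0 < e / 2 by rewrite divr_gt0.
have [_ [s1 [s11 s12] <-] h1] := lb_ereal_inf_adherent e2
  (ltac:(by rewrite ge0_fin_numE// ltey) : finite_content dist k delta B \is a fin_num).
have [_ [s2 [s21 s22] <-] h2] := lb_ereal_inf_adherent e2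
  (ltac:(by rewrite ge0_fin_numE// ltey) : finite_content dist k delta C \is a fin_num).
apply: (@le_trans _ _ (\sum_(D <- s1 ++ s2) hausdorff_gauge dist k D)%E).
  apply: ereal_inf_lbound; exists (s1 ++ s2) => //; split => [x /ABC[Bx|Cx]|D].
  - by have [D Ds Dx] := s11 x Bx; exists D; rewrite // mem_cat Ds.
  - by have [D Ds Dx] := s21 x Cx; exists D; rewrite // mem_cat Ds orbT.
  - by rewrite mem_cat => /orP[/s12|/s22].
rewrite big_cat/=; apply: le_trans (leeD (ltW h1) (ltW h2)) _.
by rewrite addeACA -EFinD -splitr.
Qed.

Lemma hausdorff_content_finite (R : realType) (T : Type) (dist : T -> T -> R) k delta (A : set T) :
  (forall x y, 0 <= dist x y) ->
  (hausdorff_content dist k delta A <= finite_content dist k delta A)%E.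
Proof.
move=> d0; apply: le_ereal_inf_tmp => _ [s [s1 s2] <-].
(* The finite cover is continued by empty sets, whose gauge is 0. *)
apply: (@le_trans _ _ (\sum_(0 <= i <oo) hausdorff_gauge dist k (nth set0 s i))%E).
  apply: ereal_inf_lbound; exists (nth set0 s) => //; split => [x /s1[C Cs Cx]|i].
    by exists (index C s) => //; rewrite nth_index.
  have [si|si] := ltnP i (size s); first by apply: s2; exact: mem_nth.
  by rewrite nth_default//; apply: diam_le.
apply: lime_le; first by apply: is_cvg_nneseries => i _ _; exact: hausdorff_gauge_ge0.
apply: nearW => m; rewrite [leRHS](big_nth set0).
have [ms|ms] := leqP m (size s).
  rewrite (big_cat_nat (n := m) (leq0n m) ms)/=; apply: leeDl.
  by apply: sume_ge0 => i _; exact: hausdorff_gauge_ge0.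
rewrite (big_cat_nat (n := size s) (leq0n _) (ltnW ms))/= [X in (_ + X)%E]big1_seq ?adde0//.
move=> i /andP[_]; rewrite mem_index_iota => /andP[si _].
by rewrite nth_default// /hausdorff_gauge eqxx.
Qed.

(** The Jacobian of [stereo]: the power [n] of its conformal factor. *)
Definition stereo_density (R : realType) n (y : 'rV[R]_n) : R := (2 / (1 + dotp y y)) ^+ n.

Lemma stereo_density_ge0 (R : realType) n (y : 'rV[R]_n) : 0 <= stereo_density y.
Proof. by rewrite exprn_ge0// divr_ge0// ltW// dotp1_gt0. Qed.

Lemma stereo_densityE (R : realType) n (y : 'rV[R]_n) :
  (stereo_density y)%:E = ((2 ^+ n)%:E * ((1 + dotp y y) `^ (- n%:R))%:E)%E.
Proof.
by rewrite -EFinM powRN powR_mulrn ?ltW ?dotp1_gt0// /stereo_density expr_div_n.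
Qed.

Lemma integral_stereo_density (R : realType) n :
  (\int[lebesgue_rV n]_y (@stereo_density R n y)%:E = (2 ^+ n)%:E * @radial_int R n n%:R)%E.
Proof.
under eq_integral do rewrite stereo_densityE.
rewrite ge0_integralZT//.
- exact: measurable_radial.
- by move=> x; rewrite lee_fin powR_ge0.
Qed.

Lemma measurable_stereo_density (R : realType) n :
  measurable_fun setT (fun y : 'rV[R]_n => (stereo_density y)%:E).
Proof.
rewrite (_ : (fun _ => _) = (fun y : 'rV[R]_n => (2 ^+ n)%:E * ((1 + dotp y y) `^ (- n%:R))%:E)%E); last first.
  by apply/funext => y; rewrite stereo_densityE.
apply: emeasurable_funM => //; exact: measurable_radial.
Qed.

Definition osc_factor (R : realType) (e : R) : R := 1 + 2 * e * (1 + e).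

Lemma osc_factor_gt0 (R : realType) (e : R) : 0 <= e -> 0 < osc_factor e.
Proof. by move=> e0; rewrite /osc_factor ltr_pwDl// mulr_ge0 ?mulr_ge0// addr_ge0. Qed.

Lemma osc_bound (R : realType) n (x y : 'rV[R]_n) (e : R) : enorm (x - y) <= e ->
  1 + dotp x x <= osc_factor e * (1 + dotp y y).
Proof.
move=> xe; apply: le_trans (radial_osc x y) _; rewrite ler_pM2r ?dotp1_gt0//.
have := enorm_ge0 (x - y); rewrite /osc_factor; nra.
Qed.

Lemma stereo_lipschitz (R : realType) d (x y z : 'rV[R]_d.-1) (e : R) :
  enorm (z - x) <= e -> enorm (z - y) <= e ->
  norm2 (stereo x - stereo y : pt R d) <= 2 / (1 + dotp z z) * osc_factor e * enorm (x - y).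
Proof.
move=> zx zy; have e0 : 0 <= e := le_trans (enorm_ge0 _) zx.
have E0 := osc_factor_gt0 e0; have Z0 := dotp1_gt0 z.
have X0 := dotp1_gt0 x; have Y0 := dotp1_gt0 y.
rewrite stereo_chord mulrAC ler_wpM2r ?enorm_ge0//.
rewrite -mulrA ler_pM2l// -[leRHS]invrK lef_pV2 ?posrE ?invr_gt0 ?mulr_gt0 ?invr_gt0 ?sqrtr_gt0 ?mulr_gt0//.
rewrite invfM invrK mulrC.
rewrite -[leLHS]ger0_norm; last by rewrite mulr_ge0 ?invr_ge0// ltW.
rewrite -sqrtr_sqr; apply: ler_wsqrtr; rewrite expr2; apply: ler_pM.
- by rewrite mulr_ge0 ?invr_ge0// ltW.
- by rewrite mulr_ge0 ?invr_ge0// ltW.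
- by rewrite ler_pdivrMl// osc_bound.
- by rewrite ler_pdivrMl// osc_bound.
Qed.

Lemma stereo_expand (R : realType) d (x y z : 'rV[R]_d.-1) (e : R) :
  enorm (x - z) <= e -> enorm (y - z) <= e ->
  enorm (x - y) <= osc_factor e * (1 + dotp z z) / 2 * norm2 (stereo x - stereo y : pt R d).
Proof.
move=> zx zy; have e0 : 0 <= e := le_trans (enorm_ge0 _) zx.
have E0 := osc_factor_gt0 e0; have Z0 := dotp1_gt0 z.
have X0 := dotp1_gt0 x; have Y0 := dotp1_gt0 y.
have S0 : 0 < Num.sqrt ((1 + dotp x x) * (1 + dotp y y)) by rewrite sqrtr_gt0 mulr_gt0.
rewrite stereo_chord mulrA ler_pdivlMr//.
rewrite (_ : _ * (2 * _) = enorm (x - y) * (osc_factor e * (1 + dotp z z))); last by field.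
apply: ler_wpM2l; first exact: enorm_ge0.
rewrite -[leRHS]ger0_norm; last by rewrite mulr_ge0// ltW.
rewrite -sqrtr_sqr; apply: ler_wsqrtr; rewrite expr2.
by apply: ler_pM; [exact: ltW|exact: ltW|exact: osc_bound|exact: osc_bound].
Qed.

Definition dist2 (R : realType) d (x y : pt R d) : R := norm2 (x - y).

Lemma dist2_ge0 (R : realType) d (x y : pt R d) : 0 <= dist2 x y.
Proof. exact: norm2_ge0. Qed.

(* Each small box is mapped by [stereo] almost as by a similarity of ratio
   [2 / (1 + |z|^2)]. *)
Lemma stereo_box_content (R : realType) d (a z : 'rV[R]_d.-1) (h delta : R) :
  0 < h -> osc_factor (d.-1%:R * h) * 2 * (d.-1%:R * h) <= delta -> box a h z ->
  (finite_content (@dist2 R d) d.-1 delta (@stereo R d @` box a h) <=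
   (osc_factor (d.-1%:R * h) ^+ d.-1 * stereo_density z * h ^+ d.-1)%:E)%E.
Proof.
move=> h0 hd bz; have dist0 := @dist2_ge0 R d.
set n := d.-1; set e := n%:R * h.
have e0 : 0 <= e by rewrite mulr_ge0// ltW.
have E0 := osc_factor_gt0 e0.
pose L := 2 / (1 + dotp z z) * osc_factor e.
have L0 : 0 <= L by rewrite mulr_ge0 ?divr_ge0// ltW// dotp1_gt0.
have Ld : L * e <= delta.
  apply: le_trans hd; rewrite -/e ler_wpM2r// /L mulrC; apply: ler_wpM2l; first exact: ltW.
  by rewrite ler_pdivrMr ?dotp1_gt0// ler_peMr// lerDl dotp_ge0.
have Lip x y : box a h x -> box a h y -> dist2 (stereo x) (stereo y) <= L * enorm (x - y).
  by move=> bx by'; apply: stereo_lipschitz; apply: box_enorm h0 _ _.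
(* Restricting to the box makes the Lipschitz constant [L] valid for every set, so [box_content_le]
   applies with [c = L ^+ n]. *)
pose nu A := finite_content (@dist2 R d) n delta (@stereo R d @` (A `&` box a h)).
have -> : finite_content (@dist2 R d) n delta (@stereo R d @` box a h) = nu (box a h).
  by rewrite /nu setIid.
rewrite (_ : osc_factor e ^+ n * stereo_density z = L ^+ n); last by rewrite /L exprMn mulrC.
apply: box_content_le => //; first exact: exprn_ge0.
- by rewrite /nu set0I image_set0 finite_content0.
- by move=> A; exact: finite_content_ge0.
- move=> A B C ABC; apply: finite_contentU => // _ [x [Ax bx] <-].
  by have [Bx|Cx] := ABC x Ax; [left|right]; exists x.
move=> x r r0; rewrite /nu; set B := (@stereo R d @` _).
have H1 p q : B p -> B q -> dist2 p q <= L * e.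
  move=> [y [_ by'] <-] [y' [_ by''] <-]; apply: le_trans (Lip _ _ by' by'') _.
  by apply: ler_wpM2l => //; exact: box_enorm h0 by' by''.
have H2 p q : B p -> B q -> dist2 p q <= L * (2 * r).
  move=> [y [/= yr by'] <-] [y' [/= yr' by''] <-]; apply: le_trans (Lip _ _ by' by'') _.
  rewrite ler_wpM2l//; rewrite (_ : y - y' = (y - x) - (y' - x)); last by rewrite opprB addrA subrK.
  by apply: le_trans (enormD _ _) _; rewrite enormN; lra.
(* [2 r L] gives the right gauge, but only [L e], from the size of the box, is known to be below
   [delta]; the minimum serves both. *)
have := @finite_content1 R _ (@dist2 R d) n delta (Num.min (L * e) (L * (2 * r))) B dist0.
move=> /(_ _ _ _)/le_trans; apply.
- by rewrite le_min; apply/andP; split; apply: mulr_ge0 => //; lra.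
- by rewrite ge_min Ld.
- by move=> p q Bp Bq; rewrite le_min H1 ?H2.
rewrite muleCA; apply: lee_wpmul2l; first exact: ltW (ball_volume_gt0 _ _).
rewrite -EFinM lee_fin -exprMn; apply: lerXn2r.
- by rewrite nnegrE divr_ge0// le_min; apply/andP; split; apply: mulr_ge0 => //; lra.
- by rewrite nnegrE mulr_ge0// ltW.
by rewrite ler_pdivrMr// ge_min; apply/orP; right; rewrite [2 * r]mulrC mulrA.
Qed.

(** The previous bound holds with the density at any point [z] of the box, so averaging over [z]
    produces the integral. *)
Lemma stereo_box_content_int (R : realType) d (a : 'rV[R]_d.-1) (h delta : R) :
  0 < h -> osc_factor (d.-1%:R * h) * 2 * (d.-1%:R * h) <= delta ->
  (finite_content (@dist2 R d) d.-1 delta (@stereo R d @` box a h) <=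
   (osc_factor (d.-1%:R * h) ^+ d.-1)%:E * \int[lebesgue_rV d.-1]_(z in box a h) (stereo_density z)%:E)%E.
Proof.
move=> h0 hd; set n := d.-1; set e := n%:R * h; set c := finite_content _ _ _ _.
have hn : 0 < h ^+ n by exact: exprn_gt0.
have E0 : 0 < osc_factor e by apply: osc_factor_gt0; rewrite mulr_ge0// ltW.
have mb := @measurable_box R n a h.
have ba : box a h a by move=> i; rewrite lexx/= ltrDl.
have c0 : (0 <= c)%E by apply: finite_content_ge0; exact: dist2_ge0.
have cf : c \is a fin_num.
  by rewrite ge0_fin_numE//; exact: le_lt_trans (stereo_box_content h0 hd ba) (ltry _).
rewrite -ge0_integralZl//; last 3 first.
- by apply: measurable_funTS; exact: measurable_stereo_density.
- by move=> x _; rewrite lee_fin stereo_density_ge0.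
- by rewrite lee_fin exprn_ge0// ltW.
apply: (@le_trans _ _ (\int[lebesgue_rV n]_(z in box a h) (fine c / h ^+ n)%:E)%E).
  by rewrite integral_cst// [X in (_ * X)%E]lebesgue_rV_box// -EFinM divfK ?gt_eqF// fineK.
apply: ge0_le_integral => //.
- by move=> x _; rewrite lee_fin divr_ge0 ?fine_ge0// ltW.
- by apply: emeasurable_funM => //; apply: measurable_funTS; exact: measurable_stereo_density.
move=> z bz; rewrite -EFinM lee_fin ler_pdivrMr// -lee_fin fineK//.
exact: stereo_box_content.
Qed.

Lemma stereo_cube_content (R : realType) d (a : 'rV[R]_d.-1) (h delta : R) (N : nat) :
  0 < h -> osc_factor (d.-1%:R * (h / N.+1%:R)) * 2 * (d.-1%:R * (h / N.+1%:R)) <= delta ->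
  (finite_content (@dist2 R d) d.-1 delta (@stereo R d @` box a h) <=
   (osc_factor (d.-1%:R * (h / N.+1%:R)) ^+ d.-1)%:E * \int[lebesgue_rV d.-1]_z (stereo_density z)%:E)%E.
Proof.
move=> h0 hd; set n := d.-1; have dist0 := @dist2_ge0 R d.
have e0 : 0 < h / N.+1%:R by rewrite divr_gt0.
set c := (osc_factor _ ^+ _)%:E; have c0 : (0 <= c)%E.
  by rewrite lee_fin exprn_ge0// ltW// osc_factor_gt0// mulr_ge0// ltW.
have dens0 z : (0 <= (@stereo_density R n z)%:E)%E by rewrite lee_fin stereo_density_ge0.
have cover (I : eqType) (s : seq I) (F : I -> set (pt R d)) (A : set (pt R d)) :
    (forall x, A x -> exists2 i, i \in s & F i x) ->
    (finite_content (@dist2 R d) n delta A <= \sum_(i <- s) finite_content (@dist2 R d) n delta (F i))%E.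
  elim: s A => [|i s IHs] A AF.
    rewrite big_nil (_ : A = set0) ?finite_content0//.
    by apply/seteqP; split => // x /AF[].
  rewrite big_cons; apply: (@le_trans _ _ (finite_content (@dist2 R d) n delta (F i) +
      finite_content (@dist2 R d) n delta [set x | exists2 j, j \in s & F j x])%E).
    apply: finite_contentU => // x /AF[j]; rewrite inE => /predU1P[->|js] Fj; first by left.
    by right; exists j.
  by apply: leeD => //; apply: IHs.
pose K := {ffun 'I_n -> 'I_N.+1}.
have key := cover _ (enum K) (fun k => @stereo R d @` grid_cell a h k) (@stereo R d @` box a h).
apply: le_trans (key _) _ => [_ [x bx <-]|].
  have [k kx] := @grid_cell_cover R n a h N x h0 bx.
  by exists k; rewrite ?mem_enum//; exists x.
apply: (@le_trans _ _ (\sum_(k <- enum K) (c * \int[lebesgue_rV n]_(z in grid_cell a h k) (stereo_density z)%:E))%E).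
  by apply: lee_sum => k _; exact: stereo_box_content_int.
rewrite -ge0_sume_distrr; last by move=> k _; apply: integral_ge0.
apply: lee_wpmul2l => //.
have mk k : measurable (@grid_cell R n a h N k) by exact: measurable_box.
have md := @measurable_stereo_density R n.
rewrite -(@ge0_integral_bigsetU _ _ _ (lebesgue_rV n) _ (fun k => grid_cell a h k) _ (enum K))//.
- apply: ge0_subset_integral => //.
  by apply: bigsetU_measurable => k _; exact: mk.
- exact: enum_uniq.
- by move=> k l _ _ [x [kx lx]]; exact: (grid_cell_trivIset h0 kx lx).
- by apply: measurable_funTS.
Qed.

Lemma norm2_rV_cons (R : realType) d (x : pt R d) : norm2 x = enorm (rV_cons (x.2, x.1)).
Proof. by rewrite norm2E /enorm dotp_rV_cons addrC. Qed.

Lemma dist2C (R : realType) d (x y : pt R d) : dist2 x y = dist2 y x.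
Proof.
by rewrite /dist2 !norm2E -opprB /= dotpN sqrrN.
Qed.

Lemma dist2_triangle (R : realType) d (x y z : pt R d) : dist2 x z <= dist2 x y + dist2 y z.
Proof.
rewrite /dist2 !norm2_rV_cons; apply: le_trans (enormD _ _); rewrite le_eqVlt; apply/orP; left; apply/eqP.
congr enorm; have := rV_cons_affine 1 (x - y).2 (y - z).2 (x - y).1 (y - z).1.
by rewrite !scale1r mul1r => ->; rewrite /= !addrA !subrK.
Qed.

Lemma stereo_north (R : realType) d (y : 'rV[R]_d.-1) (K : R) : 0 < K -> K <= enorm y ->
  dist2 (stereo y : pt R d) (0, 1) <= 2 / K.
Proof.
move=> K0 Ky; have Y0 := dotp1_gt0 y.
rewrite -(@ler_pXn2r _ 2) ?nnegrE ?dist2_ge0 ?divr_ge0//; last exact: ltW.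
rewrite sqr_norm2 /= subr0 dotpZ.
rewrite (_ : _ + _ = 2 ^+ 2 / (1 + dotp y y)); last by field; rewrite gt_eqF.
rewrite expr_div_n ler_pM2l// lef_pV2 ?posrE ?exprn_gt0//.
by rewrite -sqr_enorm ler_wpDl// lerXn2r ?nnegrE ?enorm_ge0// ltW.
Qed.

Lemma cvg_exprn (R : realType) n (u : nat -> R) (l : R) : u @ \oo --> l ->
  (fun m => u m ^+ n) @ \oo --> l ^+ n.
Proof.
move=> ul; elim: n => [|k IHk]; first by rewrite expr0; exact: cvg_cst.
by rewrite exprS; under eq_fun do rewrite exprS; exact: cvgM.
Qed.

Lemma osc_factor_cvg (R : realType) (u : nat -> R) : u @ \oo --> 0 ->
  (fun m => osc_factor (u m)) @ \oo --> (1 : R).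
Proof.
move=> u0; rewrite -[X in _ --> X]addr0; apply: cvgD; first exact: cvg_cst.
rewrite -[X in _ --> X](mul0r (1 + 0 : R)); apply: cvgM.
  by rewrite -[X in _ --> X](mulr0 2); apply: cvgM => //; exact: cvg_cst.
by apply: cvgD => //; exact: cvg_cst.
Qed.

(** The sphere is covered by the image of a large cube and by a cap around the north pole, where
    [stereo] has no preimage. The cap has diameter [O(1 / M)], and its gauge vanishes in the limit
    because [d - 1 >= 1]. *)
Lemma hausdorff_sphere_upper (R : realType) d : (1 < d)%N ->
  (sphere_area R d <= \int[lebesgue_rV d.-1]_z (@stereo_density R d.-1 z)%:E)%E.
Proof.
move=> d1; apply: ub_ereal_sup => _ [delta /= delta0 <-].
have n0 : (0 < d.-1)%N by rewrite -ltnS prednK// (ltn_trans _ d1).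
set S := [set _ | _]; pose n := d.-1.
rewrite -/(@dist2 R d).
have dist0 := @dist2_ge0 R d.
pose I0 := (\int[lebesgue_rV n]_z (@stereo_density R n z)%:E)%E.
have I00 : (0 <= I0)%E by apply: integral_ge0 => z _; rewrite lee_fin stereo_density_ge0.
have If : I0 \is a fin_num.
  rewrite ge0_fin_numE// /I0 integral_stereo_density.
  apply: lte_mul_pinfty; rewrite ?lee_fin ?exprn_ge0//.
  by apply: radial_int_lty; rewrite ltr_pdivrMr// ltr_pMr ?ltr1n// ltr0n.
have omf : @ball_volume R n \is a fin_num by rewrite ge0_fin_numE ?ball_volume_lty// ltW// ball_volume_gt0.
pose t (m : nat) : R := m.+1%:R^-1.
have tc : t @ \oo --> 0 by exact: cvg_harmonic.
have t0 m : 0 < t m by rewrite invr_gt0.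
have tK m : (t m)^-1 = m.+1%:R by rewrite invrK.
have ntc : (fun m => n%:R * t m) @ \oo --> (0 : R).
  by rewrite -[X in _ --> X](mulr0 n%:R); apply: cvgM => //; exact: cvg_cst.
have oc := osc_factor_cvg ntc.
pose u (m : nat) : R := fine (@ball_volume R n) * (2 * t m) ^+ n + osc_factor (n%:R * t m) ^+ n * fine I0.
have uc : u @ \oo --> fine I0.
  have -> : fine I0 = fine (@ball_volume R n) * (2 * 0) ^+ n + 1 ^+ n * fine I0.
    by rewrite mulr0 expr0n expr1n mul1r gtn_eqF// mulr0 add0r.
  apply: cvgD.
    apply: cvgM; first exact: cvg_cst.
    by apply: cvg_exprn; apply: cvgM => //; exact: cvg_cst.
  apply: cvgM; last exact: cvg_cst.
  exact: cvg_exprn.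
have main m : 4 * t m <= delta -> osc_factor (n%:R * t m) * 2 * (n%:R * t m) <= delta ->
    (hausdorff_content (@dist2 R d) n delta S <= (u m)%:E)%E.
  (* The cube has side [2 M] with [M = m + 1]; [2 (m + 1)^2] cells per side give the mesh
     [1 / (m + 1) = t m], so cube and mesh are governed by one index. *)
  move=> h1 h2; pose M : R := m.+1%:R; pose N := (2 * m.+1 * m.+1).-1.
  have M0 : 0 < 2 * M by rewrite mulr_gt0.
  have NE : 2 * M / N.+1%:R = t m.
    rewrite /N prednK ?muln_gt0// !natrM /M /t; field.
    by rewrite nat1r pnatr_eq0.
  pose a : 'rV[R]_n := const_mx (- M).
  pose cap := [set p : pt R d | S p /\ (p = (0, 1) \/ exists2 y, stereo y = p & M <= enorm y)].
  have capN p : cap p -> dist2 p (0, 1) <= 2 * t m.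
    move=> [_ [->|[y <- My]]]; last exact: stereo_north.
    by rewrite /dist2 subrr norm2E /= /dotp big1 ?expr0n ?addr0 ?sqrtr0 ?mulr_ge0 ?ltW// => i _; rewrite mxE mul0r.
  apply: le_trans (hausdorff_content_finite _ _ _ dist0) _.
  apply: le_trans (finite_contentU n delta dist0 (_ : S `<=` cap `|` (@stereo R d @` box a (2 * M)))) _.
    move=> p Sp; have [pN|pN] := pselect (p = (0, 1)); first by left; split => //; left.
    have [y yp] := stereo_onto Sp pN.
    have [by'|by'] := pselect (box a (2 * M) y); first by right; exists y.
    left; split => //; right; exists y => //; rewrite leNgt; apply/negP => yM; apply: by' => i.
    have := le_lt_trans (coord_le_enorm y i) yM; rewrite mxE ltr_norml => /andP[? ?].
    by apply/andP; split; lra.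
  rewrite EFinD; apply: leeD.
    have t2 : 0 <= 4 * t m by rewrite mulr_ge0// ltW.
    have := @finite_content1 R _ (@dist2 R d) n delta (4 * t m) cap dist0 t2 h1.
    rewrite (_ : 4 * t m / 2 = 2 * t m); last by field.
    rewrite EFinM (fineK omf); apply=> p q Cp Cq.
    apply: le_trans (dist2_triangle p (0, 1) q) _; rewrite [dist2 _ q]dist2C.
    have := capN _ Cp; have := capN _ Cq; lra.
  rewrite EFinM (fineK If) -NE; apply: stereo_cube_content => //.
  by rewrite NE.
rewrite -[leRHS]/I0 -(fineK If).
have n1 : \forall m \near \oo, 4 * t m <= delta.
  have : (fun m => 4 * t m) @ \oo --> (0 : R).
    by rewrite -[X in _ --> X](mulr0 4); apply: cvgM => //; exact: cvg_cst.
  move=> /(cvgr_lt 0) /(_ _ delta0); apply: filterS => m; exact: ltW.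
have n2 : \forall m \near \oo, osc_factor (n%:R * t m) * 2 * (n%:R * t m) <= delta.
  have : (fun m => osc_factor (n%:R * t m) * 2 * (n%:R * t m)) @ \oo --> (0 : R).
    rewrite -[X in _ --> X](mulr0 (1 * 2)); apply: cvgM => //.
    by apply: cvgM => //; exact: cvg_cst.
  move=> /(cvgr_lt 0) /(_ _ delta0); apply: filterS => m; exact: ltW.
have c0 : (0 <= hausdorff_content (@dist2 R d) n delta S)%E.
  apply: le_ereal_inf_tmp => _ [C _ <-].
  by apply: nneseries_ge0 => i _ _; exact: hausdorff_gauge_ge0.
have cf : hausdorff_content (@dist2 R d) n delta S \is a fin_num.
  rewrite ge0_fin_numE//.
  have [m [m1 m2]] : exists m, 4 * t m <= delta /\ osc_factor (n%:R * t m) * 2 * (n%:R * t m) <= delta.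
    by near \oo => m; exists m; split; near: m.
  exact: le_lt_trans (main m m1 m2) (ltry _).
rewrite -(fineK cf) lee_fin; apply: (cvgr_to_ge uc).
near=> m; rewrite -lee_fin fineK//; apply: main; by near: m.
Unshelve. all: end_near. Qed.

Lemma integral_enorm_balls (R : realType) n (f : 'rV[R]_n -> \bar R) :
  measurable_fun setT f -> (forall x, 0 <= f x)%E ->
  (fun m : nat => \int[lebesgue_rV n]_(x in [set x : 'rV[R]_n | (enorm x <= m%:R)%R]) f x)%E @ \oo -->
  (\int[lebesgue_rV n]_x f x)%E.
Proof.
move=> mf f0; pose F (m : nat) := [set x : 'rV[R]_n | enorm x <= m%:R].
have := @ge0_nondecreasing_set_cvg_integral _ _ R F f (lebesgue_rV n).
rewrite (_ : \bigcup_i F i = setT); last first.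
  apply/seteqP; split => // x _; exists (Num.truncn (enorm x)).+1 => //=.
  by have /andP[_ /ltW] := truncn_itv (enorm_ge0 x).
apply => //.
- by move=> a b ab; apply/subsetPset => x /= /le_trans; apply; rewrite ler_nat.
- by move=> m; exact: measurable_enorm_ball.
- by move=> m; exact: measurable_funTS.
Qed.

Lemma closed_enorm_ball (R : realType) n (a : 'rV[R]_n) (r : R) : closed [set x : 'rV[R]_n | enorm (x - a) <= r].
Proof.
have [r0|r0] := leP 0 r; last first.
  rewrite (_ : [set _ | _] = set0); first exact: closed0.
  by apply/seteqP; split => // x /= /le_lt_trans /(_ r0); rewrite ltNge enorm_ge0.
rewrite (_ : [set _ | _] = (fun x : 'rV[R]_n => dotp (x - a) (x - a)) @^-1` [set y | y <= r ^+ 2]); last first.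
  by apply/seteqP; split => x /=; rewrite enorm_le.
have cf : continuous (fun x : 'rV[R]_n => dotp (x - a) (x - a)).
  apply: continuous_big => [z|i _ x]; first exact: add_continuous.
  have cc : {for x, continuous (fun x : 'rV[R]_n => (x - a) ord0 i)}.
    rewrite (_ : (fun _ => _) = (fun t : R => t - a ord0 i) \o (fun x : 'rV[R]_n => x ord0 i)); last first.
      by apply/funext => z; rewrite /= !mxE.
    apply: continuous_comp; first exact: coord_continuous.
    by apply: cvgB; [exact: cvg_id|exact: cvg_cst].
  exact: (cvgM cc cc).
by apply: closed_comp => [x _|]; [exact: cf|exact: closed_le].
Qed.

(* The closed set [A] below has the same diameter bound as [B], and stays where
   the density is comparable to its value at [z]. *)
Lemma stereo_preimage_measure (R : realType) d (C : set (pt R d)) (B : set 'rV[R]_d.-1) (e delta : R) z :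
  0 <= e -> (diam (@dist2 R d) C <= delta%:E)%E -> B z ->
  (forall y, B y -> C (stereo y)) -> (forall y, B y -> enorm (y - z) <= e) ->
  exists A, [/\ measurable A, B `<=` A &
    (\int[lebesgue_rV d.-1]_(y in A) (stereo_density y)%:E <=
     (osc_factor e ^+ (2 * d.-1))%:E * hausdorff_gauge (@dist2 R d) d.-1 C)%E].
Proof.
move=> e0 Cd Bz BC Be; pose n := d.-1.
have Cz : C (stereo z) by exact: BC.
have E := diam_fineK Cz Cd; set D := fine _ in E.
have dC p q : C p -> C q -> dist2 p q <= D by move=> Cp Cq; rewrite -lee_fin E; exact: diam_ge.
have D0 : 0 <= D by apply: le_trans (dC _ _ Cz Cz); exact: dist2_ge0.
have Z0 := dotp1_gt0 z; have O0 := osc_factor_gt0 e0.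
pose r := osc_factor e * (1 + dotp z z) / 2 * D.
have r0 : 0 <= r by rewrite mulr_ge0// divr_ge0// mulr_ge0// ltW.
have Br x y : B x -> B y -> enorm (x - y) <= r.
  move=> Bx By; apply: le_trans (stereo_expand (Be _ Bx) (Be _ By)) _.
  apply: ler_wpM2l; first by rewrite divr_ge0// mulr_ge0// ltW.
  exact: dC _ _ (BC _ Bx) (BC _ By).
(* [A1] is within [r] of every point of [B], and [A] within [r] of every point of [A1]. So [A] keeps
   the diameter bound [r], and it contains [B]. Being closed it is measurable, although [C] is
   arbitrary. *)
pose A1 := [set y : 'rV[R]_n | enorm (y - z) <= e] `&` \bigcap_(b in B) [set y | enorm (y - b) <= r].
pose A := A1 `&` \bigcap_(b in A1) [set y | enorm (y - b) <= r].
have cA1 : closed A1.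
  by apply: closedI; [exact: closed_enorm_ball|apply: closed_bigI => b _; exact: closed_enorm_ball].
have mA : measurable A.
  apply: closed_measurable_rV; apply: closedI => //.
  by apply: closed_bigI => b _; exact: closed_enorm_ball.
exists A; split => //.
  move=> x Bx; split; first by split; [exact: Be|move=> b Bb; exact: Br].
  by move=> b [_ bB] /=; rewrite -enormN opprB; exact: bB.
have iso := isodiametric r0 mA (fun x y Ax Ay => Ax.2 y Ay.1).
pose c := (2 * osc_factor e / (1 + dotp z z)) ^+ n.
have c0 : 0 <= c by rewrite exprn_ge0// divr_ge0 ?mulr_ge0// ltW.
apply: (@le_trans _ _ (\int[lebesgue_rV n]_(y in A) c%:E)%E).
  apply: ge0_le_integral => //.
  - by move=> y _; rewrite lee_fin stereo_density_ge0.
  - by apply: measurable_funTS; exact: measurable_stereo_density.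
  move=> y [[/= yz _] _]; rewrite lee_fin /stereo_density /c.
  have Y0 := dotp1_gt0 y.
  apply: lerXn2r; rewrite ?nnegrE; [by rewrite divr_ge0// ltW|by rewrite divr_ge0 ?mulr_ge0// ltW|].
  rewrite ler_pdivrMr// mulrAC ler_pdivlMr// -mulrA ler_pM2l//.
  by apply: osc_bound; rewrite -enormN opprB.
rewrite integral_cst//; apply: le_trans (lee_wpmul2l _ iso) _; first by rewrite lee_fin.
rewrite /hausdorff_gauge; case: eqP => [C0|_]; first by rewrite C0 in Cz.
rewrite -/D muleCA [X in (_ <= X)%E]muleCA; apply: lee_wpmul2l; first exact: ltW (ball_volume_gt0 _ _).
rewrite -!EFinM lee_fin exprM -!exprMn le_eqVlt; apply/orP; left; apply/eqP; congr (_ ^+ _).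
by rewrite /r; field; rewrite gt_eqF.
Qed.

(** On [|y| <= rho] the chord formula bounds the diameter of the preimage of a covering set by
    [delta (1 + rho^2) / 2], so the density hardly varies there. The preimages cover the ball, and
    their integrals are summed. *)
Lemma hausdorff_content_sphere_lower (R : realType) d (rho delta : R) : 0 <= rho -> 0 <= delta ->
  (\int[lebesgue_rV d.-1]_(y in [set y : 'rV[R]_d.-1 | (enorm y <= rho)%R]) (stereo_density y)%:E <=
   (osc_factor (delta * (1 + rho ^+ 2) / 2) ^+ (2 * d.-1))%:E *
   hausdorff_content (@dist2 R d) d.-1 delta [set x : pt R d | norm2 x = 1%R])%E.
Proof.
move=> rho0 delta0; pose n := d.-1; set e := delta * _ / 2; set S := [set x : pt R d | _].
have e0 : 0 <= e by rewrite divr_ge0// mulr_ge0// addr_ge0// sqr_ge0.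
set q := osc_factor e ^+ _; have q0 : 0 < q by rewrite exprn_gt0// osc_factor_gt0.
set I0 := integral _ _ _.
suff H : ((q^-1)%:E * I0 <= hausdorff_content (@dist2 R d) d.-1 delta S)%E.
  have := lee_wpmul2l (_ : (0 <= q%:E)%E) H; rewrite muleA -EFinM divff ?gt_eqF// mul1e; apply.
  by rewrite lee_fin ltW.
apply: le_ereal_inf_tmp => _ [C [SC Cd] <-].
rewrite muleC lee_pdivrMr//.
have gauge0 i : (0 <= hausdorff_gauge (@dist2 R d) n (C i))%E.
  by apply: hausdorff_gauge_ge0; exact: dist2_ge0.
pose ball := [set y : 'rV[R]_n | enorm y <= rho].
have /choice[A HA] : forall i, exists A, [/\ measurable A, ball `&` (@stereo R d @^-1` C i) `<=` A &
    (\int[lebesgue_rV n]_(y in A) (stereo_density y)%:E <= q%:E * hausdorff_gauge (@dist2 R d) n (C i))%E].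
  move=> i; have [[z [bz Cz]]|/forallNP N] := pselect (exists z, (ball `&` (@stereo R d @^-1` C i)) z).
    apply: (stereo_preimage_measure e0 (Cd i) (z := z)) => // [y []//|y [by' Cy]].
    have Y0 := dotp1_gt0 y; have Z0 := dotp1_gt0 z.
    have rr x : ball x -> 1 + dotp x x <= 1 + rho ^+ 2 by move=> bx; rewrite lerD2l -enorm_le.
    have S0 : 0 < Num.sqrt ((1 + dotp y y) * (1 + dotp z z)) by rewrite sqrtr_gt0 mulr_gt0.
    have : dist2 (stereo y : pt R d) (stereo z) <= delta.
      by rewrite -lee_fin; apply: le_trans (Cd i); exact: diam_ge.
    rewrite /dist2 stereo_chord ler_pdivrMr// => /le_trans H.
    have : 2 * enorm (y - z) <= delta * (1 + rho ^+ 2).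
      apply: H; apply: ler_wpM2l => //; rewrite -[leRHS]ger0_norm ?addr_ge0 ?sqr_ge0//.
      rewrite -sqrtr_sqr; apply: ler_wsqrtr; rewrite expr2.
      by apply: ler_pM; [exact: ltW|exact: ltW|exact: rr|exact: rr].
    by rewrite /e ler_pdivlMr// mulrC.
  exists set0; split; [exact: measurable0|by move=> y /N|].
  by rewrite integral_set0 mule_ge0// lee_fin ltW.
have md := @measurable_stereo_density R n.
have d0 y : (0 <= (@stereo_density R n y)%:E)%E by rewrite lee_fin stereo_density_ge0.
pose f i y : \bar R := (\1_(A i) y * stereo_density y)%:E.
have f0 i y : (0 <= f i y)%E by rewrite lee_fin mulr_ge0 ?stereo_density_ge0.
have mf i : measurable_fun setT (f i).
  apply/measurable_EFinP; apply: measurable_funM; last by apply/measurable_EFinP.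
  by apply: measurable_indicT; have [] := HA i.
apply: (@le_trans _ _ (\int[lebesgue_rV n]_y (\sum_(0 <= i <oo) f i y))%E).
  rewrite /I0 integral_mkcond/=; apply: ge0_le_integral => //.
  - by move=> y _; rewrite patchE; case: ifP.
  - by apply/(measurable_restrictT _ (measurable_enorm_ball rho)); exact: measurable_funTS.
  - by apply: ge0_emeasurable_sum => // i y _ _; exact: f0.
  move=> y _; rewrite patchE; case: ifP => [|_]; last by apply: nneseries_ge0 => i _ _; exact: f0.
  rewrite inE => by'; have [i _ Cy] := SC _ (stereo_sphere y).
  have Ay : A i y by have [_ sA _] := HA i; apply: sA.
  rewrite (nneseriesD1 (n := i))//; apply: le_trans (leeDl _ _).
    by rewrite /f indicE mem_set// mul1r.
  by apply: nneseries_ge0 => k _ _; exact: f0.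
rewrite integral_nneseries//.
rewrite muleC -nneseriesZl//; apply: lee_nneseries => [*|i *]; first exact: integral_ge0.
have [mA _] := HA i; apply: le_trans.
rewrite [leRHS]integral_mkcond; apply: ge0_le_integral => //.
  by apply/(measurable_restrictT _ mA); exact: measurable_funTS.
by move=> y _; rewrite /f patchE indicE; case: (y \in A i); rewrite ?mul1r ?mul0r.
Qed.

Lemma hausdorff_sphere_lower (R : realType) d :
  (\int[lebesgue_rV d.-1]_z (@stereo_density R d.-1 z)%:E <= sphere_area R d)%E.
Proof.
set H := sphere_area R d; pose n := d.-1.
(* Solves [delta (1 + rho^2) / 2 = 1 / (m + 1)] for [rho = m]: the ball grows while the distortion
   tends to 1. *)
pose delta (m : nat) : R := 2 * (m.+1%:R^-1 / (1 + m%:R ^+ 2)).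
have r0 m : 0 < 1 + m%:R ^+ 2 :> R by rewrite ltr_wpDr// sqr_ge0.
have d0 m : 0 < delta m by rewrite mulr_gt0// divr_gt0.
have dE m : delta m * (1 + m%:R ^+ 2) / 2 = m.+1%:R^-1.
  by rewrite /delta; field; rewrite nat1r pnatr_eq0/= gt_eqF.
have main m : (\int[lebesgue_rV n]_(y in [set y : 'rV[R]_n | (enorm y <= m%:R)%R]) (stereo_density y)%:E <=
    (osc_factor (m.+1%:R^-1) ^+ (2 * n))%:E * H)%E.
  rewrite -dE; apply: le_trans (hausdorff_content_sphere_lower d (ler0n R m) (ltW (d0 m))) _.
  apply: lee_wpmul2l; first by rewrite lee_fin exprn_ge0// ltW// osc_factor_gt0// dE.
  by apply: ereal_sup_ubound; exists (delta m) => //; exact: d0.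
have H0 : (0 <= H)%E.
  apply: le_trans (ereal_sup_ubound (_ : [set hausdorff_content (@dist2 R d) n t [set x : pt R d | norm2 x = 1] | t in [set t | 0 < t]] (hausdorff_content (@dist2 R d) n 1 [set x : pt R d | norm2 x = 1]))).
    apply: le_ereal_inf_tmp => _ [C _ <-].
    by apply: nneseries_ge0 => i _ _; apply: hausdorff_gauge_ge0; exact: dist2_ge0.
  by exists 1 => //=.
have [->|Hf] := eqVneq H +oo%E; first exact: leey.
have {}Hf : H \is a fin_num by rewrite ge0_fin_numE// ltey.
have lim1 := integral_enorm_balls (@measurable_stereo_density R n)
  (fun x => ltac:(by rewrite lee_fin stereo_density_ge0) : (0 <= (stereo_density x)%:E)%E).
have lim2 : (fun m : nat => (osc_factor (m.+1%:R^-1 : R) ^+ (2 * n) * fine H)%:E) @ \oo --> H.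
  rewrite -[X in _ --> X](fineK Hf); apply: cvg_EFin; first exact: nearW.
  rewrite -[X in _ --> X](mul1r (fine H)); apply: cvgM; last exact: cvg_cst.
  have oc := osc_factor_cvg (@cvg_harmonic R).
  by have := @cvg_exprn R (2 * n) _ _ oc; rewrite expr1n.
apply: (lee_cvg_to lim1 lim2); apply: nearW => m.
by rewrite EFinM fineK//; exact: main.
Qed.

(** * The constant sigma_d / (2 d) *)

(** [j m] stands for the Cauchy integral of exponent [m / 2], and [n] for [d - 1]: the left-hand
    side is the area of the sphere, the right-hand side [2 d] times the limit constant. Only the
    recursion enters, not the values of the integrals. *)
Lemma falling_products (R : realType) (j : nat -> R) :
  (forall m, (1 < m)%N -> m%:R * j m.+2 = (m%:R - 1) * j m) ->
  forall n, (0 < n)%N ->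
  2 ^+ n * \prod_(i < n) j (2 * n - i)%N = 2 * (n%:R + 1) * \prod_(i < n) j (n + 3 - i)%N.
Proof.
move=> jS; pose P n m := \prod_(i < n) j (m - i)%N.
have PSr n m : P n.+1 m = P n m * j (m - n)%N by rewrite /P big_ord_recr.
have PSl n m : P n.+1 m.+1 = j m.+1 * P n m.
  by rewrite /P big_ord_recl subn0; congr (_ * _); apply: eq_bigr => i _; rewrite subSS.
(* As for Wallis integrals, this product does not depend on [m]. *)
have pairs m : (1 < m)%N -> (m%:R - 1) * (j m * j m.+1) = j 2 * j 3.
  elim: m => // m IHm; rewrite ltnS leq_eqVlt => /predU1P[<-|m1]; first by ring.
  rewrite -(IHm m1) -natr1 addrK mulrCA jS//; ring.
(* The induction step replaces [2 j_(2n+3) j_(2n+4)] by [j_(n+2) j_(n+3)]; the two agree by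
   [pairs]. *)
have A n : (0 < n)%N -> 2 ^+ n * P n (2 * n)%N = 2 * P n n.+1.
  elim: n => // -[_ _|n IHn _].
    by rewrite /P !big_ord_recl !big_ord0 !subn0.
  have := IHn isT.
  rewrite (_ : (2 * n.+2 = (2 * n.+1).+2)%N); last by rewrite [LHS]mulnS.
  have -> : P n.+2 (2 * n.+1).+2 = j (2 * n.+1).+2 * (j (2 * n.+1).+1 * P n (2 * n.+1)%N) by rewrite !PSl.
  rewrite PSr (_ : (2 * n.+1 - n = n.+2)%N); last by rewrite mul2n -addnn addnS -addSn addnK.
  rewrite [P n.+2 n.+3]PSl => E.
  have e1 : (n.+1%:R != 0 :> R) by rewrite pnatr_eq0.
  have predr k : k.+1%:R - 1 = k%:R :> R by rewrite -natr1 addrK.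
  have E2 := pairs (2 * n.+1).+1 (ltac:(by rewrite mulnS)).
  have := pairs n.+2 isT; rewrite -E2 (predr n.+1) (predr (2 * n.+1)%N) natrM => E3'.
  have E3 : 2 * (j (2 * n.+1).+1 * j (2 * n.+1).+2) = j n.+2 * j n.+3.
    by apply: (mulfI e1); rewrite E3'; ring.
  rewrite exprS (_ : _ * _ = 2 ^+ n.+1 * P n (2 * n.+1)%N * (2 * (j (2 * n.+1).+1 * j (2 * n.+1).+2))); last by ring.
  transitivity ((2 ^+ n.+1 * (P n (2 * n.+1)%N * j n.+2)) * j n.+3); first by rewrite E3; ring.
  by rewrite E; ring.
(* Lowering every index by two brings in the ratios [(m - 1) / m] for [m] from 2 to [n + 1], which
   telescope to [1 / (n + 1)]. *)
have C n : (n%:R + 1) * P n (n + 3)%N = P n n.+1.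
  elim: n => [|n IHn]; first by rewrite /P !big_ord0 add0r mulr1.
  rewrite addSn !PSl -IHn addn3.
  have := jS n.+2 isT; rewrite -natr1 addrK natr1 => E.
  by rewrite mulrA E -natr1; ring.
by move=> n n0; rewrite -[LHS]/(2 ^+ n * P n (2 * n)%N) A// -C mulrA.
Qed.

(** Integration by parts: with [x^2 = (1 + x^2) - 1], the derivative of [x (1 + x^2)^(-p)] is a
    combination of the two integrands, and its boundary values are [O(m^(1 - 2 p))]. *)
Lemma cauchy_int_rec (R : realType) (p : R) : 2^-1 < p ->
  2 * p * fine (cauchy_int (p + 1)) = (2 * p - 1) * fine (cauchy_int p).
Proof.
move=> p2; have p0 : 0 < p by rewrite (lt_trans _ p2)// invr_gt0.
pose f (r x : R) : R := (1 + x ^+ 2) `^ (- r).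
have u0 (x : R) : 0 < 1 + x ^+ 2 by rewrite ltr_pwDl// sqr_ge0.
have mf r : measurable_fun setT (fun x : R => (f r x)%:E).
  apply/measurable_EFinP; apply: measurable_powR_fun.
  by apply: measurable_funD => //; exact: exprn_measurable.
have f0 r x : (0 <= (f r x)%:E)%E by rewrite lee_fin powR_ge0.
have du (x : R) : is_derive x 1 (fun x : R => 1 + x ^+ 2) (2 * x).
  have dX := is_deriveX 2 (is_derive_id x (1 : R)).
  by apply: (is_derive_eq (is_deriveD (is_derive_cst (1 : R) x 1) dX)); rewrite /GRing.scale/= add0r mulr1 expr1.
have cf r x : {for x, continuous (f r)}.
  apply: (@continuous_comp _ _ _ (fun x : R => 1 + x ^+ 2) (@powR R ^~ (- r))).
    by apply: differentiable_continuous; apply/derivable1_diffP; have [] := du x.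
  exact: powR_continuous_gt0.
pose I (m : nat) : set R := `[- m.+1%:R, m.+1%:R]%classic.
have mI m : measurable (I m) by exact: measurable_itv.
have Jfin (r : R) : 2^-1 < r -> cauchy_int r \is a fin_num.
  by move=> r2; rewrite ge0_fin_numE; [exact: cauchy_int_lty|apply: integral_ge0 => x _; exact: (f0 r)].
have lim r : 2^-1 < r -> (fun m => fine (\int[lebR]_(x in I m) (f r x)%:E)%E) @ \oo --> fine (cauchy_int r).
  move=> r2; apply: fine_cvg; rewrite fineK; last exact: Jfin.
  have := @ge0_nondecreasing_set_cvg_integral _ _ R I (fun x => (f r x)%:E) lebR.
  rewrite (_ : \bigcup_i I i = setT); last first.
    apply/seteqP; split => // x _; exists (Num.truncn `|x|) => //=.
    by rewrite /I/= in_itv/= -ler_norml ltW//; have /andP[_] := truncn_itv (normr_ge0 x).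
  apply=> //.
  - move=> a b ab; apply/subsetPset => x; rewrite /I /= !in_itv/= -!ler_norml => /le_trans; apply.
    by rewrite ler_nat ltnS.
  - by move=> m; exact: measurable_funTS.
have fin r m : 2^-1 < r -> (\int[lebR]_(x in I m) (f r x)%:E)%E \is a fin_num.
  move=> r2; rewrite ge0_fin_numE; last by apply: integral_ge0.
  by apply: le_lt_trans (cauchy_int_lty r2); apply: ge0_subset_integral.
have ifin r m : 2^-1 < r -> lebR.-integrable (I m) (EFin \o f r).
  move=> r2; apply/integrableP; split; first by apply: measurable_funTS; exact: (mf r).
  have := fin r m r2; rewrite ge0_fin_numE; last by apply: integral_ge0.
  by congr (_ < _)%E; apply: eq_integral => x _; rewrite /= ger0_norm// powR_ge0.
have p12 : 2^-1 < p + 1 by lra.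
pose F (x : R) : R := x * (1 + x ^+ 2) `^ (- p).
have dF (x : R) : is_derive x 1 F ((1 - 2 * p) * f p x + 2 * p * f (p + 1) x).
  have dp := @is_derive1_comp _ (@powR R ^~ (- p)) (fun x : R => 1 + x ^+ 2) x _ _ (is_derive1_powR (- p) (u0 x)) (du x).
  apply: (is_derive_eq (is_deriveM (is_derive_id x (1 : R)) dp)).
  rewrite /f /GRing.scale/=.
  have E : (1 + x ^+ 2) `^ (- p) = (1 + x ^+ 2) * (1 + x ^+ 2) `^ (- p - 1).
    rewrite -{2}(powRr1 (ltW (u0 x))) -powRD; last by rewrite (gt_eqF (u0 x)) implybT.
    by congr (_ `^ _); ring.
  rewrite opprD E; ring.
have key m : F m.+1%:R - F (- m.+1%:R) =
    (1 - 2 * p) * fine (\int[lebR]_(x in I m) (f p x)%:E)%E +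
    2 * p * fine (\int[lebR]_(x in I m) (f (p + 1) x)%:E)%E.
  have m0 : - m.+1%:R < m.+1%:R :> R by rewrite gtrN.
  apply: EFin_inj; rewrite -(FTC_is_derive m0 (fun x _ => dF x)); last first.
    by move=> x _; apply: cvgD; apply: cvgM; try exact: cvg_cst; exact: cf.
  rewrite (EFinD _ (2 * p * _)) !EFinM !fineK ?fin//.
  rewrite -!integralZl// ?ifin// -integralD//.
  - by apply: integrableZl => //; exact: ifin.
  - by apply: integrableZl => //; exact: ifin.
have lim0 : (fun m : nat => F m.+1%:R - F (- m.+1%:R)) @ \oo --> (0 : R).
  have h0 : (fun m : nat => 2 * (m.+1%:R^-1 `^ (2 * p - 1) : R)) @ \oo --> (0 : R).
    rewrite -[X in _ --> X](mulr0 2); apply: cvgM; first exact: cvg_cst.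
    by apply: cvg_powR0; [lra|by move=> m; rewrite invr_gt0|exact: cvg_harmonic].
  apply: (squeeze_cvgr _ (cvg_cst 0) h0); apply: nearW => m.
  rewrite /F sqrrN mulNr opprK -mulr2n -[X in _ <= X <= _]mulr_natl.
  have M0 : 0 < m.+1%:R :> R by [].
  apply/andP; split; first by rewrite !mulr_ge0// powR_ge0.
  rewrite ler_pM2l//.
  have -> : (m.+1%:R^-1 : R) `^ (2 * p - 1) = m.+1%:R * (m.+1%:R ^+ 2) `^ (- p).
    rewrite -powR_mulrn// -powRrM -powR_inv1// -powRrM -{2}(powRr1 (ltW M0)) -powRD; last by rewrite (gt_eqF M0) implybT.
    by congr (_ `^ _); ring.
  rewrite ler_pM2l// !powRN lef_pV2 ?posrE ?powR_gt0 ?exprn_gt0//.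
  by apply: ge0_ler_powR; rewrite ?nnegrE ?addr_ge0 ?sqr_ge0 ?lerDr// ltW.
have lim1 : (fun m : nat => F m.+1%:R - F (- m.+1%:R)) @ \oo -->
    (1 - 2 * p) * fine (cauchy_int p) + 2 * p * fine (cauchy_int (p + 1)).
  under eq_fun do rewrite key.
  by apply: cvgD; apply: cvgM; try exact: cvg_cst; exact: lim.
have E : 0 = (1 - 2 * p) * fine (cauchy_int p) + 2 * p * fine (cauchy_int (p + 1)).
  exact: (cvg_unique _ lim0 lim1).
lra.
Qed.

(** Iterates [radial_intS]; half-integer exponents are indexed by their double, so each coordinate
    lowers the index by one. The condition [n < m] keeps all factors finite. *)
Lemma radial_int_prod (R : realType) n (m : nat) : (n < m)%N ->
  @radial_int R n (m%:R / 2) = (\prod_(i < n) fine (@cauchy_int R ((m - i)%:R / 2)))%:E.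
Proof.
elim: n m => [|n IHn] m nm.
  rewrite big_ord0 /radial_int/= integral_dirac//.
    by rewrite diracT mul1e /dotp big_ord0 addr0 powR1.
  exact: measurable_radial.
case: m nm => // m nm; rewrite radial_intS big_ord_recl subn0 EFinM; congr (_ * _)%E.
  rewrite fineK// ge0_fin_numE; last by apply: integral_ge0 => x _; rewrite lee_fin powR_ge0.
  apply: cauchy_int_lty; rewrite -[ltLHS]mul1r ltr_pM2r ?invr_gt0// ltr1n.
  exact: leq_ltn_trans (ltn0Sn n) nm.
rewrite (_ : m.+1%:R / 2 - 2^-1 = m%:R / 2); last by rewrite -natr1; field.
by rewrite IHn//; congr EFin; apply: eq_bigr => i _; rewrite subSS.
Qed.

(** With [n = d - 1], the stereographic density has the doubled exponent [2 n] and the weight [w_1]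
    has [n + 3]; [falling_products] compares the two. *)
Lemma sphere_areaE (R : realType) d : (1 < d)%N ->
  (sphere_area R d * ((2 * d%:R)^-1)%:E = @Csd R d 1)%E.
Proof.
move=> d1; have dE : d = d.-1.+1 by rewrite prednK// (ltn_trans _ d1).
have n0 : (0 < d.-1)%N by rewrite -ltnS -dE.
have -> : sphere_area R d = (\int[lebesgue_rV d.-1]_z (@stereo_density R d.-1 z)%:E)%E.
  by apply/eqP; rewrite eq_le hausdorff_sphere_upper ?hausdorff_sphere_lower.
rewrite integral_stereo_density CsdE.
have -> : (\int[lebesgue_rV d.-1]_xi (@wt R d 1 xi)%:E)%E = @radial_int R d.-1 ((d.-1 + 3)%:R / 2).
  apply: eq_integral => y _; rewrite /wt; congr (_ `^ _)%:E.
  by rewrite {1}dE natrD -natr1; field.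
have -> : @radial_int R d.-1 d.-1%:R = @radial_int R d.-1 ((2 * d.-1)%N%:R / 2).
  by rewrite natrM; congr radial_int; field.
rewrite radial_int_prod; last by rewrite mul2n -addnn -[ltnLHS]addn0 ltn_add2l.
rewrite radial_int_prod; last by rewrite -[ltnLHS]addn0 ltn_add2l.
rewrite -EFinM (@falling_products R (fun m => fine (cauchy_int (m%:R / 2))))//.
  have d0 : d%:R != 0 :> R by rewrite pnatr_eq0 dE.
  rewrite natr1 -dE; congr EFin; field.
  by rewrite d0.
move=> m m1; have := @cauchy_int_rec R (m%:R / 2).
rewrite (_ : m%:R / 2 + 1 = m.+2%:R / 2); last by rewrite -addn2 natrD; field.
rewrite (_ : 2 * (m%:R / 2) = m%:R); last by field.
by apply; rewrite -[ltLHS]mul1r ltr_pM2r ?invr_gt0// ltr1n.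
Qed.

Unset Implicit Arguments.
Set Strict Implicit.
Set Printing Implicit Defensive.

Theorem theorem3p3 (R : realType) (d : nat) (omega : set 'rV[R]_(d.-1))
    (s0 : R) (s : R -> R)
    (d_ge2 : (2 <= d)%N)
    (omega_bounded : bounded_set omega)
    (omega_connected : connected omega)
    (omega_open : open omega)
    (omega_lipschitz : lipschitz_boundary omega)
    (s0_itv : 0 <= s0 <= 1)
    (s_itv : forall eps, 0 < eps -> 0 < s eps < 1)
    (s_cvg : s eps @[eps --> 0^'+] --> s0) :
  (s0 < 1 ->
   gamma_limit (fun eps => Hs (s eps) (cylinder omega eps)) scaled
     (weak_L2loc (cylinder omega 1)) (L2 (cylinder omega 1))
     (energy s omega)
     (limit_lt1 s0 omega)) /\
  (s0 = 1 ->
   gamma_limit (fun eps => Hs (s eps) (cylinder omega eps)) scaled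
     (weak_L2loc (cylinder omega 1)) (L2 (cylinder omega 1))
     (fun eps u => ((1 - s eps)%:E * energy s omega eps u)%E)
     (limit_eq1 omega)).
Proof.
have /andP[s00 s01] := s0_itv.
have sc (eps : nat -> R) : (forall j, 0 < eps j) -> eps @ \oo --> 0 ->
    (fun j => s (eps j)) @ \oo --> s0.
  move=> eps0 epsc; apply: cvg_comp s_cvg.
  move=> P [e /= e0 eP].
  (* The limit of [s] is taken along right neighbourhoods of 0, so smallness and positivity of
     [eps j] are both used. *)
  have epse : \forall j \near \oo, eps j < e by exact: cvgr_lt epsc _ e0.
  near=> j; apply: eP => /=; last exact: eps0.
  by rewrite sub0r normrN gtr0_norm//; near: j.
split => [s0lt|s0E] eps eps0 epsc v v2; have sce := sc eps eps0 epsc.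
  split => [u uH uv|Gv].
    by apply: liminf_lt1 => // j; have [] := uH j.
  by apply: limsup_lt1 => //; rewrite s00 s0lt.
have hS := @sphere_areaE R d d_ge2; rewrite s0E in sce.
split => [u uH uv|Gv].
  by apply: liminf_eq1 => // j; have [] := uH j.
exact: limsup_eq1.
Unshelve. all: end_near. Qed.
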